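(* Let $\Psi$ be a closed $2$-cell embedding of a $2$-connected graph $G$ in the projective plane. Suppose $\Psi$ contains a noncontractible elementary face ring $\mathcal{F} = (f_1, f_2, \ldots, f_l)$ which has odd length $l \ge 3$. Then $G$ has a closed $2$-cell embedding in some orientable surface.
   Context: Graphs are finite and may have multiple edges but no loops. A surface is a connected compact $2$-manifold without boundary. A face of an embedding of $G$ in a surface $\Sigma$ is a connected component of $\Sigma - G$; $\partial f$ denotes the boundary of a face $f$ and $\overline{f}$ its closure. A closed $2$-cell embedding is an embedding such that every face is homeomorphic to an open disk and is bounded by a cycle (no repeated vertices) in the graph. Two faces $f, g$ touch if $\partial f \cap \partial g \neq \emptyset$; they touch $k$ times if $\partial f \cap \partial g$ has $k$ connected components. A cyclic sequence of distinct faces $(f_1, f_2, \ldots, f_n)$ of a closed $2$-cell embedding is a face ring of length $n$ if (i) $n = 2$ and $f_1$ and $f_2$ touch at least twice, or (ii) $n \ge 3$ and the sets $\partial f_i \cap \partial f_j$, $i \ne j$, are pairwise disjoint (for different unordered pairs $\{i,j\}$), nonempty when $j = i-1$ or $j = i+1$, and empty otherwise (subscripts modulo $n$). A face ring is elementary if (i) $n=2$ and the two faces touch exactly twice, or (ii) $n \ge 3$ and any two faces of the ring touch at most once. A face ring is noncontractible if $\bigcup_{i=1}^{n} \overline{f_i}$ contains a noncontractible simple closed curve of the surface. *)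

(* Defs.v *)
From HB Require Import structures.
From mathcomp Require Import all_boot all_order all_algebra.
From mathcomp Require Import all_classical all_reals all_analysis.
Set Implicit Arguments.
Unset Strict Implicit.
Unset Printing Implicit Defensive.
Import Order.TTheory GRing.Theory Num.Theory.
Import numFieldNormedType.Exports.
Local Open Scope classical_set_scope.
Local Open Scope ring_scope.

(* Finite loopless multigraphs: parallel edges are distinct elements of [edge]
   with the same set of ends. *)
Record mgraph := MGraph {
  vert : finType;
  edge : finType;
  ends : edge -> {set vert};
  card_ends : forall e, #|ends e| = 2%N
}.

Section Graph.
Variable G : mgraph.

Definition adjacent_vert (u v : vert G) : bool :=
  [exists e : edge G, ends e == [set u; v]%SET].

(* The graph obtained from G by deleting the vertices in X is connected. *)
Definition connected_without (X : {set vert G}) : Prop :=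
  forall u v, u \notin X -> v \notin X ->
    connect [rel x y | [&& x \notin X, y \notin X & adjacent_vert x y]] u v.

Definition two_connected : Prop :=
  (2 < #|vert G|)%N /\
  forall X : {set vert G}, (#|X| < 2)%N -> connected_without X.

Record cycle_of := CycleOf {
  clen : nat;
  cvert : 'I_clen -> vert G;
  cedge : 'I_clen -> edge G;
  clen_ge2 : (2 <= clen)%N;
  cvert_inj : injective cvert;
  cedge_inj : injective cedge;
  cedge_ends : forall i, ends (cedge i) = [set cvert i; cvert (ordS i)]%SET
}.

End Graph.

(* f maps A homeomorphically onto B, with inverse g. *)
Definition homeo_between (S T : topologicalType) (A : set S) (B : set T)
    (f : S -> T) (g : T -> S) : Prop :=
  [/\ f @` A `<=` B, g @` B `<=` A,
      {in A, cancel f g}, {in B, cancel g f} &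
      {within A, continuous f} /\ {within B, continuous g}].

Definition boundary (T : topologicalType) (A : set T) : set T :=
  closure A `\` interior A.

Section Models.
Variable R : realType.

Definition unit_interval : set R := [set t | 0 <= t <= 1].
Definition open_disk : set (R * R) := [set p | p.1 ^+ 2 + p.2 ^+ 2 < 1].
Definition closed_disk : set (R * R) := [set p | p.1 ^+ 2 + p.2 ^+ 2 <= 1].
Definition circle : set (R * R) := [set p | p.1 ^+ 2 + p.2 ^+ 2 = 1].
Definition sphere : set (R * R * R) :=
  [set p | p.1.1 ^+ 2 + p.1.2 ^+ 2 + p.2 ^+ 2 = 1].

(* Two closed curves (maps on the unit circle) are freely homotopic in X. *)
Definition circle_homotopic (T : topologicalType) (X : set T)
    (f g : R * R -> T) : Prop :=
  exists H : R * (R * R) -> T,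
    [/\ {within unit_interval `*` circle, continuous H},
        H @` (unit_interval `*` circle) `<=` X,
        forall p, circle p -> H (0, p) = f p &
        forall p, circle p -> H (1, p) = g p].

(* A homeomorphism h from an open plane set U to an open plane set preserves
   orientation iff the image of every small positively oriented circle about x
   winds once, positively, around h x. *)
Definition orientation_preserving (U : set (R * R)) (h : R * R -> R * R) :=
  forall (x : R * R) (r : R), 0 < r ->
    (forall p, closed_disk p -> U (x.1 + r * p.1, x.2 + r * p.2)) ->
    @circle_homotopic (R * R)%type [set p | p <> 0]
      (fun p => h (x.1 + r * p.1, x.2 + r * p.2) - h x) id.

End Models.

Section Surfaces.
Variables (R : realType) (T : topologicalType).

Definition chart (U : set T) (phi : T -> R * R) (psi : R * R -> T) : Prop :=
  [/\ open U, open (phi @` U) & homeo_between U (phi @` U) phi psi].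

(* Second countability follows from compactness. *)
Definition surface : Prop :=
  [/\ [set: T] !=set0, connected [set: T], compact [set: T],
      hausdorff_space T &
      forall x : T, exists U phi psi, U x /\ chart U phi psi].

Definition orientable : Prop :=
  exists (I : Type) (U : I -> set T)
         (phi : I -> T -> R * R) (psi : I -> R * R -> T),
    [/\ forall i, chart (U i) (phi i) (psi i),
        \bigcup_i U i = [set: T] &
        forall i j, orientation_preserving
          (phi i @` (U i `&` U j)) (phi j \o psi i)].

(* The quotient of the 2-sphere identifying antipodal points. *)
Definition projective_plane : Prop :=
  surface /\
  exists q : R * R * R -> T,
    [/\ q @` @sphere R = [set: T],
        forall x y, sphere x -> sphere y -> (q x = q y <-> x = y \/ x = - y) &
        forall U : set T,
          open U <-> open (q @^-1` U : set (subspace (@sphere R)))].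

Definition simple_closed_curve (c : R * R -> T) : Prop :=
  {within @circle R, continuous c} /\ set_inj (@circle R) c.

Definition contractible (c : R * R -> T) : Prop :=
  exists x : T, circle_homotopic [set: T] c (fun=> x).

End Surfaces.

Section Embeddings.
Variables (R : realType) (G : mgraph) (T : topologicalType).

Record embedding := Embedding {
  vpt : vert G -> T;
  edge_curve : edge G -> R -> T;
  vpt_inj : injective vpt;
  arc_cont : forall e, {within @unit_interval R, continuous (edge_curve e)};
  arc_inj : forall e, set_inj (@unit_interval R) (edge_curve e);
  arc_ends : forall e, vpt @` [set` ends e] = [set edge_curve e 0; edge_curve e 1];
  arc_vpt : forall e v (t : R), 0 < t < 1 -> edge_curve e t <> vpt v;
  arc_arc : forall e e' (s t : R), 0 < s < 1 -> 0 < t < 1 ->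
    edge_curve e s = edge_curve e' t -> e = e'
}.

Definition graph_points (Psi : embedding) : set T :=
  range (vpt Psi) `|` \bigcup_e (edge_curve Psi e @` @unit_interval R).

Definition cycle_points (Psi : embedding) (C : cycle_of G) : set T :=
  \bigcup_i (edge_curve Psi (cedge (c := C) i) @` @unit_interval R).

Definition face (Psi : embedding) (f : set T) : Prop :=
  exists2 x, ~ graph_points Psi x &
    f = connected_component (~` graph_points Psi) x.

(* The homeomorphism phi between the open disk and the face has to extend
   injectively to the boundary circle: this says that the boundary walk of f
   traverses the bounding cycle exactly once. It does not follow from the face
   being an open disk whose boundary is the point set of a cycle: a
   noncontractible cycle embedded by itself in the projective plane has a single
   face, an open disk, whose boundary walk runs twice around the cycle. *)
Definition closed_2cell_face (Psi : embedding) (f : set T) : Prop :=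
  (exists (phi : R * R -> T) (psi : T -> R * R),
     homeo_between (@closed_disk R) (closure f) phi psi /\
     phi @` @open_disk R = f) /\
  exists C : cycle_of G, boundary f = cycle_points Psi C.

Definition closed_2cell_embedding (Psi : embedding) : Prop :=
  forall f, face Psi f -> closed_2cell_face Psi f.

(* The set of connected components of the common boundary of f and g; f and g
   touch k times when it has k elements. *)
Definition touchings (f g : set T) : set (set T) :=
  connected_component (boundary f `&` boundary g) @` (boundary f `&` boundary g).

Definition face_ring (Psi : embedding) (n : nat) (F : 'I_n -> set T) : Prop :=
  let common i j := boundary (F i) `&` boundary (F j) in
  [/\ forall i, face Psi (F i),
      injective F &
      (n = 2%N /\ forall i j, i != j -> (`I_2 #<= touchings (F i) (F j))%card) \/
      [/\ (3 <= n)%N,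
          forall i j k m, i != j -> k != m ->
            [set i; j]%SET != [set k; m]%SET ->
            common i j `&` common k m = set0,
          forall i, common i (ordS i) !=set0 &
          forall i j, i != j -> j != ordS i -> i != ordS j ->
            common i j = set0]].

Definition elementary (n : nat) (F : 'I_n -> set T) : Prop :=
  (n = 2%N /\ forall i j, i != j -> (touchings (F i) (F j) #= `I_2)%card) \/
  ((3 <= n)%N /\
   forall i j, i != j -> (touchings (F i) (F j) #<= `I_1)%card).

Definition noncontractible (n : nat) (F : 'I_n -> set T) : Prop :=
  exists c : R * R -> T,
    [/\ simple_closed_curve c,
        c @` @circle R `<=` \bigcup_i closure (F i) & ~ contractible c].

End Embeddings.

(* Main.v *)
(* Orient the bounding cycle of every face.  Around a vertex the orientations of the
   incident faces that agree at every edge form a two-element set, so coherent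
   orientations are the sections of a two-valued local system on the projective plane;
   the same holds after changing signs at some edges, as long as the signs around
   every vertex cancel.  Lifted to the sphere such a system has a section, which is
   either invariant or reversed by the antipodal map.  If the system has a section over
   the faces of the ring, the second case is impossible: comparing the two sections
   would lift a noncontractible curve of the ring to a loop of the sphere that misses
   a point.  So there is a global section.

   If the faces of the ring can be oriented coherently, then so can all faces.
   Otherwise, as the length of the ring is odd, its faces can be oriented so that any
   two consecutive ones disagree along their common boundary, which is connected.
   Changing the signs along one side of the ring and along the common boundaries makes
   a global section possible.  Now replace the ring by two faces, running along its two
   sides and crossing over at every common boundary: all faces are then coherently
   oriented.

   Finally, a graph with coherently oriented facial cycles is embedded in the geometric
   realisation of its barycentric subdivision.  The charts are the open stars of the
   nodes, laid out in the plane by cyclically ordered vectors; a transition map is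
   linear of positive determinant on both sides of a line, hence orientation
   preserving. *)
From HB Require Import structures.
From mathcomp Require Import all_boot all_order all_algebra.
From mathcomp Require Import all_classical all_reals all_analysis.
From mathcomp Require Import finmap ring lra zify.
Require Import Defs.
Set Implicit Arguments.
Unset Strict Implicit.
Unset Printing Implicit Defensive.
Import Order.TTheory GRing.Theory Num.Theory.
Import numFieldNormedType.Exports.
Local Open Scope classical_set_scope.
Local Open Scope ring_scope.

(** * General topology *)

(** Oddness of the length is a solvability condition: if [g i] is the sign between consecutive ring
    faces and [theta] the sum of all [g i], orientations with consecutive differences
    [g i (+) theta] exist iff [(l + 1) theta] vanishes modulo 2. Elementarity enters twice:
    connected common boundaries make [g i] independent of the vertex where it is read, and they
    separate the boundary of a ring face into two arcs between its neighbours, so that one arc can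
    be singled out. The delicate points of the surgery are the vertices on two consecutive ring
    faces: the crossing strands could tear the rotation at such a vertex into several cycles. A
    parity count, [boundary_parity], excludes this. Only a labelling of the darts survives the
    surgery, each label passing a vertex at most once. A strand may consist of several cycles, so
    the final faces are orbits rather than labels. The topology rests on one device, two-valued
    systems with sections over pieces of the plane. Applied to complex square roots it yields
    invariance of domain; applied to signs of faces it yields sections over the sphere. *)

Lemma within_contP (T U : topologicalType) (A : set T) (f : T -> U) :
  {within A, continuous f} <->
  forall x, A x -> forall O, nbhs (f x) O ->
    exists2 W, nbhs x W & forall y, W y -> A y -> O (f y).
Proof.
split=> [/subspace_continuousP cf x Ax O Ofx|H].
  have := cf x Ax O Ofx; rewrite /nbhs /= /within /= => W.
  by exists [set y | A y -> O (f y)].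
apply/subspace_continuousP => x Ax O Ofx.
have [W Wx WO] := H x Ax O Ofx.
by rewrite /nbhs /= /within /=; apply: filterS Wx => y /WO.
Qed.

Lemma within_comp (T U V : topologicalType) (A : set T) (B : set U) (f : T -> U) (g : U -> V) :
  {within A, continuous f} -> {within B, continuous g} ->
  (forall x, A x -> B (f x)) -> {within A, continuous (fun x => g (f x))}.
Proof.
move=> /within_contP cf /within_contP cg AB; apply/within_contP => x Ax O Ox.
have [W Wx WO] := cg _ (AB _ Ax) _ Ox.
have [W' W'x W'W] := cf _ Ax _ Wx.
by exists W' => // y W'y Ay; apply: WO; [exact: W'W|exact: AB].
Qed.

Lemma within_eq (T U : topologicalType) (A : set T) (f g : T -> U) :
  (forall x, A x -> f x = g x) ->
  {within A, continuous f} -> {within A, continuous g}.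
Proof.
move=> fg /within_contP cf; apply/within_contP => x Ax O.
by rewrite -fg// => /(cf _ Ax)[W Wx WO]; exists W => // y Wy Ay; rewrite -fg//; exact: WO.
Qed.

Lemma within_pair (T U V : topologicalType) (A : set T) (f : T -> U) (g : T -> V) :
  {within A, continuous f} -> {within A, continuous g} ->
  {within A, continuous (fun x => (f x, g x))}.
Proof. by move=> cf cg x; apply: cvg_pair; [exact: cf|exact: cg]. Qed.

Lemma within_glue (T U : topologicalType) (A B : set T) (f g h : T -> U) : closed A -> closed B ->
  {within A, continuous f} -> {within B, continuous g} ->
  (forall x, A x -> h x = f x) -> (forall x, B x -> h x = g x) ->
  {within A `|` B, continuous h}.
Proof.
move=> cA cB cf cg hf hg; apply: withinU_continuous => //.
  by apply: within_eq cf => x Ax; rewrite hf.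
by apply: within_eq cg => x Bx; rewrite hg.
Qed.

(** The part of [K] outside a neighbourhood of [x] is compact, so its image is closed and can be
    avoided near [f x]. *)
Lemma within_inv (T U : topologicalType) (K : set T) (f : T -> U) (g : U -> T) :
  hausdorff_space U -> compact K -> {within K, continuous f} ->
  (forall x, K x -> g (f x) = x) -> {within f @` K, continuous g}.
Proof.
move=> hU cK cf gf; apply/within_contP => y [x Kx <-]; rewrite gf// => O Ox.
have cKO : compact (K `&` ~` O°) by apply: compact_closedI => //; exact: open_closedC (open_interior O).
have cf2 : {within K `&` ~` O°, continuous f} by apply: continuous_subspaceW cf => z [].
have := compact_closed hU (continuous_compact cf2 cKO) => /closed_openC oC.
exists (~` (f @` (K `&` ~` O°))).
  apply: open_nbhs_nbhs; split=> // -[z [Kz +] fzx]; apply.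
  by rewrite -(gf z Kz) fzx gf.
move=> y1 H [z Kz E]; rewrite -E in H *; rewrite gf//; apply: contrapT => nO; apply: H.
exists z => //; split=> // Oz; apply: nO; exact: (interior_subset Oz).
Qed.

Section Connected.
Variables (T : topologicalType).

(** The form in which connectedness is mostly used: [Q] and its negation are both relatively open in
    [A]. *)
Lemma locally_constant_connected (A : set T) (Q : T -> Prop) : connected A ->
  (forall x, A x -> exists2 W, nbhs x W & forall y, W y -> A y -> (Q x <-> Q y)) ->
  forall x y, A x -> A y -> Q x -> Q y.
Proof.
move=> cA lQ x y Ax Ay Qx.
have oQ (B : set T) : (forall x, A x -> B x -> exists2 W, nbhs x W & forall y, W y -> A y -> B y) ->
    exists2 C, open C & A `&` B = A `&` C.
  move=> H; exists (\bigcup_(C in [set C | open C /\ A `&` C `<=` B]) C).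
    by apply: bigcup_open => C [].
  apply/seteqP; split=> [z [Az Bz]|z [Az [C [oC ACB] Cz]]]; split=> //; last exact: ACB.
  have [W Wz WB] := H z Az Bz; exists W°; last exact: Wz.
  by split; [exact: open_interior|move=> t [At /interior_subset Wt]; exact: WB].
suff E : A `&` Q = A by have [] : (A `&` Q) y by rewrite E.
apply: cA.
- by exists x.
- have [] := oQ Q; last by move=> C oC E; exists C.
  move=> z Az Qz; have [W Wz WQ] := lQ z Az; exists W => // t Wt At.
  by apply/(WQ t Wt At).
- have [] := oQ (~` Q).
    move=> z Az Qz; have [W Wz WQ] := lQ z Az; exists W => // t Wt At Qt.
    by apply: Qz; apply/(WQ t Wt At).
  move=> C oC E; exists (~` C); first exact: open_closedC.
  apply/seteqP; split=> z [Az H]; split=> //.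
    by move=> Cz; have [] : (A `&` ~` Q) z by rewrite E.
  by apply: contrapT => nQ; apply: H; have [] : (A `&` C) z by rewrite -E.
Qed.

Lemma connected_closed_sub (A X Y : set T) : connected A -> closed X -> closed Y ->
  A `<=` X `|` Y -> (forall x, A x -> X x -> Y x -> False) ->
  forall x, A x -> X x -> A `<=` X.
Proof.
move=> cA cX cY AXY dXY x Ax Xx y Ay.
apply: (locally_constant_connected cA _ Ax Ay Xx) => z Az.
have aux (Z Z' : set T) : closed Z' -> A `<=` Z `|` Z' ->
    (forall x, A x -> Z x -> Z' x -> False) -> Z z ->
    exists2 W, nbhs z W & forall t, W t -> A t -> Z t.
  move=> cZ' AZ dZ Zz; exists (~` Z').
    by apply: open_nbhs_nbhs; split; [exact: closed_openC|exact: dZ].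
  by move=> t nZ' /AZ[].
have [Xz|nXz] := pselect (X z).
  have [W Wz WX] := aux X Y cY AXY dXY Xz.
  by exists W => // t Wt At; split=> // _; exact: WX.
have [//|Yz] := AXY z Az.
have [] := aux Y X cX _ _ Yz.
- by move=> t /AXY[]; [right|left].
- by move=> t At Yt Xt; exact: dXY Yt.
by move=> W Wz WY; exists W => // t Wt At; split=> // Xt; case: (dXY t) => //; exact: WY.
Qed.

Lemma star_connected (A : set T) (c : T) :
  (forall x, A x -> exists B, [/\ B c, B x, B `<=` A & connected B]) ->
  connected A.
Proof.
move=> H; have [[x Ax]|A0] := pselect (A !=set0); last first.
  have -> : A = set0 by apply/seteqP; split=> // x Ax; case: A0; exists x.
  exact: connected0.
have Ac : A c by have [B [Bc _ + _]] := H x Ax; exact.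
rewrite -(_ : connected_component A c = A); first exact: component_connected.
apply/seteqP; split; first exact: connected_component_sub.
by move=> y /H[B [Bc By BA cB]]; exists B.
Qed.

End Connected.

Section WithinReal.
Variables (R : realType) (T : topologicalType) (A : set T).
Implicit Types (f g : T -> R).

Lemma wc_cst (U : topologicalType) (c : U) : {within A, continuous (fun=> c)}.
Proof. by move=> x; exact: cvg_cst. Qed.

Lemma wc_id : {within A, continuous (fun x => x)}.
Proof. by apply: continuous_subspaceT => x; exact: cvg_id. Qed.

Lemma wcD f g : {within A, continuous f} -> {within A, continuous g} ->
  {within A, continuous (fun x => f x + g x)}.
Proof. by move=> cf cg x; apply: cvgD; [exact: cf|exact: cg]. Qed.

Lemma wcM f g : {within A, continuous f} -> {within A, continuous g} ->
  {within A, continuous (fun x => f x * g x)}.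
Proof. by move=> cf cg x; apply: cvgM; [exact: cf|exact: cg]. Qed.

Lemma wcN f : {within A, continuous f} -> {within A, continuous (fun x => - f x)}.
Proof. by move=> cf x; apply: cvgN; exact: cf. Qed.

Lemma wc_sqr f n : {within A, continuous f} -> {within A, continuous (fun x => f x ^+ n)}.
Proof.
move=> cf; elim: n => [|n IH]; first exact: wc_cst.
by under [X in continuous X]eq_fun do rewrite exprS; exact: wcM.
Qed.

Lemma wcV f : (forall x, A x -> f x != 0) ->
  {within A, continuous f} -> {within A, continuous (fun x => (f x)^-1)}.
Proof.
move=> f0 cf; apply/subspace_continuousP => x Ax; apply: cvgV; first exact: f0.
by move/subspace_continuousP : cf; apply.
Qed.

Lemma wc_sqrt f : {within A, continuous f} ->
  {within A, continuous (fun x => Num.sqrt (f x))}.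
Proof. by move=> cf x; apply: continuous_comp; [exact: cf|exact: sqrt_continuous]. Qed.

Lemma wc_norm f : {within A, continuous f} ->
  {within A, continuous (fun x => `|f x|)}.
Proof. by move=> cf x; apply: continuous_comp; [exact: cf|exact: norm_continuous]. Qed.

Lemma wc_fst (U V : topologicalType) (f : T -> U * V) : {within A, continuous f} ->
  {within A, continuous (fun x => (f x).1)}.
Proof. by move=> cf x; apply: continuous_comp; [exact: cf|exact: cvg_fst]. Qed.

Lemma wc_snd (U V : topologicalType) (f : T -> U * V) : {within A, continuous f} ->
  {within A, continuous (fun x => (f x).2)}.
Proof. by move=> cf x; apply: continuous_comp; [exact: cf|exact: cvg_snd]. Qed.

Lemma wc_min f g : {within A, continuous f} -> {within A, continuous g} ->
  {within A, continuous (fun x => Num.min (f x) (g x))}.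
Proof.
move=> cf cg.
have -> : (fun x => Num.min (f x) (g x)) = fun x => 2^-1 * (f x + g x + - `|f x + - g x|).
  apply/funext => x; have [fg|fg] := leP (f x) (g x).
    by rewrite (ler0_norm (_ : f x - g x <= 0)) ?subr_le0//; lra.
  by rewrite (gtr0_norm (_ : 0 < f x - g x)) ?subr_gt0//; lra.
by apply: wcM; [exact: wc_cst|apply: wcD; [exact: wcD|apply/wcN/wc_norm/wcD => //; exact: wcN]].
Qed.

Lemma wc_max f g : {within A, continuous f} -> {within A, continuous g} ->
  {within A, continuous (fun x => Num.max (f x) (g x))}.
Proof.
move=> cf cg.
have -> : (fun x => Num.max (f x) (g x)) = fun x => - Num.min (- f x) (- g x).
  by apply/funext => x; rewrite -oppr_max opprK.
by apply/wcN/wc_min; exact: wcN.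
Qed.

End WithinReal.

Lemma wc_fst0 (T U : topologicalType) (A : set (T * U)) : {within A, continuous fst}.
Proof. by apply: continuous_subspaceT => x; exact: cvg_fst. Qed.

Lemma wc_snd0 (T U : topologicalType) (A : set (T * U)) : {within A, continuous snd}.
Proof. by apply: continuous_subspaceT => x; exact: cvg_snd. Qed.

Ltac wcont1 := match goal with
  | |- {within _, continuous fst} => exact: wc_fst0
  | |- {within _, continuous snd} => exact: wc_snd0
  | |- {within _, continuous id} => exact: wc_id
  | |- {within _, continuous (fun _ => (_, _))} => apply: within_pair
  | |- {within _, continuous (fun _ => _ + _)} => apply: wcD
  | |- {within _, continuous (fun _ => _ * _)} => apply: wcM
  | |- {within _, continuous (fun _ => - _)} => apply: wcN
  | |- {within _, continuous (fun _ => _ ^+ _)} => apply: wc_sqr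
  | |- {within _, continuous (fun _ => Num.sqrt _)} => apply: wc_sqrt
  | |- {within _, continuous (fun _ => `|_|)} => apply: wc_norm
  | |- {within _, continuous (fun _ => Num.min _ _)} => apply: wc_min
  | |- {within _, continuous (fun _ => Num.max _ _)} => apply: wc_max
  | |- {within _, continuous (fun x => x)} => exact: wc_id
  | |- {within _, continuous (fun _ => ?c)} => exact: wc_cst
  | |- {within _, continuous (fun _ => fst _)} => apply: wc_fst
  | |- {within _, continuous (fun _ => snd _)} => apply: wc_snd
  end.
Ltac wcont := repeat (wcont1 || assumption).

Section Real.
Variable R : realType.
Implicit Types (a b c d t x : R).

(** Compactness of the interval without subdivisions: the supremum of the [x] with [Q a x] satisfies
    it too, and locality there carries the property further unless [b] is reached. *)
Lemma additive_local_interval (Q : R -> R -> Prop) (a b : R) :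
  (forall x y z, x <= y -> y <= z -> Q x y -> Q y z -> Q x z) ->
  (forall t, a <= t <= b -> exists2 e, 0 < e &
     forall c d, t - e <= c -> c <= d -> d <= t + e -> a <= c -> d <= b -> Q c d) ->
  a <= b -> Q a b.
Proof.
move=> Qadd Qloc ab; pose S := [set x | a <= x <= b /\ Q a x].
have Sa : S a.
  split; first by rewrite lexx ab.
  have [|e e0 H] := Qloc a; first by rewrite lexx ab.
  by apply: H => //; lra.
have uS : has_sup S by split; [exists a|exists b => x [/andP[]]].
have supS := sup_upper_bound uS.
set m := sup S; have am : a <= m by exact: supS.
have mb : m <= b by apply: ge_sup; [exists a|move=> x [/andP[]]].
have [|e e0 H] := Qloc m; first by rewrite am mb.
have [s [/andP[as_ sb] Qas] ms] := sup_adherent e0 uS.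
have sm : s <= m by apply: supS; split=> //; rewrite as_ sb.
have Qam : Q a m by apply: (Qadd _ s) => //; apply: H => //; rewrite -/m in ms; lra.
pose m' := Num.min b (m + e).
have mm' : m <= m' by rewrite /m' le_min; apply/andP; split=> //; lra.
have m'b : m' <= b by rewrite /m' ge_min lexx.
have Qam' : Q a m'.
  apply: (Qadd _ m) => //; apply: H => //; first lra.
  by rewrite /m' ge_min lexx orbT.
have : m' <= m by apply: supS; split=> //; rewrite m'b andbT; lra.
rewrite /m' ge_min => /orP[bm|]; last lra.
by have -> : b = m by lra.
Qed.

Definition convex2 (A : set (R * R)) := forall p q t, A p -> A q ->
  0 <= t <= 1 -> A (p.1 + t * (q.1 - p.1), p.2 + t * (q.2 - p.2)).

Lemma path_connected (T : topologicalType) (f : R -> T) a b :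
  {within `[a, b], continuous f} -> connected (f @` `[a, b]).
Proof. by apply: connected_continuous_connected; exact: segment_connected. Qed.

Lemma convex_connected (A : set (R * R)) : convex2 A -> connected A.
Proof.
move=> cA; have [[c Ac]|A0] := pselect (A !=set0); last first.
  have -> : A = set0 by apply/seteqP; split=> // x Ax; case: A0; exists x.
  exact: connected0.
apply: (@star_connected _ _ c) => x Ax.
pose f (t : R) := (c.1 + t * (x.1 - c.1), c.2 + t * (x.2 - c.2)).
exists (f @` `[0, 1]); split.
- exists 0; first by rewrite /= in_itv/= lexx ler01.
  by rewrite /f !mul0r !addr0; case: (c).
- exists 1; first by rewrite /= in_itv/= lexx ler01.
  by rewrite /f !mul1r !subrKC; case: (x).
- by move=> _ [t /= + <-]; rewrite in_itv/= => t01; exact: cA.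
by apply: path_connected; rewrite /f; wcont.
Qed.

End Real.

(** * Two-valued local systems *)

Section Torsor.
Variables (R : realType) (T : topologicalType) (V : Type) (X : set T).
Variables (good : set T -> (T -> V) -> Prop) (eqv : T -> V -> V -> Prop) (flip : V -> V).

(** Read [good A s] as: [s] is a section over [A]. Values at [x] are compared by [eqv x], and [flip]
    gives the only other section over a connected set. The two instances are square roots of a
    plane-valued map and signs of faces pulled back to the sphere. *)
Definition two_valued_system : Prop :=
  [/\ forall A B s, A `<=` B -> good B s -> good A s,
      forall A s, good A s -> good A (flip \o s),
      forall A s s', A `<=` X -> connected A -> good A s -> good A s' ->
        (forall x, A x -> eqv x (s x) (s' x)) \/
        (forall x, A x -> eqv x (s x) (flip (s' x))),
      forall A B s s', A `<=` X -> B `<=` X -> closed A -> closed B ->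
        good A s -> good B s' ->
        (forall x, A x -> B x -> eqv x (s x) (s' x)) ->
        good (A `|` B) (fun x => if x \in A then s x else s' x) &
      (exists s, good set0 s) /\
      forall x, X x -> exists2 W, nbhs x W & exists s, good (W `&` X) s].

Hypothesis sysP : two_valued_system.

(** On the connected overlap the sections agree or differ by [flip]; in the second case [s'] is
    flipped before gluing. *)
Lemma system_glue A B s s' : A `<=` X -> B `<=` X -> closed A -> closed B ->
  connected (A `&` B) -> good A s -> good B s' ->
  exists2 s'', good (A `|` B) s'' & forall x, A x -> s'' x = s x.
Proof.
have [gsub gflip guniq gglue _] := sysP.
move=> AX BX cA cB cAB gs gs'.
have [||||E|E] := guniq (A `&` B) s s'; rewrite //.
- by move=> x [/AX].
- by apply: gsub gs => x [].
- by apply: gsub gs' => x [].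
- exists (fun x => if x \in A then s x else s' x); last by move=> x Ax; rewrite mem_set.
  by apply: gglue => // x Ax Bx; exact: E.
- exists (fun x => if x \in A then s x else (flip \o s') x); last by move=> x Ax; rewrite mem_set.
  by apply: gglue => //; [exact: gflip|move=> x Ax Bx; exact: E].
Qed.

Variables (pr : T -> R * R).
Hypotheses (cX : compact X) (clX : closed X) (cpr : continuous pr)
  (pr_inj : forall x y, X x -> X y -> pr x = pr y -> x = y).

(** The pieces of [X] over closed rectangles. Connectedness of all of them, degenerate rectangles
    included, stands in for simple connectedness: it allows gluing along every cut. *)
Definition prect a b c d := X `&` [set x | (a <= (pr x).1 <= b) && (c <= (pr x).2 <= d)].

Hypothesis (conn : forall a b c d, connected (prect a b c d)).

Let prect_sub a b c d : prect a b c d `<=` X.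
Proof. by move=> x []. Qed.

Let prect_closed a b c d : closed (prect a b c d).
Proof.
apply: closedI => //.
rewrite (_ : mkset _ = pr @^-1` ((fst @^-1` `[a, b]) `&` (snd @^-1` `[c, d]))).
  apply: closed_comp => [x _|]; first exact: cpr.
  apply: closedI; apply: closed_comp => //; try exact: itv_closed.
    by move=> x _; exact: cvg_fst.
  by move=> x _; exact: cvg_snd.
apply/seteqP; split=> x /=; rewrite !in_itv /=; first by move=> /andP[].
by move=> [-> ->].
Qed.

Let local_rect u v : exists2 e, 0 < e & exists s, good (prect (u - e) (u + e) (v - e) (v + e)) s.
Proof.
have [gsub _ _ _ [g0 gloc]] := sysP.
(* A compact set that misses the fibre over [(u, v)] misses a small square around it. This is
   applied to [X] minus a neighbourhood of the point over [(u, v)], or to [X] itself if there is no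
   such point. *)
have aux (K : set T) : closed K -> K `<=` X -> (forall x, K x -> pr x <> (u, v)) ->
    exists2 e, 0 < e & forall x, K x -> ~ prect (u - e) (u + e) (v - e) (v + e) x.
  move=> clK KX Kuv.
  have : compact K by apply: subclosed_compact cX KX.
  have cpr2 : {within K, continuous pr} by exact: continuous_subspaceT.
  move=> /(continuous_compact cpr2)/compact_closed.
  have hR2 : hausdorff_space (R * R)%type by exact: norm_hausdorff.
  move=> /(_ hR2) /closed_openC oK.
  have : nbhs (u, v) (~` (pr @` K)).
    by apply: open_nbhs_nbhs; split=> // -[x Kx /(Kuv x Kx)].
  rewrite -nbhs_ballE => -[e /= e0 He]; exists (e / 2); first exact: divr_gt0.
  move=> x Kx [_ /= /andP[/andP[h1 h2] /andP[h3 h4]]].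
  apply: (He (pr x)); last by exists x.
  rewrite /ball /= /prod_ball /= /ball /= !ltr_norml; split; apply/andP; split; lra.
have [[x [Xx xuv]]|nX] := pselect (exists x, X x /\ pr x = (u, v)).
- have [W Wx [s gs]] := gloc x Xx.
  have [||y [Xy nWy] yuv|e e0 He] := aux (X `&` ~` W°).
  + by apply: closedI => //; apply: open_closedC; exact: open_interior.
  + by move=> y [].
  + apply: nWy; suff -> : y = x by [].
    by apply: pr_inj => //; rewrite yuv.
  + exists e => //; exists s; apply: gsub gs => y py; have [Xy _] := py; split=> //.
    apply: contrapT => nWy; apply: (He y) => //; split=> // /interior_subset //.
- have [//|y Xy yuv|e e0 He] := aux X clX; first by apply: nX; exists y.
  have [s gs] := g0; exists e => //; exists s; apply: gsub gs => y py.
  by have [Xy _] := py; have := He y Xy py.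
Qed.

Let add_rect a b c c' d : c <= c' -> c' <= d -> (exists s, good (prect a b c c') s) ->
  (exists s, good (prect a b c' d) s) -> exists s, good (prect a b c d) s.
Proof.
have [gsub _ _ _ _] := sysP.
move=> h1 h2 [s gs] [s' gs'].
have [||//|s'' gs'' _] := system_glue (@prect_sub _ _ _ _) (@prect_sub _ _ _ _) _ _ _ gs gs'.
- exact: prect_closed.
- exact: prect_closed.
- rewrite (_ : _ `&` _ = prect a b c' c'); first exact: conn.
  apply/seteqP; split=> x.
    by move=> [[Xx /= k] [_ /= k']]; split=> //=; lra.
  by move=> [Xx /= k]; split; split=> //=; lra.
exists s''; apply: gsub gs'' => x [Xx /= /andP[k k']].
by have [xc|xc] := leP (pr x).2 c'; [left|right]; split => //=; rewrite k /=; lra.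
Qed.

Let add_rect2 a a' b c d : a <= a' -> a' <= b -> (exists s, good (prect a a' c d) s) ->
  (exists s, good (prect a' b c d) s) -> exists s, good (prect a b c d) s.
Proof.
have [gsub _ _ _ _] := sysP.
move=> h1 h2 [s gs] [s' gs'].
have [||//|s'' gs'' _] := system_glue (@prect_sub _ _ _ _) (@prect_sub _ _ _ _) _ _ _ gs gs'.
- exact: prect_closed.
- exact: prect_closed.
- rewrite (_ : _ `&` _ = prect a' a' c d); first exact: conn.
  apply/seteqP; split=> x.
    by move=> [[Xx /= k] [_ /= k']]; split=> //=; lra.
  by move=> [Xx /= k]; split; split=> //=; lra.
exists s''; apply: gsub gs'' => x [Xx /= /andP[k k']].
by have [xc|xc] := leP (pr x).1 a'; [left|right]; split => //=; rewrite k' /=; lra.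
Qed.

Lemma system_rect a b c d : a <= b -> c <= d -> exists s, good (prect a b c d) s.
Proof.
move=> ab cd; have [gsub _ _ _ _] := sysP.
pose Q a b := exists s, good (prect a b c d) s.
apply: (@additive_local_interval _ Q) => //.
  by move=> x y z; exact: add_rect2.
move=> u _.
(* The half-width is left free, so that two stacked strips can be glued after passing to the smaller
   width. Gluing vertically near each abscissa and then horizontally replaces a covering of the
   rectangle. *)
pose Q' c d := exists2 e, 0 < e & exists s, good (prect (u - e) (u + e) c d) s.
have [||//|e e0 [s gs]] := @additive_local_interval _ Q' c d.
- move=> x y z xy yz [e e0 [s gs]] [e' e0' [s' gs']].
  exists (Num.min e e'); first by rewrite lt_min e0 e0'.
  apply: (add_rect xy yz); [exists s; apply: gsub gs|exists s'; apply: gsub gs'];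
  move=> t [Xt /= /andP[/andP[k1 k2] k3]]; split=> //=; rewrite k3 andbT.
    have : Num.min e e' <= e by rewrite ge_min lexx.
    by move=> h; lra.
  have : Num.min e e' <= e' by rewrite ge_min lexx orbT.
  by move=> h; lra.
- move=> v _; have [e e0 [s gs]] := local_rect u v; exists e => // c' d' h1 h2 h3 _ _.
  exists e => //; exists s; apply: gsub gs => t [Xt /= /andP[k1 k3]]; split=> //=.
  by rewrite k1 /=; lra.
exists e => // c' d' h1 h2 h3 _ _.
exists s; apply: gsub gs => t [Xt /= /andP[k1 k3]]; split=> //=.
by rewrite k3 andbT /=; lra.
Qed.

Lemma system_section m : (forall x, X x -> `|(pr x).1| <= m /\ `|(pr x).2| <= m) ->
  0 <= m -> exists s, good X s.
Proof.
have [gsub _ _ _ _] := sysP.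
move=> Xm m0; have [||s gs] := @system_rect (- m) m (- m) m; try lra.
exists s; apply: gsub gs => x Xx; split=> //=.
by have [] := Xm x Xx; rewrite !ler_norml => -> ->.
Qed.

End Torsor.

(** * Square roots on the circle and invariance of domain *)

Section PlaneSquareRoot.
Variable R : realType.
Implicit Types p q : R * R.

(** Points of the plane are read as complex numbers; this is the square. *)
Definition csq p : R * R := (p.1 ^+ 2 - p.2 ^+ 2, 2 * (p.1 * p.2)).
Definition cneg p : R * R := (- p.1, - p.2).

Lemma wc_cneg (A : set (R * R)) : {within A, continuous cneg}.
Proof. by apply: (@within_eq _ _ _ (fun p : R * R => (- p.1, - p.2))) => //; wcont. Qed.

Lemma pair_ext (S T : Type) (p q : S * T) : p.1 = q.1 -> p.2 = q.2 -> p = q.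
Proof. by case: p q => a b [c d] /= -> ->. Qed.

Lemma cnegK p : cneg (cneg p) = p.
Proof. by case: p => a b; rewrite /cneg /= !opprK. Qed.

Lemma csq_cneg p : csq (cneg p) = csq p.
Proof. by rewrite /csq /cneg /= !sqrrN mulrNN. Qed.

Lemma sumsq_eq0 (a b : R) : a ^+ 2 + b ^+ 2 = 0 -> a = 0 /\ b = 0.
Proof.
move/eqP; rewrite paddr_eq0 ?sqr_ge0// !sqrf_eq0 => /andP[/eqP -> /eqP ->].
by [].
Qed.

Lemma csq_eq p q : csq p = csq q -> p = q \/ p = cneg q.
Proof.
case: p q => [a b] [c d]; rewrite /csq /cneg /= => -[e1 e2].
(* Squared moduli in the factorisation of [p ^ 2 - q ^ 2] as [p - q] times [p + q]. *)
have : ((a - c) ^+ 2 + (b - d) ^+ 2) * ((a + c) ^+ 2 + (b + d) ^+ 2) = 0.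
  transitivity ((a ^+ 2 - b ^+ 2 - (c ^+ 2 - d ^+ 2)) ^+ 2
    + (2 * (a * b) - 2 * (c * d)) ^+ 2); first by ring.
  by rewrite e1 e2; ring.
move/eqP; rewrite mulf_eq0 => /orP[] /eqP /sumsq_eq0[h1 h2]; [left|right].
  by congr (_, _); lra.
by congr (_, _); lra.
Qed.

Lemma csq_neq0 p : csq p <> (0, 0) -> 0 < p.1 ^+ 2 + p.2 ^+ 2.
Proof.
move=> p0; rewrite lt_neqAle addr_ge0 ?sqr_ge0// andbT eq_sym.
apply: contra_notN p0 => /eqP /sumsq_eq0[a0 b0].
by rewrite /csq a0 b0 !mul0r mulr0 expr0n /= subrr.
Qed.

(** The principal square root by the half-angle formulas, to be used off the closed negative real
    axis. *)
Definition psqrt p : R * R :=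
  let r := Num.sqrt ((Num.sqrt (p.1 ^+ 2 + p.2 ^+ 2) + p.1) / 2) in
  (r, p.2 / (2 * r)).

Lemma psqrtK p : 0 < Num.sqrt (p.1 ^+ 2 + p.2 ^+ 2) + p.1 -> csq (psqrt p) = p.
Proof.
case: p => x y; rewrite /psqrt /csq /=; set n := Num.sqrt (_ + _) => nx.
have n2 : n ^+ 2 = x ^+ 2 + y ^+ 2 by rewrite sqr_sqrtr// addr_ge0 ?sqr_ge0.
set r := Num.sqrt _; have r0 : 0 < r by rewrite sqrtr_gt0; lra.
have r2 : r ^+ 2 = (n + x) / 2 by rewrite sqr_sqrtr//; lra.
have rne : r != 0 by rewrite gt_eqF.
congr (_, _); last by field.
rewrite exprMn exprVn exprMn r2.
have -> : y ^+ 2 = (n - x) * (n + x) by rewrite -subr_sqr n2; ring.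
have nxne : n + x != 0 by rewrite gt_eqF.
by field.
Qed.

Lemma wc_sign (T : topologicalType) (A : set T) (g : T -> R) : connected A ->
  {within A, continuous g} -> (forall x, A x -> g x <> 0) ->
  (forall x, A x -> 0 < g x) \/ (forall x, A x -> g x < 0).
Proof.
move=> cA cg g0; have [[x [Ax gx]]|H] := pselect (exists x, A x /\ 0 < g x); last first.
  right=> x Ax; rewrite lt_neqAle; apply/andP; split; first by apply/eqP/g0.
  by rewrite leNgt; apply/negP => gx; apply: H; exists x.
left=> y Ay; apply: (locally_constant_connected (Q := fun x => 0 < g x) cA _ Ax Ay gx) => z Az.
move/within_contP : cg => /(_ z Az) cg.
have := g0 z Az => /eqP; rewrite neq_lt => /orP[gz|gz].
- have [|W Wz WO] := cg [set t | t < 0].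
    by apply: open_nbhs_nbhs; split=> //; exact: open_lt.
  by exists W => // t Wt At; have /= := WO t Wt At; split; lra.
- have [|W Wz WO] := cg [set t | 0 < t].
    by apply: open_nbhs_nbhs; split=> //; exact: open_gt.
  by exists W => // t Wt At; have /= := WO t Wt At; split; lra.
Qed.

Section System.
Variables (T : topologicalType) (X : set T) (h : T -> R * R).
Hypotheses (ch : {within X, continuous h}) (h0 : forall x, X x -> h x <> (0, 0)).

Definition csqrt_on (A : set T) (s : T -> R * R) :=
  {within A, continuous s} /\ forall x, A x -> csq (s x) = h x.

(** Pointwise the roots are equal or opposite, so their inner product is plus or minus a nonzero
    squared length. It never vanishes, and its constant sign decides between the alternatives. *)
Lemma csqrt_uniq (A : set T) s s' : A `<=` X -> connected A -> csqrt_on A s -> csqrt_on A s' ->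
  (forall x, A x -> s x = s' x) \/ (forall x, A x -> s x = cneg (s' x)).
Proof.
move=> AX cA [cs hs] [cs' hs'].
have E x (Ax : A x) := csq_eq (etrans (hs x Ax) (esym (hs' x Ax))).
have P x (Ax : A x) : 0 < (s' x).1 ^+ 2 + (s' x).2 ^+ 2.
  by apply: csq_neq0; rewrite hs'//; exact/h0/AX.
have [|x Ax|H|H] := @wc_sign _ A (fun x => (s x).1 * (s' x).1 + (s x).2 * (s' x).2) cA.
- by wcont.
- have := P x Ax; have [->|->] := E x Ax; rewrite /cneg /=; nra.
- left=> x Ax; have := H x Ax; have := P x Ax; have [//|->] := E x Ax; rewrite /cneg /= => p0 n0; exfalso; nra.
- right=> x Ax; have := H x Ax; have := P x Ax; have [->|//] := E x Ax; rewrite /cneg /= => p0 n0; exfalso; nra.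
Qed.

Lemma csqrt_system : two_valued_system X csqrt_on (fun=> eq) cneg.
Proof.
split.
- move=> A B s AB [cs hs]; split; first exact: continuous_subspaceW cs.
  by move=> x /AB; exact: hs.
- move=> A s [cs hs]; split; first by rewrite /comp /cneg; wcont.
  by move=> x Ax; rewrite /= csq_cneg hs.
- exact: csqrt_uniq.
- move=> A B s s' AX BX cA cB [cs hs] [cs' hs'] ss'; split.
    apply: (within_glue cA cB cs cs') => x Kx; first by rewrite mem_set.
    by have [/set_mem Ax|//] := boolP (x \in A); exact: ss'.
  move=> x ABx; have [/set_mem Ax|/negP nA] := boolP (x \in A); first exact: hs.
  by apply: hs'; case: ABx => // /mem_set.
- split; first by exists (fun=> (0, 0)); split=> //; exact: continuous_subspace0.
  move=> x Xx.
  have aux (k : T -> R * R) : {within X, continuous k} -> 0 < Num.sqrt ((k x).1 ^+ 2 + (k x).2 ^+ 2) + (k x).1 ->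
      exists2 W, nbhs x W & {within W `&` X, continuous (psqrt \o k)} /\
        forall y, (W `&` X) y -> csq (psqrt (k y)) = k y.
    move=> ck kx.
    have cg : {within X, continuous (fun x => Num.sqrt ((k x).1 ^+ 2 + (k x).2 ^+ 2) + (k x).1)} by wcont.
    have [|W Wx WO] := (within_contP _ _).1 cg x Xx [set t | 0 < t].
      by apply: open_nbhs_nbhs; split=> //; exact: open_gt.
    exists W => //; split; last by move=> y [Wy Xy]; exact/psqrtK/WO.
    have ck' : {within W `&` X, continuous k} by apply: continuous_subspaceW ck => ? [].
    rewrite /comp /psqrt /=; wcont; apply: wcV; last by wcont.
    move=> y [Wy Xy]; rewrite mulf_neq0// gt_eqF// sqrtr_gt0 divr_gt0//.
    exact: WO.
  have [hx|hx] := ltP 0 (Num.sqrt ((h x).1 ^+ 2 + (h x).2 ^+ 2) + (h x).1).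
    by have [W Wx [cW hW]] := aux h ch hx; exists W => //; exists (psqrt \o h).
  (* Near the negative real axis [i] times the principal root of [- h] serves as a root of [h]. *)
  have [||W Wx [cW hW]] := aux (cneg \o h).
  + by rewrite /comp /cneg; wcont.
  + rewrite /cneg /= !sqrrN.
    have : 0 < Num.sqrt ((h x).1 ^+ 2 + (h x).2 ^+ 2); last by lra.
    rewrite sqrtr_gt0 lt_neqAle addr_ge0 ?sqr_ge0// andbT eq_sym.
    apply: contra_notN (h0 Xx) => /eqP /sumsq_eq0[a0 b0].
    by case: (h x) a0 b0 => a b /= -> ->.
  exists W => //; exists (fun y => (- (psqrt (cneg (h y))).2, (psqrt (cneg (h y))).1)).
  split; first by have cW' : {within W `&` X, continuous (fun y => psqrt (cneg (h y)))} by []; wcont.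
  move=> y Wy; have := hW y Wy; case: (psqrt _) => a b; rewrite /csq /cneg /= sqrrN.
  by case: (h y) => c d /= [e1 e2]; congr (_, _); lra.
Qed.

End System.

Lemma convex_csqrt (X : set (R * R)) (h : R * R -> R * R) m : 0 <= m ->
  convex2 X -> compact X -> (forall p, X p -> `|p.1| <= m /\ `|p.2| <= m) ->
  {within X, continuous h} -> (forall x, X x -> h x <> (0, 0)) ->
  exists s, csqrt_on h X s.
Proof.
move=> m0 vX cX Xm ch h0.
have clX : closed X by apply: compact_closed cX; exact: norm_hausdorff.
apply: (@system_section _ _ _ X _ _ _ (csqrt_system ch h0) idfun cX clX _ _ _ m) => //.
  by move=> p; exact: cvg_id.
move=> a b c d; apply: convex_connected => p q t [Xp /= pr] [Xq /= qr] t01.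
split; first exact: vX.
by move: p q pr qr {Xp Xq} => [p1 p2] [q1 q2] /=; nra.
Qed.


Lemma rect_convex (a b c d : R) : convex2 [set p : R * R | (a <= p.1 <= b) && (c <= p.2 <= d)].
Proof. by move=> [p1 p2] [q1 q2] t /= pr qr t01; nra. Qed.

Lemma rect_compact (a b c d : R) : compact [set p : R * R | (a <= p.1 <= b) && (c <= p.2 <= d)].
Proof.
rewrite (_ : mkset _ = `[a, b]%classic `*` `[c, d]%classic).
  by apply: compact_setX; exact: segment_compact.
by apply/seteqP; split=> -[x y] /=; rewrite !in_itv /=; [move=> /andP[]|move=> [-> ->]].
Qed.

(** [e] is [1] or [-1] and selects the upper or the lower half, on which the first coordinate is
    injective. *)
Definition half_circle (e : R) : set (R * R) := [set p | p.1 ^+ 2 + p.2 ^+ 2 = 1 /\ 0 <= e * p.2].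

Definition half_strip (e : R) : set (R * (R * R)) :=
  [set z | 0 <= z.1 <= 1 /\ half_circle e z.2].

Lemma circle_halves : @circle R = half_circle 1 `|` half_circle (-1).
Proof.
apply/seteqP; split=> p; rewrite /circle /half_circle /=; last by move=> [[]|[]].
by move=> p1; have [h|h] := leP 0 p.2; [left|right]; split=> //; lra.
Qed.

Lemma circle_bound (p : R * R) : p.1 ^+ 2 + p.2 ^+ 2 <= 1 -> `|p.1| <= 1 /\ `|p.2| <= 1.
Proof. by move=> H; split; rewrite -[_ <= 1]ler_sqr ?nnegrE// expr1n real_normK ?num_real//; nra. Qed.

Lemma sqr1_unit (e : R) : e ^+ 2 = 1 -> e = 1 \/ e = -1.
Proof. by move/eqP; rewrite sqrf_eq1 => /orP[/eqP|/eqP]; [left|right]. Qed.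

Definition strip_map e (q : R * R) : R * (R * R) := (q.1, (q.2, e * Num.sqrt (1 - q.2 ^+ 2))).

Lemma strip_map_prect e a b c d : e ^+ 2 = 1 ->
  prect (half_strip e) (fun z => (z.1, z.2.1)) a b c d =
  strip_map e @` ([set p | (0 <= p.1 <= 1) && (-1 <= p.2 <= 1)] `&`
                  [set p | (a <= p.1 <= b) && (c <= p.2 <= d)]).
Proof.
move=> e2; apply/seteqP; split.
- move=> [t [x y]] [[/= t01 [/= xy ey]] /= abcd]; exists (t, x); last first.
    rewrite /strip_map /=; congr (_, (_, _)).
    have -> : 1 - x ^+ 2 = (e * y) ^+ 2 by rewrite exprMn e2; lra.
    by rewrite sqrtr_sqr ger0_norm// mulrA -expr2 e2 mul1r.
  by split=> //=; rewrite t01 /=; nra.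
- move=> _ [[t x] [/= /andP[t01 x01] abcd] <-]; split=> //; split=> //=.
  have h : 0 <= 1 - x ^+ 2 by nra.
  split=> /=; last by rewrite mulrA -expr2 e2 mul1r sqrtr_ge0.
  by rewrite exprMn e2 mul1r sqr_sqrtr//; ring.
Qed.

Lemma strip_map_cont e A : {within A, continuous (strip_map e)}.
Proof. rewrite /strip_map; wcont. Qed.

Lemma half_strip_connected e a b c d : e ^+ 2 = 1 ->
  connected (prect (half_strip e) (fun z => (z.1, z.2.1)) a b c d).
Proof.
move=> e2; rewrite strip_map_prect//; apply: connected_continuous_connected.
  apply: convex_connected => p q t [p1 p2] [q1 q2] t01.
  by split; exact: rect_convex.
exact: strip_map_cont.
Qed.

Lemma half_stripE e : half_strip e = prect (half_strip e) (fun z => (z.1, z.2.1)) 0 1 (-1) 1.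
Proof.
apply/seteqP; split=> z; last by case.
move=> /[dup] zh [z01 [zc _]]; split=> //=; rewrite z01 /=.
by have [] := @circle_bound z.2; rewrite ?zc// ler_norml.
Qed.

Lemma half_strip_compact e : e ^+ 2 = 1 -> compact (half_strip e).
Proof.
move=> e2; rewrite half_stripE strip_map_prect// setIid.
by apply: continuous_compact; [exact: strip_map_cont|exact: rect_compact].
Qed.

Lemma half_circle_connected e : e ^+ 2 = 1 -> connected (half_circle e).
Proof.
move=> e2; have := @half_strip_connected e 0 0 (-1) 1 e2.
move=> /(@connected_continuous_connected _ _ _ snd) => /(_ (continuous_subspaceT _)).
rewrite (_ : _ @` _ = half_circle e); first by apply=> z; exact: cvg_snd.
apply/seteqP; split=> p; first by move=> [z [[_ zh] _] <-].
move=> ph; exists (0, p) => //.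
have : half_strip e (0, p) by split=> //=; lra.
rewrite half_stripE => -[h /= k]; split=> //=; lra.
Qed.

Lemma circle_connected : connected (@circle R).
Proof.
rewrite circle_halves; apply: connectedU.
- by exists (1, 0); split; split=> /=; lra.
- by apply: half_circle_connected; lra.
- by apply: half_circle_connected; lra.
Qed.

(** The squares of [r p] and [r (- p)] are opposite, so [r (- p)] is [i] or [- i] times [r p]. Their
    cross product [k] is therefore continuous, nowhere zero and odd, which is impossible on the
    connected circle. *)
Lemma odd_no_csqrt (g r : R * R -> R * R) :
  (forall p, circle p -> g (cneg p) = cneg (g p)) ->
  (forall p, circle p -> g p <> (0, 0)) ->
  csqrt_on g (@circle R) r -> False.
Proof.
move=> godd g0 [cr hr].
pose k p := (r p).1 * (r (cneg p)).2 - (r p).2 * (r (cneg p)).1.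
have cc p : circle p -> circle (cneg p) by rewrite /circle /cneg /= !sqrrN.
have ck : {within @circle R, continuous k}.
  have cr' : {within @circle R, continuous (fun p => r (cneg p))}.
    apply: (@within_comp _ _ _ _ _ cneg r _ cr) => //.
    exact: wc_cneg.
  by rewrite /k; wcont.
have kne p : circle p -> k p <> 0.
  move=> cp.
  have h1 := hr p cp; have h2 := hr _ (cc p cp); rewrite godd// -h1 in h2.
  have := csq_neq0 (_ : csq (r p) <> (0, 0)); rewrite h1 => /(_ (g0 p cp)).
  rewrite /k; move: h2; case: (r p) (r (cneg p)) => a b [c d].
  rewrite /csq /cneg /= => -[e1 e2].
  have : csq (c, d) = csq (- b, a) by rewrite /csq /=; congr (_, _); lra.
  by move=> /csq_eq[] [-> ->]; rewrite /cneg /=; nra.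
have kodd p : k (cneg p) = - k p.
  by rewrite /k cnegK; ring.
have c1 : @circle R (1, 0) by rewrite /circle /=; lra.
have [] := wc_sign circle_connected ck kne => H.
  by have := H _ (cc _ c1); rewrite kodd; have := H _ c1; lra.
by have := H _ (cc _ c1); rewrite kodd; have := H _ c1; lra.
Qed.

(** The root at time 0 extends over each half of the cylinder, where sections exist and can be
    flipped to match [r]; the two halves are then glued. *)
Lemma homotopy_csqrt (H : R * (R * R) -> R * R) (r : R * R -> R * R) :
  {within @unit_interval R `*` @circle R, continuous H} ->
  (forall (t : R) p, 0 <= t <= 1 -> circle p -> H (t, p) <> (0, 0)) ->
  csqrt_on (fun p => H (0, p)) (@circle R) r ->
  exists r', csqrt_on (fun p => H (1, p)) (@circle R) r'.
Proof.
move=> cH H0 [cr hr].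
have sub e : half_strip e `<=` @unit_interval R `*` @circle R by move=> z [z1 [z2 _]].
have one : (1 : R) ^+ 2 = 1 /\ (-1 : R) ^+ 2 = 1 by split; lra.
have sysE e := @csqrt_system _ (half_strip e) H (continuous_subspaceW (@sub e) cH)
    (fun z => match z with (t, p) => fun h => H0 t p h.1 h.2.1 end).
have half e : e ^+ 2 = 1 -> exists2 s, csqrt_on H (half_strip e) s &
    forall p, half_circle e p -> s (0, p) = r p.
  move=> e2.
  have clX : closed (half_strip e) by apply: compact_closed (half_strip_compact e2); exact: norm_hausdorff.
  have [|||||s [cs hs]] := @system_section R _ _ (half_strip e) _ _ _ (sysE e)
      (fun z => (z.1, z.2.1)) (half_strip_compact e2) clX _ _ _ 1.
  - apply/continuous_subspace_setT; wcont.
  - move=> [t [x y]] [t' [x' y']] [/= _ [/= xy ey]] [/= _ [/= xy' ey']] [-> xx']; subst x'.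
    congr (_, (_, _)); have [] := sqr1_unit e2 => ee; subst e; nra.
  - by move=> a b c d; exact: half_strip_connected.
  - move=> z; rewrite half_stripE => -[_ /= h]; rewrite !ler_norml; split; lra.
  - by [].
  - pose C0 := [set z | half_strip e z /\ z.1 = 0].
    have cC0 : connected C0.
      have := @half_strip_connected e 0 0 (-1) 1 e2; congr connected.
      apply/seteqP; split=> z; first by move=> [zh /= k]; split=> //; lra.
      by move=> [zh z0]; have := zh; rewrite half_stripE => -[_ /= k]; split=> //=; lra.
    have gr : csqrt_on H C0 (r \o snd).
      split; last first.
        move=> [t p] [[/= _ [pc _]] t0]; have -> : t = 0 := t0.
        exact: (hr p pc).
      apply: (@within_comp _ _ _ _ (@circle R)) => //; first exact: wc_snd0.
      by move=> z [[_ []]].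
    have gs : csqrt_on H C0 s.
      split; first by apply: continuous_subspaceW cs => z [].
      by move=> z [zh _]; exact: hs.
    have C0sub : C0 `<=` half_strip e by move=> z [].
    have C0p p : half_circle e p -> C0 (0, p) by move=> pc; split=> //; split=> //=; lra.
    have [_ gflip guniq _ _] := sysE e.
    have [E|E] := guniq _ _ _ C0sub cC0 gr gs.
      by exists s => // p /C0p /E /= ->.
    exists (cneg \o s); first exact: gflip.
    by move=> p /C0p /E /= ->.
have [s1 [cs1 hs1] rs1] := half 1 one.1.
have [s2 [cs2 hs2] rs2] := half (-1) one.2.
have clX e : e ^+ 2 = 1 -> closed (half_strip e).
  by move=> e2; apply: compact_closed (half_strip_compact e2); exact: norm_hausdorff.
(* The halves meet in the segments over [(1, 0)] and [(-1, 0)]. Along each, the roots are equal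
   throughout or opposite throughout, and both equal [r] at time 0. *)
have E z : half_strip 1 z -> half_strip (-1) z -> s1 z = s2 z.
  case: z => t [x y] h1 h2; have [/= t01 [/= xy y0]] := h1.
  have y00 : y = 0 by have [_ [_ /= h]] := h2; lra.
  subst y; pose S := (fun t : R => (t, (x, 0 : R))) @` `[0, 1]%classic.
  have cS : connected S by apply: path_connected; wcont.
  have S1 : S `<=` half_strip 1.
    by move=> _ [u /= + <-]; rewrite in_itv /= => u01; split=> //=; split=> //=; lra.
  have S2 : S `<=` half_strip (-1).
    by move=> _ [u /= + <-]; rewrite in_itv /= => u01; split=> //=; split=> //=; lra.
  have [_ _ guniq _ _] := sysE 1.
  have [||EE|EE] := guniq S s1 s2 S1 cS.
  - by split; [exact: continuous_subspaceW cs1|move=> z /S1 /hs1].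
  - by split; [exact: continuous_subspaceW cs2|move=> z /S2 /hs2].
  - by apply: EE; exists t => //; rewrite /= in_itv.
  - have S0 : S (0, (x, 0)) by exists 0 => //; rewrite /= in_itv /=; lra.
    have := EE _ S0; rewrite rs1 ?rs2; try by split=> /=; lra.
    have cx : circle (x, 0 : R) by rewrite /circle /=; lra.
    have := csq_neq0 (p := r (x, 0)); rewrite hr// => /(_ (H0 _ _ _ cx)).
    case: (r _) => a b; rewrite /cneg /= => P [ea eb].
    exfalso; have {}P : 0 < a ^+ 2 + b ^+ 2 by apply: P; lra.
    have a0 : a = 0 by lra.
    have b0 : b = 0 by lra.
    by move: P; rewrite a0 b0; lra.
exists (fun p => if (1, p) \in half_strip 1 then s1 (1, p) else s2 (1, p)).
have glued : csqrt_on H (half_strip 1 `|` half_strip (-1))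
    (fun z => if z \in half_strip 1 then s1 z else s2 z).
  split.
    apply: within_glue cs1 cs2 _ _; [exact: clX one.1|exact: clX one.2| |].
      by move=> z zh; rewrite mem_set.
    by move=> z zh; case: ifPn => // /set_mem zh1; rewrite E.
  move=> z zh; case: ifPn => [/set_mem|/negP] zh1; first exact: hs1.
  by apply: hs2; case: zh => // /mem_set.
have inj p : circle p -> (half_strip 1 `|` half_strip (-1)) (1, p).
  by rewrite circle_halves => -[] ph; [left|right]; split=> //=; lra.
case: glued => cg hg; split; last by move=> p /inj /hg.
have cp : {within @circle R, continuous (fun p => (1 : R, p))} by wcont.
exact: (@within_comp _ _ _ _ _ (fun p => (1 : R, p)) _ cp cg inj).
Qed.

Lemma disk_convex : convex2 (@closed_disk R).
Proof.
move=> [a b] [c d] t; rewrite /closed_disk /= => h1 h2 t01.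
have -> : (a + t * (c - a)) ^+ 2 + (b + t * (d - b)) ^+ 2 =
  (1 - t) * (a ^+ 2 + b ^+ 2) + t * (c ^+ 2 + d ^+ 2) - t * (1 - t) * ((a - c) ^+ 2 + (b - d) ^+ 2) by ring.
have : 0 <= t * (1 - t) * ((a - c) ^+ 2 + (b - d) ^+ 2).
  by apply: mulr_ge0; [nra|rewrite addr_ge0 ?sqr_ge0].
nra.
Qed.

Lemma disk_compact : compact (@closed_disk R).
Proof.
apply: (@subclosed_compact _ _ [set p : R * R | (-1 <= p.1 <= 1) && (-1 <= p.2 <= 1)]).
- rewrite (_ : @closed_disk R = (fun p : R * R => p.1 ^+ 2 + p.2 ^+ 2) @^-1` [set t | t <= 1])//.
  apply: closed_comp; last exact: closed_le.
  move=> p _; suff : continuous (fun p : R * R => p.1 ^+ 2 + p.2 ^+ 2) by exact.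
  by apply/continuous_subspace_setT; wcont.
- exact: rect_compact.
- move=> p /circle_bound; rewrite !ler_norml /=; lra.
Qed.

Lemma circle_compact : compact (@circle R).
Proof.
apply: (@subclosed_compact _ _ (@closed_disk R)).
- rewrite (_ : @circle R = (fun p : R * R => p.1 ^+ 2 + p.2 ^+ 2) @^-1` [set t | t = 1])//.
  apply: closed_comp; last exact: closed_eq.
  move=> p _; suff : continuous (fun p : R * R => p.1 ^+ 2 + p.2 ^+ 2) by exact.
  by apply/continuous_subspace_setT; wcont.
- exact: disk_compact.
- by move=> p; rewrite /circle /closed_disk /= => ->.
Qed.

(* If [y] is missed, [h - y] has a square root on the disk, hence so does the loop
   [h - h 0] on the circle; but that loop is homotopic to the odd loop
   [h (p / 2) - h (- p / 2)], which has none. *)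
Lemma invariance_of_domain (h : R * R -> R * R) :
  {within @closed_disk R, continuous h} -> set_inj (@closed_disk R) h ->
  nbhs (h (0, 0)) (h @` @closed_disk R).
Proof.
move=> ch ih.
have CD : @circle R `<=` @closed_disk R by move=> p; rewrite /circle /closed_disk /= => ->.
have D0 : closed_disk (0 : R, 0 : R) by rewrite /closed_disk /=; lra.
have chC : {within @circle R, continuous h} by exact: continuous_subspaceW ch.
have := compact_closed (@norm_hausdorff _ _) (continuous_compact chC circle_compact).
move=> /closed_openC oC.
have : nbhs (h (0, 0)) (~` (h @` @circle R)).
  apply: open_nbhs_nbhs; split=> // -[p cp hp].
  have := ih _ _ (mem_set (CD _ cp)) (mem_set D0) hp.
  by move=> p0; move: cp; rewrite p0 /circle /=; lra.
rewrite -nbhs_ballE => -[e /= e0 He].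
exists e => // y By; apply: contrapT => ny.
have ballH t : 0 <= t <= 1 -> ~ (h @` @circle R)
    (y.1 + t * ((h (0, 0)).1 - y.1), y.2 + t * ((h (0, 0)).2 - y.2)).
  move=> t01; apply: He; move: By; rewrite /ball /= /prod_ball /= /ball /= !ltr_norml.
  case: (h (0, 0)) y {ny} => a b [c d] /= [/andP[h1 h2] /andP[h3 h4]]; split; nra.
have [r1 r1P] : exists r, csqrt_on (fun p => ((h p).1 - y.1, (h p).2 - y.2)) (@circle R) r.
  have [||s [cs hs]] := @convex_csqrt (@closed_disk R) (fun p => ((h p).1 - y.1, (h p).2 - y.2))
      1 ler01 disk_convex disk_compact (@circle_bound).
  - by wcont.
  - move=> p Dp [] /eqP + /eqP; rewrite !subr_eq0 => /eqP e1 /eqP e2; apply: ny.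
    by exists p => //; exact: pair_ext.
  - by exists s; split; [exact: continuous_subspaceW cs|move=> p /CD /hs].
have [r2 r2P] : exists r, csqrt_on (fun p => ((h p).1 - (h (0, 0)).1, (h p).2 - (h (0, 0)).2)) (@circle R) r.
  (* The subtracted point moves from [y] to the image of the centre, inside a ball that misses the
     image of the circle. *)
  pose H (z : R * (R * R)) := ((h z.2).1 - (y.1 + z.1 * ((h (0, 0)).1 - y.1)),
     (h z.2).2 - (y.2 + z.1 * ((h (0, 0)).2 - y.2))).
  have [|||r [cr hr]] := @homotopy_csqrt H r1.
  - have ch2 : {within @unit_interval R `*` @circle R, continuous (fun z => h z.2)}.
      by apply: (@within_comp _ _ _ _ (@circle R) snd h) => //; [exact: wc_snd0|move=> z []].
    by rewrite /H; wcont.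
  - move=> t p t01 cp; rewrite /H /= => -[] /eqP + /eqP; rewrite !subr_eq0 => /eqP e1 /eqP e2.
    by apply: (ballH t t01); exists p => //; rewrite -e1 -e2; case: (h p).
  - case: r1P => c1 h1; split=> // p cp; rewrite h1// /H /= !mul0r !addr0.
    by [].
  - exists r; split=> // p cp; rewrite hr// /H /= !mul1r.
    by congr (_, _); ring.
pose sc (t : R) p : R * R := (t * p.1, t * p.2).
have scD (t : R) p : -1 <= t <= 1 -> circle p -> closed_disk (sc t p).
  move=> t1; rewrite /circle /closed_disk /sc /= => cp.
  have -> : (t * p.1) ^+ 2 + (t * p.2) ^+ 2 = t ^+ 2 * (p.1 ^+ 2 + p.2 ^+ 2) by ring.
  by rewrite cp; nra.
have inv2 (t : R) : 0 <= t <= 1 -> 0 < (1 + t)^-1 <= 1 /\ (1 + t) * (1 + t)^-1 = 1.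
  move=> t01; have h1 : (1 + t) * (1 + t)^-1 = 1 by rewrite divff// gt_eqF//; lra.
  by split=> //; nra.
(* At time [t] the two arguments of [h] are [p / (1 + t)] and [- t p / (1 + t)]. They always differ
   by [p], so injectivity of [h] keeps the loop away from 0. *)
pose G (z : R * (R * R)) :=
  ((h (sc (1 + z.1)^-1 z.2)).1 - (h (sc (- z.1 * (1 + z.1)^-1) z.2)).1,
   (h (sc (1 + z.1)^-1 z.2)).2 - (h (sc (- z.1 * (1 + z.1)^-1) z.2)).2).
have b1 (t : R) : 0 <= t <= 1 -> -1 <= (1 + t)^-1 <= 1 by move=> t01; have [] := inv2 t t01; lra.
have b2 (t : R) : 0 <= t <= 1 -> -1 <= - t * (1 + t)^-1 <= 1.
  by move=> t01; have [h1 h2] := inv2 t t01; nra.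
have [|||r3 r3P] := @homotopy_csqrt G r2.
- have ci : {within @unit_interval R `*` @circle R, continuous (fun z : R * (R * R) => (1 + z.1)^-1)}.
    apply: wcV; last by wcont.
    by move=> z [/= z1 _]; rewrite gt_eqF//; move: z1; rewrite /unit_interval /=; lra.
  have c1 : {within @unit_interval R `*` @circle R, continuous (fun z => h (sc (1 + z.1)^-1 z.2))}.
    apply: (@within_comp _ _ _ _ (@closed_disk R) (fun z : R * (R * R) => sc (1 + z.1)^-1 z.2) h) => //.
      by rewrite /sc; wcont.
    by move=> z [z1 z2]; apply: scD => //; exact: b1.
  have c2 : {within @unit_interval R `*` @circle R, continuous (fun z => h (sc (- z.1 * (1 + z.1)^-1) z.2))}.
    apply: (@within_comp _ _ _ _ (@closed_disk R) (fun z : R * (R * R) => sc (- z.1 * (1 + z.1)^-1) z.2) h) => //.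
      by rewrite /sc; wcont.
    by move=> z [z1 z2]; apply: scD => //; exact: b2.
  by rewrite /G; wcont.
- move=> t p t01 cp; rewrite /G /= => -[] /eqP + /eqP; rewrite !subr_eq0 => /eqP e1 /eqP e2.
  have := ih _ _ (mem_set (scD _ _ (b1 t t01) cp)) (mem_set (scD _ _ (b2 t t01) cp)).
  have -> : h (sc (1 + t)^-1 p) = h (sc (- t * (1 + t)^-1) p).
    by case: (h _) (h _) e1 e2 => a b [c d] /= -> ->.
  move=> /(_ erefl); rewrite /sc => -[k1 k2].
  have [h1 h2] := inv2 t t01.
  have n0 : (1 + t)^-1 + t * (1 + t)^-1 = 1 by have := h2; rewrite mulrDl mul1r.
  have p1 : p.1 = 0.
    have -> : p.1 = ((1 + t)^-1 + t * (1 + t)^-1) * p.1 by rewrite n0 mul1r.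
    by rewrite mulrDl k1; ring.
  have p2 : p.2 = 0.
    have -> : p.2 = ((1 + t)^-1 + t * (1 + t)^-1) * p.2 by rewrite n0 mul1r.
    by rewrite mulrDl k2; ring.
  by move: cp; rewrite /circle /= p1 p2; lra.
- case: r2P => c1 h1; split=> // p cp; rewrite h1// /G /sc /=.
  by rewrite addr0 invr1 !mul1r oppr0 !mul0r; case: (p).
apply: (odd_no_csqrt _ _ r3P).
- move=> p cp; rewrite /G /sc /cneg /= !mulN1r !mulrN !mulNr !opprK.
  by congr (_, _); ring.
- move=> p cp; rewrite /G /= => -[] /eqP + /eqP; rewrite !subr_eq0 => /eqP e1 /eqP e2.
  have t01 : 0 <= (1 : R) <= 1 by lra.
  have := ih _ _ (mem_set (scD _ _ (b1 1 t01) cp)) (mem_set (scD _ _ (b2 1 t01) cp)).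
  have -> : h (sc (1 + 1)^-1 p) = h (sc (- 1 * (1 + 1)^-1) p).
    by case: (h _) (h _) e1 e2 => a b [c d] /= -> ->.
  move=> /(_ erefl); rewrite /sc => -[k1 k2].
  have [h1 h2] := inv2 1 t01.
  have p1 : p.1 = 0 by nra.
  have p2 : p.2 = 0 by nra.
  by move: cp; rewrite /circle /= p1 p2; lra.
Qed.

End PlaneSquareRoot.

(** * Faces of an embedding *)

Lemma filter_finType (T : topologicalType) (I : finType) (x : T) (Q : I -> T -> Prop) :
  (forall i, exists2 W, nbhs x W & forall y, W y -> Q i y) ->
  exists2 W, nbhs x W & forall y, W y -> forall i, Q i y.
Proof.
move=> H; suff [W Wx WQ] : exists2 W, nbhs x W & forall y, W y -> forall i, i \in enum I -> Q i y.
  by exists W => // y Wy i; apply: WQ => //; rewrite mem_enum.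
elim: (enum I) => [|i s [W Wx WQ]]; first by exists setT; [exact: filterT|].
have [W' W'x W'Q] := H i; exists (W `&` W'); first exact: filterI.
by move=> y [Wy W'y] j; rewrite inE => /predU1P[->|/WQ]; [exact: W'Q|exact].
Qed.

Lemma near_closed_family (T : topologicalType) (I : finType) (A : I -> set T) x :
  (forall i, closed (A i)) ->
  exists2 W, nbhs x W & forall y, W y -> forall i, A i y -> A i x.
Proof.
move=> cA; apply: filter_finType => i; have [Ax|nAx] := pselect (A i x).
  by exists setT => //; exact: filterT.
exists (~` A i) => //; apply: open_nbhs_nbhs; split=> //; exact: closed_openC.
Qed.

(** * Local topology of a surface *)

Section SurfaceLocal.
Variables (R : realType) (P : topologicalType).
Hypothesis P_surf : surface R P.

Lemma surface_hausdorff : hausdorff_space P. Proof. by case: P_surf. Qed.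

Lemma nbhs_disk (q : R * R) (O : set (R * R)) : nbhs q O ->
  exists2 r : R, 0 < r & forall p : R * R, closed_disk p -> O (q.1 + r * p.1, q.2 + r * p.2).
Proof.
rewrite -nbhs_ballE => -[e /= e0 He]; exists (e / 2); first exact: divr_gt0.
move=> p /circle_bound[h1 h2]; apply: He; rewrite /ball /= /prod_ball /= /ball /=.
have aux (a u : R) : `|u| <= 1 -> `|a - (a + e / 2 * u)| < e.
  move=> u1; rewrite opprD addNKr normrN normrM gtr0_norm ?divr_gt0//.
  have : e / 2 * `|u| <= e / 2 by rewrite ler_piMr// divr_ge0// ltW.
  by lra.
by split; exact: aux.
Qed.

Lemma chart_disk (x : P) (V : set P) : nbhs x V ->
  exists h : R * R -> P, [/\ {within @closed_disk R, continuous h},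
    set_inj (@closed_disk R) h, h (0, 0) = x & h @` @closed_disk R `<=` V].
Proof.
move=> Vx; have [_ _ _ _ /(_ x)[U [phi [psi [Ux [oU oW [h1 h2 pK kP [cphi cpsi]]]]]]]] := P_surf.
have Wx : (phi @` U) (phi x) by exists x.
have [|W Wn WV] := (within_contP _ _).1 cpsi (phi x) Wx V.
  by rewrite pK ?mem_set.
have [r r0 Hr] := nbhs_disk (filterI (open_nbhs_nbhs (conj oW Wx)) Wn).
exists (fun p => psi ((phi x).1 + r * p.1, (phi x).2 + r * p.2)); split.
- apply: (@within_comp _ _ _ _ (phi @` U) (fun p : R * R => ((phi x).1 + r * p.1, (phi x).2 + r * p.2)) psi) => //.
    by wcont.
  by move=> p /Hr[].
- move=> p q /set_mem Dp /set_mem Dq /(congr1 phi).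
  rewrite !kP ?mem_set//; try by have [] := Hr _ Dp; try by have [] := Hr _ Dq.
  + by move=> [e1 e2]; apply: pair_ext; apply: (mulfI (lt0r_neq0 r0)); lra.
- by rewrite !mulr0 !addr0 -surjective_pairing pK ?mem_set.
- by move=> _ [p Dp <-]; have [U1 W1] := Hr _ Dp; exact: WV.
Qed.

(** The disk is shrunk by the factor [r1] until its image lies in the domain of one chart, where
    invariance of domain in the plane applies. *)
Lemma surface_domain (h : R * R -> P) :
  {within @closed_disk R, continuous h} -> set_inj (@closed_disk R) h ->
  nbhs (h (0, 0)) (h @` @closed_disk R).
Proof.
move=> ch ih; set x := h (0, 0).
have D0 : closed_disk (0 : R, 0 : R) by rewrite /closed_disk /=; lra.
have [_ _ _ _ /(_ x)[U [phi [psi [Ux [oU oW [h1 h2 pK kP [cphi cpsi]]]]]]]] := P_surf.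
have [|W Wn WU] := (within_contP _ _).1 ch (0, 0) D0 U.
  exact: open_nbhs_nbhs.
have [r r0 Hr] := nbhs_disk Wn.
pose r1 := Num.min r 1; have r10 : 0 < r1 by rewrite lt_min r0 ltr01.
have r1r : r1 <= r by rewrite ge_min lexx.
have r11 : r1 <= 1 by rewrite ge_min lexx orbT.
pose sc (p : R * R) := (r1 * p.1, r1 * p.2).
have scD p : closed_disk p -> closed_disk (sc p) /\ U (h (sc p)).
  move=> Dp; have D1 : closed_disk (sc p).
    rewrite /closed_disk /sc /=.
    have -> : (r1 * p.1) ^+ 2 + (r1 * p.2) ^+ 2 = r1 ^+ 2 * (p.1 ^+ 2 + p.2 ^+ 2) by ring.
    have : r1 ^+ 2 <= 1 by nra.
    by move: Dp; rewrite /closed_disk /=; have := sqr_ge0 p.1; have := sqr_ge0 p.2; nra.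
  split=> //; apply: WU => //.
  have := Hr ((r1 / r) * p.1, (r1 / r) * p.2); rewrite /= !add0r !mulrA.
  rewrite (mulrC r) mulfK ?gt_eqF//; apply; rewrite /closed_disk /=.
  have rr1 : 0 <= r1 / r <= 1 by rewrite divr_ge0 ?(ltW r0) ?(ltW r10)//= ler_pdivrMr// mul1r.
  have -> : (r1 / r * p.1) ^+ 2 + (r1 / r * p.2) ^+ 2 = (r1 / r) ^+ 2 * (p.1 ^+ 2 + p.2 ^+ 2) by ring.
  have : (r1 / r) ^+ 2 <= 1 by nra.
  by move: Dp; rewrite /closed_disk /=; have := sqr_ge0 p.1; have := sqr_ge0 p.2; nra.
have csc : {within @closed_disk R, continuous (fun p => h (sc p))}.
  apply: (@within_comp _ _ _ _ (@closed_disk R) sc h) => //; last by move=> p /scD[].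
  by rewrite /sc; wcont.
have hx0 : h (sc (0, 0)) = x by rewrite /sc /= !mulr0.
have N : nbhs (phi x) ((fun p => phi (h (sc p))) @` @closed_disk R).
  rewrite -[in nbhs (phi x)]hx0; apply: (@invariance_of_domain R (fun p => phi (h (sc p)))).
- by apply: (@within_comp _ _ _ _ U (fun p => h (sc p)) phi) => // p /scD[].
- move=> p q /set_mem Dp /set_mem Dq /(congr1 psi).
  rewrite !pK ?mem_set//; try by have [] := scD _ Dp; try by have [] := scD _ Dq.
  + move=> /(ih _ _ (mem_set (scD _ Dp).1) (mem_set (scD _ Dq).1)) [e1 e2].
    by apply: pair_ext; apply: (mulfI (lt0r_neq0 r10)).
have [W' W'x W'N] := (within_contP _ _).1 cphi x Ux _ N.
have Ux' : nbhs x U by exact: open_nbhs_nbhs.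
apply: filterS (filterI W'x Ux') => y [W'y Uy].
have [p Dp pE] := W'N y W'y Uy.
exists (sc p); first by have [] := scD p Dp.
rewrite -[RHS]pK ?mem_set// -pE pK ?mem_set//.
by have [] := scD p Dp.
Qed.

Lemma surface_domain_chart (x : P) (V : set P) (g : P -> R * R) : nbhs x V ->
  {within V, continuous g} -> set_inj V g -> nbhs (g x) (g @` V).
Proof.
move=> Vx cg ig; have [h [ch ih hx hV]] := chart_disk Vx.
have := @invariance_of_domain R (fun p => g (h p)); rewrite hx => N.
apply: filterS (N _ _).
- by move=> _ [p Dp <-]; exists (h p) => //; apply: hV; exists p.
- by apply: (@within_comp _ _ _ _ V h g) => // p Dp; apply: hV; exists p.
- move=> p q /set_mem Dp /set_mem Dq E; apply: ih; rewrite ?mem_set//; apply: ig => //.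
    by apply/mem_set/hV; exists p.
  by apply/mem_set/hV; exists q.
Qed.

Lemma disk_image_connected (T : topologicalType) (h : R * R -> T) :
  {within @closed_disk R, continuous h} -> connected (h @` @closed_disk R).
Proof. by apply: connected_continuous_connected; apply: convex_connected; exact: disk_convex. Qed.

Lemma component_open (A : set P) x : open A -> open (connected_component A x).
Proof.
move=> oA; rewrite openE => y Cy; have Ay := connected_component_sub Cy.
have [h [ch ih hy hA]] := chart_disk (open_nbhs_nbhs (conj oA Ay)).
have D0 : closed_disk (0 : R, 0 : R) by rewrite /closed_disk /=; lra.
have N := surface_domain ch ih; rewrite hy in N.
change (nbhs y (connected_component A x)); apply: filterS N => z hz.
apply: connected_component_trans Cy _; exists (h @` @closed_disk R) => //; split=> //.
  by exists (0, 0).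
exact: disk_image_connected.
Qed.

Lemma punctured_disk_connected : connected (@closed_disk R `\ (0, 0)).
Proof.
(* Four such convex half disks cover the punctured disk, and they can be joined through overlapping
   pairs. *)
pose H (a b : R) := @closed_disk R `&` [set p | 0 < a * p.1 + b * p.2].
have cH a b : connected (H a b).
  apply: convex_connected => p q t [Dp /= hp] [Dq /= hq] t01; split; first exact: disk_convex.
  rewrite /=.
  have -> : a * (p.1 + t * (q.1 - p.1)) + b * (p.2 + t * (q.2 - p.2)) =
    (1 - t) * (a * p.1 + b * p.2) + t * (a * q.1 + b * q.2) by ring.
  have [t1|t1] := ltP t 1; last by have -> : t = 1; lra.
  by apply: ltr_wpDr; [apply: mulr_ge0; lra|apply: mulr_gt0 => //; lra].
have -> : @closed_disk R `\ (0, 0) = H 1 0 `|` H 0 1 `|` (H (-1) 0 `|` H 0 (-1)).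
  apply/seteqP; split=> -[a b].
    move=> [Dp /= p0]; have [a0|a0|a0] := ltrgtP a 0; have [b0|b0|b0] := ltrgtP b 0;
      try (by right; left; split=> //=; lra); try (by right; right; split=> //=; lra);
      try (by left; left; split=> //=; lra); try (by left; right; split=> //=; lra).
    by case: p0; rewrite a0 b0.
  by move=> [[]|[]] [Dp /= h]; split=> //= -[a0 b0]; move: h; rewrite a0 b0; lra.
have D (a b : R) : a ^+ 2 + b ^+ 2 <= 1 -> closed_disk (a, b) by [].
apply: connectedU.
- exists (- 2^-1, 2^-1); split; [right|left]; split=> /=; try apply: D; nra.
- apply: connectedU => //; exists (2^-1, 2^-1); split; split=> /=; try apply: D; nra.
- apply: connectedU => //; exists (- 2^-1, - 2^-1); split; split=> /=; try apply: D; nra.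
Qed.

Lemma punctured_chart (x : P) (V : set P) : nbhs x V ->
  exists D : set P, [/\ nbhs x D, D `<=` V & connected (D `\ x)].
Proof.
move=> Vx; have [h [ch ih hx hV]] := chart_disk Vx.
have D0 : closed_disk (0 : R, 0 : R) by rewrite /closed_disk /=; lra.
exists (h @` @closed_disk R); split=> //.
  by have := surface_domain ch ih; rewrite hx.
rewrite (_ : _ `\ x = h @` (@closed_disk R `\ (0, 0))).
  apply: connected_continuous_connected; first exact: punctured_disk_connected.
  by apply: continuous_subspaceW ch => p [].
apply/seteqP; split=> y.
  by move=> [[p Dp <-] /= px]; exists p => //; split=> // p0; apply: px; rewrite p0.
move=> [p [Dp /= p0] <-]; split; first by exists p.
rewrite /= -hx => E; apply: p0; exact: (ih _ _ (mem_set Dp) (mem_set D0) E).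
Qed.

End SurfaceLocal.

Lemma unit_cases (R : realType) (t : R) : 0 <= t <= 1 -> [\/ t = 0, t = 1 | 0 < t < 1].
Proof.
move=> /andP[]; rewrite le_eqVlt => /predU1P[<- _|t0]; first by constructor 1.
by rewrite le_eqVlt => /predU1P[->|t1]; [constructor 2|constructor 3; rewrite t0 t1].
Qed.

Section Arcs.
Variables (R : realType) (G : mgraph) (T : topologicalType) (Psi : embedding R G T).
Hypothesis T_haus : hausdorff_space T.

Definition arc (e : edge G) : set T := edge_curve Psi e @` @unit_interval R.
(** A witness for the whole edge: [closure f (midp e)] is used to say that [e] lies on the boundary
    of [f]. The midpoint is on no other arc, and facial boundaries consist of entire arcs. *)
Definition midp (e : edge G) : T := edge_curve Psi e (1 / 2).

Lemma unit_interval_compact : compact (@unit_interval R).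
Proof.
rewrite (_ : @unit_interval R = `[0, 1]%classic); first exact: segment_compact.
by apply/seteqP; split=> t; rewrite /unit_interval /= in_itv.
Qed.

Lemma arc_compact e : compact (arc e).
Proof. by apply: continuous_compact; [exact: arc_cont|exact: unit_interval_compact]. Qed.

Lemma arc_closed e : closed (arc e).
Proof. by apply: compact_closed T_haus _; exact: arc_compact. Qed.

Lemma unit0 : @unit_interval R 0. Proof. by rewrite /unit_interval /=; lra. Qed.
Lemma unit1 : @unit_interval R 1. Proof. by rewrite /unit_interval /=; lra. Qed.

Lemma edge_ends e : exists u v, [/\ u != v, ends e = [set u; v]%SET,
  edge_curve Psi e 0 = vpt Psi u & edge_curve Psi e 1 = vpt Psi v].
Proof.
have E := arc_ends Psi e.
have [u ue u0] : (vpt Psi @` [set` ends e]) (edge_curve Psi e 0) by rewrite E; left.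
have [v ve v1] : (vpt Psi @` [set` ends e]) (edge_curve Psi e 1) by rewrite E; right.
have uv : u != v.
  apply/eqP => uv; have := @arc_inj _ _ _ Psi e _ _ (mem_set unit0) (mem_set unit1).
  by rewrite -u0 -v1 uv => /(_ erefl); lra.
exists u, v; split=> //; apply/esym/eqP.
by rewrite eqEcard cards2 uv card_ends leqnn andbT finset.subUset !finset.sub1set; apply/andP.
Qed.

Lemma vpt_arc e v : arc e (vpt Psi v) <-> v \in ends e.
Proof.
have [a [b [ab eE e0 e1]]] := edge_ends e; split.
  move=> [t /= t01]; rewrite /unit_interval /= in t01.
  have [->|->|t0] := unit_cases t01.
  - by rewrite e0 => /vpt_inj <-; rewrite eE !inE eqxx.
  - by rewrite e1 => /vpt_inj <-; rewrite eE !inE eqxx orbT.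
  - by move/(arc_vpt t0).
rewrite eE !inE => /orP[]/eqP->; first by exists 0 => //; exact: unit0.
by exists 1 => //; exact: unit1.
Qed.

Lemma arc_cases e x : arc e x ->
  (exists2 v, v \in ends e & x = vpt Psi v) \/
  (exists2 t : R, 0 < t < 1 & x = edge_curve Psi e t).
Proof.
have [a [b [ab eE e0 e1]]] := edge_ends e.
move=> [t /= t01 <-]; rewrite /unit_interval /= in t01.
have [->|->|t0] := unit_cases t01; last by right; exists t.
  by left; exists a; rewrite // eE !inE eqxx.
by left; exists b; rewrite // eE !inE eqxx orbT.
Qed.

Lemma interior_arc e e' (t : R) : 0 < t < 1 -> arc e' (edge_curve Psi e t) -> e' = e.
Proof.
move=> t01 /arc_cases[[v _ E]|[s s01 E]]; first by case: (arc_vpt t01 E).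
by apply/esym/(arc_arc _ _ E).
Qed.

Lemma half01 : 0 < (1 / 2 : R) < 1. Proof. lra. Qed.

Lemma arc_curve e (t : R) : 0 < t < 1 -> arc e (edge_curve Psi e t).
Proof. by move=> t01; exists t => //; rewrite /unit_interval /=; lra. Qed.

Lemma arc_midp e e' : arc e (midp e') -> e = e'.
Proof. by apply: interior_arc; exact: half01. Qed.

Lemma midp_vpt e v : midp e <> vpt Psi v.
Proof. by apply: arc_vpt; exact: half01. Qed.

Lemma arc_inter e e' x : e <> e' -> arc e x -> arc e' x ->
  exists v, [/\ x = vpt Psi v, v \in ends e & v \in ends e'].
Proof.
move=> ee' /arc_cases[[v ve ->]|[t t01 ->]].
  by move=> /vpt_arc ve'; exists v.
by move/(interior_arc t01) => E; case: ee'.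
Qed.

Lemma graph_cases x : graph_points Psi x -> (exists v, x = vpt Psi v) \/ exists e, arc e x.
Proof. by move=> [[v _ <-]|[e _ ex]]; [left; exists v|right; exists e]. Qed.

Lemma arc_graph e x : arc e x -> graph_points Psi x.
Proof. by move=> ex; right; exists e. Qed.

Lemma vpt_graph v : graph_points Psi (vpt Psi v).
Proof. by left; exists v. Qed.

Lemma graph_closed : closed (graph_points Psi).
Proof.
apply: closedU.
  rewrite -bigcup_imset1.
  apply: closed_bigcup => [|v _]; first exact: finite_finset.
  exact/accessible_closed_set1/hausdorff_accessible.
apply: closed_bigcup => [|e _]; first exact: finite_finset.
exact: arc_closed.
Qed.

End Arcs.

Section Faces.
Variables (R : realType) (G : mgraph) (P : topologicalType) (Psi : embedding R G P).
Hypotheses (P_surf : surface R P) (Psi_closed : closed_2cell_embedding Psi).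
Local Notation face := (face Psi).
Local Notation arc := (arc Psi).
Local Notation midp := (midp Psi).
Let hausP := surface_hausdorff P_surf.

Lemma face_open f : face f -> open f.
Proof.
move=> [x nx ->]; apply: (component_open P_surf).
by apply: closed_openC; exact: graph_closed.
Qed.

Lemma face_graph f x : face f -> f x -> ~ graph_points Psi x.
Proof. by move=> [y ny ->] /connected_component_sub. Qed.

Lemma face_eq f g x : face f -> face g -> f x -> g x -> f = g.
Proof.
move=> [y ny ->] [z nz ->] /same_connected_component -> /same_connected_component ->.
by [].
Qed.

Lemma face_ex x : ~ graph_points Psi x -> exists2 f, face f & f x.
Proof.
move=> nx; exists (connected_component (~` graph_points Psi) x); first by exists x.
exact: connected_component_refl.
Qed.

Lemma face_closure f g x : face f -> face g -> g x -> closure f x -> f = g.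
Proof.
move=> ff fg gx cfx; have [y [fy gy]] := cfx g (open_nbhs_nbhs (conj (face_open fg) gx)).
exact: face_eq fy gy.
Qed.

Lemma boundary_face f : face f -> boundary f = closure f `\` f.
Proof. by move=> ff; rewrite /boundary (interior_id _).1//; exact: face_open. Qed.

Lemma face_cycle f : face f -> exists C : cycle_of G, boundary f = cycle_points Psi C.
Proof. by case/Psi_closed. Qed.

Lemma face_disk f : face f -> exists (phi : R * R -> P) (psi : P -> R * R),
  [/\ {within @closed_disk R, continuous phi}, {within closure f, continuous psi},
      forall p, closed_disk p -> closure f (phi p) /\ psi (phi p) = p,
      forall x, closure f x -> closed_disk (psi x) /\ phi (psi x) = x &
      forall x, closure f x -> (f x <-> open_disk (psi x))].
Proof.
case/Psi_closed => -[phi [psi [[h1 h2 pK kP [c1 c2]] E]]] _; exists phi, psi; split=> //.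
- by move=> p Dp; split; [apply: h1; exists p|rewrite pK// mem_set].
- by move=> x fx; split; [apply: h2; exists x|rewrite kP// mem_set].
- have DD p : open_disk p -> closed_disk p by rewrite /open_disk /closed_disk /=; lra.
  move=> x fx; split; rewrite -{1}E.
    by move=> [p op <-]; rewrite pK// mem_set//; exact: DD.
  by move=> op; exists (psi x) => //; rewrite kP// mem_set.
Qed.

Section Cycle.
Variables (f : set P) (C : cycle_of G).
Hypotheses (ff : face f) (fC : boundary f = cycle_points Psi C).

Lemma closure_graph x : closure f x -> graph_points Psi x -> boundary f x.
Proof. by move=> fx gx; rewrite boundary_face//; split=> // /(face_graph ff). Qed.

Lemma cycle_closure i x : arc (cedge (c := C) i) x -> closure f x.
Proof.
move=> ax; have : boundary f x by rewrite fC; exists i.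
by rewrite boundary_face// => -[].
Qed.

Lemma cycle_edge e (t : R) : 0 < t < 1 ->
  closure f (edge_curve Psi e t) <-> exists i, cedge (c := C) i = e.
Proof.
move=> t01; split; last by move=> [i <-]; apply: (@cycle_closure i); exact: arc_curve.
move=> cl; have : boundary f (edge_curve Psi e t).
  by apply: closure_graph => //; apply: arc_graph; exact: arc_curve.
by rewrite fC => -[i _ /(interior_arc t01)]; exists i.
Qed.

Lemma cycle_vert v : closure f (vpt Psi v) <-> exists i, cvert (c := C) i = v.
Proof.
split; last first.
  move=> [i <-]; apply: (@cycle_closure i); apply/vpt_arc.
  by rewrite cedge_ends !inE eqxx.
move=> cl; have : boundary f (vpt Psi v) by apply: closure_graph => //; exact: vpt_graph.
rewrite fC => -[i _ /vpt_arc]; rewrite cedge_ends !inE => /orP[]/eqP ->; first by exists i.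
by exists (ordS i).
Qed.

End Cycle.

Lemma closure_edge f e (t : R) x : face f -> 0 < t < 1 ->
  closure f (edge_curve Psi e t) -> arc e x -> closure f x.
Proof.
move=> ff t01; have [C fC] := face_cycle ff.
by move=> /(cycle_edge ff fC _ t01)[i <-]; exact: cycle_closure.
Qed.

Lemma closure_mid f e x : face f -> closure f (midp e) -> arc e x -> closure f x.
Proof. by move=> ff; apply: closure_edge => //; exact: half01. Qed.

Lemma closure_cases f x : face f -> closure f x ->
  f x \/ exists2 e, closure f (midp e) & arc e x.
Proof.
move=> ff cx; have [fx|nfx] := pselect (f x); first by left.
right; have [C fC] := face_cycle ff.
have : boundary f x by rewrite boundary_face.
rewrite fC => -[i _ ax]; exists (cedge (c := C) i) => //.
by apply/(cycle_edge ff fC _ (half01 R)); exists i.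
Qed.

Lemma face_has_edge f : face f -> exists e, closure f (midp e).
Proof.
move=> ff; have [C fC] := face_cycle ff.
have i : 'I_(clen C) := Ordinal (leq_trans (isT : 0 < 2)%N (clen_ge2 C)).
by exists (cedge (c := C) i); apply/(cycle_edge ff fC _ (half01 R)); exists i.
Qed.

End Faces.

(** * Every edge lies on exactly two faces *)

Lemma sqr_scale_gt1 (R : realType) (r n : R) : 0 < r -> 1 <= n -> (1 + r) ^+ 2 * n <= 1 -> False.
Proof. by move=> r0 n1; nra. Qed.

Section EdgeFaces.
Variables (R : realType) (G : mgraph) (P : topologicalType) (Psi : embedding R G P).
Hypotheses (P_surf : surface R P) (Psi_closed : closed_2cell_embedding Psi).
Local Notation face := (face Psi).
Local Notation arc := (arc Psi).
Local Notation midp := (midp Psi).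
Let hausP := surface_hausdorff P_surf.

(* The collar [k s t = phi ((1 - t) * psi (e s))] of [e] in a face; two collars
   glue to an embedded disk, which leaves no room for a third face. *)
Lemma collar f e : face f -> closure f (midp e) ->
  exists k : R * R -> P,
    [/\ {within [set q | 0 <= q.1 <= 1 /\ 0 <= q.2 < 1], continuous k},
        forall q q', 0 <= q.1 <= 1 -> 0 <= q.2 < 1 -> 0 <= q'.1 <= 1 -> 0 <= q'.2 < 1 ->
          k q = k q' -> q = q',
        forall s, 0 <= s <= 1 -> k (s, 0) = edge_curve Psi e s &
        forall q, 0 <= q.1 <= 1 -> 0 < q.2 < 1 -> f (k q)].
Proof.
move=> ff cm; have [phi [psi [cphi cpsi pK kP fP]]] := face_disk Psi_closed ff.
have clE (s : R) : 0 <= s <= 1 -> closure f (edge_curve Psi e s).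
  by move=> s01; apply: (closure_mid P_surf Psi_closed ff cm); exists s.
have oncirc (s : R) : 0 <= s <= 1 -> circle (psi (edge_curve Psi e s)).
  move=> s01; have [D _] := kP _ (clE s s01).
  have nf : ~ f (edge_curve Psi e s).
    by move=> /(face_graph ff); apply; apply: (@arc_graph _ _ _ Psi e); exists s.
  have no : ~ open_disk (psi (edge_curve Psi e s)) by move=> /(fP _ (clE s s01)).
  move: D no; rewrite /closed_disk /open_disk /circle /= => D /negP; rewrite -leNgt => D'.
  by apply/eqP; rewrite eq_le D D'.
pose sc (t : R) (p : R * R) : R * R := ((1 - t) * p.1, (1 - t) * p.2).
have nsc t p : circle p -> (sc t p).1 ^+ 2 + (sc t p).2 ^+ 2 = (1 - t) ^+ 2.
  rewrite /circle /sc /= => cp.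
  by transitivity ((1 - t) ^+ 2 * (p.1 ^+ 2 + p.2 ^+ 2)); [ring|rewrite cp mulr1].
have Dsc t p : 0 <= t < 1 -> circle p -> closed_disk (sc t p).
  by move=> t01 cp; rewrite /closed_disk /= nsc//; nra.
exists (fun q => phi (sc q.2 (psi (edge_curve Psi e q.1)))); split.
- have c1 : {within [set q : R * R | 0 <= q.1 <= 1 /\ 0 <= q.2 < 1],
      continuous (fun q => psi (edge_curve Psi e q.1))}.
    apply: (@within_comp _ _ _ _ (closure f) (fun q => edge_curve Psi e q.1) psi) => //.
      apply: (@within_comp _ _ _ _ (@unit_interval R) fst _) => //; first exact: wc_fst0.
        exact: arc_cont.
      by move=> q [].
    by move=> q [] /clE.
  apply: (@within_comp _ _ _ _ (@closed_disk R)
    (fun q : R * R => sc q.2 (psi (edge_curve Psi e q.1))) phi) => //.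
    by rewrite /sc; wcont.
  by move=> q [q1 q2]; apply: Dsc => //; exact: oncirc.
- move=> [s t] [s' t'] /= s01 t01 s01' t01' E.
  have {}E : sc t (psi (edge_curve Psi e s)) = sc t' (psi (edge_curve Psi e s')).
    have [_ <-] := pK _ (Dsc _ _ t01 (oncirc s s01)).
    by rewrite E; have [_ ->] := pK _ (Dsc _ _ t01' (oncirc s' s01')).
  have tt' : t = t'.
    have := nsc t _ (oncirc s s01); rewrite E nsc; last exact: oncirc.
    by move=> h; nra.
  subst t'; congr (_, _).
  have E2 : psi (edge_curve Psi e s) = psi (edge_curve Psi e s').
    case: E => /= e1 e2; have t0 : 1 - t != 0 by rewrite gt_eqF//; lra.
    by apply: pair_ext; apply: (mulfI t0).
  have E3 : edge_curve Psi e s = edge_curve Psi e s'.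
    have [_ <-] := kP _ (clE s s01); rewrite E2.
    by have [_ ->] := kP _ (clE s' s01').
  by apply: (arc_inj (mem_set s01) (mem_set s01') E3).
- move=> s s01 /=; have -> : sc 0 (psi (edge_curve Psi e s)) = psi (edge_curve Psi e s).
    by rewrite /sc subr0 !mul1r -surjective_pairing.
  by have [_ ->] := kP _ (clE s s01).
- move=> [s t] /= s01 t01; have t01' : 0 <= t < 1 by lra.
  have [cl E] := pK _ (Dsc _ _ t01' (oncirc s s01)).
  by apply/(fP _ cl); rewrite E /open_disk /= nsc; [nra|exact: oncirc].
Qed.

Lemma edge_le2_faces f1 f2 f3 e : face f1 -> face f2 -> face f3 ->
  f1 <> f2 -> f1 <> f3 -> f2 <> f3 ->
  closure f1 (midp e) -> closure f2 (midp e) -> closure f3 (midp e) -> False.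
Proof.
have b1 (t : R) : -1 <= t <= 1 -> 0 <= (t + 2) / 4 <= 1 by move=> ?; lra.
have b2 (t : R) : 0 <= t -> -1 <= t <= 1 -> 0 <= t / 2 < 1 by move=> ? ?; lra.
have b3 (t : R) : t < 0 -> -1 <= t <= 1 -> 0 < - t / 2 < 1 by move=> ? ?; lra.
have b4 (t : R) : t < 0 -> -1 <= t <= 1 -> 0 <= - t / 2 < 1 by move=> ? ?; lra.
have e1 (s t : R) : (s + 2) / 4 = (t + 2) / 4 -> s = t by move=> ?; lra.
have e2 (s t : R) : s / 2 = t / 2 -> s = t by move=> ?; lra.
have e3 (s t : R) : - s / 2 = - t / 2 -> s = t by move=> ?; lra.
have half0 : (0 + 2) / 4 = 1 / 2 :> R by field.
move=> F1 F2 F3 n12 n13 n23 c1 c2 c3.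
have [k1 [ck1 ik1 k10 k1f]] := collar F1 c1.
have [k2 [ck2 ik2 k20 k2f]] := collar F2 c2.
(* The upper half disk goes into the collar in [f1], the lower one into that in [f2], and the
   diameter into the edge. The first parameter stays within [[1/4, 3/4]], with the midpoint at the
   centre, and the second below 1, where the collars are injective. *)
pose h (p : R * R) := if 0 <= p.2 then k1 ((p.1 + 2) / 4, p.2 / 2) else k2 ((p.1 + 2) / 4, - p.2 / 2).
have bnd (p : R * R) : closed_disk p -> -1 <= p.1 <= 1 /\ -1 <= p.2 <= 1.
  by move=> /circle_bound; rewrite !ler_norml.
have kk (s : R) : 0 <= s <= 1 -> k1 (s, 0) = k2 (s, 0) by move=> s01; rewrite k10// k20.
have clh (s : R) : s <> 0 -> s * 0 = 0 by rewrite mulr0.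
have ch : {within @closed_disk R, continuous h}.
  have -> : @closed_disk R = (@closed_disk R `&` [set p | 0 <= p.2]) `|`
      (@closed_disk R `&` [set p | p.2 <= 0]).
    apply/seteqP; split=> p; last by move=> [] [].
    by move=> Dp; have [h0|h0] := leP 0 p.2; [left|right]; split=> //=; lra.
  have clD : closed (@closed_disk R).
    by apply: compact_closed (@disk_compact R); exact: norm_hausdorff.
  have cl1 : closed (@closed_disk R `&` [set p : R * R | 0 <= p.2]).
    apply: closedI => //; apply: (@closed_comp _ _ snd [set t : R | 0 <= t]) => [p _|].
      exact: cvg_snd.
    exact: closed_ge.
  have cl2 : closed (@closed_disk R `&` [set p : R * R | p.2 <= 0]).
    apply: closedI => //; apply: (@closed_comp _ _ snd [set t : R | t <= 0]) => [p _|].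
      exact: cvg_snd.
    exact: closed_le.
  apply: (within_glue (f := fun p : R * R => k1 ((p.1 + 2) / 4, p.2 / 2))
    (g := fun p : R * R => k2 ((p.1 + 2) / 4, - p.2 / 2)) cl1 cl2).
  + apply: (@within_comp _ _ _ _ _ (fun p : R * R => ((p.1 + 2) / 4, p.2 / 2)) k1 _ ck1).
      by wcont.
    by move=> p [/bnd[p1 p2] /= p20]; split; [exact: b1|exact: b2].
  + apply: (@within_comp _ _ _ _ _ (fun p : R * R => ((p.1 + 2) / 4, - p.2 / 2)) k2 _ ck2).
      by wcont.
    move=> p [/bnd[p1 p2] /= p20]; split; first exact: b1.
      by rewrite /= ltr_pdivrMr// mul1r; lra.
  + by move=> p [_ /= p2]; rewrite /h p2.
  + move=> p [/bnd[p1 p2] /= p20]; rewrite /h; have [p21|//] := leP 0 p.2.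
    have -> : p.2 = 0 by apply/eqP; rewrite eq_le p20 p21.
    by rewrite oppr0 mul0r kk//; exact: b1.
have disj q q' : 0 <= q.1 <= 1 -> 0 <= q.2 < 1 -> 0 <= q'.1 <= 1 -> 0 < q'.2 < 1 -> k1 q = k2 q' -> False.
  move=> q1 q2 q1' q2' E; have f2k := k2f q' q1' q2'.
  have [q20|q20] := ltP 0 q.2.
    apply: n12; apply: (face_eq F1 F2 _ f2k); rewrite -E; apply: k1f => //; lra.
  have qE : q = (q.1, 0) by apply: pair_ext => //=; lra.
  move: E; rewrite qE k10// => E; apply: (face_graph F2 f2k); rewrite -E.
  by apply: (@arc_graph _ _ _ Psi e); exists q.1.
have ih : set_inj (@closed_disk R) h.
  move=> p q /set_mem /bnd[p1 p2] /set_mem /bnd[q1 q2]; rewrite /h.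
  have [p0|p0] := leP 0 p.2; have [q0|q0] := leP 0 q.2.
  - move=> /(ik1 (_, _) (_, _) (b1 _ p1) (b2 _ p0 p2) (b1 _ q1) (b2 _ q0 q2)) [k k'].
    by apply: pair_ext; [exact: e1|exact: e2].
  - by move=> /(disj (_, _) (_, _) (b1 _ p1) (b2 _ p0 p2) (b1 _ q1) (b3 _ q0 q2)).
  - by move=> /esym /(disj (_, _) (_, _) (b1 _ q1) (b2 _ q0 q2) (b1 _ p1) (b3 _ p0 p2)).
  - move=> /(ik2 (_, _) (_, _) (b1 _ p1) (b4 _ p0 p2) (b1 _ q1) (b4 _ q0 q2)) [k k'].
    by apply: pair_ext; [exact: e1|exact: e3].
have hx : h (0, 0) = midp e.
  by rewrite /h /= lexx mul0r half0 k10//; have := half01 R; lra.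
have N := surface_domain P_surf ch ih; rewrite hx in N.
have [y [f3y [p Dp py]]] := c3 _ N.
have [p1 p2] := bnd p Dp; move: py; rewrite /h.
have no (g : set P) (k : R * R -> P) q : face g -> g <> f3 ->
   (forall s, 0 <= s <= 1 -> k (s, 0) = edge_curve Psi e s) ->
   (forall q, 0 <= q.1 <= 1 -> 0 < q.2 < 1 -> g (k q)) ->
   0 <= q.1 <= 1 -> 0 <= q.2 < 1 -> k q = y -> False.
  move=> fg gf3 ks kf q1 q2 E; have [q20|q20] := ltP 0 q.2.
    by apply: gf3; apply: (face_eq fg F3 _ f3y); rewrite -E; apply: kf => //; lra.
  have qE : q = (q.1, 0) by apply: pair_ext => //=; lra.
  move: E; rewrite qE ks// => E; apply: (face_graph F3 f3y); rewrite -E.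
  by apply: (@arc_graph _ _ _ Psi e); exists q.1.
have [p20|p20] := leP 0 p.2.
  by apply: (no f1 k1 _ F1 n13 k10 k1f); [exact: b1|exact: b2].
by apply: (no f2 k2 _ F2 n23 k20 k2f); [exact: b1|exact: b4].
Qed.

(** Every face has an edge on its boundary, and every edge has at most two faces. *)
Lemma faces_finite : finite_set [set f | face f].
Proof.
apply: (@sub_finite_set _ _ (\bigcup_(e in [set: edge G]) [set f | face f /\ closure f (midp e)])).
  by move=> f ff; have [e ce] := face_has_edge P_surf Psi_closed ff; exists e.
apply: bigcup_finite => [|e _]; first exact: finite_finset.
have [[f [ff cf]]|H] := pselect (exists f, face f /\ closure f (midp e)); last first.
  by apply: (@sub_finite_set _ _ set0) => // f Hf; case: H; exists f.
have [[g [fg cg gf]]|H] := pselect (exists g, [/\ face g, closure g (midp e) & g <> f]).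
  apply: (@sub_finite_set _ _ [set f; g]); last by apply: finite_set2.
  move=> k [fk ck]; have [->|kf] := pselect (k = f); first by left.
  have [->|kg] := pselect (k = g); first by right.
  by case: (@edge_le2_faces k f g e) => // fg'; apply: gf.
apply: (@sub_finite_set _ _ [set f]); last exact: finite_set1.
by move=> k [fk ck]; apply: contrapT => kf; apply: H; exists k.
Qed.

Definition faces : finType := fset_sub_type (fset_set [set f | face f]).

Lemma faceP (f : faces) : face (val f).
Proof. by have := fsvalP f; rewrite (in_fset_set faces_finite) => /set_mem. Qed.

Lemma face_in f : face f -> exists g : faces, val g = f.
Proof.
move=> ff; have fin : f \in fset_set [set f | face f] by rewrite (in_fset_set faces_finite) mem_set.
by exists (FSetSub fin).
Qed.

(** Closures of faces, arcs and vertices are finitely many closed sets; those that miss [p] also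
    miss a neighbourhood of it. *)
Lemma near_star p : exists2 W, nbhs p W & forall y, W y ->
  [/\ forall f, face f -> closure f y -> closure f p,
      forall e, arc e y -> arc e p & forall v, y = vpt Psi v -> p = vpt Psi v].
Proof.
have [W1 W1p H1] := @near_closed_family P faces (fun f => closure (val f)) p (fun f => @closed_closure _ _).
have [W2 W2p H2] := @near_closed_family P (edge G) arc p (fun e => arc_closed hausP (e := e)).
have [|W3 W3p H3] := @near_closed_family P (vert G) (fun v => [set vpt Psi v]) p.
  by move=> v; exact/accessible_closed_set1/hausdorff_accessible.
exists (W1 `&` (W2 `&` W3)); first by do 2 apply: filterI => //.
move=> y [y1 [y2 y3]]; split.
- by move=> f /face_in[g <-]; exact: H1.
- exact: H2.
- exact: H3.
Qed.

(** Without a face at [e], a neighbourhood of the midpoint would lie in the arc and embed in a line.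
    With only one face it would lie in the closure of that face and embed in a closed disk with the
    midpoint on the boundary circle. Both contradict invariance of domain. *)
Lemma edge_two_faces e : exists f g, [/\ face f, face g, f <> g &
  forall k, face k -> closure k (midp e) <-> k = f \/ k = g].
Proof.
have [W Wx HW] := near_star (midp e).
have Wcases y : W y -> arc e y \/ exists k, [/\ face k, k y & closure k (midp e)].
  move=> Wy; have [H1 H2 H3] := HW y Wy.
  have [gy|ngy] := pselect (graph_points Psi y); last first.
    have [k fk ky] := face_ex ngy; right; exists k; split=> //.
    by apply: H1 => //; exact: subset_closure.
  left; have [[v yv]|[e' ye]] := graph_cases gy; first by have := @midp_vpt _ _ _ Psi e v; rewrite (H3 _ yv).
  by have := arc_midp (H2 _ ye) => <-.
have [[f [ff cf]]|H] := pselect (exists f, face f /\ closure f (midp e)); last first.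
  exfalso.
  have Warc : W `<=` arc e by move=> y /Wcases[//|[k [fk _ ck]]]; case: H; exists k.
  have inv : forall x, exists t : R, arc e x -> unit_interval t /\ edge_curve Psi e t = x.
    move=> x; have [[t t01 tx]|nx] := pselect (arc e x); first by exists t.
    by exists 0.
  have [g Hg] := choice inv.
  have cg : {within arc e, continuous g}.
    apply: within_inv => //; [exact: unit_interval_compact|exact: arc_cont|].
    move=> t t01; have [|u1 u2] := Hg (edge_curve Psi e t); first by exists t.
    exact: (arc_inj (mem_set u1) (mem_set t01) u2).
  have := @surface_domain_chart _ _ P_surf (midp e) W (fun x => (g x, 0)) Wx.
  have cgW : {within W, continuous g} by exact: continuous_subspaceW cg.
  have cW : {within W, continuous (fun x => (g x, 0 : R))} by wcont.
  move=> /(_ cW) N; have /N : set_inj W (fun x => (g x, 0 : R)).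
    move=> x y /set_mem /Warc xe /set_mem /Warc ye [E].
    by have [_ <-] := Hg x xe; have [_ <-] := Hg y ye; rewrite E.
  move=> /nbhs_disk[r r0 /(_ (0, 1))] /= []; first by rewrite /closed_disk /=; lra.
  by move=> x Wxx [_ /eqP]; rewrite add0r mulr1 lt_eqF.
have [[g [fg cg gf]]|H] := pselect (exists g, [/\ face g, closure g (midp e) & g <> f]).
  exists f, g; split=> // [E|k fk]; first exact: gf.
  split; last by move=> [->|->].
  move=> ck; have [->|kf] := pselect (k = f); first by left.
  have [->|kg] := pselect (k = g); first by right.
  by case: (@edge_le2_faces k f g e) => // fg'; apply: gf.
exfalso.
have Wf : W `<=` closure f.
  move=> y /Wcases[ye|[k [fk ky ck]]]; first exact: (closure_mid P_surf Psi_closed ff cf).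
  have [<-|kf] := pselect (k = f); first exact: subset_closure.
  by case: H; exists k.
have [phi [psi [cphi cpsi pK kP fP]]] := face_disk Psi_closed ff.
have := @surface_domain_chart _ _ P_surf (midp e) W psi Wx.
have cW : {within W, continuous psi} by exact: continuous_subspaceW cpsi.
move=> /(_ cW) N; have /N : set_inj W psi.
  move=> x y /set_mem /Wf xf /set_mem /Wf yf E.
  by have [_ <-] := kP x xf; have [_ <-] := kP y yf; rewrite E.
move=> /nbhs_disk[r r0 Hr].
have nm : ~ f (midp e).
  move=> /(face_graph ff); apply; apply: (@arc_graph _ _ _ Psi e).
  by apply: arc_curve; exact: half01.
have [Dm _] := kP _ cf.
have no : ~ open_disk (psi (midp e)) by move=> /(fP _ cf).
(* The image of [psi] would contain [1 + r] times the point [psi (midp e)] of the unit circle, which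
   is outside the closed disk. *)
have [x Wxx E] := Hr _ Dm; have [+ _] := kP _ (Wf _ Wxx).
rewrite E /closed_disk /=.
have -> : ((psi (midp e)).1 + r * (psi (midp e)).1) ^+ 2 + ((psi (midp e)).2 + r * (psi (midp e)).2) ^+ 2
  = (1 + r) ^+ 2 * ((psi (midp e)).1 ^+ 2 + (psi (midp e)).2 ^+ 2) by ring.
move: no; rewrite /open_disk /= => /negP; rewrite -leNgt; move: (_ + _) => n n1.
exact: sqr_scale_gt1.
Qed.

End EdgeFaces.

(** * Faces around a vertex *)

Section Link.
Variables (R : realType) (G : mgraph) (P : topologicalType) (Psi : embedding R G P).
Hypotheses (P_surf : surface R P) (Psi_closed : closed_2cell_embedding Psi).
Hypothesis no_isolated : forall v : vert G, exists e : edge G, v \in ends e.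
Local Notation face := (face Psi).
Local Notation arc := (arc Psi).
Local Notation midp := (midp Psi).

Lemma closures_cover p : exists2 f, face f & closure f p.
Proof.
have edge_case e : arc e p -> exists2 f, face f & closure f p.
  move=> ep; have [f [g [ff fg _ H]]] := edge_two_faces P_surf Psi_closed e.
  by exists f => //; apply: (closure_mid P_surf Psi_closed ff _ ep); apply/H => //; left.
have [gp|ngp] := pselect (graph_points Psi p); last first.
  by have [f ff fp] := face_ex ngp; exists f => //; exact: subset_closure.
have [[v pv]|[e ep]] := graph_cases gp; last exact: edge_case ep.
by have [e ve] := no_isolated v; apply: (edge_case e); rewrite pv; apply/vpt_arc.
Qed.

Lemma closures_meet f g p : face f -> face g -> f <> g -> closure f p -> closure g p ->
  (exists e, [/\ closure f (midp e), closure g (midp e) & arc e p]) \/ exists v, p = vpt Psi v.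
Proof.
move=> ff fg nfg cf cg.
have [fp|[e fe ep]] := closure_cases P_surf Psi_closed ff cf.
  by case: nfg; apply/esym/(face_closure P_surf fg ff fp cg).
have [gp|[e' ge' ep']] := closure_cases P_surf Psi_closed fg cg.
  by case: nfg; exact: (face_closure P_surf ff fg gp cf).
have [ee'|ee'] := pselect (e = e'); first by left; exists e; rewrite {2}ee'.
by have [v [-> _ _]] := arc_inter ee' ep ep'; right; exists v.
Qed.

(** In a small neighbourhood of [v] closures of distinct faces meet only at [v] and along edges at
    [v]. If [Z] spreads across those edges, the closures of the faces in [Z] and of those outside
    [Z] separate a punctured disk around [v], which is connected. *)
Lemma link_connected v (Z : set (set P)) :
  (exists f, [/\ face f, closure f (vpt Psi v) & Z f]) ->
  (forall f g e, face f -> face g -> v \in ends e ->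
     closure f (midp e) -> closure g (midp e) -> Z f -> Z g) ->
  forall g, face g -> closure g (vpt Psi v) -> Z g.
Proof.
move=> [f [ff cf Zf]] Zstep g fg cg; apply: contrapT => nZg.
have [W Wv HW] := near_star P_surf Psi_closed (vpt Psi v).
have [D [Dv DW cD]] := punctured_chart P_surf Wv.
pose X (b : Prop) := \bigcup_(k in [set k : faces Psi | (Z (val k) <-> b) /\ closure (val k) (vpt Psi v)]) closure (val k).
have clX b : closed (X b).
  by apply: closed_bigcup => [|k _]; [exact: finite_finset|exact: closed_closure].
have inX (b : Prop) k y : face k -> (Z k <-> b) -> W y -> closure k y -> X b y.
  move=> fk Zk Wy cy; have [k' kk'] := face_in P_surf Psi_closed fk.
  exists k'; rewrite /= kk' //; split=> //.
  by have [H _ _] := HW y Wy; exact: H.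
have pick k : face k -> closure k (vpt Psi v) -> exists2 y, k y & (D `\ vpt Psi v) y.
  move=> fk ck; have [y [ky Dy]] := ck D Dv; exists y => //; split=> // yv.
  by apply: (face_graph fk ky); rewrite yv; exact: vpt_graph.
have cover : D `\ vpt Psi v `<=` X True `|` X False.
  move=> y [/DW Wy _]; have [k fk ck] := closures_cover y.
  by have [Zk|nZk] := pselect (Z k); [left|right]; apply: inX ck.
have disj y : (D `\ vpt Psi v) y -> X True y -> X False y -> False.
  move=> [/DW Wy yv] [k1 [Z1 c1] k1y] [k2 [Z2 c2] k2y].
  have F1 := faceP P_surf Psi_closed k1; have F2 := faceP P_surf Psi_closed k2.
  have n12 : val k1 <> val k2 by move=> E; apply/Z2; rewrite -E; apply/Z1.
  have [_ H2 H3] := HW y Wy.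
  have [[e [e1 e2 ey]]|[u yu]] := closures_meet F1 F2 n12 k1y k2y; last first.
    by apply: yv; rewrite yu; have := H3 _ yu => /vpt_inj ->.
  by apply/Z2; apply: (Zstep (val k1) _ e) => //; [apply/(vpt_arc Psi)/H2|apply/Z1].
have [y fy Dy] := pick f ff cf.
have [z gz Dz] := pick g fg cg.
have Xy : X True y by apply: (inX _ f) => //; [exact/DW/(Dy.1)|exact: subset_closure].
have [k [Zk ck] kz] := connected_closed_sub cD (clX True) (clX False) cover disj Dy Xy Dz.
apply: nZg; have <- : val k = g; last exact/Zk.
exact: (face_closure P_surf (faceP P_surf Psi_closed k) fg gz kz).
Qed.

End Link.

(** * Global sections over the projective plane *)

Section Sphere.
Variable R : realType.
Local Notation R3 := (R * R * R)%type.

Definition hemisphere (e : R) : set R3 := [set x | sphere x /\ 0 <= e * x.2].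

Definition hemi_map e (p : R * R) : R3 := (p, e * Num.sqrt (1 - (p.1 ^+ 2 + p.2 ^+ 2))).

Lemma sphere_disk (x : R3) : sphere x -> closed_disk x.1.
Proof. by case: x => [[a b] c]; rewrite /sphere /closed_disk /=; nra. Qed.

Lemma hemi_prect e a b c d : e ^+ 2 = 1 ->
  prect (hemisphere e) fst a b c d =
  hemi_map e @` (@closed_disk R `&` [set p | (a <= p.1 <= b) && (c <= p.2 <= d)]).
Proof.
move=> e2; apply/seteqP; split.
- move=> [[x y] z] [[/= xyz ez] /= abcd]; exists (x, y); last first.
    rewrite /hemi_map /=; congr (_, _).
    have -> : 1 - (x ^+ 2 + y ^+ 2) = (e * z) ^+ 2.
      by rewrite exprMn e2; move: xyz; rewrite /sphere /=; lra.
    by rewrite sqrtr_sqr ger0_norm// mulrA -expr2 e2 mul1r.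
  by split=> //; exact: (sphere_disk xyz).
- move=> _ [[x y] [D /= abcd] <-]; split=> //.
  have h : 0 <= 1 - (x ^+ 2 + y ^+ 2) by move: D; rewrite /closed_disk /=; lra.
  split=> /=; last by rewrite mulrA -expr2 e2 mul1r sqrtr_ge0.
  by rewrite /sphere /= exprMn e2 mul1r sqr_sqrtr//; ring.
Qed.

Lemma hemi_map_cont e A : {within A, continuous (hemi_map e)}.
Proof. rewrite /hemi_map; wcont. Qed.

Lemma hemi_prect_connected e a b c d : e ^+ 2 = 1 -> connected (prect (hemisphere e) fst a b c d).
Proof.
move=> e2; rewrite hemi_prect//; apply: connected_continuous_connected; last exact: hemi_map_cont.
apply: convex_connected => p q t [p1 p2] [q1 q2] t01.
by split; [exact: disk_convex|exact: rect_convex].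
Qed.

Lemma hemisphereE e : hemisphere e = prect (hemisphere e) fst (-1) 1 (-1) 1.
Proof.
apply/seteqP; split=> x; last by case.
move=> /[dup] xh [xs _]; split=> //=.
by have [] := circle_bound (sphere_disk xs); rewrite !ler_norml => -> ->.
Qed.

Lemma hemisphere_connected e : e ^+ 2 = 1 -> connected (hemisphere e).
Proof. by move=> e2; rewrite hemisphereE; exact: hemi_prect_connected. Qed.

Lemma hemisphere_compact e : e ^+ 2 = 1 -> compact (hemisphere e).
Proof.
move=> e2; rewrite hemisphereE hemi_prect//; apply: continuous_compact; first exact: hemi_map_cont.
rewrite setIC; apply: compact_closedI; first exact: rect_compact.
by apply: compact_closed (@disk_compact R); exact: norm_hausdorff.
Qed.

Lemma sphere_halves : @sphere R = hemisphere 1 `|` hemisphere (-1).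
Proof.
apply/seteqP; split=> x; last by move=> [[]|[]].
by move=> sx; have [h|h] := leP 0 x.2; [left|right]; split=> //; lra.
Qed.

Let one2 : (1 : R) ^+ 2 = 1 /\ (-1 : R) ^+ 2 = 1. Proof. by split; lra. Qed.

Lemma sphere_compact : compact (@sphere R).
Proof. by rewrite sphere_halves; apply: compactU; apply: hemisphere_compact; have [] := one2. Qed.

Lemma equator_connected : connected (hemisphere 1 `&` hemisphere (-1)).
Proof.
rewrite (_ : _ `&` _ = (fun p : R * R => (p, 0 : R)) @` @circle R); last first.
  apply/seteqP; split=> [[[x y] z]|_ [p cp <-]].
    move=> [[/= s z1] [_ /= z2]]; have z0 : z = 0 by lra.
    exists (x, y); last by rewrite z0.
    by move: s; rewrite z0 /sphere /circle /= expr0n /= addr0.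
  by split; split=> /=; rewrite ?mulr0// /sphere /= expr0n /= addr0.
apply: connected_continuous_connected; first exact: circle_connected.
by wcont.
Qed.

Lemma sphere_connected : connected (@sphere R).
Proof.
rewrite sphere_halves; apply: connectedU.
- by exists (1, 0, 0); split; split=> /=; rewrite ?mulr0// /sphere /=; lra.
- by apply: hemisphere_connected; have [] := one2.
- by apply: hemisphere_connected; have [] := one2.
Qed.

Lemma sphere_section (V : Type) (good : set R3 -> (R3 -> V) -> Prop) eqv flip :
  (forall X, X `<=` @sphere R -> two_valued_system X good eqv flip) ->
  exists s, good (@sphere R) s.
Proof.
move=> sysP.
have half e : e ^+ 2 = 1 -> exists s, good (hemisphere e) s.
  move=> e2; have hs : hemisphere e `<=` @sphere R by move=> x [].
  have clX : closed (hemisphere e) by apply: compact_closed (hemisphere_compact e2); exact: norm_hausdorff.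
  apply: (@system_section R _ _ _ _ _ _ (sysP _ hs) fst (hemisphere_compact e2) clX _ _ _ 1) => //.
  - by move=> x; exact: cvg_fst.
  - move=> [[x y] z] [[x' y'] z'] [/= xyz ez] [/= xyz' ez'] [ex ey]; subst x' y'.
    congr (_, _); move: xyz xyz'; rewrite /sphere /= => h1 h2.
    by have [] := sqr1_unit e2 => ee; subst e; nra.
  - by move=> a b c d; exact: hemi_prect_connected.
  - by move=> x [xs _]; apply: circle_bound; exact: (sphere_disk xs).
have [s1 g1] := half 1 one2.1; have [s2 g2] := half (-1) one2.2.
have clX e : e ^+ 2 = 1 -> closed (hemisphere e).
  by move=> e2; apply: compact_closed (hemisphere_compact e2); exact: norm_hausdorff.
have hs e : hemisphere e `<=` @sphere R by move=> x [].
have [s gs _] := system_glue (sysP _ (fun _ h => h)) (hs 1) (hs (-1)) (clX 1 one2.1) (clX (-1) one2.2)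
  equator_connected g1 g2.
by exists s; rewrite sphere_halves.
Qed.

Definition opp3 (x : R3) : R3 := (- x.1.1, - x.1.2, - x.2).

Lemma opp3E (x : R3) : - x = opp3 x. Proof. by case: x => [[a b] c]. Qed.

Lemma sphere_opp3 x : sphere x -> sphere (opp3 x).
Proof. by rewrite /sphere /= !sqrrN. Qed.

Lemma opp3_neq x : sphere x -> x <> opp3 x.
Proof.
case: x => [[a b] c]; rewrite /sphere /opp3 /= => s [ea eb ec].
have ha : a = 0 by lra. have hb : b = 0 by lra. have hc : c = 0 by lra.
by move: s; rewrite ha hb hc; lra.
Qed.

Lemma opp3_cont A : {within A, continuous opp3}.
Proof. by apply: (@within_eq _ _ _ (fun x : R3 => (- x.1.1, - x.1.2, - x.2))) => //; wcont. Qed.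

(** If the segment met 0, comparing lengths would give [1 - t = t], hence [a = - z]. *)
Lemma sphere_slide_neq0 (a z : R3) (t : R) : sphere a -> sphere z -> a <> opp3 z -> 0 <= t <= 1 ->
  0 < ((1 - t) * a.1.1 + t * z.1.1) ^+ 2 + ((1 - t) * a.1.2 + t * z.1.2) ^+ 2 +
    ((1 - t) * a.2 + t * z.2) ^+ 2.
Proof.
case: a z => [[a b] c] [[x y] z]; rewrite /sphere /opp3 /= => s1 s2 ne t01.
rewrite lt_neqAle; apply/andP; split; last by rewrite !addr_ge0 ?sqr_ge0.
apply/eqP => /esym h; apply: ne.
have [h1 h3] : ((1 - t) * a + t * x) ^+ 2 + ((1 - t) * b + t * y) ^+ 2 = 0 /\ (1 - t) * c + t * z = 0.
  move/eqP : h; rewrite paddr_eq0 ?addr_ge0 ?sqr_ge0// sqrf_eq0 => /andP[/eqP -> /eqP ->].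
  by [].
have [h2 h4] := sumsq_eq0 h1.
have e1 : (1 - t) * a = - (t * x) by lra.
have e2 : (1 - t) * b = - (t * y) by lra.
have e3 : (1 - t) * c = - (t * z) by lra.
have : (1 - t) ^+ 2 = t ^+ 2.
  transitivity (((1 - t) * a) ^+ 2 + ((1 - t) * b) ^+ 2 + ((1 - t) * c) ^+ 2).
    by transitivity ((1 - t) ^+ 2 * (a ^+ 2 + b ^+ 2 + c ^+ 2)); [rewrite s1 mulr1|ring].
  rewrite e1 e2 e3; transitivity (t ^+ 2 * (x ^+ 2 + y ^+ 2 + z ^+ 2)); first by ring.
  by rewrite s2 mulr1.
move=> tt; have t2 : t = 1 / 2 by lra.
by move: e1 e2 e3; rewrite t2 => e1 e2 e3; congr (_, _, _); lra.
Qed.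

Definition normalize3 (v : R3) : R3 :=
  let n := (Num.sqrt (v.1.1 ^+ 2 + v.1.2 ^+ 2 + v.2 ^+ 2))^-1 in (n * v.1.1, n * v.1.2, n * v.2).

Lemma normalize3_sphere v : 0 < v.1.1 ^+ 2 + v.1.2 ^+ 2 + v.2 ^+ 2 -> sphere (normalize3 v).
Proof.
move=> v0; rewrite /sphere /normalize3 /= !exprMn -!mulrDr exprVn sqr_sqrtr ?ltW//.
by rewrite mulVf// gt_eqF.
Qed.

Lemma normalize3_id v : sphere v -> normalize3 v = v.
Proof.
by move=> s; rewrite /normalize3; move: (s); rewrite /sphere /= => ->;
  rewrite sqrtr1 invr1 !mul1r; case: (v) => [[]].
Qed.

Lemma normalize3_cont (A : set R3) : (forall v, A v -> 0 < v.1.1 ^+ 2 + v.1.2 ^+ 2 + v.2 ^+ 2) ->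
  {within A, continuous normalize3}.
Proof.
move=> A0.
have cn : {within A, continuous (fun v : R3 => (Num.sqrt (v.1.1 ^+ 2 + v.1.2 ^+ 2 + v.2 ^+ 2))^-1)}.
  by apply: wcV; [move=> v /A0 v0; rewrite gt_eqF// sqrtr_gt0|wcont].
by rewrite /normalize3; wcont.
Qed.

End Sphere.

(** * The two-valued system of signs on faces and its pullback to the sphere *)

Section Monodromy.
Variables (R : realType) (G : mgraph) (P : topologicalType) (Psi : embedding R G P).
Hypotheses (P_proj : projective_plane R P) (Psi_closed : closed_2cell_embedding Psi).
Hypothesis no_isolated : forall v : vert G, exists e : edge G, v \in ends e.
Local Notation face := (face Psi).
Local Notation arc := (arc Psi).
Local Notation midp := (midp Psi).
Local Notation R3 := (R * R * R)%type.
Let P_surf : surface R P := P_proj.1.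

(* [c e] prescribes whether the two faces at [e] carry different values. *)
Variable c : edge G -> bool.

Definition edge_eqn (s : set P -> bool) (e : edge G) : Prop :=
  forall f g, face f -> face g -> f <> g -> closure f (midp e) -> closure g (midp e) ->
    s f (+) s g = c e.

Hypothesis c_local : forall v : vert G, exists s, forall e, v \in ends e -> edge_eqn s e.

(** Stalks of the system: a value at [p] solves the equations of the edges through [p], and only its
    restriction to the faces at [p] counts, which is what [agree] compares. *)
Definition point_eqn (p : P) (s : set P -> bool) := forall e, arc e p -> edge_eqn s e.
Definition agree (p : P) (s s' : set P -> bool) := forall f, face f -> closure f p -> s f = s' f.
Definition flips (s : set P -> bool) : set P -> bool := fun f => ~~ s f.

Lemma edge_eqn_flips s e : edge_eqn s e -> edge_eqn (flips s) e.
Proof. by move=> H f g *; rewrite /flips addbN addNb negbK; exact: H. Qed.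

Lemma point_cases p : [\/ ~ graph_points Psi p, exists v, p = vpt Psi v |
  exists e, exists2 t : R, 0 < t < 1 & p = edge_curve Psi e t].
Proof.
have [gp|ngp] := pselect (graph_points Psi p); last by constructor 1.
have [[v ->]|[e /arc_cases[[v _ ->]|[t t01 ->]]]] := graph_cases gp.
- by constructor 2; exists v.
- by constructor 2; exists v.
- by constructor 3; exists e, t.
Qed.

(** The stalk has at most two elements. The difference of two solutions does not change across an
    edge through [p]; at a vertex it is constant because the faces there are linked through
    edges. *)
Lemma point_eqn_uniq p s s' : point_eqn p s -> point_eqn p s' ->
  agree p s s' \/ agree p s (flips s').
Proof.
move=> Hs Hs'; have [ngp|[v pv]|[e [t t01 pt]]] := point_cases p.
- have [f ff fp] := face_ex ngp.
  have one g : face g -> closure g p -> g = f by move=> fg cg; exact: (face_closure P_surf fg ff fp cg).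
  have [E|E] := boolP (s f == s' f); [left|right] => g fg cg; rewrite (one g fg cg); first exact/eqP.
  by move: E; rewrite /flips; case: (s f) (s' f) => [] [].
- subst p.
  have step (b : bool) f g e : face f -> face g -> v \in ends e ->
      closure f (midp e) -> closure g (midp e) -> s f (+) s' f = b -> s g (+) s' g = b.
    move=> ff fg ve cf cg; have [<-//|nfg] := pselect (f = g).
    have ve' : arc e (vpt Psi v) by apply/vpt_arc.
    have := Hs e ve' f g ff fg nfg cf cg; have := Hs' e ve' f g ff fg nfg cf cg.
    by case: (s f) (s g) (s' f) (s' g) (c e) => [] [] [] [] [].
  have [f ff cf] := closures_cover P_surf Psi_closed no_isolated (vpt Psi v).
  have := link_connected P_surf Psi_closed no_isolated (Z := fun g => s g (+) s' g = s f (+) s' f).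
  move=> /(_ v) /(_ (ex_intro _ f (And3 ff cf erefl))) /(_ (fun g h e fg fh ve cg ch => step _ g h e fg fh ve cg ch)) H.
  by case E : (s f (+) s' f); [right|left] => g fg cg; have := H g fg cg; rewrite E /flips;
    case: (s g) (s' g) => [] [].
- subst p; have ec : arc e (edge_curve Psi e t) by exact: arc_curve.
  have [f [g [ff fg nfg H]]] := edge_two_faces P_surf Psi_closed e.
  have cf : closure f (midp e) by apply/H => //; left.
  have cg : closure g (midp e) by apply/H => //; right.
  have := Hs e ec f g ff fg nfg cf cg; have := Hs' e ec f g ff fg nfg cf cg.
  have two k : face k -> closure k (edge_curve Psi e t) -> k = f \/ k = g.
    move=> fk ck; apply/H => //; apply: (closure_edge P_surf Psi_closed fk t01 ck).
    by apply: arc_curve; exact: half01.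
  move=> E1 E2; case E : (s f == s' f); [left|right] => k fk ck; rewrite /flips; have [->|->] := two k fk ck;
    by move: E E1 E2; case: (s f) (s' f) (s g) (s' g) (c e) => [] [] [] [] [].
Qed.

Lemma point_eqn_ex p : exists s, point_eqn p s.
Proof.
have [ngp|[v ->]|[e [t t01 ->]]] := point_cases p.
- by exists xpredT => e /arc_graph.
- by have [s H] := c_local v; exists s => e /vpt_arc; exact: H.
- have [f [g [ff fg nfg H]]] := edge_two_faces P_surf Psi_closed e.
  exists (fun k => `[< k = f >] && c e) => e' /(interior_arc t01) -> k k' fk fk' nkk ck ck'.
  move: nkk; have [->|->] := (H k fk).1 ck; have [->|->] := (H k' fk').1 ck' => //= _.
    by rewrite asboolT// asboolF ?addbF// => E; apply: nfg.
  by rewrite asboolF ?asboolT// => E; apply: nfg.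
Qed.

Variable q : R3 -> P.
Hypotheses (q_onto : q @` @sphere R = [set: P])
  (q_fib : forall x y, sphere x -> sphere y -> (q x = q y <-> x = y \/ x = - y))
  (q_cont : {within @sphere R, continuous q}).

(** Continuity of a section: near [x] it coincides with its value at [x], compared in the stalk of
    the nearby point, where fewer faces may occur. *)
Definition good_on (A : set R3) (s : R3 -> set P -> bool) := forall x, A x ->
  point_eqn (q x) (s x) /\
  exists2 W, nbhs x W & forall y, W y -> A y -> agree (q y) (s y) (s x).

Lemma near_q x : sphere x -> exists2 W, nbhs x W & forall y, W y -> sphere y ->
  (forall f, face f -> closure f (q y) -> closure f (q x)) /\ (forall e, arc e (q y) -> arc e (q x)).
Proof.
move=> sx; have [W Wx HW] := near_star P_surf Psi_closed (q x).
have [W' W'x H] := (within_contP _ _).1 q_cont x sx W Wx.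
by exists W' => // y W'y sy; have [] := HW _ (H y W'y sy).
Qed.

Lemma good_uniq A s s' : A `<=` @sphere R -> connected A -> good_on A s -> good_on A s' ->
  (forall x, A x -> agree (q x) (s x) (s' x)) \/
  (forall x, A x -> agree (q x) (s x) (flips (s' x))).
Proof.
move=> AS cA gs gs'.
have [[x [Ax Qx]]|H] := pselect (exists x, A x /\ agree (q x) (s x) (s' x)); last first.
  right=> x Ax; have [E1 _] := gs x Ax; have [E2 _] := gs' x Ax.
  by have [Q|//] := point_eqn_uniq E1 E2; case: H; exists x.
left=> y Ay; apply: (locally_constant_connected (Q := fun x => agree (q x) (s x) (s' x)) cA _ Ax Ay Qx).
move=> z Az; have [E1 [W1 W1z H1]] := gs z Az; have [E2 [W2 W2z H2]] := gs' z Az.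
have [W3 W3z H3] := near_q (AS _ Az).
exists (W1 `&` (W2 `&` W3)); first by do 2 apply: filterI => //.
move=> t [t1 [t2 t3]] At.
have a1 := H1 t t1 At; have a2 := H2 t t2 At; have [a3 _] := H3 t t3 (AS _ At).
split=> Q; first by move=> f ff cf; rewrite a1// a2//; apply: Q => //; exact: a3.
have [//|Q'] := point_eqn_uniq E1 E2.
have [f ff cf] := closures_cover P_surf Psi_closed no_isolated (q t).
have := Q f ff cf; rewrite a1// a2// Q'//; last exact: a3.
by rewrite /flips; case: (s' z f).
Qed.

Lemma good_system X : X `<=` @sphere R ->
  two_valued_system X good_on (fun x => agree (q x)) flips.
Proof.
move=> XS; split.
- move=> A B s AB gs x /AB /[dup] Bx /gs[E [W Wx H]]; split=> //; exists W => // y Wy /AB; exact: H.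
- move=> A s gs x /gs[E [W Wx H]]; split; first by move=> e /E; exact: edge_eqn_flips.
  by exists W => // y Wy Ay f ff cf; rewrite /= /flips H.
- by move=> A s s' AX; apply: good_uniq; exact: subset_trans AX XS.
- move=> A B s s' AX BX cA cB gs gs' ss' x ABx.
  have sx : sphere x by apply: XS; case: ABx; [exact: AX|exact: BX].
  have [W3 W3x H3] := near_q sx.
  have sideB : B x -> exists2 W, nbhs x W & forall y, W y -> B y -> agree (q y) (s' y) (s' x).
    by move=> /gs'[].
  have sideA : A x -> exists2 W, nbhs x W & forall y, W y -> A y -> agree (q y) (s y) (s x).
    by move=> /gs[].
  have away (K : set R3) : closed K -> ~ K x -> nbhs x (~` K).
    by move=> cK nK; apply: open_nbhs_nbhs; split=> //; exact: closed_openC.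
  have [Ax|nAx] := pselect (A x).
    rewrite mem_set//; split; first by have [] := gs x Ax.
    have [W1 W1x H1] := sideA Ax; have [Bx|nBx] := pselect (B x).
      have [W2 W2x H2] := sideB Bx; exists (W1 `&` (W2 `&` W3)); first by do 2 apply: filterI => //.
      move=> y [y1 [y2 y3]] ABy; case: ifPn => [/set_mem Ay|/negP nAy]; first exact: H1.
      have By : B y by case: ABy => // Ay; case: nAy; rewrite mem_set.
      have [a3 _] := H3 y y3 (XS _ (BX _ By)).
      by move=> f ff cf; rewrite (H2 y y2 By)// (ss' x)//; exact: a3.
    exists (W1 `&` ~` B); first by apply: filterI => //; exact: away.
    by move=> y [y1 nBy] [Ay|//]; rewrite mem_set//; exact: H1.
  have Bx : B x by case: ABx.
  rewrite memNset//; split; first by have [] := gs' x Bx.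
  have [W2 W2x H2] := sideB Bx; exists (W2 `&` ~` A); first by apply: filterI => //; exact: away.
  by move=> y [y2 nAy] [//|By]; rewrite memNset//; exact: H2.
- split; first by exists (fun _ _ => true) => x [].
  move=> x Xx; have [W Wx HW] := near_q (XS _ Xx); have [s0 E0] := point_eqn_ex (q x).
  exists W => //; exists (fun=> s0) => y [Wy Xy]; split.
    by move=> e ey; apply: E0; have [_ H] := HW y Wy (XS _ Xy); exact: H.
  by exists setT => //; exact: filterT.
Qed.

Lemma sphere_good : exists s, good_on (@sphere R) s.
Proof. exact: sphere_section good_system. Qed.

Lemma q_opp3 x : sphere x -> q (opp3 x) = q x.
Proof. by move=> sx; apply/q_fib => //; [exact: sphere_opp3|right; rewrite opp3E]. Qed.

Lemma q_fib3 x y : sphere x -> sphere y -> q x = q y -> x = y \/ x = opp3 y.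
Proof. by move=> sx sy; rewrite -opp3E => /q_fib; exact. Qed.

Lemma good_opp3 s : good_on (@sphere R) s -> good_on (@sphere R) (fun x => s (opp3 x)).
Proof.
move=> gs x sx; have [E [W Wx H]] := gs _ (sphere_opp3 sx); rewrite q_opp3// in E.
split=> //; have [W' W'x H'] := (within_contP _ _).1 (@opp3_cont R setT) x I W Wx.
exists W' => // y W'y sy; have := H _ (H' y W'y I) (sphere_opp3 sy).
by rewrite q_opp3.
Qed.

(** The quotient map is closed because the sphere is compact, so a neighbourhood of a whole fibre
    contains the preimage of a neighbourhood of [p]. *)
Lemma q_preimage_near p (O : set R3) : (forall x, sphere x -> q x = p -> nbhs x O) ->
  exists2 W, nbhs p W & forall x, sphere x -> W (q x) -> O x.
Proof.
move=> H; pose K := @sphere R `&` ~` O°.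
have cK : compact K.
  by apply: compact_closedI; [exact: sphere_compact|apply: open_closedC; exact: open_interior].
have cq : {within K, continuous q} by apply: continuous_subspaceW q_cont => x [].
have := compact_closed (surface_hausdorff P_surf) (continuous_compact cq cK).
move=> /closed_openC oK; exists (~` (q @` K)).
  apply: open_nbhs_nbhs; split=> // -[x [sx nO] qx]; exact/nO/(H x sx qx).
by move=> x sx nK; apply: interior_subset; apply: contrapT => nO; apply: nK; exists x.
Qed.

(** By invariance the value of [s] on a face [f] at a point of its closure does not depend on the
    preimage chosen. It is locally constant on the closure of [f], which is connected, so it is a
    single sign attached to [f]. *)
Lemma descend s : good_on (@sphere R) s ->
  (forall x, sphere x -> agree (q x) (s x) (s (opp3 x))) ->
  exists s0, forall e, edge_eqn s0 e.
Proof.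
move=> gs sym.
have pre p : exists x, sphere x /\ q x = p.
  have [x sx qx] : (q @` @sphere R) p by rewrite q_onto.
  by exists x.
have [lam lamP] := choice pre.
have lam_eq x f : sphere x -> face f -> closure f (q x) -> s (lam (q x)) f = s x f.
  move=> sx ff cf; have [sl ql] := lamP (q x).
  by have [->//|->] := q_fib3 sl sx ql; rewrite (sym x)//; rewrite q_opp3.
have const f p p' : face f -> closure f p -> closure f p' -> s (lam p) f = s (lam p') f.
  move=> ff cp cp'.
  have cf : connected (closure f).
    by apply: connected_closure; case: ff => y ny ->; exact: component_connected.
  apply/esym; apply: (locally_constant_connected (Q := fun z => s (lam z) f = s (lam p) f) cf _ cp cp') => //.
  move=> z cz; have [sz qz] := lamP z.
  have near x : sphere x -> q x = z -> nbhs x [set y | sphere y -> closure f (q y) -> s y f = s (lam z) f].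
    move=> sx qx; have [_ [W Wx H]] := gs x sx; apply: filterS Wx => y Wy sy cy.
    by rewrite (H y Wy sy)// -qx lam_eq// qx.
  have [W Wz HW] := q_preimage_near near.
  exists W => // y Wy cy; have [sy qy] := lamP y.
  by rewrite (HW (lam y))// ?qy.
(* The sign of [f] is read at a chosen point of [f]; [q (1, 0, 0)] is the default of [xget] for an
   empty set. *)
exists (fun f => s (lam (xget (q (1, 0, 0)) f)) f) => e f g ff fg nfg cf cg.
have inf k : face k -> k (xget (q (1, 0, 0)) k) by move=> [y ny ->]; apply: xgetPex; exists y; exact: connected_component_refl.
rewrite (const f _ _ ff (subset_closure (inf f ff)) cf).
rewrite (const g _ _ fg (subset_closure (inf g fg)) cg).
have [sl ql] := lamP (midp e); have [E _] := gs _ sl; rewrite ql in E.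
by apply: E => //; apply: arc_curve; exact: half01.
Qed.


Section Ring.
Variables (ring : set (set P)) (o : set P -> bool).
Hypothesis ring_face : forall f, ring f -> face f.
Hypothesis o_local : forall v f, ring f -> closure f (vpt Psi v) ->
  exists s, (forall e, v \in ends e -> edge_eqn s e) /\
    forall g, ring g -> closure g (vpt Psi v) -> s g = o g.

Lemma ring_point_eqn p f : ring f -> closure f p ->
  exists2 s, point_eqn p s & forall g, ring g -> closure g p -> s g = o g.
Proof.
move=> rf cf; have [ngp|[v pv]|[e [t t01 pt]]] := point_cases p.
- by exists o => // e /arc_graph.
- subst p; have [s [H1 H2]] := o_local rf cf; exists s => // e /vpt_arc; exact: H1.
- have ep : arc e p by rewrite pt; exact: arc_curve.
  have [v [u [_ eE _ _]]] := edge_ends Psi e.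
  have ve : v \in ends e by rewrite eE !inE eqxx.
  have cv g : face g -> closure g p -> closure g (vpt Psi v).
    move=> fg cg; rewrite pt in cg; apply: (closure_edge P_surf Psi_closed fg t01 cg).
    exact/vpt_arc.
  have [s [H1 H2]] := o_local rf (cv f (ring_face rf) cf).
  exists s; first by move=> e'; rewrite pt => /(interior_arc t01) ->; exact: H1.
  by move=> g rg cg; apply: H2 => //; apply: cv => //; exact: ring_face.
Qed.

Let U := \bigcup_(f in ring) closure f.

(* Over the ring, the value [o] selects one of the two preimages of each point. *)
Lemma ring_lift s (k : R * R -> P) : good_on (@sphere R) s ->
  (forall x, sphere x -> agree (q x) (s x) (flips (s (opp3 x)))) ->
  {within @circle R, continuous k} -> (forall z, circle z -> U (k z)) ->
  exists l : R * R -> R3, {within @circle R, continuous l} /\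
    forall z, circle z -> sphere (l z) /\ q (l z) = k z.
Proof.
move=> gs anti ck kU.
have lift p : exists x, U p -> [/\ sphere x, q x = p & forall f, ring f -> closure f p -> s x f = o f].
  have [x sx qx] : (q @` @sphere R) p by rewrite q_onto.
  have [[f rf cf]|nU] := pselect (U p); last by exists x.
  have [t Et to] := ring_point_eqn rf cf.
  have [Ex _] := gs x sx; rewrite qx in Ex.
  have [E|E] := point_eqn_uniq Ex Et.
    by exists x => _; split=> // g rg cg; rewrite E ?to//; exact: ring_face.
  exists (opp3 x) => _; split; [exact: sphere_opp3|by rewrite q_opp3|].
  move=> g rg cg; have fg := ring_face rg.
  have := anti x sx g fg; rewrite qx E// /flips => /(_ cg) /negb_inj <-.
  exact: to.
have [lam lamP] := choice lift.
exists (fun z => lam (k z)); split; last by move=> z /kU /lamP[].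
apply/within_contP => z cz O Oz.
have [sx qx sox] := lamP _ (kU z cz); set x := lam (k z) in sx qx sox Oz *.
have [_ [W1 W1x H1]] := gs (opp3 x) (sphere_opp3 sx).
(* A lift of a nearby point lies in [O] or near the antipode of [x]. Near the antipode [s] takes the
   flipped values, which the choice by [o] rules out. *)
have near y : sphere y -> q y = k z -> nbhs y (O `|` W1).
  rewrite -qx => sy /(q_fib3 sy sx)[->|->]; first by apply: filterS Oz => t; left.
  by apply: filterS W1x => t; right.
have [W2 W2p H2] := q_preimage_near near.
have [W3 W3p H3] := near_star P_surf Psi_closed (k z).
have [W Wz HW] := (within_contP _ _).1 ck z cz _ (filterI W2p W3p).
exists W => // y Wy cy; have [w2 w3] := HW y Wy cy.
have [sl ql sol] := lamP _ (kU y cy).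
have w2l : W2 (q (lam (k y))) by rewrite ql.
have [//|W1l] := H2 _ sl w2l.
have [f rf cf] := kU y cy; have ff := ring_face rf.
have [a3 _ _] := H3 _ w3.
have := H1 _ W1l sl f ff; rewrite ql sol// => /(_ cf).
have := anti x sx f ff; rewrite qx sox//; last exact: a3.
by move=> /(_ (a3 _ ff cf)) ->; rewrite /flips; case: (s (opp3 x) f).
Qed.

(** As [k] is injective, its lift never meets the antipode of [l z0]. So it slides to [l z0] along
    normalised segments, and the image of this homotopy contracts [k]. *)
Lemma lift_contractible (k : R * R -> P) (l : R * R -> R3) :
  set_inj (@circle R) k -> {within @circle R, continuous l} ->
  (forall z, circle z -> sphere (l z) /\ q (l z) = k z) -> contractible k.
Proof.
move=> ik cl lP; pose z0 : R * R := (1, 0).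
have cz0 : circle z0 by rewrite /circle /=; lra.
have [s0 q0] := lP z0 cz0.
have ne z : circle z -> l z <> opp3 (l z0).
  move=> cz E; have [sz qz] := lP z cz.
  have : k z = k z0 by rewrite -qz E q_opp3.
  move=> /(ik _ _ (mem_set cz) (mem_set cz0)) zz0; subst z.
  exact: opp3_neq s0 E.
pose slide (h : R * (R * R)) : R3 := ((1 - h.1) * (l h.2).1.1 + h.1 * (l z0).1.1,
  (1 - h.1) * (l h.2).1.2 + h.1 * (l z0).1.2, (1 - h.1) * (l h.2).2 + h.1 * (l z0).2).
have slide0 h : (@unit_interval R `*` @circle R) h ->
    0 < (slide h).1.1 ^+ 2 + (slide h).1.2 ^+ 2 + (slide h).2 ^+ 2.
  move=> [h1 h2]; apply: sphere_slide_neq0 => //; [exact: (lP _ h2).1|exact: ne].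
exists (k z0), (fun h => q (normalize3 (slide h))); split=> //.
- apply: (@within_comp _ _ _ _ (@sphere R) (fun h => normalize3 (slide h)) q) => //.
    apply: (@within_comp _ _ _ _ [set v : R3 | 0 < v.1.1 ^+ 2 + v.1.2 ^+ 2 + v.2 ^+ 2] slide) => //.
      have cl2 : {within @unit_interval R `*` @circle R, continuous (fun h => l h.2)}.
        by apply: (@within_comp _ _ _ _ (@circle R) snd l) => //; [exact: wc_snd0|move=> h []].
      by rewrite /slide; wcont.
    exact: normalize3_cont.
  by move=> h /slide0; exact: normalize3_sphere.
- move=> p cp; have [sp qp] := lP p cp; rewrite -qp; congr q.
  have -> : slide (0, p) = l p.
    by rewrite /slide /= subr0 !mul1r !mul0r !addr0; case: (l p) => [[]].
  exact: normalize3_id.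
- move=> p cp; rewrite -q0; congr q.
  have -> : slide (1, p) = l z0.
    by rewrite /slide /= subrr !mul1r !mul0r !add0r; case: (l z0) => [[]].
  exact: normalize3_id.
Qed.

End Ring.

End Monodromy.

(* A two-valued local system that has a section over a set of faces carrying a
   noncontractible simple closed curve is trivial: its pullback to the sphere is,
   and if it were not, it would be isomorphic to the double cover by the sphere,
   so that the section would lift the curve. *)
Lemma global_section (R : realType) (G : mgraph) (P : topologicalType) (Psi : embedding R G P)
    (P_proj : projective_plane R P) (Psi_closed : closed_2cell_embedding Psi)
    (no_isolated : forall v : vert G, exists e : edge G, v \in ends e)
    (c : edge G -> bool) (ring : set (set P)) (o : set P -> bool) (k : R * R -> P) :
  (forall v : vert G, exists s, forall e, v \in ends e -> edge_eqn Psi c s e) ->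
  (forall f, ring f -> face Psi f) ->
  (forall v f, ring f -> closure f (vpt Psi v) ->
    exists s, (forall e, v \in ends e -> edge_eqn Psi c s e) /\
      forall g, ring g -> closure g (vpt Psi v) -> s g = o g) ->
  simple_closed_curve k -> k @` @circle R `<=` \bigcup_(f in ring) closure f ->
  ~ contractible k ->
  exists s, forall e, edge_eqn Psi c s e.
Proof.
move=> cloc rf oloc [ck ik] kU nk.
have [_ [q [q_onto q_fib q_top]]] := P_proj.
have q_cont : {within @sphere R, continuous q}.
  by apply/continuousP => O /q_top.
have [s gs] := sphere_good P_proj Psi_closed no_isolated cloc q_cont.
have gs' := good_opp3 q_fib gs.
have [H|H] := good_uniq P_proj Psi_closed no_isolated q_cont (fun _ h => h) (@sphere_connected R) gs gs'.
  exact: (descend P_proj q_onto q_fib q_cont gs).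
exfalso; apply: nk.
have kU' z : circle z -> (\bigcup_(f in ring) closure f) (k z) by move=> cz; apply: kU; exists z.
have [l [cl lP]] := ring_lift P_proj Psi_closed no_isolated q_onto q_fib q_cont rf oloc gs H ck kU'.
exact: (lift_contractible q_fib q_cont ik cl lP).
Qed.

(** * Darts *)

Section BoolSums.
Variable I : finType.

Lemma addb_sum_two (A : pred I) (F : I -> bool) a b : a != b ->
  (forall i, A i = (i == a) || (i == b)) -> \big[addb/false]_(i | A i) F i = F a (+) F b.
Proof.
move=> ab AE; rewrite (bigD1 a) ?AE ?eqxx//=; congr (_ (+) _).
rewrite (bigD1 b) /=; last by rewrite AE eqxx orbT eq_sym ab.
rewrite big1 ?addbF// => i /andP[/andP[]]; rewrite AE.
by case: (i == a) => //=; case: (i == b).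
Qed.

(** Toggling the value at [i0] is an involution that exchanges [S] with its complement. *)
Lemma even_functions_card (i0 : I) (S : {set {ffun I -> bool}}) :
  (forall s : {ffun I -> bool}, (([ffun i => s i (+) (i == i0)] : {ffun I -> bool}) \in S) = (s \notin S)) ->
  (#|S|.*2 = 2 ^ #|I|)%N.
Proof.
move=> H; pose fl (s : {ffun I -> bool}) : {ffun I -> bool} := [ffun i => s i (+) (i == i0)].
have flK : involutive fl by move=> s; apply/ffunP => i; rewrite !ffunE -addbA addbb addbF.
have E : (fl @: S)%SET = (~: S)%SET.
  apply/setP => s; rewrite inE; apply/imsetP/idP => [[t tS ->]|sS].
    by rewrite -H -/(fl (fl t)) flK tS.
  by exists (fl s); rewrite ?flK// H.
rewrite -addnn -{2}(card_imset S (inv_inj flK)) E cardsC.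
by rewrite card_ffun card_bool.
Qed.

End BoolSums.

Lemma cycle_card (E F : finType) (inc : F -> E -> bool) :
  (forall e, exists f g, f != g /\ forall k, inc k e = (k == f) || (k == g)) ->
  (forall f, exists a b, a != b /\ forall e, inc f e = (e == a) || (e == b)) ->
  #|E| = #|F|.
Proof.
move=> twoF twoE.
have card2 (T : finType) (A : pred T) a b : a != b -> (forall t, A t = (t == a) || (t == b)) -> #|A| = 2.
  by move=> ab H; rewrite (eq_card (B := pred2 a b)) ?card2 ?ab// => t; rewrite !inE H.
have h1 : (\sum_(e : E) \sum_(f : F | inc f e) 1 = #|E|.*2)%N.
    rewrite (eq_bigr (fun=> 2)) ?sum_nat_const ?muln2// => e _.
    by have [f [g [fg H]]] := twoF e; rewrite sum1_card (card2 _ _ _ _ fg).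
have h2 : (\sum_(f : F) \sum_(e : E | inc f e) 1 = #|F|.*2)%N.
    rewrite (eq_bigr (fun=> 2)) ?sum_nat_const ?muln2// => f _.
    by have [a [b [ab H]]] := twoE f; rewrite sum1_card (card2 _ _ _ _ ab).
apply: double_inj; rewrite -h1 -h2.
under eq_bigr do rewrite big_mkcond; rewrite exchange_big /=.
by under [RHS]eq_bigr do rewrite big_mkcond.
Qed.

(* A right-hand side with even sum on the edges of a cycle (a connected 2-regular
   incidence structure) is a coboundary: both sets have 2 ^ (n - 1) elements. *)
Lemma cycle_solvable (E F : finType) (inc : F -> E -> bool) (c : E -> bool) :
  (forall e, exists f g, f != g /\ forall k, inc k e = (k == f) || (k == g)) ->
  (forall f, exists a b, a != b /\ forall e, inc f e = (e == a) || (e == b)) ->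
  (forall Z : pred F, (exists f, Z f) ->
     (forall f g e, inc f e -> inc g e -> Z f -> Z g) -> forall g, Z g) ->
  \big[addb/false]_e c e = false ->
  exists s : F -> bool, forall e f g, f != g -> inc f e -> inc g e -> s f (+) s g = c e.
Proof.
move=> twoF twoE conn cE.
have [e0 _|E0] := pickP (@predT E); last by exists xpredT => e; have := E0 e.
have [f0 [_ [_ _]]] := twoF e0.
pose d (s : {ffun F -> bool}) : {ffun E -> bool} := [ffun e => \big[addb/false]_(f | inc f e) s f].
have dE s e f g : f != g -> inc f e -> inc g e -> d s e = s f (+) s g.
  move=> fg fe ge; have [a [b [ab H]]] := twoF e; rewrite ffunE (addb_sum_two _ ab H).
  by move: fe ge fg; rewrite !H => /orP[]/eqP-> /orP[]/eqP->; rewrite ?eqxx// addbC.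
(* By connectedness the kernel of the coboundary [d] consists of the constants; prescribing the
   value at [f0] makes [d] injective. *)
pose S := [set s : {ffun F -> bool} | ~~ s f0]%SET.
pose Ev := [set c : {ffun E -> bool} | ~~ \big[addb/false]_e c e]%SET.
have cardS : (#|S|.*2 = 2 ^ #|F|)%N.
  by apply: (@even_functions_card _ f0) => s; rewrite !inE ffunE eqxx addbT.
have cardEv : (#|Ev|.*2 = 2 ^ #|E|)%N.
  apply: (@even_functions_card _ e0) => s; rewrite !inE.
  under eq_bigr do rewrite ffunE.
  have one : \big[addb/false]_i (i == e0) = true by rewrite (bigD1 e0)//= eqxx big1// => i /negbTE.
  by rewrite big_split /= one addbT negbK.
have EF : #|E| = #|F| := cycle_card twoF twoE.
have dS : (d @: S \subset Ev)%SET.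
  apply/fintype.subsetP => _ /imsetP[s _ ->]; rewrite inE.
  under eq_bigr do rewrite ffunE big_mkcond; rewrite exchange_big /= big1// => f _.
  rewrite -big_mkcond; have [a [b [ab H]]] := twoE f.
  by rewrite (addb_sum_two _ ab H) addbb.
have dinj : {in S &, injective d}.
  move=> s t; rewrite !inE => /negbTE sf0 /negbTE tf0 st; apply/ffunP => f.
  apply/eqP; apply: (conn (fun f => s f == t f)); first by exists f0; rewrite sf0 tf0.
  move=> k g e ke ge /eqP kk; have [<-|kg] := eqVneq k g; first exact/eqP.
  have := dE s e k g kg ke ge; rewrite st (dE t e k g kg ke ge) kk => /addbI ->.
  by [].
have dEv : (d @: S)%SET = Ev.
  apply/eqP; rewrite eqEcard dS card_in_imset//.
  by rewrite /= -leq_double cardS cardEv EF.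
have : [ffun e => c e] \in (d @: S)%SET.
  by rewrite dEv inE; under eq_bigr do rewrite ffunE; rewrite cE.
by move=> /imsetP[s _ sc]; exists s => e f g fg fe ge; rewrite -(dE s e f g)// -sc ffunE.
Qed.

Section Darts.
Variable G : mgraph.

Definition dart := (edge G * bool)%type.

Lemma edge_pair (e : edge G) : {p : vert G * vert G | p.1 != p.2 /\ ends e = [set p.1; p.2]%SET}.
Proof.
apply: cid; have /cards2P[u [v [uv E]]] : #|ends e| == 2%N by rewrite card_ends.
by exists (u, v).
Qed.

Definition tail (d : dart) : vert G :=
  let p := sval (edge_pair d.1) in if d.2 then p.2 else p.1.
Definition rdart (d : dart) : dart := (d.1, ~~ d.2).
Definition head (d : dart) : vert G := tail (rdart d).

Lemma rdartK : involutive rdart. Proof. by case=> e b; rewrite /rdart /= negbK. Qed.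

Lemma tail_rdart d : tail (rdart d) = head d. Proof. by []. Qed.
Lemma head_rdart d : head (rdart d) = tail d. Proof. by rewrite /head rdartK. Qed.

Lemma ends_dart (d : dart) : ends d.1 = [set tail d; head d]%SET.
Proof.
case: d => e b; rewrite /head /tail /=; case: (edge_pair e) => p /= [_ ->].
by case: b => //=; rewrite finset.setUC.
Qed.

Lemma tail_head (d : dart) : tail d != head d.
Proof.
case: d => e b; rewrite /head /tail /=; case: (edge_pair e) => p /= [h _].
by case: b => //=; rewrite eq_sym.
Qed.

Lemma tail_ends d : tail d \in ends d.1. Proof. by rewrite ends_dart !inE eqxx. Qed.
Lemma head_ends d : head d \in ends d.1. Proof. by rewrite ends_dart !inE eqxx orbT. Qed.

Lemma dart_of (e : edge G) v : v \in ends e -> exists2 d : dart, d.1 = e & tail d = v.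
Proof.
have := ends_dart (e, false); rewrite /= => -> ; rewrite !inE => /orP[]/eqP ->.
  by exists (e, false).
by exists (rdart (e, false)).
Qed.

Lemma dart_eq (d d' : dart) : d.1 = d'.1 -> d = d' \/ d = rdart d'.
Proof.
case: d d' => e b [e' b'] /= <-; rewrite /rdart /=.
by case: b b' => [] []; [left|right|right|left].
Qed.

Lemma dart_tail_eq (d d' : dart) : d.1 = d'.1 -> tail d = tail d' -> d = d'.
Proof.
by move=> /dart_eq[//|->]; rewrite tail_rdart => h; have := tail_head d'; rewrite h eqxx.
Qed.

End Darts.

(** * Facial cycles *)

Section Facial.
Variables (G : mgraph) (F : finType) (A : F -> {set dart G}).
Local Notation dart := (dart G).

Definition vin f v := [exists d, (d \in A f) && (tail d == v)].
Definition ein f e := [exists d, (d \in A f) && (d.1 == e)].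

(** [A f] is the boundary of [f] traversed in an arbitrary direction, as a set of darts. The axioms
    are local: they do not force [A f] to be a single cycle. *)
Record facial : Prop := Facial {
  f_next : forall f d, d \in A f -> exists2 d', d' \in A f & tail d' = head d;
  f_prev : forall f d, d \in A f -> exists2 d', d' \in A f & head d' = tail d;
  f_tail : forall f d d', d \in A f -> d' \in A f -> tail d = tail d' -> d = d';
  f_head : forall f d d', d \in A f -> d' \in A f -> head d = head d' -> d = d';
  f_rdart : forall f d, d \in A f -> rdart d \notin A f;
  f_two : forall e, exists f g, f != g /\ forall k, ein k e = (k == f) || (k == g);
  f_link : forall v (Z : F -> Prop), (exists f, vin f v /\ Z f) ->
    (forall f g e, v \in ends e -> ein f e -> ein g e -> Z f -> Z g) ->
    forall g, vin g v -> Z g }.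

Hypothesis FA : facial.

(** The facial cycles reoriented by [s], which marks the faces to be reversed. *)
Definition As (s : F -> bool) f (d : dart) := (if s f then rdart d else d) \in A f.

Lemma einP f d : reflect (d \in A f \/ rdart d \in A f) (ein f d.1).
Proof.
apply: (iffP existsP) => [[d' /andP[d'A /eqP /dart_eq[<-|]]]|[dA|dA]].
- by left.
- by move=> dE; right; rewrite -dE.
- by exists d; rewrite dA eqxx.
- by exists (rdart d); rewrite dA eqxx.
Qed.

Lemma As_rdart s f d : ein f d.1 -> As s f (rdart d) = ~~ As s f d.
Proof.
move=> /einP[] dA; rewrite /As rdartK; case: (s f); have := f_rdart FA dA; rewrite ?rdartK dA;
by case: (_ \in _).
Qed.

Lemma AsE s f d : ein f d.1 -> As s f d = (d \in A f) (+) s f.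
Proof.
by move=> /(@As_rdart (fun=> false) f d); rewrite /As; case: (s f) => [->|_]; rewrite ?addbT ?addbF.
Qed.

Lemma As_ein s f d : As s f d -> ein f d.1.
Proof. by move=> H; apply/einP; move: H; rewrite /As; case: (s f); [right|left]. Qed.

Lemma As_irr s f d : As s f d -> ~~ As s f (rdart d).
Proof. by move=> H; rewrite As_rdart ?H//; exact: As_ein H. Qed.

Lemma As_next s f d : As s f d -> exists2 d', As s f d' & tail d' = head d.
Proof.
rewrite /As; case: (s f) => [/(f_prev FA)[d' dA' h]|/(f_next FA)[d' dA' h]]; last by exists d'.
by exists (rdart d'); rewrite ?rdartK// tail_rdart h.
Qed.

Lemma As_prev s f d : As s f d -> exists2 d', As s f d' & head d' = tail d.
Proof.
rewrite /As; case: (s f) => [/(f_next FA)[d' dA' h]|/(f_prev FA)[d' dA' h]]; last by exists d'.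
by exists (rdart d'); rewrite ?rdartK// head_rdart h head_rdart.
Qed.

Lemma As_tail s f d d' : As s f d -> As s f d' -> tail d = tail d' -> d = d'.
Proof.
rewrite /As; case: (s f) => h1 h2 h; last exact: (f_tail FA h1 h2 h).
by apply: (inv_inj (@rdartK G)); apply: (f_head FA h1 h2); rewrite !head_rdart.
Qed.

Lemma As_head s f d d' : As s f d -> As s f d' -> head d = head d' -> d = d'.
Proof.
rewrite /As; case: (s f) => h1 h2 h; last exact: (f_head FA h1 h2 h).
by apply: (inv_inj (@rdartK G)); apply: (f_tail FA h1 h2); rewrite !tail_rdart.
Qed.

Lemma As_ext s s' f d : s f = s' f -> As s f d = As s' f d.
Proof. by rewrite /As => ->. Qed.

Lemma As_vin s f d : As s f d -> vin f (tail d).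
Proof.
rewrite /As; case: (s f) => dA; last by apply/existsP; exists d; rewrite dA eqxx.
have [d' dA' h] := f_next FA dA; apply/existsP; exists d'.
by rewrite dA' h head_rdart eqxx.
Qed.

Lemma As_vin_head s f d : As s f d -> vin f (head d).
Proof. by move=> /As_next[d' /As_vin + <-]. Qed.

Lemma ein_vin f e v : ein f e -> v \in ends e -> vin f v.
Proof.
move=> /existsP[d /andP[dA /eqP <-]]; rewrite ends_dart !inE.
have dA' : As (fun=> false) f d by [].
by move=> /orP[]/eqP ->; [exact: As_vin dA'|exact: As_vin_head dA'].
Qed.

Lemma vin_darts s f v : vin f v -> exists a b, [/\ As s f a, head a = v, As s f b, tail b = v &
  a.1 != b.1 /\ forall e, v \in ends e -> ein f e = (e == a.1) || (e == b.1)].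
Proof.
move=> /existsP[d /andP[dA /eqP dv]].
have [b bA bv] : exists2 b, As s f b & tail b = v.
  rewrite /As; case E : (s f); last by exists d.
  have [d' dA' h] := f_prev FA dA; exists (rdart d'); rewrite ?rdartK//.
  by rewrite tail_rdart h.
have [a aA av] := As_prev bA; rewrite bv in av.
have ab : a.1 != b.1.
  apply/eqP => /dart_eq[] E; first by have := tail_head b; rewrite bv -av E eqxx.
  by have := As_irr bA; rewrite -E aA.
exists a, b; split=> //; split=> // e ve.
apply/idP/orP => [|[]/eqP->]; [|exact: As_ein aA|exact: As_ein bA].
have [c cE cv] := dart_of ve; rewrite -cE => ec.
have [cA|] := boolP (As s f c); first by right; rewrite (As_tail cA bA) ?bv ?cv.
rewrite -As_rdart// => cA; left.
by rewrite -(As_head cA aA) ?av ?head_rdart.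
Qed.

(** If [k e] is false the two faces at [e] run along it in opposite directions, as in an oriented
    surface; if it is true they run in the same direction. *)
Definition coherent (k : edge G -> bool) (s : F -> bool) (e : edge G) : Prop :=
  forall f g d, f != g -> d.1 = e -> ein f e -> ein g e -> As s f d (+) As s g d = ~~ k e.

Lemma coherentP k s e f g d : f != g -> d.1 = e -> ein f e -> ein g e ->
  As s f d (+) As s g d = ~~ k e -> coherent k s e.
Proof.
move=> fg de fe ge H f' g' d' fg' de' fe' ge'.
have {}H : forall d', d'.1 = e -> As s f d' (+) As s g d' = ~~ k e.
  move=> c ce; have [->//|->] := dart_eq (etrans ce (esym de)).
  by rewrite !As_rdart ?de// addbN addNb negbK.
have [a [b [ab two]]] := f_two FA e.
move: fe ge fe' ge' fg fg' H; rewrite !two.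
by move=> /orP[]/eqP-> /orP[]/eqP-> /orP[]/eqP-> /orP[]/eqP->; rewrite ?eqxx// => _ _ H;
  rewrite ?H// addbC H.
Qed.

Lemma coherent_flip k s e : coherent k s e -> coherent k (fun f => ~~ s f) e.
Proof.
move=> H f g d fg de fe ge; have := H f g d fg de fe ge.
by rewrite !AsE ?de// !addbN addNb negbK.
Qed.

Lemma coherent_uniq k s s' v : (forall e, v \in ends e -> coherent k s e) ->
  (forall e, v \in ends e -> coherent k s' e) ->
  forall f g, vin f v -> vin g v -> s f (+) s' f = s g (+) s' g.
Proof.
move=> H H' f g fv gv; apply/esym.
apply: (f_link FA (v := v) (Z := fun g => s g (+) s' g = s f (+) s' f)) => //; first by exists f.
move=> f1 g1 e ve fe ge <-; have [->//|fg] := eqVneq f1 g1.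
have [d de _] := dart_of ve.
have := H e ve f1 g1 d fg de fe ge; have := H' e ve f1 g1 d fg de fe ge.
rewrite !AsE ?de//.
by case: (s f1) (s g1) (s' f1) (s' g1) (d \in _) (d \in _) (k e) => [] [] [] [] [] [] [].
Qed.

(** The faces and edges at [v] form a cycle, so only the parity of the right-hand side matters.
    Every face leaves [v] along exactly one of its two edges there; the traversal terms thus sum to
    the number of faces, which equals the number of edges and cancels the negations of [k]. *)
Lemma local_solution k v : \big[addb/false]_(e | v \in ends e) k e = false ->
  exists s, forall e, v \in ends e -> coherent k s e.
Proof.
move=> keven; pose E := {e : edge G | v \in ends e}; pose F' := {f : F | vin f v}.
pose inc (f : F') (e : E) := ein (val f) (val e).
have [od odP] : exists od : E -> dart, forall e, (od e).1 = val e /\ tail (od e) = v.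
  have H (e : E) : exists d : dart, d.1 = val e /\ tail d = v.
    by have [d d1 d2] := dart_of (valP e); exists d.
  by have [od odP] := choice H; exists od.
pose x (f : F') (e : E) := od e \in A (val f).
pose c e := ~~ k (val e) (+) \big[addb/false]_(f | inc f e) x f e.
have twoF e : exists f g, f != g /\ forall h, inc h e = (h == f) || (h == g).
  have [f [g [fg H]]] := f_two FA (val e).
  have fv : vin f v by apply: (ein_vin _ (valP e)); rewrite H eqxx.
  have gv : vin g v by apply: (ein_vin _ (valP e)); rewrite H eqxx orbT.
  by exists (exist _ f fv), (exist _ g gv); split=> // h; rewrite /inc H.
have twoE f : exists a b, a != b /\ forall e, inc f e = (e == a) || (e == b).
  have [a [b [aA av bA bv [ab H]]]] := vin_darts (fun=> false) (valP f).
  have va : v \in ends a.1 by rewrite -av head_ends.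
  have vb : v \in ends b.1 by rewrite -bv tail_ends.
  by exists (exist _ a.1 va), (exist _ b.1 vb); split=> // e; rewrite /inc H ?(valP e).
have conn (Z : pred F') : (exists f, Z f) ->
     (forall f g e, inc f e -> inc g e -> Z f -> Z g) -> forall g, Z g.
  move=> [f Zf] step g.
  pose Z' f := exists2 f' : F', val f' = f & Z f'.
  have : Z' (val g); last by move=> [g' /val_inj <-].
  apply: (f_link FA (v := v) (Z := Z') _ _ (valP g)).
    by exists (val f); split; [exact: (valP f)|exists f].
  move=> f1 g1 e ve fe ge [f' fE Zf'].
  exists (exist _ g1 (ein_vin ge ve)) => //.
  by apply: (step f' _ (exist _ e ve)) => //; rewrite /inc /= fE.
have cE : \big[addb/false]_e c e = false.
  rewrite big_split /=.
  have -> : \big[addb/false]_(e : E) \big[addb/false]_(f | inc f e) x f e =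
      \big[addb/false]_(f : F') true.
    under eq_bigr do rewrite big_mkcond; rewrite exchange_big /=; apply: eq_bigr => f _.
    rewrite -big_mkcond; have [a [b [aA av bA bv [ab H]]]] := vin_darts (fun=> false) (valP f).
    have va : v \in ends a.1 by rewrite -av head_ends.
    have vb : v \in ends b.1 by rewrite -bv tail_ends.
    rewrite (@addb_sum_two _ _ _ (exist _ a.1 va) (exist _ b.1 vb)); last first.
    - by move=> e; rewrite /inc H ?(valP e).
    - by [].
    have -> : x f (exist _ b.1 vb) = true.
      rewrite /x; have [h1 h2] := odP (exist _ b.1 vb).
      by rewrite (_ : od _ = b) //; apply: dart_tail_eq; rewrite ?h2.
    have -> : x f (exist _ a.1 va) = false; last by [].
    rewrite /x; have [h1 h2] := odP (exist _ a.1 va).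
    rewrite (_ : od _ = rdart a); last by apply: dart_tail_eq; rewrite ?h2 ?tail_rdart.
    by apply/negbTE; exact: f_rdart FA _ _ aA.
  have -> : \big[addb/false]_(e : E) ~~ k (val e) =
      \big[addb/false]_(e : E) true (+) \big[addb/false]_(e : E) k (val e).
    by rewrite -big_split; apply: eq_bigr => e _.
  have -> : \big[addb/false]_(e : E) k (val e) = false.
    transitivity (\big[addb/false]_(e | v \in ends e) k e); last exact: keven.
    rewrite [RHS](reindex_omap (val : E -> edge G) insub); last first.
      by move=> e ve; rewrite insubT.
    by apply: eq_bigl => e; rewrite (valP e) valK eqxx.
  have par (T : finType) : \big[addb/false]_(t : T) true = odd #|T|.
    by rewrite big_const; elim: #|T| => //= n ->.
  by rewrite !par (cycle_card twoF twoE) addbF addbb.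
have [s sP] := cycle_solvable twoF twoE conn cE.
exists (fun f => if insub f is Some f' then s f' else false) => e ve.
have [f [g [fg H]]] := twoF (exist _ e ve).
have fe : inc f (exist _ e ve) by rewrite H eqxx.
have ge : inc g (exist _ e ve) by rewrite H eqxx orbT.
have [h1 h2] := odP (exist _ e ve).
apply: (@coherentP _ _ _ (val f) (val g) (od (exist _ e ve))) => //.
rewrite !AsE ?h1// !valK.
have := sP _ _ _ fg fe ge; rewrite /c (addb_sum_two _ fg H) /x.
by case: (s f) (s g) (k _) (_ \in _) (_ \in _) => [] [] [] [] [].
Qed.

(* Double counting of the incidences between the faces in [Z] and the edges at [v]. *)
Lemma boundary_parity (t : F -> bool) v (Z : pred F) (d1 d2 : dart) f1 f2 :
  (forall e, v \in ends e -> coherent (fun=> false) t e) ->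
  (forall f, Z f -> vin f v) ->
  tail d1 = v -> tail d2 = v -> d1 != d2 -> ein f1 d1.1 -> ein f2 d2.1 -> ~~ Z f1 -> ~~ Z f2 ->
  (forall e f g, v \in ends e -> f != g -> ein f e -> ein g e ->
     Z f (+) Z g = (e == d1.1) || (e == d2.1)) ->
  As t f1 d1 (+) As t f2 d2 = true.
Proof.
move=> tcoh Zv d1v d2v d12 f1e f2e nZ1 nZ2 bd.
pose E := {e : edge G | v \in ends e}.
have [od odP] : exists od : E -> dart, forall e, (od e).1 = val e /\ tail (od e) = v.
  have H (e : E) : exists d : dart, d.1 = val e /\ tail d = v.
    by have [d h1 h2] := dart_of (valP e); exists d.
  by have [od odP] := choice H; exists od.
have v1 : v \in ends d1.1 by rewrite -d1v tail_ends.
have v2 : v \in ends d2.1 by rewrite -d2v tail_ends.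
pose e1 : E := exist _ d1.1 v1; pose e2 : E := exist _ d2.1 v2.
have od1 : od e1 = d1 by have [h1 h2] := odP e1; apply: dart_tail_eq; rewrite ?h2.
have od2 : od e2 = d2 by have [h1 h2] := odP e2; apply: dart_tail_eq; rewrite ?h2.
have e12 : e1 != e2 by apply: contra_neq d12 => E12; rewrite -od1 -od2 E12.
pose inn (e : E) := [exists f, Z f && ein f (val e)].
have two (e : E) : exists f g, f != g /\ forall h, ein h (val e) = (h == f) || (h == g).
  exact: f_two FA (val e).
have faceE f : Z f -> exists a b : E, [/\ a != b, forall e : E, ein f (val e) = (e == a) || (e == b),
    As t f (od a) = false & As t f (od b) = true].
  move=> /Zv /(vin_darts t)[a [b [aA av bA bv [ab H]]]].
  have va : v \in ends a.1 by rewrite -av head_ends.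
  have vb : v \in ends b.1 by rewrite -bv tail_ends.
  exists (exist _ a.1 va), (exist _ b.1 vb); split=> //.
  - by move=> e; rewrite H ?(valP e).
  - have [h1 h2] := odP (exist _ a.1 va).
    rewrite (_ : od _ = rdart a); last by apply: dart_tail_eq; rewrite ?h2 ?tail_rdart.
    by apply/negbTE; exact: As_irr aA.
  - have [h1 h2] := odP (exist _ b.1 vb).
    by rewrite (_ : od _ = b) //; apply: dart_tail_eq; rewrite ?h2.
(* Counted by faces: of the two darts at [v] on edges of a face in [Z], exactly one follows its
   orientation out of [v]. *)
have xorE : \big[addb/false]_(f | Z f) true =
    \big[addb/false]_(e : E) \big[addb/false]_(f | Z f && ein f (val e)) As t f (od e).
  under [RHS]eq_bigr do rewrite big_mkcondr.
  rewrite exchange_big /=; apply: eq_bigr => f Zf; rewrite -big_mkcond.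
  by have [a [b [ab H aF bT]]] := faceE f Zf; rewrite (addb_sum_two _ ab H) aF bT.
(* Counted by edges: an edge between two faces of [Z] contributes 1 by coherence, and a boundary
   edge contributes the opposite of what its face outside [Z] would. *)
have edgeX (e : E) : \big[addb/false]_(f | Z f && ein f (val e)) As t f (od e) =
    inn e (+) ((e == e1) && As t f1 d1) (+) ((e == e2) && As t f2 d2).
  have [f [g [fg H]]] := two e; have [h1 h2] := odP e.
  have fe : ein f (val e) by rewrite H eqxx.
  have ge : ein g (val e) by rewrite H eqxx orbT.
  have co := tcoh _ (valP e) f g (od e) fg h1 fe ge.
  have B := bd _ f g (valP e) fg fe ge.
  have nZco h h' d : d.1 = val e -> h != h' -> ein h (val e) -> ein h' (val e) -> As t h d = ~~ As t h' d.
    move=> de hh he he'; have := tcoh _ (valP e) h h' d hh de he he'.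
    by case: (As t h d) (As t h' d) => [] [].
  rewrite big_mkcondl (addb_sum_two _ fg H).
  have innE : inn e = Z f || Z g.
    apply/existsP/orP => [[h /andP[Zh]]|[] Zh]; [|by exists f; rewrite Zh|by exists g; rewrite Zh].
    by rewrite H => /orP[]/eqP<-; [left|right].
  have e1E : (val e == d1.1) = (e == e1) by [].
  have e2E : (val e == d2.1) = (e == e2) by [].
  rewrite e1E e2E in B.
  have case1 (k : F) : ein k (val e) -> ~~ Z k -> Z f (+) Z g = true ->
      (if Z f then As t f (od e) else false) (+) (if Z g then As t g (od e) else false)
        = true (+) As t k (od e).
    have fgE := nZco f g _ h1 fg fe ge.
    rewrite H => /orP[]/eqP -> /negbTE ->; rewrite ?addFb ?addbF => ->; last by rewrite fgE addTb.
    by rewrite fgE addTb negbK.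
  have [ee1|ne1] := eqVneq e e1.
    have ne2 : (e == e2) = false by rewrite ee1; apply/negbTE.
    have ZZ : Z f (+) Z g = true by rewrite B ee1 eqxx.
    rewrite ne2 andFb addbF innE (case1 f1)//; last by rewrite ee1.
    by rewrite ee1 od1; move: ZZ; case: (Z f) (Z g) => [] [].
  have [ee2|ne2] := eqVneq e e2.
    have ZZ : Z f (+) Z g = true by rewrite B ee2 eqxx orbT.
    rewrite andFb addbF innE (case1 f2)//; last by rewrite ee2.
    by rewrite ee2 od2; move: ZZ; case: (Z f) (Z g) => [] [].
  rewrite !andFb !addbF innE; move: B; rewrite (negbTE ne1) (negbTE ne2) /=.
  by move: co; case: (Z f) (Z g) => [] [] //=; case: (As _ _ _) (As _ _ _) => [] [].
(* The edges at [v] met by [Z] outnumber its faces by exactly one; this is the source of the odd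
   parity. *)
have cnt : (\sum_(f | Z f) 2 + 2 = (\sum_(e : E) inn e).*2)%N.
  have edgeN (e : E) : (\sum_(f | Z f && ein f (val e)) 1 + ((e == e1) + (e == e2)) = (inn e).*2)%N.
    have [f [g [fg H]]] := two e.
    have fe : ein f (val e) by rewrite H eqxx.
    have ge : ein g (val e) by rewrite H eqxx orbT.
    have B := bd _ f g (valP e) fg fe ge.
    have innE : inn e = Z f || Z g.
      apply/existsP/orP => [[h /andP[Zh]]|[] Zh]; [|by exists f; rewrite Zh|by exists g; rewrite Zh].
      by rewrite H => /orP[]/eqP<-; [left|right].
    have e1E : (val e == d1.1) = (e == e1) by [].
    have e2E : (val e == d2.1) = (e == e2) by [].
    rewrite e1E e2E in B.
    have -> : (\sum_(h | Z h && ein h (val e)) 1 = Z f + Z g)%N.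
      rewrite big_mkcondl (bigD1 f) //= (bigD1 g) ?ge 1?eq_sym//= big1; last first.
        by move=> h; rewrite H; case: (h == f) => //=; case: (h == g).
      by case: (Z f) (Z g) => [] [].
    have : ~~ ((e == e1) && (e == e2)).
      by apply/negP => /andP[/eqP -> /eqP E12]; move: e12; rewrite E12 eqxx.
    by move: B; rewrite innE; case: (Z f) (Z g) (e == e1) (e == e2) => [] [] [] [].
  rewrite -muln2 big_distrl /=; under [RHS]eq_bigr do rewrite muln2 -edgeN.
  rewrite big_split /= big_split /=; congr (_ + _)%N; last first.
    have one (e0 : E) : (\sum_(e : E) (e == e0) = 1)%N.
      by rewrite (bigD1 e0)//= eqxx big1// => e /negbTE ->.
    by rewrite !one.
  under [RHS]eq_bigr do rewrite big_mkcondr.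
  rewrite exchange_big /=; apply: eq_bigr => f Zf.
  have [a [b [ab H _ _]]] := faceE f Zf.
  rewrite (bigD1 a) ?H ?eqxx//= (bigD1 b) ?H ?eqxx ?orbT 1?eq_sym//= big1 ?addn0//.
  by move=> e; rewrite H; case: (e == a) => //=; case: (e == b).
have parE (T : finType) (Q : pred T) : \big[addb/false]_(i | Q i) true = odd (\sum_(i | Q i) 1).
  by apply: (big_ind2 (fun x y => x = odd y)) => // x1 x2 y1 y2 -> ->; rewrite oddD.
have parE2 : \big[addb/false]_(e : E) inn e = odd (\sum_(e : E) inn e).
  by apply: (big_ind2 (fun x y => x = odd y)) => [|x1 x2 y1 y2 -> ->|e _]; rewrite ?oddD//; case: (inn e).
move: xorE; under [RHS]eq_bigr do rewrite edgeX.
rewrite !big_split /= parE parE2.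
have pick1 (e0 : E) (x : bool) : \big[addb/false]_(e : E) ((e == e0) && x) = x.
  by rewrite (bigD1 e0)//= eqxx big1 ?addbF// => e /negbTE ->.
rewrite !pick1.
have : (\sum_(f | Z f) 1).+1 = (\sum_(e : E) inn e)%N.
  have h2 : (\sum_(f | Z f) 2 = (\sum_(f | Z f) 1).*2)%N by rewrite -muln2 big_distrl.
  by apply: double_inj; rewrite -cnt h2 doubleS addn2.
move=> <- /=; by case: (odd _) (As _ _ _) (As _ _ _) => [] [] [].
Qed.

End Facial.

(** * Replacing the faces of a ring *)

(* [lab d] is the face on the left of [d]; the faces of the map are the classes of
   [lab], possibly subdivided. *)
Record labelled_map (G : mgraph) (L : finType) (lab : dart G -> L) : Prop := LabelledMap {
  lm_next : forall d, exists2 d', lab d' = lab d & tail d' = head d;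
  lm_tail : forall d d', lab d = lab d' -> tail d = tail d' -> d = d';
  lm_head : forall d d', lab d = lab d' -> head d = head d' -> d = d';
  lm_rdart : forall d, lab (rdart d) <> lab d;
  lm_link : forall v (M : pred (dart G)), (exists2 d, tail d = v & M d) ->
    (forall d d', tail d = v -> tail d' = v -> lab (rdart d) = lab d' -> M d = M d') ->
    forall d, tail d = v -> M d }.

Section OrientedMap.
Variables (G : mgraph) (F : finType) (A : F -> {set dart G}).
Hypothesis FA : facial A.

(** Coherently oriented facial cycles partition the darts, so the face itself can be the label. *)
Lemma oriented_labelled_map s : (forall e, coherent A (fun=> false) s e) ->
  exists lab : dart G -> F, labelled_map lab.
Proof.
move=> coh.
have ex (d : dart G) : exists f, As A s f d.
  have [f [g [fg H]]] := f_two FA d.1.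
  have := coh d.1 f g d fg erefl; rewrite !H !eqxx orbT => /(_ isT isT).
  by have [|_] := boolP (As A s f d); [exists f|move=> /= gd; exists g].
have uniq d f g : As A s f d -> As A s g d -> f = g.
  move=> fd gd; apply/eqP; apply: contraT => fg.
  by have := coh d.1 f g d fg erefl (As_ein fd) (As_ein gd); rewrite fd gd.
have [lab labP] := choice ex.
have labE d f : As A s f d -> lab d = f by move=> fd; apply: uniq fd.
exists lab; split.
- by move=> d; have [d' dA h] := As_next FA (labP d); exists d' => //; exact: labE.
- by move=> d d' E; apply: (As_tail FA (s := s) (f := lab d)); rewrite ?labP// E labP.
- by move=> d d' E; apply: (As_head FA (s := s) (f := lab d)); rewrite ?labP// E labP.
- by move=> d E; have := As_irr FA (labP d); rewrite -E labP.
- move=> v M [d0 d0v Md0] step d dv.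
  have Mface f d1 d2 : tail d1 = v -> tail d2 = v -> ein A f d1.1 -> ein A f d2.1 -> M d1 = M d2.
    move=> d1v d2v f1 f2; have v1 : v \in ends d1.1 by rewrite -d1v tail_ends.
    have fv := ein_vin FA f1 v1.
    have [a [b [aA av bA bv [_ H]]]] := vin_darts FA s fv.
    have ab : M (rdart a) = M b.
      by apply: step => //; rewrite rdartK (labE _ _ aA) (labE _ _ bA).
    have two d' : tail d' = v -> ein A f d'.1 -> M d' = M b.
      move=> d'v; have v' : v \in ends d'.1 by rewrite -d'v tail_ends.
      rewrite H// => /orP[]/eqP E; last by rewrite (dart_tail_eq E) ?bv.
      by rewrite -ab; congr M; apply: dart_tail_eq => //; rewrite tail_rdart av.
    by rewrite !two.
  have key : forall g, vin A g v -> forall d, tail d = v -> ein A g d.1 -> M d.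
    apply: (f_link FA) => [|f g e ve fe ge Zf d1 d1v g1].
      exists (lab d0); split; first by have := As_vin FA (labP d0); rewrite d0v.
      by move=> d1 d1v e1; rewrite (Mface _ d1 d0 d1v d0v e1) //; exact: As_ein (labP d0).
    have [d2 d2e d2v] := dart_of ve.
    by rewrite (Mface _ d1 d2 d1v d2v g1) ?d2e//; apply: Zf => //; rewrite d2e.
  apply: (key (lab d)) => //; last exact: As_ein (labP d).
  by have := As_vin FA (labP d); rewrite dv.
Qed.

End OrientedMap.

Section FaceRing.
Variables (G : mgraph) (F : finType) (A : F -> {set dart G}).
Hypothesis FA : facial A.
Variables (l : nat) (r : 'I_l -> F).
Hypotheses (l_ge3 : (3 <= l)%N) (r_inj : injective r).

Definition ring_edge e := [exists i, ein A (r i) e].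
Definition shared_edge e := [exists i, exists j, [&& i != j, ein A (r i) e & ein A (r j) e]].

Variables (o : F -> bool) (cls : edge G -> bool).
Hypotheses
  (ring_adj : forall i j v, i != j -> vin A (r i) v -> vin A (r j) v -> j = ordS i \/ i = ordS j)
  (ring_nodup : forall i j k v, i != j -> j != k -> i != k ->
     vin A (r i) v -> vin A (r j) v -> vin A (r k) v -> False)
  (ring_anti : forall i v, vin A (r i) v -> vin A (r (ordS i)) v ->
     exists t, [/\ forall e, v \in ends e -> coherent A (fun=> false) t e,
       t (r (ordS i)) = o (r (ordS i)) & t (r i) = ~~ o (r i)])
  (cls_head : forall i d, As A o (r i) d -> ~~ shared_edge d.1 ->
     (forall j, i = ordS j -> vin A (r j) (head d) -> cls d.1 = false) /\
     (vin A (r (ordS i)) (head d) -> cls d.1 = true))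
  (cls_tail : forall i d, As A o (r i) d -> ~~ shared_edge d.1 ->
     (forall j, i = ordS j -> vin A (r j) (tail d) -> cls d.1 = true) /\
     (vin A (r (ordS i)) (tail d) -> cls d.1 = false))
  (cls_next : forall i d d', As A o (r i) d -> As A o (r i) d' -> head d = tail d' ->
     (forall j, vin A (r j) (head d) -> j = i) -> cls d.1 = cls d'.1).

(** In each ring face [cls] selects the arc along which [o] leads from the previous face to the next
    one. At a vertex of two consecutive ring faces exactly two edges are then twisted, so the signs
    cancel there. *)
Definition twist e := shared_edge e || (ring_edge e && cls e).

Lemma ordS_neq (i : 'I_l) : i != ordS i.
Proof.
apply/eqP => /(congr1 val) /=.
have [il|il] := ltnP i.+1 l; first by rewrite modn_small//; lia.
have -> : i.+1 = l by have := ltn_ord i; lia.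
by rewrite modnn; lia.
Qed.

(* At a vertex shared by [r i] and [r (ordS i)] let [a], [b] (resp [a'], [b']) be the
   incoming and outgoing darts of [r (ordS i)] (resp [r i]). *)
Lemma junction i v : vin A (r i) v -> vin A (r (ordS i)) v ->
  exists a b a' b', [/\ As A o (r (ordS i)) a /\ head a = v, As A o (r (ordS i)) b /\ tail b = v,
    As A o (r i) a' /\ head a' = v, As A o (r i) b' /\ tail b' = v &
    [/\ forall j, vin A (r j) v -> j = i \/ j = ordS i,
      forall e, v \in ends e -> ein A (r (ordS i)) e = (e == a.1) || (e == b.1),
      forall e, v \in ends e -> ein A (r i) e = (e == a'.1) || (e == b'.1),
      forall e, v \in ends e -> twist e = (e == b.1) || (e == a'.1) &
      [/\ b.1 != a'.1, a.1 != b'.1, ein A (r i) a.1 -> a = a' & ein A (r i) b.1 -> b = b']]].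
Proof.
move=> iv Siv; have iS := ordS_neq i.
have [a [b [aA av bA bv [ab Hf]]]] := vin_darts FA o Siv.
have [a' [b' [aA' av' bA' bv' [ab' Hg]]]] := vin_darts FA o iv.
have only j : vin A (r j) v -> j = i \/ j = ordS i.
  move=> jv; have [->|ji] := eqVneq j i; first by left.
  have [->|jS] := eqVneq j (ordS i); first by right.
  by case: (ring_nodup ji iS jS jv iv Siv).
have va : v \in ends a.1 by rewrite -av head_ends.
have vb : v \in ends b.1 by rewrite -bv tail_ends.
have va' : v \in ends a'.1 by rewrite -av' head_ends.
have vb' : v \in ends b'.1 by rewrite -bv' tail_ends.
have [t [tco tf tg]] := ring_anti iv Siv.
have rij : r i != r (ordS i) by rewrite (inj_eq r_inj).
(* Consecutive faces disagree under [o], hence they run the same way along a shared edge. *)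
have same d : v \in ends d.1 -> ein A (r i) d.1 -> ein A (r (ordS i)) d.1 ->
    As A o (r i) d = As A o (r (ordS i)) d.
  move=> vd h1 h2; have := tco _ vd _ _ d rij erefl h1 h2.
  rewrite !(AsE FA)// tf tg.
  by case: (o _) (o _) (_ \in _) (_ \in _) => [] [] [] [].
have aa : ein A (r i) a.1 -> a = a'.
  move=> ha; apply: (As_head FA (s := o) (f := r i)) => //; rewrite ?av//.
  by rewrite same//; exact: As_ein aA.
have bb : ein A (r i) b.1 -> b = b'.
  move=> hb; apply: (As_tail FA (s := o) (f := r i)) => //; rewrite ?bv//.
  by rewrite same//; exact: As_ein bA.
have ba' : b.1 != a'.1.
  apply/eqP => E; have hb : ein A (r i) b.1 by rewrite E; exact: As_ein aA'.
  by move: ab'; rewrite -E (bb hb) eqxx.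
have ab'' : a.1 != b'.1.
  apply/eqP => E; have ha : ein A (r i) a.1 by rewrite E; exact: As_ein bA'.
  by move: ab'; rewrite -E (aa ha) eqxx.
have shP e : v \in ends e -> shared_edge e = ein A (r i) e && ein A (r (ordS i)) e.
  move=> ve; apply/existsP/andP => [[j /existsP[k /and3P[jk je ke]]]|[h1 h2]]; last first.
    by exists i; apply/existsP; exists (ordS i); rewrite iS h1.
  have [] := only j (ein_vin FA je ve); have [] := only k (ein_vin FA ke ve) => kE jE; subst j k => //.
  - by move: jk; rewrite eqxx.
  - by move: jk; rewrite eqxx.
have riP e : v \in ends e -> ring_edge e = ein A (r i) e || ein A (r (ordS i)) e.
  move=> ve; apply/existsP/orP => [[j je]|[h|h]]; [|by exists i|by exists (ordS i)].
  by have [jE|jE] := only j (ein_vin FA je ve); subst j; [left|right].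
exists a, b, a', b'; split=> //; split=> //.
move=> e ve; rewrite /twist shP// riP//.
have [eb|eb] /= := eqVneq e b.1.
  subst e; have [hb|hb] := boolP (ein A (r i) b.1); rewrite (As_ein bA) ?orbT//=.
  have ns : ~~ shared_edge b.1 by rewrite shP// (negbTE hb).
  by have [H _] := cls_tail bA ns; rewrite (H i)// bv.
have [ea|ea] /= := eqVneq e a'.1.
  subst e; rewrite (As_ein aA') /=; have [//|hb] := boolP (ein A (r (ordS i)) a'.1).
  have ns : ~~ shared_edge a'.1 by rewrite shP// (negbTE hb) andbF.
  by have [_ H] := cls_head aA' ns; rewrite H// av'.
rewrite Hf// Hg// (negbTE eb) (negbTE ea) /= orbF.
have [ea1|_] := eqVneq e a.1.
  subst e; rewrite andbT orbT /=; have [E|ne] := boolP (a.1 == b'.1).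
    by rewrite E in ab''.
  have ns : ~~ shared_edge a.1.
    by rewrite shP// Hg// (negbTE ea) (negbTE ne).
  by have [H _] := cls_head aA ns; rewrite (H i)// av.
rewrite andbF orbF; have [eb'|//] := eqVneq e b'.1; subst e.
have ns : ~~ shared_edge b'.1.
  rewrite shP// (Hf _ vb') (negbTE eb) orbF.
  by rewrite eq_sym (negbTE ab'') andbF.
by have [_ H] := cls_tail bA' ns; rewrite H// bv'.
Qed.

Lemma ein_cases f g h e : f != g -> ein A f e -> ein A g e -> ein A h e -> h = f \/ h = g.
Proof.
have [a [b [_ two]]] := f_two FA e; rewrite !two => fg.
by move=> /orP[]/eqP fE /orP[]/eqP gE /orP[]/eqP hE; subst f g h;
  move: fg; rewrite ?eqxx// => _; (left; reflexivity) || (right; reflexivity).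
Qed.

Lemma agree_flip (s : F -> bool) (k : edge G -> bool) v (f : F) (b : bool) :
  (forall e, v \in ends e -> coherent A k s e) ->
  exists s', (forall e, v \in ends e -> coherent A k s' e) /\ s' f = b.
Proof.
move=> H; have [E|E] := eqVneq (s f) b; first by exists s.
exists (fun f => ~~ s f); split; last by move: E; case: (s f) b => [] [].
by move=> e ve; exact/coherent_flip/H.
Qed.

Lemma untwisted_local v : exists s, forall e, v \in ends e -> coherent A (fun=> false) s e.
Proof. by apply: (local_solution FA); rewrite big1. Qed.

(** The source of all contradictions at a junction. In the coherent orientation [t] both [b] and the
    reverse of [a'] leave [v] along their ring faces, while [boundary_parity] asks that exactly one
    of them do so when they bound a set of faces avoiding the ring. *)
Lemma junction_clash i v (Z : pred F) (b a' : dart G) (t : F -> bool) :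
  vin A (r i) v -> vin A (r (ordS i)) v ->
  As A o (r (ordS i)) b -> tail b = v -> As A o (r i) a' -> head a' = v -> b.1 != a'.1 ->
  (forall e, v \in ends e -> coherent A (fun=> false) t e) ->
  t (r (ordS i)) = o (r (ordS i)) -> t (r i) = ~~ o (r i) ->
  (forall f, Z f -> vin A f v) -> ~~ Z (r i) -> ~~ Z (r (ordS i)) ->
  (forall e f g, v \in ends e -> f != g -> ein A f e -> ein A g e ->
     Z f (+) Z g = (e == b.1) || (e == a'.1)) -> False.
Proof.
move=> iv Siv bA bv aA' av' ba' tco tf tg Zv nZi nZS bd.
have := boundary_parity FA (t := t) (v := v) (Z := Z) (d1 := b) (d2 := rdart a')
  (f1 := r (ordS i)) (f2 := r i) tco Zv bv _ _ (As_ein bA) (As_ein aA') nZS nZi bd.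
rewrite tail_rdart av' => /(_ erefl) H.
have : b != rdart a' by apply: contra_neq ba' => ->.
move=> /H; rewrite (As_ext _ _ tf) bA (AsE FA) ?(As_ein aA')// tg.
by move: (As_irr FA aA'); rewrite (AsE FA) ?(As_ein aA')//; case: (_ \in _) (o _) => [] [].
Qed.

(** At a junction the even twist has a local solution, normalised on one ring face. If it were wrong
    on the other, the faces where it differs from the coherent [t] would avoid both ring faces and
    be bounded exactly by the two twisted edges, against [junction_clash]. *)
Lemma twisted_local v : exists s, (forall e, v \in ends e -> coherent A twist s e) /\
  forall i, vin A (r i) v -> s (r i) = o (r i).
Proof.
have [i iv|nov] := pickP (fun i => vin A (r i) v); last first.
  have [s sco] := untwisted_local v; exists s; split; last by move=> i; rewrite nov.
  move=> e ve f g d fg de fe ge; rewrite (sco e ve f g d fg de fe ge).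
  have nor j : ein A (r j) e = false by apply: contraFF (nov j) => h; exact: ein_vin h ve.
  rewrite /twist /shared_edge /ring_edge; case: existsP => [[j /existsP[k /and3P[_ ]]]|_]; first by rewrite nor.
  by case: existsP => [[j]|//]; rewrite nor.
have [[j [jv ji]]|single] := pselect (exists j, vin A (r j) v /\ j != i); last first.
  have only j : vin A (r j) v -> j = i.
    by move=> jv; apply/eqP; apply: contrapT => ji; apply: single; exists j; split=> //; apply/negP.
  have [t0 tco0] := untwisted_local v.
  have [t [tco ti]] := agree_flip (r i) (o (r i)) tco0.
  have [a [b [aA av bA bv [ab H]]]] := vin_darts FA o iv.
  have cab : cls a.1 = cls b.1 by apply: (cls_next aA bA); rewrite av ?bv.
  have tw e : v \in ends e -> twist e = ein A (r i) e && cls a.1.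
    move=> ve; rewrite /twist.
    have -> : shared_edge e = false.
      apply/negbTE/negP => /existsP[j /existsP[k /and3P[jk je ke]]].
      by move: jk; rewrite (only _ (ein_vin FA je ve)) (only _ (ein_vin FA ke ve)) eqxx.
    have -> : ring_edge e = ein A (r i) e.
      apply/existsP/idP => [[j je]|]; last by exists i.
      by rewrite -(only _ (ein_vin FA je ve)).
    by have [|//] := boolP (ein A (r i) e); rewrite H// => /orP[]/eqP-> /=.
  exists (fun f => if f == r i then o f else t f (+) cls a.1); split; last first.
    by move=> j /only ->; rewrite eqxx.
  move=> e ve f g d fg de fe ge; have := tco e ve f g d fg de fe ge.
  rewrite tw// !(AsE FA) ?de//.
  have [fi|fi] := eqVneq f (r i); have [gi|gi] := eqVneq g (r i).
  - by move: fg; rewrite fi gi eqxx.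
  - by subst f; rewrite fe ti /=; case: (_ \in _) (_ \in _) (o _) (t g) (cls _) => [] [] [] [] [].
  - by subst g; rewrite ge ti /=; case: (_ \in _) (_ \in _) (o _) (t f) (cls _) => [] [] [] [] [].
  - have -> : ein A (r i) e = false.
      by apply/negbTE/negP => /(ein_cases fg fe ge)[E|E]; [move: fi|move: gi]; rewrite E eqxx.
    by rewrite andFb /= -!addbA; case: (_ \in _) (_ \in _) (t f) (t g) (cls _) => [] [] [] [] [].
have {i iv j jv ji} [i [iv Siv]] : exists i, vin A (r i) v /\ vin A (r (ordS i)) v.
  by have [E|E] := ring_adj ji jv iv; [exists j; rewrite -E|exists i; rewrite -E].
have [a [b [a' [b' [[aA av] [bA bv] [aA' av'] [bA' bv'] [only Hf Hg tw [ba' ab' aa bb]]]]]]] := junction iv Siv.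
have even : \big[addb/false]_(e | v \in ends e) twist e = false.
  have vb : v \in ends b.1 by rewrite -bv tail_ends.
  have va' : v \in ends a'.1 by rewrite -av' head_ends.
  rewrite (eq_bigr (fun e => (e == b.1) || (e == a'.1))); last by move=> e /tw.
  rewrite (bigD1 b.1)//= (bigD1 a'.1) /=; last by rewrite va' eq_sym.
  rewrite eqxx eqxx orbT big1// => e /andP[/andP[_ h1] h2].
  by rewrite (negbTE h1) (negbTE h2).
have [s0 sco0] := local_solution FA even.
have [s [sco sf]] := agree_flip (r (ordS i)) (o (r (ordS i))) sco0.
have [t [tco tf tg]] := ring_anti iv Siv.
exists s; split=> // j /only[]->//; apply/eqP; apply: contraT => sg.
have {}sg : s (r i) = t (r i) by rewrite tg; move: sg; case: (s _) (o _) => [] [].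
exfalso; apply: (@junction_clash i v (fun f => vin A f v && (s f (+) t f)) b a' t) => //.
- by move=> f /andP[].
- by rewrite sg addbb andbF.
- by rewrite sf tf addbb andbF.
move=> e f g ve fg fe ge.
have [d de _] := dart_of ve.
rewrite (ein_vin FA fe ve) (ein_vin FA ge ve) /= -tw//.
have := sco e ve f g d fg de fe ge; have := tco e ve f g d fg de fe ge.
rewrite !(AsE FA) ?de//.
by case: (s f) (s g) (t f) (t g) (_ \in _) (_ \in _) (twist e) => [] [] [] [] [] [] [].
Qed.

Variable s : F -> bool.
Hypotheses (s_coh : forall e, coherent A twist s e) (s_ring : forall i, s (r i) = o (r i)).

Definition outer f := ~~ [exists i, f == r i].
Definition strand0 d := [exists i, As A o (r i) d && (shared_edge d.1 || ~~ cls d.1)].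
Definition strand1 d := [exists i, As A o (r i) (rdart d) && (shared_edge d.1 || cls d.1)].

(* The two faces that replace the ring run along its two sides, crossing over at
   every common boundary: the first strand follows [o], the second reverses it. *)
Definition new_face (L : F + bool) d :=
  match L with inl f => outer f && As A s f d | inr false => strand0 d | inr true => strand1 d end.

Lemma outerP f : outer f \/ exists i, f = r i.
Proof. by rewrite /outer; case: existsP => [[i /eqP]|]; [right; exists i|left]. Qed.

Lemma outer_r i : outer (r i) = false.
Proof. by apply/negbTE; rewrite negbK; apply/existsP; exists i. Qed.

Lemma ring_ein_eq f i e : outer f -> ein A f e -> ein A (r i) e ->
  forall j, ein A (r j) e -> j = i.
Proof.
move=> fo fe ie j je; have fi : f != r i by apply: contraTneq fo => ->; rewrite outer_r.
have [E|/r_inj//] := ein_cases fi fe ie je.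
by move: fo; rewrite -E outer_r.
Qed.

(** Along a shared edge both ring faces run the same way under [o]; the first strand follows them
    and the second takes the other direction. On an edge of one ring face, the outer face runs with
    it iff [cls] holds, and then only the second strand, which reverses [o], uses the edge;
    otherwise only the first strand does. *)
Lemma new_face_ex d : exists L, new_face L d /\ forall L', new_face L' d -> L' = L.
Proof.
have [f [g [fg two]]] := f_two FA d.1.
have fe : ein A f d.1 by rewrite two eqxx.
have ge : ein A g d.1 by rewrite two eqxx orbT.
have co := s_coh fg erefl fe ge.
wlog fo : f g fg two fe ge co / outer f \/ (exists i j, f = r i /\ g = r j).
  move=> H; have [fo|[i fi]] := outerP f; first by apply: (H f g) => //; left.
  have [go|[j gj]] := outerP g; last by apply: (H f g) => //; right; exists i, j.
  apply: (H g f) => //; rewrite 1?eq_sym// 1?addbC//; last by left.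
  by move=> k; rewrite two orbC.
have outside h : outer h -> As A s h d -> h = f \/ h = g.
  by move=> _ /As_ein; rewrite two => /orP[]/eqP; [left|right].
case: fo => [fo|[i [j [fi gj]]]]; last first.
  subst f g; have ij : i != j by apply: contraNneq fg => ->.
  have sh : shared_edge d.1 by apply/existsP; exists i; apply/existsP; exists j; rewrite ij fe.
  have tw : twist d.1 by rewrite /twist sh.
  have asE k : ein A (r k) d.1 -> As A o (r k) d = As A o (r i) d.
    move: co; rewrite tw (As_ext _ _ (s_ring i)) (As_ext _ _ (s_ring j)) => co.
    rewrite two => /orP[]/eqP/r_inj -> //.
    by move: co; case: (As _ _ _ _) (As _ _ _ _) => [] [].
  have no h : ~ (outer h && As A s h d).
    by case/andP => ho hd; have [E|E] := outside h ho hd; move: ho; rewrite E outer_r.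
  have st0 : strand0 d = As A o (r i) d.
    apply/existsP/idP => [[k /andP[kd _]]|h]; last by exists i; rewrite h sh.
    by rewrite -(asE k)//; exact: As_ein kd.
  have st1 : strand1 d = ~~ As A o (r i) d.
    rewrite -As_rdart//; apply/existsP/idP => [[k /andP[kd _]]|h]; last by exists i; rewrite h sh.
    have ke : ein A (r k) d.1 := As_ein kd.
    by move: kd; rewrite !As_rdart// (asE k ke).
  have [h|h] := boolP (As A o (r i) d).
    exists (inr false); split; first by rewrite /= st0.
    by move=> [k /no//|[]//]; rewrite /= st1 h.
  exists (inr true); split; first by rewrite /= st1.
  by move=> [k /no//|[]//]; rewrite /= st0 (negbTE h).
have [go|[i gi]] := outerP g.
  have nor k : ein A (r k) d.1 = false.
    by rewrite two; apply/negP => /orP[]/eqP E; [move: fo|move: go]; rewrite -E outer_r.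
  have tw : twist d.1 = false.
    rewrite /twist /shared_edge /ring_edge; case: existsP => [[k /existsP[m /and3P[_ ]]]|_]; first by rewrite nor.
    by case: existsP => [[k]|//]; rewrite nor.
  have st0 : strand0 d = false.
    by apply/negbTE/negP => /existsP[k /andP[/As_ein]]; rewrite nor.
  have st1 : strand1 d = false.
    by apply/negbTE/negP => /existsP[k /andP[/As_ein]]; rewrite nor.
  rewrite tw in co; have [fd|fd] := boolP (As A s f d).
    exists (inl f); split; first by rewrite /= fo.
    move=> [k /= /andP[ko kd]|[]] /=; rewrite ?st0 ?st1//.
    have [->//|E] := outside k ko kd.
    by move: co; rewrite fd -E kd.
  exists (inl g); split; first by rewrite /= go; move: co; rewrite (negbTE fd).
  move=> [k /= /andP[ko kd]|[]] /=; rewrite ?st0 ?st1//.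
  have [E|->//] := outside k ko kd.
  by move: fd; rewrite -E kd.
subst g; have only k : ein A (r k) d.1 -> k = i by move=> ke; exact: (ring_ein_eq fo fe ge ke).
have sh : shared_edge d.1 = false.
  apply/negbTE/negP => /existsP[k /existsP[m /and3P[km /only kE /only mE]]].
  by move: km; rewrite kE mE eqxx.
have tw : twist d.1 = cls d.1.
  by rewrite /twist sh /=; have -> // : ring_edge d.1; apply/existsP; exists i.
have st0 : strand0 d = As A o (r i) d && ~~ cls d.1.
  apply/existsP/idP => [[k /andP[kd]]|h]; last by exists i; rewrite sh.
  by rewrite sh /= -(only k (As_ein kd)) kd.
have st1 : strand1 d = ~~ As A o (r i) d && cls d.1.
  rewrite -As_rdart//; apply/existsP/idP => [[k /andP[kd]]|h]; last by exists i; rewrite sh.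
  by rewrite sh /= -(only k (As_ein kd)) kd.
move: co; rewrite tw (As_ext _ _ (s_ring i)) => co.
have noi : ~ (outer (r i) && As A s (r i) d) by rewrite outer_r.
have [fd|fd] := boolP (As A s f d).
  exists (inl f); split; first by rewrite /= fo.
  move=> [k /= /andP[ko kd]|[]] /=.
  - by have [->//|E] := outside k ko kd; move: ko; rewrite E outer_r.
  - by rewrite st1; move: co; rewrite fd; case: (As _ _ _ _) (cls _) => [] [].
  - by rewrite st0; move: co; rewrite fd; case: (As _ _ _ _) (cls _) => [] [].
have nof k : ~ (outer k && As A s k d).
  case/andP => ko kd; have [E|E] := outside k ko kd; first by move: fd; rewrite -E kd.
  by move: ko; rewrite E outer_r.
have [h|h] := boolP (As A o (r i) d).
  exists (inr false); split.
    by rewrite /= st0 h; move: co; rewrite (negbTE fd) h; case: (cls _).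
  by move=> [k /nof//|[]//]; rewrite /= st1 h.
exists (inr true); split.
  by rewrite /= st1 h; move: co; rewrite (negbTE fd) (negbTE h); case: (cls _).
by move=> [k /nof//|[]//]; rewrite /= st0 (negbTE h).
Qed.

Lemma ring_vertex i v : vin A (r i) v -> (forall j, vin A (r j) v -> j = i) \/
  exists j, vin A (r j) v /\ vin A (r (ordS j)) v.
Proof.
move=> iv; have [[j [jv ji]]|single] := pselect (exists j, vin A (r j) v /\ j != i).
  by right; have [E|E] := ring_adj ji jv iv; [exists j; rewrite -E|exists i; rewrite -E].
by left=> j jv; apply/eqP; apply: contrapT => ji; apply: single; exists j; split=> //; apply/negP.
Qed.

Lemma only_not_shared i v e : (forall j, vin A (r j) v -> j = i) -> v \in ends e -> shared_edge e = false.
Proof.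
move=> only ve; apply/negbTE/negP => /existsP[j /existsP[k /and3P[jk je ke]]].
by move: jk; rewrite (only _ (ein_vin FA je ve)) (only _ (ein_vin FA ke ve)) eqxx.
Qed.

(** Both strands run against the order of the ring: at a junction each arrives along [r (ordS j)]
    and leaves along [r j]. This and the next three lemmas name the darts. *)
Lemma strand0_in j a : As A o (r (ordS j)) a -> vin A (r j) (head a) -> strand0 a.
Proof.
move=> aA jv; apply/existsP; exists (ordS j); rewrite aA /=.
have [//|ns] /= := boolP (shared_edge a.1).
by have [H _] := cls_head aA ns; rewrite (H j).
Qed.

Lemma strand0_out j b : As A o (r j) b -> vin A (r (ordS j)) (tail b) -> strand0 b.
Proof.
move=> bA jv; apply/existsP; exists j; rewrite bA /=.
have [//|ns] /= := boolP (shared_edge b.1).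
by have [_ H] := cls_tail bA ns; rewrite H.
Qed.

Lemma strand1_in j b : As A o (r (ordS j)) b -> vin A (r j) (tail b) -> strand1 (rdart b).
Proof.
move=> bA jv; apply/existsP; exists (ordS j); rewrite rdartK bA /=.
have [//|ns] /= := boolP (shared_edge b.1).
by have [H _] := cls_tail bA ns; rewrite (H j).
Qed.

Lemma strand1_out j a : As A o (r j) a -> vin A (r (ordS j)) (head a) -> strand1 (rdart a).
Proof.
move=> aA jv; apply/existsP; exists j; rewrite rdartK aA /=.
have [//|ns] /= := boolP (shared_edge a.1).
by have [_ H] := cls_head aA ns; rewrite H.
Qed.

Lemma new_face_next L d : new_face L d -> exists2 d', new_face L d' & tail d' = head d.
Proof.
case: L => [f /= /andP[fo fd]|[]] /=.
- by have [d' dA h] := As_next FA fd; exists d'; rewrite ?fo.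
- move=> /existsP[i /andP[iA]].
  have iv : vin A (r i) (head d) by have := As_vin FA iA; rewrite tail_rdart.
  have [only|[j [jv Sjv]]] := ring_vertex iv.
    rewrite (only_not_shared only (head_ends d)) /= => c1.
    have [d0 d0A d0v] := As_prev FA iA; rewrite tail_rdart in d0v.
    exists (rdart d0); last by rewrite tail_rdart.
    apply/existsP; exists i; rewrite rdartK d0A /=.
    by rewrite (cls_next d0A iA) ?d0v ?tail_rdart ?c1 ?orbT// => j; rewrite d0v; exact: only.
  move=> _; have [a [b [a' [b' [_ _ [aA' av'] _ _]]]]] := junction jv Sjv.
  exists (rdart a'); last by rewrite tail_rdart.
  by apply: (strand1_out aA'); rewrite av'.
- move=> /existsP[i /andP[iA]].
  have iv : vin A (r i) (head d) := As_vin_head FA iA.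
  have [only|[j [jv Sjv]]] := ring_vertex iv.
    rewrite (only_not_shared only (head_ends d)) /= => c1.
    have [d0 d0A d0v] := As_next FA iA.
    exists d0; last by [].
    apply/existsP; exists i; rewrite d0A /=.
    by rewrite -(cls_next iA d0A) ?d0v ?c1 ?orbT.
  move=> _; have [a [b [a' [b' [_ _ _ [bA' bv'] _]]]]] := junction jv Sjv.
  exists b'; last by [].
  by apply: (strand0_out bA'); rewrite bv'.
Qed.

(** A strand leaves a junction only once: the dart from [r (ordS j)] would belong to it only on a
    shared edge, and there it coincides with the dart from [r j]. *)
Lemma new_face_tail L d d' : new_face L d -> new_face L d' -> tail d = tail d' -> d = d'.
Proof.
case: L => [f /= /andP[fo fd] /andP[_ fd']|[]] /=; first by move=> h; exact: (As_tail FA fd fd' h).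
- move=> /existsP[i /andP[iA ic]] /existsP[i' /andP[iA' ic']] tt.
  apply: (inv_inj (@rdartK G)).
  have iv : vin A (r i) (tail d) by have := As_vin_head FA iA; rewrite head_rdart.
  have iv' : vin A (r i') (tail d) by have := As_vin_head FA iA'; rewrite head_rdart tt.
  have [only|[j [jv Sjv]]] := ring_vertex iv.
    by move: iA'; rewrite (only _ iv') => iA'; apply: (As_head FA iA iA'); rewrite !head_rdart.
  have [a [b [a' [b' [[aA av] _ [aA' av'] _ [only _ _ _ [_ _ aa _]]]]]]] := junction jv Sjv.
  have key k c : vin A (r k) (tail d) -> As A o (r k) c -> head c = tail d ->
      shared_edge c.1 || cls c.1 -> c = a'.
    move=> /only[]-> cA cv cc; first by apply: (As_head FA cA aA'); rewrite cv av'.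
    have ca : c = a by apply: (As_head FA cA aA); rewrite cv av.
    subst c; apply: aa; have [/existsP[m /existsP[n /and3P[mn me ne]]]|ns] := boolP (shared_edge a.1).
      have va : tail d \in ends a.1 by rewrite -av head_ends.
      have [mE|mE] := only _ (ein_vin FA me va); have [nE|nE] := only _ (ein_vin FA ne va); subst m n => //.
      by move: mn; rewrite eqxx.
    by move: cc; rewrite (negbTE ns) /=; have [H _] := cls_head cA ns; rewrite (H j)// cv.
  have -> : rdart d = a' by apply: (key i) => //; rewrite head_rdart.
  by apply/esym/(key i') => //; rewrite head_rdart.
- move=> /existsP[i /andP[iA ic]] /existsP[i' /andP[iA' ic']] tt.
  have iv : vin A (r i) (tail d) := As_vin FA iA.
  have iv' : vin A (r i') (tail d) by have := As_vin FA iA'; rewrite tt.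
  have [only|[j [jv Sjv]]] := ring_vertex iv.
    by move: iA'; rewrite (only _ iv') => iA'; apply: (As_tail FA iA iA').
  have [a [b [a' [b' [_ [bA bv] _ [bA' bv'] [only _ _ _ [_ _ _ bb]]]]]]] := junction jv Sjv.
  have key k c : vin A (r k) (tail d) -> As A o (r k) c -> tail c = tail d ->
      shared_edge c.1 || ~~ cls c.1 -> c = b'.
    move=> /only[]-> cA cv cc; first by apply: (As_tail FA cA bA'); rewrite cv bv'.
    have cb : c = b by apply: (As_tail FA cA bA); rewrite cv bv.
    subst c; apply: bb; have [/existsP[m /existsP[n /and3P[mn me ne]]]|ns] := boolP (shared_edge b.1).
      have vb : tail d \in ends b.1 by rewrite -bv tail_ends.
      have [mE|mE] := only _ (ein_vin FA me vb); have [nE|nE] := only _ (ein_vin FA ne vb); subst m n => //.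
      by move: mn; rewrite eqxx.
    by move: cc; rewrite (negbTE ns) /=; have [H _] := cls_tail cA ns; rewrite (H j)// cv.
have -> : d = b' by exact: (key i).
  by apply/esym/(key i').
Qed.

Lemma new_face_head L d d' : new_face L d -> new_face L d' -> head d = head d' -> d = d'.
Proof.
case: L => [f /= /andP[fo fd] /andP[_ fd']|[]] /=; first by move=> h; exact: (As_head FA fd fd' h).
- move=> /existsP[i /andP[iA ic]] /existsP[i' /andP[iA' ic']] tt.
  apply: (inv_inj (@rdartK G)).
  have iv : vin A (r i) (head d) by have := As_vin FA iA; rewrite tail_rdart.
  have iv' : vin A (r i') (head d) by have := As_vin FA iA'; rewrite tail_rdart tt.
  have [only|[j [jv Sjv]]] := ring_vertex iv.
    by move: iA'; rewrite (only _ iv') => iA'; apply: (As_tail FA iA iA'); rewrite !tail_rdart.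
  have [a [b [a' [b' [_ [bA bv] _ [bA' bv'] [only Hf _ _ [_ ab' _ _]]]]]]] := junction jv Sjv.
  have key k c : vin A (r k) (head d) -> As A o (r k) c -> tail c = head d ->
      shared_edge c.1 || cls c.1 -> c = b.
    move=> /only[]-> cA cv cc; last by apply: (As_tail FA cA bA); rewrite cv bv.
    have cb : c = b' by apply: (As_tail FA cA bA'); rewrite cv bv'.
    subst c; have vb : head d \in ends b'.1 by rewrite -bv' tail_ends.
    have [/existsP[m /existsP[n /and3P[mn me ne]]]|ns] := boolP (shared_edge b'.1).
      have fb : ein A (r (ordS j)) b'.1.
        have [mE|mE] := only _ (ein_vin FA me vb); have [nE|nE] := only _ (ein_vin FA ne vb); subst m n => //.
        by move: mn; rewrite eqxx.
      move: fb; rewrite Hf// eq_sym (negbTE ab') /= => /eqP E.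
      by apply: dart_tail_eq => //; rewrite bv bv'.
    by move: cc; rewrite (negbTE ns) /=; have [_ H] := cls_tail cA ns; rewrite H// cv.
  have -> : rdart d = b by apply: (key i) => //; rewrite tail_rdart.
  by apply/esym/(key i') => //; rewrite tail_rdart.
- move=> /existsP[i /andP[iA ic]] /existsP[i' /andP[iA' ic']] tt.
  have iv : vin A (r i) (head d) := As_vin_head FA iA.
  have iv' : vin A (r i') (head d) by have := As_vin_head FA iA'; rewrite tt.
  have [only|[j [jv Sjv]]] := ring_vertex iv.
    by move: iA'; rewrite (only _ iv') => iA'; apply: (As_head FA iA iA').
  have [a [b [a' [b' [[aA av] _ [aA' av'] _ [only Hf _ _ [ba' _ _ _]]]]]]] := junction jv Sjv.
  have key k c : vin A (r k) (head d) -> As A o (r k) c -> head c = head d ->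
      shared_edge c.1 || ~~ cls c.1 -> c = a.
    move=> /only[]-> cA cv cc; last by apply: (As_head FA cA aA); rewrite cv av.
    have ca : c = a' by apply: (As_head FA cA aA'); rewrite cv av'.
    subst c; have va : head d \in ends a'.1 by rewrite -av' head_ends.
    have [/existsP[m /existsP[n /and3P[mn me ne]]]|ns] := boolP (shared_edge a'.1).
      have fa : ein A (r (ordS j)) a'.1.
        have [mE|mE] := only _ (ein_vin FA me va); have [nE|nE] := only _ (ein_vin FA ne va); subst m n => //.
        by move: mn; rewrite eqxx.
      move: fa; rewrite Hf// [X in _ || X]eq_sym (negbTE ba') orbF => /eqP E.
      apply: (inv_inj (@rdartK G)); apply: dart_tail_eq => //; rewrite !tail_rdart av av'//.
    by move: cc; rewrite (negbTE ns) /=; have [_ H] := cls_head cA ns; rewrite H// cv.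
  have -> : d = a by exact: (key i).
  by apply/esym/(key i').
Qed.

Lemma shared_As i j d : ein A (r i) d.1 -> ein A (r j) d.1 -> As A o (r i) d = As A o (r j) d.
Proof.
have [->//|ij] := eqVneq i j => ie je.
have sh : shared_edge d.1 by apply/existsP; exists i; apply/existsP; exists j; rewrite ij ie.
have rij : r i != r j by rewrite (inj_eq r_inj).
have := s_coh rij erefl ie je; rewrite /twist sh (As_ext _ _ (s_ring i)) (As_ext _ _ (s_ring j)).
by case: (As _ _ _ _) (As _ _ _ _) => [] [].
Qed.

Lemma new_face_rdart L d : new_face L d -> ~ new_face L (rdart d).
Proof.
case: L => [f /= /andP[fo fd] /andP[_]|[]] /=; first exact/negP/(As_irr FA).
- move=> /existsP[i /andP[iA _]] /existsP[j /andP[jA _]].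
  have ie : ein A (r i) d.1 := As_ein iA.
  have je : ein A (r j) d.1 by have := As_ein jA; rewrite rdartK.
  move: iA jA; rewrite rdartK As_rdart// (shared_As ie je) => /negP; exact.
- move=> /existsP[i /andP[iA _]] /existsP[j /andP[jA _]].
  have ie : ein A (r i) d.1 := As_ein iA.
  have je : ein A (r j) d.1 := As_ein jA.
  by move: iA jA; rewrite As_rdart// (shared_As ie je) => ->.
Qed.

(** The axiom at stake is [lm_link]: the crossing strands might split the rotation at a junction
    into separate cycles. *)
Lemma twisted_labelled_map : exists lab : dart G -> F + bool, labelled_map lab.
Proof.
have [lab labP] := choice new_face_ex.
have labE d L : new_face L d -> lab d = L by move=> h; have [_ H] := labP d; rewrite (H L).
have labN d : new_face (lab d) d by have [] := labP d.
exists lab; split.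
- by move=> d; have [d' dA h] := new_face_next (labN d); exists d' => //; exact: labE.
- by move=> d d' E; apply: (@new_face_tail (lab d)); rewrite ?labN// E labN.
- by move=> d d' E; apply: (@new_face_head (lab d)); rewrite ?labN// E labN.
- by move=> d E; apply: (new_face_rdart (labN d)); rewrite -E; exact: labN.
move=> v M [d0 d0v Md0] step.
have two_at f : vin A f v -> exists a b, [/\ As A s f a, head a = v, As A s f b, tail b = v &
    forall d, tail d = v -> ein A f d.1 -> d = rdart a \/ d = b].
  move=> fv; have [a [b [aA av bA bv [_ H]]]] := vin_darts FA s fv.
  exists a, b; split=> // d dv; rewrite H; last by rewrite -dv tail_ends.
  move=> /orP[]/eqP E; [left|right]; apply: dart_tail_eq => //; rewrite ?bv//.
  by rewrite tail_rdart av.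
have Mouter f d1 d2 : outer f -> tail d1 = v -> tail d2 = v -> ein A f d1.1 -> ein A f d2.1 -> M d1 = M d2.
  move=> fo d1v d2v f1 f2; have v1 : v \in ends d1.1 by rewrite -d1v tail_ends.
  have [a [b [aA av bA bv H]]] := two_at f (ein_vin FA f1 v1).
  have ab : M (rdart a) = M b.
    by apply: step => //; rewrite rdartK (labE a (inl f)) ?(labE b (inl f))//= fo.
  by have [->|->] := H d1 d1v f1; have [->|->] := H d2 d2v f2.
have finish : (forall i d1 d2, tail d1 = v -> tail d2 = v -> ein A (r i) d1.1 -> ein A (r i) d2.1 ->
    M d1 = M d2) -> forall d, tail d = v -> M d.
  move=> Mring d dv.
  have Mface f d1 d2 : tail d1 = v -> tail d2 = v -> ein A f d1.1 -> ein A f d2.1 -> M d1 = M d2.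
    by have [fo|[i ->]] := outerP f; [exact: Mouter|exact: Mring].
  have key : forall g, vin A g v -> forall d, tail d = v -> ein A g d.1 -> M d.
    apply: (f_link FA) => [|f g e ve fe ge Zf d1 d1v g1].
      have [f [g [_ two]]] := f_two FA d0.1; have fe : ein A f d0.1 by rewrite two eqxx.
      exists f; split; first by apply: (ein_vin FA fe); rewrite -d0v tail_ends.
      by move=> d1 d1v e1; rewrite (Mface _ d1 d0 d1v d0v e1).
    have [d2 d2e d2v] := dart_of ve.
    by rewrite (Mface _ d1 d2 d1v d2v g1) ?d2e//; apply: Zf => //; rewrite d2e.
  have [f [g [_ two]]] := f_two FA d.1; have fe : ein A f d.1 by rewrite two eqxx.
  by apply: (key f) => //; apply: (ein_vin FA fe); rewrite -dv tail_ends.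
have [i iv|nov] := pickP (fun i => vin A (r i) v); last first.
  apply: finish => i d1 d2 d1v _ /(fun h => ein_vin FA h) H _.
  by have := H v; rewrite -{1}d1v tail_ends nov => /(_ isT).
have [only|[j [jv Sjv]]] := ring_vertex iv.
  apply: finish => k d1 d2 d1v d2v k1 k2.
  have v1 : v \in ends d1.1 by rewrite -d1v tail_ends.
  have kv := ein_vin FA k1 v1; have kE := only k kv; subst k.
  have [a [b [aA av bA bv H]]] := two_at _ iv.
  rewrite !(As_ext _ _ (s_ring i)) in aA bA.
  have va : v \in ends a.1 by rewrite -av head_ends.
  have vb : v \in ends b.1 by rewrite -bv tail_ends.
  have cab : cls a.1 = cls b.1.
    by apply: (cls_next aA bA); rewrite av ?bv.
  have ab : M (rdart a) = M b.
    case c : (cls b.1).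
      apply/esym/step => //; rewrite ?tail_rdart//.
      rewrite (labE (rdart b) (inr true)) ?(labE (rdart a) (inr true))//=; apply/existsP; exists i;
        by rewrite rdartK ?aA ?bA /= ?cab c orbT.
    apply: step => //; rewrite rdartK.
    rewrite (labE a (inr false)) ?(labE b (inr false))//=; apply/existsP; exists i;
      by rewrite ?aA ?bA /= ?cab c orbT.
  by have [->|->] := H d1 d1v k1; have [->|->] := H d2 d2v k2.
have [a [b [a' [b' [[aA av] [bA bv] [aA' av'] [bA' bv'] [only Hf Hg tw [ba' ab' aa bb]]]]]]] := junction jv Sjv.
have m1 : M (rdart a) = M b'.
  apply: step => //; rewrite rdartK (labE a (inr false)) ?(labE b' (inr false))//=.
    by apply: (strand0_out bA'); rewrite bv'.
  by apply: (strand0_in aA); rewrite av.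
have m2 : M b = M (rdart a').
  apply: step; rewrite ?tail_rdart// (labE (rdart b) (inr true)) ?(labE (rdart a') (inr true))//=.
    by apply: (strand1_out aA'); rewrite av'.
  by apply: (strand1_in bA); rewrite bv.
have atf d : tail d = v -> ein A (r (ordS j)) d.1 -> d = rdart a \/ d = b.
  move=> dv; rewrite Hf; last by rewrite -dv tail_ends.
  move=> /orP[]/eqP E; [left|right]; apply: dart_tail_eq => //; rewrite ?bv//.
  by rewrite tail_rdart av.
have atg d : tail d = v -> ein A (r j) d.1 -> d = rdart a' \/ d = b'.
  move=> dv; rewrite Hg; last by rewrite -dv tail_ends.
  move=> /orP[]/eqP E; [left|right]; apply: dart_tail_eq => //; rewrite ?bv'//.
  by rewrite tail_rdart av'.
have [mm|mm] := eqVneq (M b) (M b').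
  apply: finish => k d1 d2 d1v d2v k1 k2.
  have v1 : v \in ends d1.1 by rewrite -d1v tail_ends.
  have [kE|kE] := only k (ein_vin FA k1 v1); subst k.
    by have [->|->] := atg d1 d1v k1; have [->|->] := atg d2 d2v k2; rewrite -?m2 ?mm.
  by have [->|->] := atf d1 d1v k1; have [->|->] := atf d2 d2v k2; rewrite ?m1 ?mm.
(* [M] now distinguishes the two strands at [v]. The outer faces whose darts at [v] have the value
   of [b] form a set bounded exactly by [b] and [a'], which cannot exist. *)
exfalso; have [t [tco tf tg]] := ring_anti jv Sjv.
pose Z f := [&& vin A f v, outer f & [exists d, [&& tail d == v, ein A f d.1 & M d == M b]]].
apply: (@junction_clash j v Z b a' t) => //.
- by move=> f /and3P[].
- by rewrite /Z outer_r andbF.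
- by rewrite /Z outer_r andbF.
move=> e f g ve fg fe ge; have [d de dv] := dart_of ve; subst e.
have Zo h : ein A h d.1 -> outer h -> Z h = (M d == M b).
  move=> he ho; rewrite /Z ho (ein_vin FA he ve) /=.
  apply/existsP/idP => [[d1 /and3P[/eqP d1v h1 /eqP <-]]|Md]; last by exists d; rewrite dv eqxx he.
  by rewrite (Mouter h d d1)//.
have Zr k : Z (r k) = false by rewrite /Z outer_r andbF.
have isb : (d.1 == b.1) = (d == b).
  by apply/eqP/eqP => [E|->//]; apply: dart_tail_eq => //; rewrite bv.
have isa' : (d.1 == a'.1) = (d == rdart a').
  by apply/eqP/eqP => [E|->//]; apply: dart_tail_eq => //; rewrite tail_rdart av'.
rewrite isb isa'.
have noring k : ein A (r k) d.1 -> (d == b) || (d == rdart a') = (M d == M b).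
  move=> ke; have kv := ein_vin FA ke ve.
  apply/idP/eqP => [/orP[]/eqP->//|Md].
  have [kE|kE] := only k kv; subst k.
    have [->|E] := atg d dv ke; first by rewrite eqxx orbT.
    by move: mm; rewrite -Md E eqxx.
  have [E|->] := atf d dv ke; last by rewrite eqxx.
  by move: mm; rewrite -Md E m1 eqxx.
have [fo|[k fk]] := outerP f; have [go|[m gm]] := outerP g.
- rewrite !Zo// addbb; apply/esym/negP => /orP[]/eqP E; subst d.
    have [E|E] := ein_cases fg fe ge (As_ein bA); [move: fo|move: go]; by rewrite -E outer_r.
  have [E|E] := ein_cases fg fe ge (As_ein aA'); [move: fo|move: go]; by rewrite -E outer_r.
- by subst g; rewrite Zr Zo// addbF (noring m).
- by subst f; rewrite Zr Zo// addFb (noring k).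
subst f g; rewrite !Zr; apply/esym/negP => /orP[]/eqP E; subst d.
  have bi : ein A (r j) b.1.
    have [kE|kE] := only k (ein_vin FA fe ve); have [mE|mE] := only m (ein_vin FA ge ve); subst k m => //.
    by move: fg; rewrite eqxx.
  by move: mm; rewrite {1}(bb bi) eqxx.
have ai : ein A (r (ordS j)) (rdart a').1.
  have [kE|kE] := only k (ein_vin FA fe ve); have [mE|mE] := only m (ein_vin FA ge ve); subst k m => //.
  by move: fg; rewrite eqxx.
have [E|E] := atf _ dv ai; last by move: ba'; rewrite -E eqxx.
by move: mm; rewrite m2 E m1 eqxx.
Qed.

End FaceRing.

(** * Induction and sums along the cyclic order of the ring *)

Section CyclicSums.
Variables (l : nat).
Implicit Type i : 'I_l.

Lemma ordS_step (Q : 'I_l -> Prop) i0 : Q i0 -> (forall i, Q i -> Q (ordS i)) -> forall i, Q i.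
Proof.
move=> Q0 step i.
have l0 : (0 < l)%N by apply: leq_ltn_trans (ltn_ord i0).
have up n (i1 i2 : 'I_l) : Q i1 -> val i2 = ((i1 + n) %% l)%N -> Q i2.
  elim: n i2 => [|n IH] i2 q1.
    by rewrite addn0 modn_small ?ltn_ord// => /val_inj ->.
  move=> E; pose i3 : 'I_l := Ordinal (ltn_pmod (i1 + n) l0).
  have -> : i2 = ordS i3; last exact/step/IH.
  by apply: val_inj; rewrite E /= addnS -addn1 -[in RHS]addn1 modnDml.
apply: (up (l - i0 + i)%N i0) => //.
by rewrite addnA subnKC 1?ltnW ?ltn_ord// modnDl modn_small ?ltn_ord.
Qed.

(** [o] is given by partial sums of [h]; the vanishing total closes them up from the last index to
    the first. *)
Lemma cyclic_difference (h : 'I_l -> bool) : \big[addb/false]_i h i = false ->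
  exists o : 'I_l -> bool, forall i, o i (+) o (ordS i) = h i.
Proof.
move=> h0; exists (fun i => \big[addb/false]_(j < l | (j < i)%N) h j) => i.
have [il|il] := ltnP i.+1 l.
  rewrite /= modn_small// [X in _ (+) X](bigD1 i) //=.
  rewrite addbCA [X in _ (+) X](_ : _ = false) ?addbF//.
    have -> : \big[addb/false]_(j < l | (j < i.+1)%N && (j != i)) h j = \big[addb/false]_(j < l | (j < i)%N) h j.
      by apply: eq_bigl => j; rewrite ltnS [RHS]ltn_neqAle andbC.
    by rewrite addbb.
have il' : i.+1 = l by have := ltn_ord i; lia.
rewrite /= il' modnn [X in _ (+) X]big_pred0 ?addbF; last by move=> j; rewrite ltn0.
move: h0; rewrite (bigD1 i) //= => h0.
rewrite (eq_bigl (fun j => j != i)); first by move: h0; case: (\big[_/_]_(_ | _) _) (h i) => [] [].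
move=> j; have := ltn_ord j; rewrite -(inj_eq val_inj) /= -[X in (_ < X)%N]il' ltnS leq_eqVlt.
by case: ltngtP.
Qed.

End CyclicSums.

(* Walking along the cycle [A f] in the direction given by [s], [hit X Y d] says that
   the first vertex of [X] or [Y] met after traversing [d] is in [Y]. *)
Section FirstHit.
Variables (G : mgraph) (F : finType) (A : F -> {set dart G}).
Hypothesis FA : facial A.
Variables (s : F -> bool) (f : F).
Hypothesis one_cycle : forall Z : vert G -> Prop, (exists2 v, vin A f v & Z v) ->
  (forall d, As A s f d -> Z (tail d) -> Z (head d)) -> forall v, vin A f v -> Z v.

Inductive hit (X Y : pred (vert G)) : dart G -> Prop :=
| hit_here d : As A s f d -> Y (head d) -> hit X Y d
| hit_next d d' : As A s f d -> As A s f d' -> head d = tail d' ->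
    ~~ X (head d) -> ~~ Y (head d) -> hit X Y d' -> hit X Y d.

Lemma hit_As X Y d : hit X Y d -> As A s f d.
Proof. by case. Qed.

(** If neither set were hit, the walk would go once around the cycle avoiding both, although it
    passes a vertex of [X]. *)
Lemma hit_total (X Y : pred (vert G)) d : (exists2 v, vin A f v & X v) -> As A s f d ->
  hit X Y d \/ hit Y X d.
Proof.
move=> [q qf Xq] dA; apply: contrapT => /not_orP[n1 n2].
pose Z x := exists c, [/\ As A s f c, head c = x, ~ hit X Y c & ~ hit Y X c].
have [||c [cA cq _]] := one_cycle (Z := Z) _ _ qf.
- by exists (head d); [exact: (As_vin_head FA dA)|exists d].
- move=> d' dA' [c [cA cd m1 m2]]; exists d'.
  have nX : ~~ X (head c) by apply/negP => h; apply: m2; exact: hit_here.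
  have nY : ~~ Y (head c) by apply/negP => h; apply: m1; exact: hit_here.
  by split=> // h; [apply: m1|apply: m2]; exact: (hit_next cA dA').
by apply; apply: hit_here => //; rewrite cq.
Qed.

(** [back X z x] says that the walk starting at [x] reaches [X] without ever leaving the vertex
    [z]. *)
Inductive back (X : pred (vert G)) (z : vert G) : vert G -> Prop :=
| back_here x : X x -> back X z x
| back_step c : As A s f c -> tail c != z -> back X z (head c) -> back X z (tail c).

Lemma back_inv X z c : As A s f c -> ~~ X (tail c) -> back X z (tail c) ->
  back X z (head c) /\ tail c != z.
Proof.
move E : (tail c) => x cA nX h; case: h E nX => [y Xy _|c' cA' cz b E _]; first by rewrite Xy.
by have -> := As_tail FA cA cA' E.
Qed.

(* [Y] is connected by edges other than that of [d], so it does not lie on both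
   sides of [X]: the walk leaving [Y] through [d] cannot come back without
   meeting [X]. *)
Lemma no_return (X Y : pred (vert G)) (sh : pred (edge G)) d :
  (exists2 v, vin A f v & X v) -> (forall v, vin A f v -> X v -> Y v -> False) ->
  (forall Z : vert G -> Prop, (exists v, [/\ vin A f v, Y v & Z v]) ->
     (forall c, ein A f c.1 -> sh c.1 -> Y (tail c) -> Y (head c) -> Z (tail c) -> Z (head c)) ->
     forall v, vin A f v -> Y v -> Z v) ->
  As A s f d -> ~~ sh d.1 -> Y (tail d) -> ~ hit X Y d.
Proof.
move=> [q qf Xq] XY conn dA nd Yd hd.
have nXd : ~~ X (tail d) by apply/negP => Xd; exact: (XY _ (As_vin FA dA) Xd Yd).
have nBd : ~ back X (tail d) (tail d) by move=> /(back_inv dA nXd)[_]; rewrite eqxx.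
have nX x : vin A f x -> Y x -> ~~ X x by move=> fx Yx; apply/negP => Xx; exact: (XY x fx Xx Yx).
have reach c : hit X Y c -> back X (tail d) (head c) ->
    exists x, [/\ vin A f x, Y x & back X (tail d) x].
  elim=> [c' cA Yc b|c' c'' cA cA' E nX' nY' _ IH b].
    by exists (head c'); split=> //; exact: (As_vin_head FA cA).
  by apply: IH; rewrite E in b nX'; have [] := back_inv cA' nX' b.
(* If [head d] can reach [X] in this sense, so can the vertex of [Y] that is hit, and by
   connectedness of [Y] so can [tail d] itself, which is absurd. Otherwise the failure propagates
   forward around the whole cycle and no vertex is in [X]. *)
have [b|nb] := pselect (back X (tail d) (head d)).
  apply: nBd; apply: (conn _ (reach d hd b)) => //; last exact: (As_vin FA dA).
  move=> c ce shc Yt Yh b'; have [cA|] := boolP (As A s f c).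
    by have [] := back_inv cA (nX _ (As_vin FA cA) Yt) b'.
  rewrite -As_rdart// => cA; rewrite -(tail_rdart c); apply: back_step => //.
    apply: contraNneq nd => /(As_tail FA cA dA) <-; exact: shc.
  by rewrite head_rdart.
have key := one_cycle (Z := fun x => ~ back X (tail d) x).
apply: key qf _ => [||]; last exact: back_here.
- by exists (head d) => //; exact: (As_vin_head FA dA).
move=> c cA n b'; have [E|ne] := eqVneq (tail c) (tail d).
  have cd : c = d := As_tail FA cA dA E.
  by subst c; exact: nb.
by apply: n; exact: back_step.
Qed.

End FirstHit.

(** * Signs around the ring and the choice of an arc in each ring face *)

Section Surgery.
Variables (G : mgraph) (F : finType) (A : F -> {set dart G}).
Hypothesis FA : facial A.
Variables (l : nat) (r : 'I_l -> F).
Hypotheses (l_ge3 : (3 <= l)%N) (l_odd : odd l) (r_inj : injective r)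
  (ring_adj : forall i j v, i != j -> vin A (r i) v -> vin A (r j) v -> j = ordS i \/ i = ordS j)
  (ring_nodup : forall i j k v, i != j -> j != k -> i != k ->
     vin A (r i) v -> vin A (r j) v -> vin A (r k) v -> False)
  (ring_meet : forall i, exists v, vin A (r i) v && vin A (r (ordS i)) v)
  (ring_conn : forall i j (Z : vert G -> Prop), i != j ->
     (exists v, [/\ vin A (r i) v, vin A (r j) v & Z v]) ->
     (forall c : dart G, ein A (r i) c.1 -> ein A (r j) c.1 -> Z (tail c) -> Z (head c)) ->
     forall v, vin A (r i) v -> vin A (r j) v -> Z v)
  (ring_cycle : forall s i (Z : vert G -> Prop), (exists2 v, vin A (r i) v & Z v) ->
     (forall d, As A s (r i) d -> Z (tail d) -> Z (head d)) -> forall v, vin A (r i) v -> Z v).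

Let local_all k s v := forall e, v \in ends e -> coherent A k s e.

(** At one vertex the sign does not depend on the coherent orientation [t], and it does not change
    along a shared edge. Since the common boundary is connected, it is a function of [i] alone. *)
Lemma ring_sign : exists (g : 'I_l -> bool), forall i v t, vin A (r i) v ->
  vin A (r (ordS i)) v -> local_all (fun=> false) t v -> t (r i) (+) t (r (ordS i)) = g i.
Proof.
have [T TP] := choice (untwisted_local FA).
have [p pP] := choice ring_meet.
exists (fun i => T (p i) (r i) (+) T (p i) (r (ordS i))) => i v t iv Siv tco.
have iS := ordS_neq l_ge3 i; have rS : r i != r (ordS i) by rewrite (inj_eq r_inj).
have same v1 s1 s2 : vin A (r i) v1 -> vin A (r (ordS i)) v1 ->
    local_all (fun=> false) s1 v1 -> local_all (fun=> false) s2 v1 ->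
    s1 (r i) (+) s1 (r (ordS i)) = s2 (r i) (+) s2 (r (ordS i)).
  move=> h1 h2 c1 c2; have := coherent_uniq FA c1 c2 h1 h2.
  by case: (s1 _) (s1 _) (s2 _) (s2 _) => [] [] [] [].
rewrite (same v t (T v))//; last exact: TP.
apply/esym/eqP; pose Z w := T (p i) (r i) (+) T (p i) (r (ordS i)) == T w (r i) (+) T w (r (ordS i)).
apply: (ring_conn (Z := Z) iS _ _ iv Siv); first by exists (p i); rewrite /Z; have /andP[] := pP i.
move=> c ci cS; rewrite /Z => /eqP ->; apply/eqP.
have := TP _ _ (tail_ends c) _ _ c rS erefl ci cS; have := TP _ _ (head_ends c) _ _ c rS erefl ci cS.
rewrite !(AsE FA)//.
by case: (T _ _) (T _ _) (T _ _) (T _ _) (_ \in _) (_ \in _) => [] [] [] [] [] [].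
Qed.

Definition extend (h : 'I_l -> bool) (f : F) := if [pick i | r i == f] is Some i then h i else false.

Lemma extendE h i : extend h (r i) = h i.
Proof.
by rewrite /extend; case: pickP => [j /eqP/r_inj->//|/(_ i)]; rewrite eqxx.
Qed.

Section Anti.
Variable o : F -> bool.

Definition prev_vert i v := [exists j, (i == ordS j) && vin A (r j) v].
Definition next_vert i v := vin A (r (ordS i)) v.
(** The instance of [cls]: after [e], the walk in the direction of [o] meets the next face before
    the previous one. Face and dart are quantified, since [e] determines them only if it is not
    shared. *)
Definition first_class (e : edge G) : bool :=
  `[< exists i d, d.1 = e /\ hit A o (r i) (prev_vert i) (next_vert i) d >].

Lemma ordS_prev (i : 'I_l) : exists j, i = ordS j.
Proof.
have [g gK _] : bijective (@ordS l) by apply: injF_bij; exact: ordS_inj.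
by have := injF_onto (@ordS_inj l) i => /codomP[j ->]; exists j.
Qed.

Lemma ordS2_neq (i : 'I_l) : i != ordS (ordS i).
Proof.
apply/eqP => /(congr1 val) /=.
have := ltn_ord i; case: (ltnP i.+1 l) => h.
  rewrite (modn_small h); case: (ltnP i.+2 l) => h2; first by rewrite modn_small//; lia.
  have E : i.+2 = l by lia.
  by rewrite E modnn => _ i0; move: l_ge3 E; rewrite i0 => + E; rewrite -[X in (_ < X)%N]E.
move=> il; have -> : i.+1 = l by lia.
rewrite modnn modn_small; lia.
Qed.

Lemma prev_next i v : vin A (r i) v -> prev_vert i v -> next_vert i v -> False.
Proof.
move=> iv /existsP[j /andP[/eqP E jv]] Siv; subst i.
have h1 := ordS_neq l_ge3 j; have h2 := ordS_neq l_ge3 (ordS j); have h3 := ordS2_neq j.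
exact: (ring_nodup h1 h2 h3 jv iv Siv).
Qed.

Lemma alone i v : vin A (r i) v ->
  (forall j, vin A (r j) v -> j = i) <-> ~~ prev_vert i v /\ ~~ next_vert i v.
Proof.
move=> iv; split=> [only|[np nn] j jv].
  split; apply/negP.
    move=> /existsP[j /andP[/eqP E jv]]; have := ordS_neq l_ge3 j.
    by rewrite -E (only j jv) eqxx.
  by move=> /only E; have := ordS_neq l_ge3 i; rewrite E eqxx.
apply/eqP; apply: contraT => ji; rewrite eq_sym in ji.
have [E|E] := ring_adj ji iv jv; first by move: nn; rewrite /next_vert -E jv.
by move: np; rewrite /prev_vert => /existsPn/(_ j); rewrite E eqxx jv.
Qed.

Lemma not_shared_face i j e : ~~ shared_edge A r e -> ein A (r i) e -> ein A (r j) e -> i = j.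
Proof.
move=> ns ie je; apply/eqP; apply: contraNT ns => ij.
by apply/existsP; exists i; apply/existsP; exists j; rewrite ij ie.
Qed.

Lemma first_classP i d : As A o (r i) d -> ~~ shared_edge A r d.1 ->
  reflect (hit A o (r i) (prev_vert i) (next_vert i) d) (first_class d.1).
Proof.
move=> dA ns; apply: (iffP (asboolP _)) => [[j [c [cd h]]]|h]; last by exists i, d.
have cA := hit_As h.
have ij : j = i by apply: (not_shared_face ns); [rewrite -cd|]; [exact: As_ein cA|exact: As_ein dA].
subst j; have [<-//|E] := dart_eq cd.
by move: (As_irr FA dA); rewrite -E cA.
Qed.

Lemma prev_vert_ex i : exists2 v, vin A (r i) v & prev_vert i v.
Proof.
have [j ij] := ordS_prev i; have [v /andP[jv iv]] := ring_meet j.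
by exists v; rewrite ij//; apply/existsP; exists j; rewrite eqxx.
Qed.

Lemma next_vert_ex i : exists2 v, vin A (r i) v & next_vert i v.
Proof. by have [v /andP[iv jv]] := ring_meet i; exists v. Qed.

Lemma class_head i d : As A o (r i) d -> ~~ shared_edge A r d.1 ->
  (forall j, i = ordS j -> vin A (r j) (head d) -> first_class d.1 = false) /\
  (vin A (r (ordS i)) (head d) -> first_class d.1 = true).
Proof.
move=> dA ns; have iv := As_vin_head FA dA; split=> [j ij jv|Siv]; last first.
  by apply/(first_classP dA ns); exact: hit_here.
have pv : prev_vert i (head d) by apply/existsP; exists j; rewrite ij eqxx.
apply/negbTE/negP => /(first_classP dA ns) h; case: h iv pv => [c _ nc iv pv|c c' _ _ _ /negP np _ _ _ pv].
  exact: prev_next iv pv nc.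
exact: np.
Qed.

(** Unlike [class_head] this needs the common boundaries to be connected: a walk that leaves one of
    them by an edge that is not shared meets the other before it can return, by [no_return]. *)
Lemma class_tail i d : As A o (r i) d -> ~~ shared_edge A r d.1 ->
  (forall j, i = ordS j -> vin A (r j) (tail d) -> first_class d.1 = true) /\
  (vin A (r (ordS i)) (tail d) -> first_class d.1 = false).
Proof.
move=> dA ns.
have conn j : i != j -> forall Z : vert G -> Prop,
    (exists v, [/\ vin A (r i) v, vin A (r j) v & Z v]) ->
    (forall c, ein A (r i) c.1 -> shared_edge A r c.1 -> vin A (r j) (tail c) -> vin A (r j) (head c) ->
       Z (tail c) -> Z (head c)) ->
    forall v, vin A (r i) v -> vin A (r j) v -> Z v.
  move=> ij Z ex st; apply: (ring_conn ij ex) => c ci cj; apply: st => //.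
  - by apply/existsP; exists i; apply/existsP; exists j; rewrite ij ci.
  - exact: (ein_vin FA cj (tail_ends c)).
  - exact: (ein_vin FA cj (head_ends c)).
split=> [j ij jv|Siv].
  have ji : i != j by rewrite ij eq_sym (ordS_neq l_ge3).
  have prevE v : prev_vert i v = vin A (r j) v.
    apply/existsP/idP => [[k /andP[/eqP + kv]]|h]; last by exists j; rewrite ij eqxx.
    by rewrite ij => /ordS_inj ->.
  apply/(first_classP dA ns); have [//|h] := hit_total FA (@ring_cycle o i) (next_vert i) (prev_vert_ex i) dA.
  case: (no_return FA (@ring_cycle o i) (sh := shared_edge A r) _ _ _ dA ns _ h).
  - exact: next_vert_ex.
  - by move=> v iv h1 h2; exact: prev_next iv h2 h1.
  - move=> Z [v [iv pv Zv]] st w iw; rewrite prevE => jw; apply: (conn j ji Z) iw jw.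
      by exists v; rewrite -prevE.
    by move=> c ce sc jt jh; apply: st; rewrite ?prevE.
  - by rewrite prevE.
apply/negbTE/negP => /(first_classP dA ns).
apply: (no_return FA (@ring_cycle o i) (sh := shared_edge A r)) => //.
- exact: prev_vert_ex.
- by move=> v iv h1 h2; exact: prev_next iv h1 h2.
exact: (conn _ (ordS_neq l_ge3 i)).
Qed.


Lemma class_next i d d' : As A o (r i) d -> As A o (r i) d' -> head d = tail d' ->
  (forall j, vin A (r j) (head d) -> j = i) -> first_class d.1 = first_class d'.1.
Proof.
move=> dA dA' E only; have [np nn] := (alone (As_vin_head FA dA)).1 only.
have ns : ~~ shared_edge A r d.1 by rewrite (only_not_shared FA only (head_ends d)).
have ns' : ~~ shared_edge A r d'.1.
  by rewrite (only_not_shared FA only)// E tail_ends.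
apply/(first_classP dA ns)/(first_classP dA' ns') => h; last exact: (hit_next dA dA' E np nn h).
case: h dA E np nn => [c _ nc _ _ _|c c' _ cA' cc _ _ h _ E _ _]; first by rewrite nc.
by rewrite -(_ : c' = d')//; apply: (As_tail FA cA' dA'); rewrite -cc.
Qed.

End Anti.

(** At each junction [s] and the local solution differ by one sign, so the discrepancy between [s]
    and [o] is the same for all ring faces, and a global flip removes it. *)
Lemma ring_agree k o s : (forall v, exists t, local_all k t v /\
    forall i, vin A (r i) v -> t (r i) = o (r i)) ->
  (forall e, coherent A k s e) ->
  exists s', (forall e, coherent A k s' e) /\ forall i, s' (r i) = o (r i).
Proof.
move=> loc sco; have l_gt0 : (0 < l)%N by lia.
pose i0 := Ordinal l_gt0.
have same i : s (r i) (+) o (r i) = s (r i0) (+) o (r i0).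
  apply: (ordS_step (Q := fun i => s (r i) (+) o (r i) = s (r i0) (+) o (r i0)) (i0 := i0)) => // {}i <-.
  have [v /andP[iv Siv]] := ring_meet i; have [t [tco to]] := loc v.
  have := coherent_uniq FA (fun e _ => sco e) tco iv Siv.
  by rewrite !to// => ->.
have [E|E] := eqVneq (s (r i0)) (o (r i0)).
  by exists s; split=> // i; have := same i; rewrite E addbb; case: (s _) (o _) => [] [].
exists (fun f => ~~ s f); split=> [e|i]; first exact: coherent_flip.
by have := same i; move: E; case: (s (r i0)) (o (r i0)) (s (r i)) (o (r i)) => [] [] [] [].
Qed.

(* If the total sign of the ring is trivial the ring can be oriented coherently with
   its neighbours and nothing has to be cut; otherwise, [l] being odd, consecutive
   faces can be oriented in opposite ways. *)
Lemma ring_surgery : exists (o : F -> bool) (k : edge G -> bool),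
  (forall v, exists t, local_all k t v /\ forall i, vin A (r i) v -> t (r i) = o (r i)) /\
  forall s, (forall e, coherent A k s e) ->
    exists (L : finType) (lab : dart G -> L), labelled_map lab.
Proof.
have [g gP] := ring_sign; pose theta := \big[addb/false]_i g i.
(* The right-hand sides sum to [theta] plus [l] times [theta], which vanishes because [l] is odd. *)
have [h hP] : exists h : 'I_l -> bool, forall i, h i (+) h (ordS i) = g i (+) theta.
  apply: cyclic_difference; rewrite big_split /= -/theta.
  have -> : \big[addb/false]_(i < l) theta = odd l && theta.
    rewrite big_const_ord; elim: l => [//|n IH]; rewrite iterS IH /=.
    by case: (odd n) (theta) => [] [].
  by rewrite l_odd addbb.
pose o := extend h; have oE i : o (r i) = h i := extendE h i.
have [th|th] := boolP theta; last first.
  exists o, (fun=> false); split=> [v|s sco]; last first.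
    by have [lab labP] := oriented_labelled_map FA sco; exists F, lab.
  have [t0 tco0] := untwisted_local FA v.
  have [i iv|nov] := pickP (fun i => vin A (r i) v); last first.
    by exists t0; split=> // i; rewrite nov.
  have [t [tco ti]] := agree_flip FA (r i) (o (r i)) tco0.
  exists t; split=> // j jv; have [<-//|ij] := eqVneq i j.
  have [E|E] := ring_adj ij iv jv; subst.
    have := gP i v t iv jv tco; have := hP i; rewrite -!oE ti (negbTE th) addbF => <- /addbI.
    exact.
  have := gP j v t jv iv tco; have := hP j; rewrite -!oE ti (negbTE th) addbF => <-.
  by rewrite ![_ (+) o (r (ordS j))]addbC => /addbI.
have anti i v : vin A (r i) v -> vin A (r (ordS i)) v -> exists t,
   [/\ forall e, v \in ends e -> coherent A (fun=> false) t e,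
     t (r (ordS i)) = o (r (ordS i)) & t (r i) = ~~ o (r i)].
  move=> iv Siv; have [t0 tco0] := untwisted_local FA v.
  have [t [tco ti]] := agree_flip FA (r (ordS i)) (o (r (ordS i))) tco0.
  exists t; split=> //; have := gP i v t iv Siv tco; have := hP i; rewrite -!oE ti th.
  by case: (g i) (o _) (t _) (o _) => [] [] [] [].
have ch := class_head (o := o); have ct := class_tail (o := o); have cn := class_next (o := o).
exists o, (twist A r (first_class o)).
have loc := twisted_local FA l_ge3 r_inj ring_adj ring_nodup anti ch ct cn.
split=> // s0 sco0; have [s [sco so]] := ring_agree loc sco0.
have [lab labP] := twisted_labelled_map FA l_ge3 r_inj ring_adj ring_nodup anti ch ct cn sco so.
by exists (F + bool)%type, lab.
Qed.

End Surgery.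

(** * Facial cycles of the embedding *)

Lemma ordS_back l (Q : 'I_l -> Prop) i0 : Q i0 -> (forall i, Q (ordS i) -> Q i) -> forall i, Q i.
Proof.
move=> Q0 step i; apply: contrapT => nQ.
by apply: (ordS_step (Q := fun i => ~ Q i) nQ) Q0 => j + /step.
Qed.

Lemma card_le1_eq T (A : set T) x y : (A #<= `I_1)%card -> A x -> A y -> x = y.
Proof.
move=> /pcard_leP[f] Ax Ay.
have fx : `I_1 (f x) by exact: (@funS _ _ A `I_1 f).
have fy : `I_1 (f y) by exact: (@funS _ _ A `I_1 f).
apply: (@inj _ _ A f _ _ (mem_set Ax) (mem_set Ay)).
by move: fx fy; rewrite /= !ltnS !leqn0 => /eqP -> /eqP ->.
Qed.

Section Bridge.
Variables (R : realType) (G : mgraph) (P : topologicalType) (Psi : embedding R G P).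
Hypotheses (P_surf : surface R P) (Psi_closed : closed_2cell_embedding Psi).
Hypothesis no_isolated : forall v : vert G, exists e : edge G, v \in ends e.
Local Notation face := (face Psi).
Local Notation arc := (arc Psi).
Local Notation midp := (midp Psi).
Local Notation F := (faces Psi).
Implicit Type f : F.

Lemma bounding_cycle f : {C : cycle_of G | boundary (val f) = cycle_points Psi C}.
Proof. by apply: cid; exact: face_cycle (faceP P_surf Psi_closed f). Qed.

Local Notation C := (fun f => sval (bounding_cycle f)).

Definition cycle_darts f : {set dart G} :=
  [set d | `[< exists i, cedge (c := C f) i = d.1 /\ cvert (c := C f) i = tail d >]]%SET.
Local Notation A := cycle_darts.

Lemma cycle_dartsP f d : d \in A f ->
  exists i, [/\ cedge (c := C f) i = d.1, cvert i = tail d & cvert (ordS i) = head d].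
Proof.
rewrite inE => /asboolP[i [ie iv]]; exists i; split=> //.
have := cedge_ends i; rewrite ie iv ends_dart => /setP/(_ (head d)).
rewrite !inE eqxx orbT eq_sym (negbTE (tail_head d)) /= => /esym/eqP.
by [].
Qed.

Lemma cycle_dart_of f i : exists d, [/\ d \in A f, d.1 = cedge (c := C f) i,
  tail d = cvert i & head d = cvert (ordS i)].
Proof.
have vi : cvert i \in ends (cedge (c := C f) i) by rewrite cedge_ends !inE eqxx.
have [d de dv] := dart_of vi; have dA : d \in A f by rewrite inE; apply/asboolP; exists i.
exists d; split=> //; have [j [je _ <-]] := cycle_dartsP dA.
by move: je; rewrite de => /cedge_inj ->.
Qed.

Arguments cycle_dart_of {f} i.

Lemma vinP f v : vin A f v <-> closure (val f) (vpt Psi v).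
Proof.
rewrite (cycle_vert P_surf (faceP P_surf Psi_closed f) (svalP (bounding_cycle f))).
split=> [/existsP[d /andP[/cycle_dartsP[i [_ iv _]] /eqP <-]]|[i <-]]; first by exists i.
have [d [dA _ dv _]] := cycle_dart_of i.
by apply/existsP; exists d; rewrite dA dv eqxx.
Qed.

Lemma ein_closure f e : ein A f e <-> closure (val f) (midp e).
Proof.
rewrite (cycle_edge P_surf (faceP P_surf Psi_closed f) (svalP (bounding_cycle f)))//; last exact: half01.
split=> [/existsP[d /andP[/cycle_dartsP[i [ie _ _]] /eqP <-]]|[i <-]]; first by exists i.
have [d [dA de _ _]] := cycle_dart_of i.
by apply/existsP; exists d; rewrite dA de eqxx.
Qed.

Lemma cycle_facial : facial A.
Proof.
split.
- move=> f d /cycle_dartsP[i [ie iv iw]]; have [d' [dA' _ dv _]] := cycle_dart_of (ordS i).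
  by exists d'; rewrite // dv.
- move=> f d /cycle_dartsP[i [ie iv iw]]; have [j ij] := ordS_prev i.
  by have [d' [dA' _ _ dv]] := cycle_dart_of j; exists d'; rewrite // dv -ij.
- move=> f d d' /cycle_dartsP[i [ie iv iw]] /cycle_dartsP[j [je jv jw]] tt.
  have ij : i = j by apply: cvert_inj; rewrite iv jv.
  by apply: dart_tail_eq => //; rewrite -ie -je ij.
- move=> f d d' /cycle_dartsP[i [ie iv iw]] /cycle_dartsP[j [je jv jw]] tt.
  have ij : i = j by apply/ordS_inj/cvert_inj; rewrite iw jw.
  by apply: dart_tail_eq; rewrite -?ie -?je -?iv -?jv ij.
- move=> f d /cycle_dartsP[i [ie iv iw]]; apply/negP => /cycle_dartsP[j [je jv jw]].
  have ij : i = j by apply: cedge_inj; rewrite ie je.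
  by have := tail_head d; rewrite -iv ij jv eqxx.
- move=> e; have [f [g [ff gg fg H]]] := edge_two_faces P_surf Psi_closed e.
  have [f' E] := face_in P_surf Psi_closed ff; have [g' E'] := face_in P_surf Psi_closed gg; subst f g.
  exists f', g'; split; first by apply/eqP => E; apply: fg; rewrite E.
  move=> k; have kf := faceP P_surf Psi_closed k.
  apply/idP/orP => [/ein_closure/(H _ kf)[/val_inj->|/val_inj->]|]; rewrite ?eqxx; [by left|by right|].
  by move=> h; apply/ein_closure/(H _ kf); case: h => /eqP ->; [left|right].
move=> v Z [f [fv Zf]] step g gv.
suff : (fun X => exists2 h : F, val h = X & Z h) (val g) by move=> [h /val_inj <-].
apply: (link_connected P_surf Psi_closed no_isolated (v := v) (Z := fun X => exists2 h : F, val h = X & Z h)).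
- by exists (val f); split; [exact: faceP|exact/vinP|exists f].
- move=> X Y e Xf Yf ve Xe Ye [h hX Zh].
  have [k kY] := face_in P_surf Psi_closed Yf; exists k => //; apply: (step h k e) => //.
    by apply/ein_closure; rewrite hX.
  by apply/ein_closure; rewrite kY.
- exact: faceP.
exact/vinP.
Qed.

Lemma cycle_one (s : F -> bool) f (Z : vert G -> Prop) : (exists2 v, vin A f v & Z v) ->
  (forall d, As A s f d -> Z (tail d) -> Z (head d)) -> forall v, vin A f v -> Z v.
Proof.
move=> [v0 /existsP[d0 /andP[/cycle_dartsP[i0 [_ iv0 _]] /eqP E0]] Z0] step.
have all i : Z (cvert (c := C f) i); last first.
  by move=> v /existsP[d /andP[/cycle_dartsP[i [_ <- _]] /eqP <-]].
have Zi0 : Z (cvert (c := C f) i0) by rewrite iv0 E0.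
case E : (s f).
  apply: (ordS_back (Q := fun i => Z (cvert (c := C f) i)) Zi0) => j.
  have [d [dA _ dv dw]] := cycle_dart_of j; rewrite -dv -dw.
  by have := step (rdart d); rewrite /As E rdartK dA head_rdart; exact.
apply: (ordS_step (Q := fun i => Z (cvert (c := C f) i)) Zi0) => j.
have [d [dA _ dv dw]] := cycle_dart_of j; rewrite -dv -dw.
by apply: step; rewrite /As E.
Qed.

(** Turns coherence into the equations of the monodromy argument: the sum compares how the two
    facial cycles traverse the reference dart [(e, false)]. *)
Definition face_eqn (k : edge G -> bool) e :=
  ~~ k e (+) \big[addb/false]_(f | ein A f e) ((e, false) \in A f).

Lemma face_eqnE k (s : set P -> bool) e :
  edge_eqn Psi (face_eqn k) s e <-> coherent A k (fun f => s (val f)) e.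
Proof.
have FA := cycle_facial.
have sum f g : f != g -> ein A f e -> ein A g e ->
    face_eqn k e = ~~ k e (+) ((e, false) \in A f) (+) ((e, false) \in A g).
  move=> fg fe ge; rewrite /face_eqn -addbA; congr (_ (+) _).
  by apply: addb_sum_two => // h; apply/idP/orP => [/(ein_cases FA fg fe ge)[]->|[]/eqP->];
    rewrite ?eqxx; [left|right| |].
split=> [H f g d fg de fe ge|H X Y Xf Yf XY Xe Ye].
  apply: (coherentP FA (f := f) (g := g) (d := (e, false))) (fg) (de) (fe) (ge) => //.
  have := H (val f) (val g) (faceP P_surf Psi_closed f) (faceP P_surf Psi_closed g).
  rewrite (sum f g)// !(AsE FA)// => E.
  have := E _ _ _; rewrite addbACA => -> //.
  - by case: (_ \in _) (_ \in _) (k e) => [] [] [].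
  - by move/val_inj => fgE; rewrite fgE eqxx in fg.
  - exact/ein_closure.
  - exact/ein_closure.
have [f E] := face_in P_surf Psi_closed Xf; have [g E'] := face_in P_surf Psi_closed Yf; subst X Y.
have fg : f != g by apply/eqP => E; apply: XY; rewrite E.
have fe : ein A f e by apply/ein_closure. have ge : ein A g e by apply/ein_closure.
have := H f g (e, false) fg erefl fe ge; rewrite (sum f g)// !(AsE FA)//.
by case: (_ \in _) (_ \in _) (k e) (s _) (s _) => [] [] [] [] [].
Qed.

Definition on_faces (s : F -> bool) (X : set P) := if [pick f | val f == X] is Some f then s f else false.

Lemma on_facesE s f : on_faces s (val f) = s f.
Proof.
rewrite /on_faces; case: pickP => [g /eqP/val_inj->//|/(_ f)]; by rewrite eqxx.
Qed.

Variables (l : nat) (D : 'I_l -> set P).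
Hypotheses (D_ring : face_ring Psi D) (D_elem : elementary D) (l_ge3 : (3 <= l)%N).

Lemma ring_faces : exists r : 'I_l -> F, injective r /\ forall i, val (r i) = D i.
Proof.
have [fD inj _] := D_ring.
have [r rP] := choice (fun i => face_in P_surf Psi_closed (fD i)).
by exists r; split=> // i j E; apply: inj; rewrite -!rP E.
Qed.

Section Ring.
Variable r : 'I_l -> F.
Hypotheses (r_inj : injective r) (rD : forall i, val (r i) = D i).

Lemma closure_boundary f v : closure (val f) (vpt Psi v) -> boundary (val f) (vpt Psi v).
Proof.
move=> cv; rewrite (boundary_face P_surf (faceP P_surf Psi_closed f)); split=> //.
by move=> /(face_graph (faceP P_surf Psi_closed f)); apply; exact: vpt_graph.
Qed.

Lemma vin_boundary i v : vin A (r i) v -> boundary (D i) (vpt Psi v).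
Proof. by move=> /vinP/closure_boundary; rewrite rD. Qed.

Lemma boundary_closure i x : boundary (D i) x -> closure (val (r i)) x.
Proof. by rewrite rD => -[]. Qed.

Lemma ring_shape :
  [/\ forall i j k m, i != j -> k != m -> [set i; j]%SET != [set k; m]%SET ->
        boundary (D i) `&` boundary (D j) `&` (boundary (D k) `&` boundary (D m)) = set0,
      forall i, boundary (D i) `&` boundary (D (ordS i)) !=set0 &
      forall i j, i != j -> j != ordS i -> i != ordS j -> boundary (D i) `&` boundary (D j) = set0].
Proof. by have [_ _ [[E _]|[]//]] := D_ring; exfalso; move: l_ge3; rewrite [l in (_ < l)%N]E. Qed.

Lemma ring_adjacent i j v : i != j -> vin A (r i) v -> vin A (r j) v -> j = ordS i \/ i = ordS j.
Proof.
move=> ij /vin_boundary iv /vin_boundary jv; apply: contrapT => /not_orP[/eqP n1 /eqP n2].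
have [_ _ H] := ring_shape.
by have : (boundary (D i) `&` boundary (D j)) (vpt Psi v) by []; rewrite H.
Qed.

Lemma ring_triple i j k v : i != j -> j != k -> i != k ->
  vin A (r i) v -> vin A (r j) v -> vin A (r k) v -> False.
Proof.
move=> ij jk ik /vin_boundary iv /vin_boundary jv /vin_boundary kv; have [H _ _] := ring_shape.
have := H i j j k ij jk; case: eqP => [/setP/(_ i)|_ /(_ isT) E].
  by rewrite !inE eqxx (negbTE ij) (negbTE ik).
by have : (boundary (D i) `&` boundary (D j) `&` (boundary (D j) `&` boundary (D k))) (vpt Psi v) by [];
  rewrite E.
Qed.

Lemma common_cases i j x : i != j -> boundary (D i) x -> boundary (D j) x ->
  (exists c : dart G, [/\ ein A (r i) c.1, ein A (r j) c.1 & arc c.1 x]) \/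
  exists v, [/\ vin A (r i) v, vin A (r j) v & x = vpt Psi v].
Proof.
move=> ij ix jx; have fi := faceP P_surf Psi_closed (r i); have fj := faceP P_surf Psi_closed (r j).
have ci := boundary_closure ix; have cj := boundary_closure jx.
have rij : val (r i) <> val (r j) by move=> /val_inj/r_inj E; rewrite E eqxx in ij.
have [[e [ei ej ex]]|[v xv]] := closures_meet P_surf Psi_closed fi fj rij ci cj.
  by left; exists (e, false); split=> //; exact/ein_closure.
by right; exists v; rewrite xv in ci cj; split=> //; exact/vinP.
Qed.

Lemma ring_touch i : exists v, vin A (r i) v && vin A (r (ordS i)) v.
Proof.
have FA := cycle_facial; have [_ H _] := ring_shape; have [x [xi xS]] := H i.
have [[c [ci cS _]]|[v [vi vS _]]] := common_cases (ordS_neq l_ge3 i) xi xS.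
  by exists (tail c); rewrite (ein_vin FA ci (tail_ends c)) (ein_vin FA cS (tail_ends c)).
by exists v; rewrite vi.
Qed.

(** Faces that touch at most once have a connected common boundary. If [Z] held at some but not all
    of its vertices, the pieces with and without [Z] would be disjoint closed sets covering it. *)
Lemma ring_connected i j (Z : vert G -> Prop) : i != j ->
  (exists v, [/\ vin A (r i) v, vin A (r j) v & Z v]) ->
  (forall c : dart G, ein A (r i) c.1 -> ein A (r j) c.1 -> Z (tail c) -> Z (head c)) ->
  forall v, vin A (r i) v -> vin A (r j) v -> Z v.
Proof.
move=> ij [v0 [iv0 jv0 Zv0]] step v iv jv; apply: contrapT => nZ.
pose K := boundary (D i) `&` boundary (D j).
have Kv w : vin A (r i) w -> vin A (r j) w -> K (vpt Psi w).
  by move=> /vin_boundary ? /vin_boundary ?.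
have Kconn : connected K.
  have [[E _]|[_ /(_ i j ij) le1]] := D_elem; first by exfalso; move: l_ge3; rewrite [l in (_ < l)%N]E.
  suff <- : connected_component K (vpt Psi v) = K by exact: component_connected.
  apply/seteqP; split; first exact: connected_component_sub.
  move=> y Ky; have yy := connected_component_refl Ky.
  rewrite (card_le1_eq le1 (x := connected_component K (vpt Psi v)) (y := connected_component K y))//.
    by exists (vpt Psi v) => //; exact: Kv.
  by exists y.
have hausP := surface_hausdorff P_surf.
(* Used for [Z] and for its negation; both spread along shared edges, so testing the tail of an edge
   is enough. *)
pose X (Q : vert G -> Prop) := (\bigcup_(w in [set w | Q w]) [set vpt Psi w]) `|`
  \bigcup_(c in [set c : dart G | [/\ ein A (r i) c.1, ein A (r j) c.1 & Q (tail c)]]) arc c.1.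
have Xcl Q : closed (X Q).
  apply: closedU; apply: closed_bigcup; do ?exact: finite_finset; first by move=> w _; exact/accessible_closed_set1/hausdorff_accessible.
  by move=> c _; exact: arc_closed.
have Xv Q w : Q w -> X Q (vpt Psi w) by move=> Qw; left; exists w.
have step' c : ein A (r i) c.1 -> ein A (r j) c.1 -> Z (head c) -> Z (tail c).
  by move=> ci cj Zh; rewrite -head_rdart; apply: step; rewrite ?tail_rdart.
have XQ Q c w : (Q = Z \/ Q = (fun w => ~ Z w)) -> ein A (r i) c.1 -> ein A (r j) c.1 ->
    Q (tail c) -> w \in ends c.1 -> Q w.
  move=> QZ ci cj; rewrite ends_dart !inE => Qt /orP[]/eqP-> //.
  by case: QZ Qt => ->; [exact: step|move=> h /(step' _ ci cj)].
have disj x : X Z x -> X (fun w => ~ Z w) x -> False.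
  move=> [[w Zw ->]|[c [ci cj Zc] cx]] [[w' Zw' E]|[c' [ci' cj' Zc'] cx']].
  - by apply: Zw'; rewrite /= -(vpt_inj E).
  - by move: cx' => /vpt_arc /(XQ _ _ _ (or_intror erefl) ci' cj' Zc'); apply.
  - by move: cx; rewrite E => /vpt_arc /(XQ _ _ _ (or_introl erefl) ci cj Zc).
  have [E|ne] := pselect (c.1 = c'.1).
    have h := XQ _ c' (tail c) (or_intror erefl) ci' cj' Zc'.
    by apply: h => //; rewrite -E tail_ends.
  have [w [_ w1 w2]] := arc_inter ne cx cx'.
  by apply: (XQ _ _ _ (or_intror erefl) ci' cj' Zc' w2); exact: (XQ _ _ _ (or_introl erefl) ci cj Zc w1).
have cover : K `<=` X Z `|` X (fun w => ~ Z w).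
  move=> x [ix jx]; have [[c [ci cj cx]]|[w [iw jw ->]]] := common_cases ij ix jx.
    by have [h|h] := pselect (Z (tail c)); [left|right]; right; exists c.
  by have [h|h] := pselect (Z w); [left|right]; exact: Xv.
have sub := connected_closed_sub Kconn (Xcl Z) (Xcl (fun w => ~ Z w)) cover
  (fun x _ => disj x) (Kv _ iv0 jv0) (Xv Z v0 Zv0).
exact: disj (sub _ (Kv _ iv jv)) (Xv (fun w => ~ Z w) v nZ).
Qed.

End Ring.
End Bridge.

Lemma ring_labelled_map (R : realType) (G : mgraph) (P : topologicalType)
    (Psi : embedding R G P) (l : nat) (D : 'I_l -> set P) :
  projective_plane R P -> closed_2cell_embedding Psi ->
  (forall v : vert G, exists e : edge G, v \in ends e) ->
  face_ring Psi D -> elementary D -> noncontractible R D -> odd l -> (3 <= l)%N ->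
  exists (L : finType) (lab : dart G -> L), labelled_map lab.
Proof.
move=> P_proj Psi_closed no_isolated D_ring D_elem [c [c_simple c_sub c_nonc]] l_odd l_ge3.
have P_surf := P_proj.1; have FA := cycle_facial P_surf Psi_closed no_isolated.
have [r [r_inj rD]] := ring_faces P_surf Psi_closed D_ring.
have [ori [k [loc finish]]] := ring_surgery FA l_ge3 l_odd r_inj (ring_adjacent D_ring l_ge3 rD)
  (ring_triple D_ring l_ge3 rD) (ring_touch P_surf Psi_closed no_isolated D_ring l_ge3 r_inj rD)
  (ring_connected D_elem l_ge3 r_inj rD) (fun s i => @cycle_one _ _ _ _ P_surf Psi_closed s (r i)).
have eqnE t e : coherent (cycle_darts P_surf Psi_closed) k t e ->
    edge_eqn Psi (face_eqn P_surf Psi_closed k) (on_faces t) e.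
  move=> h; apply/(face_eqnE P_surf Psi_closed no_isolated).
  by rewrite (_ : (fun f => _) = t)//; apply/funext => f; exact: on_facesE.
have [||||s sP] := global_section P_proj Psi_closed no_isolated (c := face_eqn P_surf Psi_closed k)
  (ring := range D) (o := on_faces ori) _ _ _ c_simple _ c_nonc.
- by move=> v; have [t [tco _]] := loc v; exists (on_faces t) => e /tco /eqnE.
- by move=> _ [i _ <-]; rewrite -rD; exact: faceP.
- move=> v _ _ _; have [t [tco to]] := loc v; exists (on_faces t); split=> [e /tco /eqnE//|].
  by move=> _ [i _ <-]; rewrite -rD !on_facesE => h; apply: to; exact/vinP.
- by move=> x /c_sub[i _ xi]; exists (D i) => //; exists i.
by apply: (finish (fun f => s (val f))) => e; apply/(face_eqnE P_surf Psi_closed no_isolated).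
Qed.

(** * Orientation of bent linear maps *)

Section Orientation.
Variable R : realType.
Local Notation R2 := (R * R)%type.
Implicit Types p q : R2.

Definition cross p q := p.1 * q.2 - p.2 * q.1.
Local Notation nonzero := [set p : R2 | p <> 0].

Lemma circle_homotopic_trans (T : topologicalType) (X : set T) (f g h : R2 -> T) :
  circle_homotopic X f g -> circle_homotopic X g h -> circle_homotopic X f h.
Proof.
move=> [H [cH HX Hf Hg]] [K [cK KX Kg Kh]].
pose M (z : R * R2) := if z.1 <= 1 / 2 then H (2 * z.1, z.2) else K (2 * z.1 - 1, z.2).
have closedIC : closed (@unit_interval R `*` @circle R).
  apply: compact_closed; first exact: norm_hausdorff.
  by apply: compact_setX; [exact: unit_interval_compact|exact: circle_compact].
have cover : @unit_interval R `*` @circle R = (@unit_interval R `*` @circle R) `&`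
   ([set z | z.1 <= 1 / 2] `|` [set z | 1 / 2 <= z.1]).
  by apply/seteqP; split=> [z [z1 z2]|z [] //]; split=> //=; case: (lerP z.1 (1/2)) => z3; [by left|by right; exact: ltW].
have lo (z : R * R2) : unit_interval z.1 -> circle z.2 -> z.1 <= 1 / 2 ->
    (@unit_interval R `*` @circle R) (2 * z.1, z.2).
  by move=> /andP[a b] c z3; split=> //; rewrite /unit_interval /=; lra.
have hi (z : R * R2) : unit_interval z.1 -> circle z.2 -> 1 / 2 <= z.1 ->
    (@unit_interval R `*` @circle R) (2 * z.1 - 1, z.2).
  by move=> /andP[a b] c z3; split=> //; rewrite /unit_interval /=; lra.
have MK (z : R * R2) : circle z.2 -> 1 / 2 <= z.1 -> M z = K (2 * z.1 - 1, z.2).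
  move=> c z3; rewrite /M; case: (lerP z.1 (1/2)) => // z4.
  have -> : z.1 = 1 / 2 by lra.
  by rewrite (_ : 2 * (1 / 2) = 1) ?subrr ?Hg ?Kg//; lra.
have MH (z : R * R2) : z.1 <= 1 / 2 -> M z = H (2 * z.1, z.2) by rewrite /M => ->.
exists M; split.
- rewrite cover setIUr; apply: (@within_glue _ _ _ _ (fun z : R * R2 => H (2 * z.1, z.2)) (fun z : R * R2 => K (2 * z.1 - 1, z.2)) M).
  + apply: closedI => //; apply: (@closed_comp _ _ (fst : R * R2 -> R) [set u : R | u <= 1 / 2]); last exact: closed_le.
    by move=> z _; exact: cvg_fst.
  + apply: closedI => //; apply: (@closed_comp _ _ (fst : R * R2 -> R) [set u : R | 1 / 2 <= u]); last exact: closed_ge.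
    by move=> z _; exact: cvg_fst.
  + apply: (within_comp (B := @unit_interval R `*` @circle R) (f := fun z : R * R2 => (2 * z.1, z.2))) => //; first by wcont.
    by move=> z [[z1 z2] z3]; exact: lo.
  + apply: (within_comp (B := @unit_interval R `*` @circle R) (f := fun z : R * R2 => (2 * z.1 - 1, z.2))) => //; first by wcont.
    by move=> z [[z1 z2] z3]; exact: hi.
  + by move=> z [_ z3]; exact: MH.
  + by move=> z [[_ z2] z3]; exact: MK.
- move=> _ [z [z1 z2] <-]; have [z3|z3] := lerP z.1 (1 / 2).
    by rewrite MH//; apply: HX; exists (2 * z.1, z.2) => //; exact: lo.
  by rewrite MK// ?ltW//; apply: KX; exists (2 * z.1 - 1, z.2) => //; apply: hi => //; exact: ltW.
- by move=> p cp; rewrite MH /=; [rewrite mulr0 Hf|lra].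
- by move=> p cp; rewrite MK//=; [rewrite mulr1 (_ : 2 - 1 = 1) ?Kh//; lra|lra].
Qed.

Lemma circle_homotopic_ext (T : topologicalType) (X : set T) (f f' g : R2 -> T) :
  (forall p, circle p -> f p = f' p) -> circle_homotopic X f g -> circle_homotopic X f' g.
Proof. by move=> E [H [h1 h2 h3 h4]]; exists H; split=> // p cp; rewrite h3 ?E. Qed.

Lemma segment_homotopic (f g : R2 -> R2) :
  {within @circle R, continuous f} -> {within @circle R, continuous g} ->
  (forall p (s : R), circle p -> 0 <= s <= 1 ->
     ((1 - s) * (f p).1 + s * (g p).1, (1 - s) * (f p).2 + s * (g p).2) <> 0) ->
  circle_homotopic nonzero f g.
Proof.
move=> cf cg nz.
have c2 (k : R2 -> R2) : {within @circle R, continuous k} ->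
    {within @unit_interval R `*` @circle R, continuous (fun z : R * R2 => k z.2)}.
  move=> ck; apply: (within_comp (B := @circle R) (f := snd)) => //; first exact: wc_snd0.
  by move=> z [].
exists (fun z => ((1 - z.1) * (f z.2).1 + z.1 * (g z.2).1, (1 - z.1) * (f z.2).2 + z.1 * (g z.2).2)); split.
- by have cf' := c2 _ cf; have cg' := c2 _ cg; wcont.
- by move=> _ [z [z1 z2] <-]; exact: nz.
- by move=> p _ /=; rewrite subr0 !mul1r !mul0r !addr0 -surjective_pairing.
- by move=> p _ /=; rewrite subrr !mul1r !mul0r !add0r -surjective_pairing.
Qed.

Definition lin (a b c d : R) p : R2 := (a * p.1 + b * p.2, c * p.1 + d * p.2).

Lemma convex_gt0 (k x y : R) : 0 <= k <= 1 -> 0 < x -> 0 < y -> 0 < (1 - k) * x + k * y.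
Proof.
move=> /andP[k0 k1] x0 y0; have [->|kn] := eqVneq k 0; first by rewrite subr0 mul1r mul0r addr0.
apply: ltr_wpDl; first by apply: mulr_ge0; [rewrite subr_ge0|exact: ltW].
by apply: mulr_gt0 => //; rewrite lt_neqAle eq_sym kn.
Qed.

Lemma lin_neq0 a b c d p : p <> 0 -> a * d - b * c != 0 -> lin a b c d p <> 0.
Proof.
move=> p0 D E; apply: p0; case: E => E1 E2.
have h1 : (a * d - b * c) * p.1 = 0.
  by transitivity (d * (a * p.1 + b * p.2) - b * (c * p.1 + d * p.2)); [ring|rewrite E1 E2; ring].
have h2 : (a * d - b * c) * p.2 = 0.
  by transitivity (a * (c * p.1 + d * p.2) - c * (a * p.1 + b * p.2)); [ring|rewrite E1 E2; ring].
move/eqP: h1; rewrite mulf_eq0 (negbTE D) => /eqP p1.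
move/eqP: h2; rewrite mulf_eq0 (negbTE D) => /eqP p2.
exact: pair_ext.
Qed.

Lemma circle_neq0 p : circle p -> p <> 0.
Proof. by rewrite /circle /= => + p0; rewrite p0 /= expr0n addr0 => /eqP; rewrite eq_sym oner_eq0. Qed.

Lemma lin_cont a b c d (A : set R2) : {within A, continuous (lin a b c d)}.
Proof. by rewrite /lin; wcont. Qed.

Lemma lin_segment a b c d a' b' c' d' :
  (forall s : R, 0 <= s <= 1 -> ((1 - s) * a + s * a') * ((1 - s) * d + s * d') -
     ((1 - s) * b + s * b') * ((1 - s) * c + s * c') != 0) ->
  circle_homotopic nonzero (lin a b c d) (lin a' b' c' d').
Proof.
move=> D; apply: segment_homotopic; [exact: lin_cont|exact: lin_cont|] => p s cp s01.
have := lin_neq0 (circle_neq0 cp) (D s s01); congr (_ <> _).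
by rewrite /lin /=; congr pair; ring.
Qed.

(* In complex notation a linear map of positive determinant is [z |-> u z + v z^*]
   with [|u| > |v|]: first let [v] go to 0, then move [u] to 1 avoiding 0. *)
Lemma lin_homotopic_id a b c d : 0 < a * d - b * c -> circle_homotopic nonzero (lin a b c d) id.
Proof.
move=> D; pose x := (a + d) / 2; pose y := (c - b) / 2.
have xy : 0 < x ^+ 2 + y ^+ 2.
  by rewrite /x /y; have := sqr_ge0 (a - d); have := sqr_ge0 (b + c); lra.
have idE : circle_homotopic nonzero (lin 1 0 0 1) id.
  apply: (@circle_homotopic_ext _ _ id); first by move=> p _; rewrite /lin !mul1r !mul0r addr0 add0r -surjective_pairing.
  apply: segment_homotopic; [exact: wc_id|exact: wc_id|] => p s cp _.
  have := circle_neq0 cp; congr (_ <> _); rewrite [LHS]surjective_pairing.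
  by congr pair; ring.
have conf u v u' v' : (forall s : R, 0 <= s <= 1 -> 0 < ((1 - s) * u + s * u') ^+ 2 + ((1 - s) * v + s * v') ^+ 2) ->
    circle_homotopic nonzero (lin u (- v) v u) (lin u' (- v') v' u').
  move=> H; apply: lin_segment => s s01; apply: lt0r_neq0; have := H s s01.
  by congr (_ < _); ring.
have to1 u v : 0 < u ^+ 2 + v ^+ 2 -> (v = 0 -> 0 < u) -> circle_homotopic nonzero (lin u (- v) v u) id.
  move=> uv u0; apply: circle_homotopic_trans idE.
  have := conf u v 1 0; rewrite oppr0; apply=> s s01.
  rewrite mulr1 mulr0 addr0 lt_neqAle addr_ge0 ?sqr_ge0// andbT eq_sym; apply/eqP => E.
  have [h1 h2] := sumsq_eq0 E; have [v0|v0] := eqVneq v 0; first by have := u0 v0; nra.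
  have s1 : s = 1 by move/eqP: h2; rewrite mulf_eq0 (negbTE v0) orbF => /eqP; lra.
  by move: h1; rewrite s1; lra.
apply: (@circle_homotopic_trans _ _ _ (lin x (- y) y x)).
  apply: lin_segment => s s01; apply: lt0r_neq0; rewrite /x /y.
  pose t := 1 - s; have ts : 0 <= t <= 1 by rewrite /t; lra.
  have -> : s = 1 - t by rewrite /t; lra.
  have h1 := sqr_ge0 (a - d); have h2 := sqr_ge0 (b + c).
  have t2 : 0 <= t ^+ 2 <= 1 by nra.
  have : 0 <= (1 - t ^+ 2) * ((a - d) ^+ 2 + (b + c) ^+ 2) by apply: mulr_ge0; lra.
  nra.
have [y0|y0] := eqVneq y 0; last by apply: to1 => // E; rewrite E eqxx in y0.
have [x0|x0] := ltP 0 x; first exact: to1.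
(* For [u] real and negative the segment to 1 passes through 0; a detour through [i] avoids it. *)
apply: (@circle_homotopic_trans _ _ _ (lin 0 (- 1) 1 0)).
  apply: conf => s s01; rewrite y0 !mulr0 add0r addr0 mulr1.
  move: xy; rewrite y0 expr0n addr0 => xy.
  have [->|s0] := eqVneq s 0; first by rewrite subr0 mul1r expr0n addr0.
  by apply: ltr_wpDl; [exact: sqr_ge0|rewrite exprn_even_gt0].
by apply: to1; [rewrite expr0n expr1n add0r|move=> /eqP; rewrite oner_eq0].
Qed.

(** The positive part has slopes between 0 and 1, so increments of a bent map are those of a linear
    map between its two linear pieces. *)
Lemma max_increment (u w : R) : exists2 t : R, 0 <= t <= 1 & Num.max 0 (u + w) - Num.max 0 u = t * w.
Proof.
have [->|w0] := eqVneq w 0; first by exists 0; rewrite ?lexx ?ler01// addr0 subrr mulr0.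
exists ((Num.max 0 (u + w) - Num.max 0 u) / w); last by rewrite divfK.
have [wp|wn] := ltP 0 w.
  rewrite ler_pdivlMr// mul0r ler_pdivrMr// mul1r.
  by have [h1|h1] := leP 0 (u + w); have [h2|h2] := leP 0 u; rewrite ?(max_l h1) ?(max_r h1); lra.
have {}wn : w < 0 by rewrite lt_neqAle w0.
rewrite ler_ndivlMr// mul0r ler_ndivrMr// mul1r.
by have [h1|h1] := leP 0 (u + w); have [h2|h2] := leP 0 u; lra.
Qed.

(* Letting [(v, w)] go to 0 straightens the map while the determinants on both sides
   of the line stay positive. *)
Lemma bent_homotopic a b c d e f v w x (r : R) : 0 < r -> 0 < a * d - b * c ->
  0 < (a + v * e) * (d + w * f) - (b + v * f) * (c + w * e) ->
  let L p : R2 := (a * p.1 + b * p.2 + Num.max 0 (e * p.1 + f * p.2) * v,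
                   c * p.1 + d * p.2 + Num.max 0 (e * p.1 + f * p.2) * w) in
  circle_homotopic nonzero (fun p => L (x.1 + r * p.1, x.2 + r * p.2) - L x) id.
Proof.
move=> r0 D1 D2 L; apply: (@circle_homotopic_trans _ _ _ (lin (r * a) (r * b) (r * c) (r * d))); last first.
  apply: lin_homotopic_id; have := mulr_gt0 (mulr_gt0 r0 r0) D1; congr (_ < _); ring.
apply: segment_homotopic; [|exact: lin_cont|] => [|p s cp s01].
  by apply: (within_eq (f := fun p => ((L (x.1 + r * p.1, x.2 + r * p.2)).1 - (L x).1,
    (L (x.1 + r * p.1, x.2 + r * p.2)).2 - (L x).2))); rewrite // /L /=; wcont.
have [t t01 tE] := max_increment (e * x.1 + f * x.2) (e * (r * p.1) + f * (r * p.2)).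
pose k := (1 - s) * t.
have k01 : 0 <= k <= 1 by rewrite /k; nra.
(* The bend adds a matrix of rank one, so the terms in [k ^+ 2] cancel and the determinant is a
   convex combination of those of the two pieces. *)
have D : 0 < (r * (a + k * (v * e))) * (r * (d + k * (w * f))) - (r * (b + k * (v * f))) * (r * (c + k * (w * e))).
  have -> : r * (a + k * (v * e)) * (r * (d + k * (w * f))) - r * (b + k * (v * f)) * (r * (c + k * (w * e))) =
    r ^+ 2 * ((1 - k) * (a * d - b * c) + k * ((a + v * e) * (d + w * f) - (b + v * f) * (c + w * e))) by ring.
  apply: mulr_gt0; first exact: exprn_gt0.
  exact: convex_gt0.
have := lin_neq0 (circle_neq0 cp) (lt0r_neq0 D); congr (_ <> _).
rewrite /L /lin /=.
have -> : e * (x.1 + r * p.1) + f * (x.2 + r * p.2) = e * x.1 + f * x.2 + (e * (r * p.1) + f * (r * p.2)) by ring.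
have {tE} -> : Num.max 0 (e * x.1 + f * x.2 + (e * (r * p.1) + f * (r * p.2))) =
   Num.max 0 (e * x.1 + f * x.2) + t * (e * (r * p.1) + f * (r * p.2)) by rewrite -tE; ring.
by congr pair; rewrite /k /=; ring.
Qed.

(* [U] is covered by the sectors on both sides of [b]; on each, [h] is affine and
   maps 0 to [a'], [b] to 0 and the third corner [c] or [d] to [c'] or [d']. *)
Lemma bent_orientation (U : set R2) (h : R2 -> R2) (b c d a' c' d' : R2) :
  0 < cross b c -> cross b d < 0 -> 0 < cross c' a' -> 0 < cross a' d' ->
  (forall y, U y -> exists s t : R, 0 <= t /\
     ((y = (s * b.1 + t * c.1, s * b.2 + t * c.2) /\
       h y = ((1 - s - t) * a'.1 + t * c'.1, (1 - s - t) * a'.2 + t * c'.2)) \/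
      (y = (s * b.1 + t * d.1, s * b.2 + t * d.2) /\
       h y = ((1 - s - t) * a'.1 + t * d'.1, (1 - s - t) * a'.2 + t * d'.2)))) ->
  orientation_preserving U h.
Proof.
move=> bc bd ca ad H x r r0 xU.
have bd0 : cross b d != 0 by rewrite lt_eqF. have bc0 : cross b c != 0 by rewrite gt_eqF.
(* [A] is the linear map with [b |-> - a'] and [d |-> d' - a'] *)
pose A11 := (- a'.1 * d.2 - (d'.1 - a'.1) * b.2) / cross b d.
pose A12 := (a'.1 * d.1 + (d'.1 - a'.1) * b.1) / cross b d.
pose A21 := (- a'.2 * d.2 - (d'.2 - a'.2) * b.2) / cross b d.
pose A22 := (a'.2 * d.1 + (d'.2 - a'.2) * b.1) / cross b d.
have Ab1 : A11 * b.1 + A12 * b.2 = - a'.1 by rewrite /A11 /A12 /cross; field.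
have Ab2 : A21 * b.1 + A22 * b.2 = - a'.2 by rewrite /A21 /A22 /cross; field.
have Ad1 : A11 * d.1 + A12 * d.2 = d'.1 - a'.1 by rewrite /A11 /A12 /cross; field.
have Ad2 : A21 * d.1 + A22 * d.2 = d'.2 - a'.2 by rewrite /A21 /A22 /cross; field.
pose v := (c'.1 - a'.1 - (A11 * c.1 + A12 * c.2)) / cross b c.
pose w := (c'.2 - a'.2 - (A21 * c.1 + A22 * c.2)) / cross b c.
have vE : cross b c * v = c'.1 - a'.1 - (A11 * c.1 + A12 * c.2) by rewrite /v; field.
have wE : cross b c * w = c'.2 - a'.2 - (A21 * c.1 + A22 * c.2) by rewrite /w; field.
move: A11 A12 A21 A22 v w Ab1 Ab2 Ad1 Ad2 vE wE => A11 A12 A21 A22 v w Ab1 Ab2 Ad1 Ad2 vE wE.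
pose L p : R2 := (A11 * p.1 + A12 * p.2 + Num.max 0 (- b.2 * p.1 + b.1 * p.2) * v,
                  A21 * p.1 + A22 * p.2 + Num.max 0 (- b.2 * p.1 + b.1 * p.2) * w).
have hL y : U y -> h y = ((L y).1 + a'.1, (L y).2 + a'.2).
  move=> /H[s [t [t0 [[yE ->]|[yE ->]]]]]; rewrite /L yE /=.
    have -> : - b.2 * (s * b.1 + t * c.1) + b.1 * (s * b.2 + t * c.2) = t * cross b c by rewrite /cross; ring.
    rewrite max_r; last by apply: mulr_ge0 => //; exact: ltW.
    have e1 : t * cross b c * v = t * (cross b c * v) by ring.
    have e2 : t * cross b c * w = t * (cross b c * w) by ring.
    rewrite e1 e2 vE wE; congr pair.
      by transitivity (s * (A11 * b.1 + A12 * b.2) + t * (c'.1 - a'.1) + a'.1); [rewrite Ab1|]; ring.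
    by transitivity (s * (A21 * b.1 + A22 * b.2) + t * (c'.2 - a'.2) + a'.2); [rewrite Ab2|]; ring.
  have -> : - b.2 * (s * b.1 + t * d.1) + b.1 * (s * b.2 + t * d.2) = t * cross b d by rewrite /cross; ring.
  rewrite max_l; last by apply: mulr_ge0_le0 => //; exact: ltW.
  rewrite !mul0r !addr0; congr pair.
    transitivity (s * (A11 * b.1 + A12 * b.2) + t * (A11 * d.1 + A12 * d.2) + a'.1); last by ring.
    by rewrite Ab1 Ad1; ring.
  transitivity (s * (A21 * b.1 + A22 * b.2) + t * (A21 * d.1 + A22 * d.2) + a'.2); last by ring.
  by rewrite Ab2 Ad2; ring.
have Ux : U x.
  have := xU (0, 0); rewrite /= !mulr0 !addr0 -surjective_pairing; apply.
  by rewrite /closed_disk /= expr0n addr0 ler01.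
have D1 : 0 < A11 * A22 - A12 * A21.
  rewrite -(nmulr_llt0 _ bd) mulrC.
  have -> : cross b d * (A11 * A22 - A12 * A21) = (A11 * b.1 + A12 * b.2) * (A21 * d.1 + A22 * d.2) -
    (A21 * b.1 + A22 * b.2) * (A11 * d.1 + A12 * d.2) by rewrite /cross; ring.
  by rewrite Ab1 Ab2 Ad1 Ad2; move: ad; rewrite /cross; lra.
have D2 : 0 < (A11 + v * - b.2) * (A22 + w * b.1) - (A12 + v * b.1) * (A21 + w * - b.2).
  rewrite -(pmulr_lgt0 _ bc) mulrC.
  have -> : cross b c * ((A11 + v * - b.2) * (A22 + w * b.1) - (A12 + v * b.1) * (A21 + w * - b.2)) =
    (A11 * b.1 + A12 * b.2) * (A21 * c.1 + A22 * c.2 + cross b c * w) -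
    (A21 * b.1 + A22 * b.2) * (A11 * c.1 + A12 * c.2 + cross b c * v) by rewrite /cross; ring.
  by rewrite Ab1 Ab2 vE wE; move: ca; rewrite /cross; nra.
apply: circle_homotopic_ext (bent_homotopic x r0 D1 D2) => p cp /=.
have Up : U (x.1 + r * p.1, x.2 + r * p.2).
  by apply: xU; move: cp; rewrite /circle /closed_disk /= => ->.
rewrite (hL _ Up) (hL _ Ux) -/(L (x.1 + r * p.1, x.2 + r * p.2)) -/(L x).
rewrite [LHS]surjective_pairing [RHS]surjective_pairing /=.
by congr pair; ring.
Qed.

Lemma id_orientation (U : set R2) (h : R2 -> R2) : (forall y, U y -> h y = y) -> orientation_preserving U h.
Proof.
move=> hE x r r0 xU; apply: (@circle_homotopic_ext _ _ (lin r 0 0 r)); last first.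
  by apply: lin_homotopic_id; rewrite mul0r subr0 mulr_gt0.
have Ux : U x.
  have := xU (0, 0); rewrite /= !mulr0 !addr0 -surjective_pairing; apply.
  by rewrite /closed_disk /= expr0n addr0 ler01.
move=> p cp; rewrite !hE//; last by apply: xU; move: cp; rewrite /circle /closed_disk /= => ->.
rewrite [RHS]surjective_pairing /lin /=.
by congr pair; ring.
Qed.

End Orientation.

(** * Fans of vectors in the plane *)

Section Fan.
Variable R : realType.
Local Notation R2 := (R * R)%type.

Definition csucc n j := if (j.+1 < n)%N then j.+1 else 0%N.

Definition consecutive n (c : nat -> R) : Prop :=
  exists2 j, (j < n)%N & forall i, (i < n)%N -> i != j -> i != csucc n j -> c i = 0.

Definition combine n (m : nat -> R2) (c : nat -> R) : R2 :=
  (\sum_(j < n) c j * (m j).1, \sum_(j < n) c j * (m j).2).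

(* The sectors spanned by consecutive vectors tile the plane; [k] gives the
   coordinates of a point in its sector. *)
Record fan n (m : nat -> R2) (k : nat -> R2 -> R) : Prop := Fan {
  fan_cross : forall j, (j < n)%N -> 0 < cross (m j) (m (csucc n j));
  fan_cont : forall j (A : set R2), {within A, continuous (k j)};
  fan_ge0 : forall j p, 0 <= k j p;
  fan_consecutive : forall p, consecutive n (fun j => k j p);
  fan_combine : forall p, combine n m (fun j => k j p) = p;
  fan_coord : forall c, (forall j, 0 <= c j) -> consecutive n c ->
    forall i, (i < n)%N -> k i (combine n m c) = c i }.

Lemma fan3 : exists m k, fan 3 m k.
Proof.
pose m j : R2 := if j == 0%N then (1, 0) else if j == 1%N then (0, 1) else (-1, -1).
(* The three vectors sum to 0, so coordinates are determined up to a common shift; [t] is the least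
   shift that makes them nonnegative, and then one of them is 0. *)
pose t (p : R2) := Num.max 0 (Num.max (- p.1) (- p.2)).
pose k j (p : R2) := if j == 0%N then p.1 + t p else if j == 1%N then p.2 + t p else t p.
have tP (p : R2) : [/\ 0 <= t p, - p.1 <= t p, - p.2 <= t p & [\/ t p = 0, t p = - p.1 | t p = - p.2]].
  rewrite /t; split.
  - by rewrite le_max lexx.
  - by rewrite !le_max lexx orbT.
  - by rewrite !le_max lexx !orbT.
  by case: (leP 0 _) => _; [case: (leP (- p.1) _) => _; [apply: Or33|apply: Or32]|apply: Or31].
have E c : combine 3 m c = (c 0%N - c 2%N, c 1%N - c 2%N).
  by rewrite /combine !big_ord_recr !big_ord0 /m /=; congr pair; ring.
exists m, k; split.
- by move=> [|[|[|//]]] _; rewrite /cross /m /csucc /=; lra.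
- by move=> j A; rewrite /k /t; case: (j == _); [wcont|case: (j == _); wcont].
- move=> j p; have [t0 t1 t2 _] := tP p.
  by rewrite /k; case: (j == _); [lra|case: (j == _) => //; lra].
- move=> p; have [_ _ _ [tE|tE|tE]] := tP p.
  + by exists 0%N => // -[|[|[|]]].
  + by exists 1%N => // -[|[|[|]]] //= _ _ _; rewrite /k tE /= addrN.
  + by exists 2%N => // -[|[|[|]]] //= _ _ _; rewrite /k tE /= addrN.
- by move=> p; rewrite E /k /= [RHS]surjective_pairing; congr pair; ring.
move=> c c0 [j j3 cz] i i3; rewrite E.
have : [\/ c 0%N = 0, c 1%N = 0 | c 2%N = 0].
  by case: j j3 cz => [|[|[|//]]] _ cz; [apply: Or33|apply: Or31|apply: Or32]; apply: cz.
have := c0 0%N; have := c0 1%N; have := c0 2%N.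
have [t0 t1 t2 tE] := tP (c 0%N - c 2%N, c 1%N - c 2%N); rewrite /= in t0 t1 t2 tE.
move=> h2 h1 h0 hz.
have T : t (c 0%N - c 2%N, c 1%N - c 2%N) = c 2%N.
  by case: hz => hz; case: tE => tE; lra.
by case: i i3 => [|[|[|//]]] _; rewrite /k /= T ?subrK.
Qed.

Lemma sum_delta n (i : nat) (x : R) (g : nat -> R) : (i < n)%N ->
  \sum_(j < n) (nat_of_ord j == i)%:R * x * g j = x * g i.
Proof.
move=> i_n; rewrite (bigD1 (Ordinal i_n))//= eqxx mul1r big1 ?addr0// => j ji.
by rewrite (_ : (nat_of_ord j == i) = false) ?mul0r//; apply: contraNF ji => /eqP E; apply/eqP/val_inj.
Qed.

(** The sector between the last and the first vector is split by their sum. A point of it takes the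
    smaller of its two coordinates as coefficient of the new vector and keeps the differences. *)
Lemma fan_insert n m k : (3 <= n)%N -> fan n m k -> exists m' k', fan n.+1 m' k'.
Proof.
move=> n3 [Fx Fc F0 Fs FE Fk].
pose m' j : R2 := if j == n then ((m n.-1).1 + (m 0%N).1, (m n.-1).2 + (m 0%N).2) else m j.
pose mu p := Num.min (k n.-1 p) (k 0%N p).
pose k' j p := if j == n then mu p else k j p - (j == 0%N)%:R * mu p - (j == n.-1)%:R * mu p.
have n0 : (0 < n)%N by lia.
have n1 : (n.-1 < n)%N by lia.
have sn : csucc n n.-1 = 0%N by rewrite /csucc prednK// ltnn.
have combE c : combine n.+1 m' c =
    combine n m (fun j => c j + (j == 0%N)%:R * c n + (j == n.-1)%:R * c n).
  rewrite /combine !big_ord_recr /= /m' eqxx; congr pair.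
    transitivity (\sum_(j < n) (c j * (m j).1 + (nat_of_ord j == 0%N)%:R * c n * (m j).1 +
        (nat_of_ord j == n.-1)%:R * c n * (m j).1)); last by apply: eq_bigr => j _; ring.
    rewrite !big_split /= (sum_delta (c n) (fun j => (m j).1) n0) (sum_delta (c n) (fun j => (m j).1) n1) -addrA; congr (_ + _); last by rewrite mulrDr addrC.
    by apply: eq_bigr => j _; rewrite ltn_eqF.
  transitivity (\sum_(j < n) (c j * (m j).2 + (nat_of_ord j == 0%N)%:R * c n * (m j).2 +
        (nat_of_ord j == n.-1)%:R * c n * (m j).2)); last by apply: eq_bigr => j _; ring.
  rewrite !big_split /= (sum_delta (c n) (fun j => (m j).2) n0) (sum_delta (c n) (fun j => (m j).2) n1) -addrA; congr (_ + _); last by rewrite mulrDr addrC.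
  by apply: eq_bigr => j _; rewrite ltn_eqF.
have mu_le p : [/\ 0 <= mu p, mu p <= k n.-1 p & mu p <= k 0%N p].
  by rewrite /mu le_min !F0 ge_min lexx ge_min lexx orbT.
have nz : (n.-1 == 0%N) = false by apply/eqP; lia.
have k'0 p : k' 0%N p = k 0%N p - mu p.
  by rewrite /k' ltn_eqF// eqxx eq_sym nz /= mul1r mul0r subr0.
have k'1 p : k' n.-1 p = k n.-1 p - mu p.
  by rewrite /k' ltn_eqF// eqxx nz /= mul1r mul0r subr0.
have k'n p : k' n p = mu p by rewrite /k' eqxx.
have k'j j p : j != n -> j != 0%N -> j != n.-1 -> k' j p = k j p.
  by rewrite /k' => /negbTE -> /negbTE -> /negbTE ->; rewrite !mul0r !subr0.
have noboth j : (j < n.-1)%N -> n.-1 != j /\ n.-1 != j.+1 \/ 0%N != j /\ 0%N != j.+1.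
  by case: j => [|j] h; [left; split; apply/eqP; lia|right].
exists m', k'; split.
- move=> j; rewrite ltnS leq_eqVlt => /orP[/eqP->|jn].
    rewrite /csucc ltnn /m' eqxx /= (_ : (0 == n)%N = false); last by apply/eqP; lia.
    by have := Fx _ n1; rewrite sn /cross /=; lra.
  have jn' : (j == n) = false by rewrite ltn_eqF.
  rewrite /csucc ltnS jn /m' jn'; have [jE|jN] := eqVneq j.+1 n.
    by have := Fx _ n1; rewrite sn -jE /cross /=; lra.
  have j1 : (j.+1 < n)%N by lia.
  by have := Fx _ jn; rewrite /csucc j1.
- move=> j A; have c1 := Fc n.-1 A; have c2 := Fc 0%N A; have c3 := Fc j A.
  by rewrite /k' /mu; case: (j == n); wcont.
- move=> j p; have [m0 m1 m2] := mu_le p.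
  have [->|jn] := eqVneq j n; first by rewrite k'n.
  have [->|j0] := eqVneq j 0%N; first by rewrite k'0 subr_ge0.
  have [->|j1] := eqVneq j n.-1; first by rewrite k'1 subr_ge0.
  by rewrite k'j.
- move=> p; have [j jn jz] := Fs p; have [m0 m1 m2] := mu_le p.
  have [jE|jN] := eqVneq j n.-1.
    subst j; rewrite sn in jz; have [le|lt] := leP (k n.-1 p) (k 0%N p).
      exists n => //; rewrite /csucc ltnn => i; rewrite ltnS => i_n i1 i0.
      have [->|i2] := eqVneq i n.-1; first by rewrite k'1 /mu min_l// subrr.
      by rewrite k'j//; apply: jz => //; lia.
    exists n.-1; first by lia.
    rewrite /csucc prednK// leqnn => i; rewrite ltnS => i_n i1 i0.
    have [->|i2] := eqVneq i 0%N; first by rewrite k'0 /mu min_r ?subrr// ltW.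
    by rewrite k'j//; apply: jz => //; lia.
  have jn1 : (j < n.-1)%N by lia.
  have jS : csucc n j = j.+1 by rewrite /csucc; have -> : (j.+1 < n)%N by lia.
  have jS' : csucc n.+1 j = j.+1 by rewrite /csucc; have -> : (j.+1 < n.+1)%N by lia.
  have mu0 : mu p = 0.
    apply/eqP; rewrite eq_le m0 andbT.
    have [[h1 h2]|[h1 h2]] := noboth j jn1.
      by rewrite -(jz n.-1)// ?jS//.
    by rewrite -(jz 0%N)// ?jS//.
  exists j; first by lia.
  rewrite jS' => i; rewrite ltnS => i_n ij ij'.
  have [->|iN] := eqVneq i n; first by rewrite k'n.
  have i_n' : (i < n)%N by lia.
  have iz : k i p = 0 by apply: jz => //; rewrite jS.
  by rewrite /k' (negbTE iN) iz mu0 !mulr0 !subr0.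
- move=> p; rewrite combE -[RHS](FE p); rewrite /combine; congr pair; apply: eq_bigr => j _; congr (_ * _);
    rewrite k'n /k' ltn_eqF//; ring.
move=> c c0 [j jn cz] i i_n; rewrite combE; set c' := (fun j => _).
have ge0 l : 0 <= c' l by rewrite /c' !addr_ge0// mulr_ge0.
have onez : c 0%N = 0 \/ c n.-1 = 0.
  have [jn1|] := ltnP j n.-1.
    have jS' : csucc n.+1 j = j.+1 by rewrite /csucc; have -> : (j.+1 < n.+1)%N by lia.
    have [[h1 h2]|[h1 h2]] := noboth j jn1; [right|left]; apply: cz; rewrite ?jS'//; lia.
  move=> jn1; have [jE|jE] : j = n.-1 \/ j = n by lia.
    left; rewrite jE in cz; apply: cz => //; first by apply/eqP; lia.
    by rewrite /csucc prednK// leqnn; apply/eqP; lia.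
  right; rewrite jE in cz; apply: cz; [lia|apply/eqP; lia|rewrite /csucc ltnn; apply/eqP; lia].
have cons : consecutive n c'.
  have [jn1|jn1] := ltnP j n.-1.
    have jS' : csucc n.+1 j = j.+1 by rewrite /csucc; have -> : (j.+1 < n.+1)%N by lia.
    have cn : c n = 0 by apply: cz => //; rewrite ?jS'; apply/eqP; lia.
    exists j; first by lia.
    rewrite /csucc (_ : (j.+1 < n)%N); last by lia.
    by move=> l ln lj lj'; rewrite /c' cn !mulr0 !addr0; apply: cz => //; [lia|rewrite jS'].
  exists n.-1 => //; rewrite sn => l ln l1 l0.
  rewrite /c' (negbTE l1) (negbTE l0) !mul0r !addr0; apply: cz => //; first by lia.
    have [->//|->] : j = n.-1 \/ j = n by lia.
    by apply/eqP; lia.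
  have [->|->] : j = n.-1 \/ j = n by lia.
    by rewrite /csucc prednK// leqnn; apply/eqP; lia.
  by rewrite /csucc ltnn.
have kE l : (l < n)%N -> k l (combine n m c') = c' l by exact: Fk.
have c'0 : c' 0%N = c 0%N + c n by rewrite /c' eqxx eq_sym nz /= mul1r mul0r addr0.
have c'1 : c' n.-1 = c n.-1 + c n by rewrite /c' eqxx nz /= mul1r mul0r addr0.
have muE : mu (combine n m c') = c n.
  rewrite /mu !kE// c'0 c'1; have := c0 0%N; have := c0 n.-1.
  by case: onez => ->; rewrite ?add0r => h1 h2; [rewrite min_r//|rewrite min_l//]; rewrite lerDr.
have [->|iN] := eqVneq i n; first by rewrite k'n muE.
have i_n' : (i < n)%N by lia.
by rewrite /k' (negbTE iN) muE kE// /c'; ring.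
Qed.

Lemma fan_ex n : (3 <= n)%N -> exists m k, fan n m k.
Proof.
elim: n => [//|n IH]; rewrite leq_eqVlt => /orP[/eqP<-|n3]; first exact: fan3.
by have [m [k F]] := IH n3; exact: fan_insert F.
Qed.

End Fan.

(** * Geometric realisation of an oriented complex *)

Lemma cont_sum (R : realType) (T : topologicalType) (I : Type) (r : seq I) (P : pred I) (f : I -> T -> R) x :
  (forall i, {for x, continuous (f i)}) -> {for x, continuous (fun t => \sum_(i <- r | P i) f i t)}.
Proof.
move=> cf; elim: r => [|i r IH].
  by under [X in {for _, continuous X}]eq_fun do rewrite big_nil; exact: cvg_cst.
under [X in {for _, continuous X}]eq_fun do rewrite big_cons.
by case: (P i) => //; apply: cvgD; [exact: cf|exact: IH].
Qed.

Lemma wc_sum (R : realType) (T : topologicalType) (A : set T) (I : Type) (r : seq I) (P : pred I) (f : I -> T -> R) :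
  (forall i, {within A, continuous (f i)}) -> {within A, continuous (fun t => \sum_(i <- r | P i) f i t)}.
Proof. by move=> cf x; apply: cont_sum => i; exact: cf. Qed.

(** A connected closed triangulated surface, given by its positively oriented triangles. [oc_fun]
    and [oc_next] provide one triangle on each side of an edge, [oc_link] makes every link a single
    cycle, and [oc_three] excludes links of length two. *)
Record oriented_complex (N : finType) (tri : N -> N -> N -> bool) : Prop := OrientedComplex {
  oc_rot : forall a b c, tri a b c -> tri b c a;
  oc_fun : forall a b c c', tri a b c -> tri a b c' -> c = c';
  oc_next : forall a b c, tri a b c -> exists e, tri a c e;
  oc_neq : forall a b c, tri a b c -> a != b;
  oc_three : forall a b c, tri a b c -> ~~ tri a c b;
  oc_link : forall a (Z : N -> Prop), (exists b c, tri a b c /\ Z b) ->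
    (forall b c, tri a b c -> Z b -> Z c) -> forall b c, tri a b c -> Z b;
  oc_conn : forall Z : N -> Prop, (exists a b c, tri a b c /\ Z a) ->
    (forall a b c, tri a b c -> Z a -> Z b) -> forall a b c, tri a b c -> Z a }.

Section Complex.
Variables (R : realType) (N : finType) (tri : N -> N -> N -> bool).
Hypothesis oc : oriented_complex tri.
Local Notation R2 := (R * R)%type.

Lemma oc_rot2 a b c : tri a b c -> tri c a b.
Proof. by move=> /(oc_rot oc)/(oc_rot oc). Qed.

Lemma oc_neqs a b c : tri a b c -> [/\ a != b, b != c & a != c].
Proof.
move=> t; split; [exact: (oc_neq oc t)|exact: (oc_neq oc (oc_rot oc t))|].
by rewrite eq_sym; exact: (oc_neq oc (oc_rot2 t)).
Qed.

Lemma oc_opposite a b c : tri a b c -> exists d, tri b a d.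
Proof. by move=> /(oc_rot oc)/(oc_next oc). Qed.

(** Iterating the successor in the link of [a] from [b0]: backward uniqueness makes the first
    repetition a return to [b0], and [oc_link] shows that the orbit exhausts the link. *)
Lemma link_list a b0 c0 : tri a b0 c0 -> exists n (q : nat -> N), [/\ (3 <= n)%N,
  forall j, (j < n)%N -> tri a (q j) (q (csucc n j)),
  forall i j, (i < n)%N -> (j < n)%N -> q i = q j -> i = j &
  forall b c, tri a b c -> exists2 j, (j < n)%N & b = q j].
Proof.
move=> t0; pose nx b := if [pick c | tri a b c] is Some c then c else b.
have nxP b c : tri a b c -> nx b = c.
  by rewrite /nx; case: pickP => [c' t'|->//] /(oc_fun oc t').
pose q j := iter j nx b0.
have live j : exists c, tri a (q j) c.
  elim: j => [|j [c t]]; first by exists c0.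
  by have [e t'] := oc_next oc t; exists e; rewrite /q iterS (nxP _ _ t).
have qS j : tri a (q j) (q j.+1) by have [c t] := live j; rewrite /q iterS (nxP _ _ t).
have cancel i k : q (i + k)%N = q i -> q k = b0.
  elim: i => [|i IH]; first by rewrite add0n.
  rewrite addSn => E; apply: IH; have := oc_rot2 (qS (i + k)%N); have := oc_rot2 (qS i).
  by rewrite E => t1 t2; exact: (oc_fun oc t2 t1).
have [n nP] : exists n, (0 < n)%N && (q n == b0).
  have : ~~ injectiveb (fun i : 'I_#|N|.+1 => q i).
    by apply/negP => /injectiveP /leq_card; rewrite card_ord ltnn.
  move=> /injectivePn[i [j ij E]].
  wlog lt : i j ij E / (i < j)%N.
    move=> H; have [lt|lt|E'] := ltngtP i j; [exact: (H i j)|by apply: (H j i) => //; rewrite eq_sym|].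
    by move: ij; rewrite (val_inj E') eqxx.
  exists (j - i)%N; rewrite subn_gt0 lt; apply/eqP/(@cancel i).
  by rewrite subnKC// ltnW.
have exn : exists n, (0 < n)%N && (q n == b0) by exists n.
have [{nP}n /andP[n0 /eqP qn] nmin] := ex_minnP exn.
have inj i j : (i < n)%N -> (j < n)%N -> q i = q j -> i = j.
  wlog lt : i j / (i < j)%N.
    by move=> H; have [lt|lt|//] := ltngtP i j => hi hj E; [exact: H|apply/esym; apply: H].
  move=> hi hj E; have := nmin (j - i)%N; rewrite subn_gt0 lt /=.
  have -> : q (j - i)%N == b0 by apply/eqP/(@cancel i); rewrite subnKC// ltnW.
  by move=> /(_ isT); lia.
have qs j : (j < n)%N -> q j.+1 = q (csucc n j).
  rewrite /csucc => jn; case: ltnP => // h; have -> : j.+1 = n by lia.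
  by rewrite qn.
exists n, q; split=> //.
- case: n n0 qn {nmin inj qs} => [//|[|[|//]]] _ qn.
    by have [] := oc_neqs (qS 0%N); rewrite qn eqxx.
  by have := oc_three oc (qS 0%N); have := qS 1%N; rewrite qn => ->.
- by move=> j jn; rewrite -qs.
apply: (oc_link oc); first by exists b0, c0; split=> //; exists 0%N.
move=> b c t [j jn E]; exists (csucc n j); first by rewrite /csucc; case: ifP.
by rewrite -qs//; apply: (oc_fun oc t); rewrite E.
Qed.

Definition valid (y : N -> R) : Prop := [/\ forall a, 0 <= y a, \sum_a y a = 1 &
  exists a b c, tri a b c /\ forall z, z != a -> z != b -> z != c -> y z = 0].

Definition coords (v : 'rV[R]_#|N|) (a : N) : R := v ord0 (enum_rank a).
Definition point_type := {v : 'rV[R]_#|N| | `[< valid (coords v) >]}.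
Definition space := initial_topology (val : point_type -> 'rV[R]_#|N|).
HB.instance Definition _ := Topological.on space.

Definition co (x : space) : N -> R := coords (val (x : point_type)).

Lemma coP x : valid (co x).
Proof. exact: (elimT (asboolP _) (valP (x : point_type))). Qed.

Lemma co_ext x y : (forall a, co x a = co y a) -> x = y.
Proof.
move=> E; apply: (val_inj : injective (val : point_type -> _)); apply/rowP => i.
by have := E (enum_val i); rewrite /co /coords enum_valK.
Qed.

Lemma row_coords (y : N -> R) : coords (\row_i y (enum_val i)) = y.
Proof. by apply/funext => a; rewrite /coords mxE enum_rankK. Qed.

Lemma point_of (y : N -> R) : valid y -> exists x : space, co x = y.
Proof.
move=> vy; have h : `[< valid (coords (\row_i y (enum_val i))) >] by rewrite row_coords; apply/asboolP.
by exists (exist (fun v => `[< valid (coords v) >]) _ h : point_type); rewrite /co /= row_coords.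
Qed.

Lemma co_cont a (A : set space) : {within A, continuous (fun x => co x a)}.
Proof.
apply: continuous_subspaceT => x; apply: (@continuous_comp _ _ _ (val : space -> 'rV[R]_#|N|) (fun v : 'rV[R]_#|N| => coords v a)).
  exact: initial_continuous.
exact: coord_continuous.
Qed.

Lemma into_cont (T : topologicalType) (A : set T) (g : T -> space) :
  (forall a, {within A, continuous (fun t => co (g t) a)}) -> {within A, continuous g}.
Proof.
move=> H; apply/within_contP => t At O; rewrite nbhsE => -[B [[C oC <-] Cx] BO].
have : nbhs (val (g t : point_type)) C by exact: open_nbhs_nbhs.
move=> /nbhs_ballP[e e0 eC].
have [W Wt HW] : exists2 W, nbhs t W & forall y, W y -> forall a, A y -> ball (co (g t) a) e (co (g y) a).
  apply: filter_finType => a; have /within_contP := H a; apply => //.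
  exact: nbhsx_ballx.
exists W => // y Wy Ay; apply: BO; apply: eC; split=> // i j.
by have := HW y Wy (enum_val j) Ay; rewrite /co /coords enum_valK (ord1 i).
Qed.

Variables (a0 b0 c0 : N).
Hypothesis tri0 : tri a0 b0 c0.

Definition delta (a z : N) : R := (z == a)%:R.

Lemma delta_valid a b c : tri a b c -> valid (delta a).
Proof.
move=> t; split=> [z||]; first exact: ler0n.
  by rewrite (bigD1 a)//= /delta eqxx big1 ?addr0// => z /negbTE ->.
by exists a, b, c; split=> // z /negbTE za _ _; rewrite /delta za.
Qed.

Definition center a b c (t : tri a b c) : space := sval (cid (point_of (delta_valid t))).

(** Total, so that maps into the space can be written by coordinates; invalid coordinates give a
    fixed vertex. *)
Definition mkpt (y : N -> R) : space :=
  if pselect (exists x : space, co x = y) is left h then sval (cid h) else center tri0.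

Lemma mkptE y : valid y -> co (mkpt y) = y.
Proof.
by move=> /point_of h; rewrite /mkpt; case: pselect => // h'; case: cid.
Qed.

Lemma space_compact : compact [set: space].
Proof.
pose K := [set v : 'rV[R]_#|N| | valid (coords v)].
have coord_c a : continuous (fun v : 'rV[R]_#|N| => coords v a) by move=> v; exact: coord_continuous.
have closedK : closed K.
  have -> : K = (\bigcap_a [set v | 0 <= coords v a]) `&` [set v | \sum_a coords v a = 1] `&`
      \bigcup_(abc in [set abc : N * N * N | tri abc.1.1 abc.1.2 abc.2])
        \bigcap_(z in [set z | [/\ z != abc.1.1, z != abc.1.2 & z != abc.2]]) [set v | coords v z = 0].
    apply/seteqP; split=> v; rewrite /K /=.
      move=> [h1 h2 [a [b [c [t h3]]]]]; split; first by split=> // a' _; exact: h1.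
      by exists (a, b, c) => // z [z1 z2 z3]; exact: h3.
    move=> [[h1 h2] [[[a b] c] /= t h3]]; split=> //; first by move=> a'; exact: h1.
    by exists a, b, c; split=> // z z1 z2 z3; exact: h3.
  apply: closedI; first apply: closedI.
  - apply: closed_bigI => a _; apply: (@closed_comp _ _ (fun v => coords v a) [set u : R | 0 <= u]).
      by move=> v _; exact: coord_c.
    exact: closed_ge.
  - apply: (@closed_comp _ _ (fun v => \sum_a coords v a) [set u : R | u = 1]); last exact: closed_eq.
    by move=> v _; apply: (cont_sum (f := fun a v => coords v a)) => a; exact: coord_c.
  apply: closed_bigcup; first exact: finite_finset.
  move=> [[a b] c] _; apply: closed_bigI => z _.
  apply: (@closed_comp _ _ (fun v => coords v z) [set u : R | u = 0]); last exact: closed_eq.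
  by move=> v _; exact: coord_c.
have compactK : compact K.
  have compact01 : compact [set v : 'rV[R]_#|N| | forall i, v ord0 i \in `[0, 1]].
    exact: (@rV_compact R #|N| (fun=> `[0, 1]%classic) (fun=> @segment_compact R 0 1)).
  apply: subclosed_compact closedK compact01 _ => v [h1 h2 _] i /=; have E : v ord0 i = coords v (enum_val i) by rewrite /coords enum_valK.
  rewrite in_itv /= E h1 /= -h2 (bigD1 (enum_val i))//= lerDl.
  by apply: sumr_ge0 => a _; exact: h1.
pose g v := mkpt (coords v).
have gE v a : K v -> co (g v) a = coords v a by move=> Kv; rewrite /g mkptE.
have -> : [set: space] = g @` K.
  apply/seteqP; split=> // x _; exists (val (x : point_type)); first exact: coP.
  by apply: co_ext => a; rewrite gE//; exact: coP.
apply: continuous_compact => //; apply: into_cont => a.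
apply: (within_eq (f := fun v => coords v a)); first by move=> v Kv; rewrite gE.
by apply: continuous_subspaceT => v; exact: coord_c.
Qed.

Lemma space_hausdorff : hausdorff_space space.
Proof.
move=> x y cl; apply: (val_inj : injective (val : point_type -> _)).
apply: (@norm_hausdorff _ 'rV[R]_#|N|) => A B xA yB.
have [z [Az Bz]] := cl _ _ (initial_continuous (f := val : point_type -> _) xA)
  (initial_continuous (f := val : point_type -> _) yB).
by exists (val (z : point_type)).
Qed.

Lemma mkpt_cont (T : topologicalType) (A : set T) (y : T -> N -> R) :
  (forall t, A t -> valid (y t)) -> (forall a, {within A, continuous (fun t => y t a)}) ->
  {within A, continuous (fun t => mkpt (y t))}.
Proof.
move=> vy cy; apply: into_cont => a; apply: within_eq (cy a) => t At.
by rewrite mkptE//; exact: vy.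
Qed.

End Complex.

Lemma within_setT (T U : topologicalType) (f : T -> U) : {within [set: T], continuous f} -> continuous f.
Proof.
move=> /within_contP cf x O Ox; have [W Wx WO] := cf x Logic.I O Ox.
by apply: filterS Wx => y Wy; exact: WO.
Qed.

(** * Open stars and their charts *)

Section Stars.
Variables (R : realType) (N : finType) (tri : N -> N -> N -> bool).
Hypothesis oc : oriented_complex tri.
Variables (a0 b0 c0 : N).
Hypothesis tri0 : tri a0 b0 c0.
Local Notation R2 := (R * R)%type.
Local Notation S := (space R tri).
Local Notation mk := (mkpt tri0).
Implicit Types x y : S.

Definition supp a b c x := forall z, z != a -> z != b -> z != c -> co x z = 0.
Definition closed_star a x := exists b c, tri a b c /\ supp a b c x.
Definition open_star a : set S := [set x | 0 < co x a].

Lemma supp_rot a b c x : supp a b c x -> supp b c a x.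
Proof. by move=> H z z1 z2 z3; exact: H. Qed.

Lemma co_ge0 x a : 0 <= co x a. Proof. by have [] := coP x. Qed.
Lemma co_sum x : \sum_a co x a = 1. Proof. by have [] := coP x. Qed.

Lemma supp_ex x : exists a b c, tri a b c /\ supp a b c x.
Proof. by have [] := coP x. Qed.

Lemma supp_at a b c a' x : tri a b c -> supp a b c x -> co x a' <> 0 ->
  exists b' c', [/\ tri a' b' c', supp a' b' c' x & [\/ a' = a, a' = b | a' = c]].
Proof.
move=> t s xa; have [->|na] := eqVneq a' a; first by exists b, c; split=> //; apply: Or31.
have [->|nb] := eqVneq a' b.
  by exists c, a; split; [exact: oc_rot oc _ _ _ t|exact: supp_rot|apply: Or32].
have [->|nc] := eqVneq a' c; last by case: xa; exact: s.
by exists a, b; split; [exact: oc_rot2 oc _ _ _ t|do 2 apply: supp_rot|apply: Or33].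
Qed.

Lemma star_ex a x : 0 < co x a -> closed_star a x.
Proof.
move=> xa; have [a' [b [c [t s]]]] := supp_ex x.
have [|b' [c' [t' s' _]]] := supp_at (a' := a) t s; first by move=> E; rewrite E ltxx in xa.
by exists b', c'.
Qed.

Lemma live_delta a b c : tri a b c -> co (mk (delta R a)) = delta R a.
Proof. by move=> t; rewrite mkptE//; exact: delta_valid t. Qed.

Lemma supp_delta a b c d : tri a b c -> [\/ d = a, d = b | d = c] -> supp a b c (mk (delta R d)).
Proof.
move=> t H z z1 z2 z3; have [b' [c' t']] : exists b' c', tri d b' c'.
  by case: H => ->; [exists b, c|exists c, a; exact: oc_rot oc _ _ _ t|exists a, b; exact: (oc_rot2 oc t)].
rewrite (live_delta t') /delta; case: eqP => // E; subst z.
by case: H z1 z2 z3 => ->; rewrite eqxx.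
Qed.

Lemma convex_valid a b c x y (t : R) : tri a b c -> supp a b c x -> supp a b c y -> 0 <= t <= 1 ->
  valid tri (fun z => (1 - t) * co x z + t * co y z).
Proof.
move=> abc sx sy /andP[t0 t1]; split.
- by move=> z; rewrite addr_ge0// mulr_ge0 ?co_ge0// subr_ge0.
- by rewrite big_split /= -!mulr_sumr !co_sum !mulr1 subrK.
by exists a, b, c; split=> // z z1 z2 z3; rewrite (sx z)// (sy z)// !mulr0 addr0.
Qed.

Lemma segment a b c x y : tri a b c -> supp a b c x -> supp a b c y ->
  exists B : set S, [/\ B x, B y, connected B &
    forall w, B w -> exists2 t : R, 0 <= t <= 1 & forall z, co w z = (1 - t) * co x z + t * co y z].
Proof.
move=> abc sx sy; pose g (t : R) := mk (fun z => (1 - t) * co x z + t * co y z).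
have gE t : 0 <= t <= 1 -> co (g t) = fun z => (1 - t) * co x z + t * co y z.
  by move=> t01; rewrite /g mkptE//; exact: (convex_valid abc).
have i01 (t : R) : `[0, 1]%classic t = (0 <= t <= 1) :> Prop by rewrite /= in_itv.
exists (g @` `[0, 1]); split.
- exists 0; first by rewrite i01 lexx ler01.
  by apply: co_ext => z; rewrite gE ?lexx ?ler01// subr0 mul1r mul0r addr0.
- exists 1; first by rewrite i01 lexx ler01.
  by apply: co_ext => z; rewrite gE ?lexx ?ler01// subrr mul1r mul0r add0r.
- have cg z : {within `[0, 1], continuous (fun t : R => (1 - t) * co x z + t * co y z)}.
    apply: wcD; apply: wcM; [|exact: wc_cst|exact: wc_id|exact: wc_cst].
    by apply: wcD; [exact: wc_cst|apply: wcN; exact: wc_id].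
  apply: path_connected; apply: (mkpt_cont _ cg) => t; rewrite i01; exact: (convex_valid abc).
by move=> _ [t + <-]; rewrite i01 => t01; exists t => // z; rewrite gE.
Qed.

Lemma open_star_connected a : connected (open_star a).
Proof.
apply: (@star_connected _ _ (mk (delta R a))) => x xa; have [b [c [t s]]] := star_ex xa.
have [B [Bx By cB HB]] := segment t s (supp_delta t (Or31 _ _ erefl)).
exists B; split=> // w /HB[u /andP[u0 u1] E]; rewrite /open_star /= E (live_delta t) /delta eqxx.
by move: xa; rewrite /open_star /= => xa; have [->|u0'] := eqVneq u 0;
  [rewrite subr0 mul1r mul0r addr0|apply: ltr_wpDl; [rewrite mulr_ge0 ?co_ge0 ?subr_ge0|rewrite mulr1 lt_neqAle eq_sym u0']].
Qed.

Lemma open_star_open a : open (open_star a).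
Proof.
have -> : open_star a = (fun x => co x a) @^-1` [set u : R | 0 < u] by [].
apply: open_comp; last exact: open_gt.
by move=> x _; exact/within_setT/co_cont.
Qed.

Lemma space_connected : connected [set: S].
Proof.
have near x a b c y : tri a b c -> supp a b c x -> supp a b c y -> connected_component [set: S] x y.
  by move=> t sx sy; have [B [Bx By cB _]] := segment t sx sy; exists B.
pose Z a := connected_component [set: S] (mk (delta R a0)) (mk (delta R a)).
have all a b c : tri a b c -> Z a.
  apply: (oc_conn oc (Z := Z)); first by exists a0, b0, c0; split=> //; exact: connected_component_refl.
  move=> {}a {}b {}c t Za; apply: connected_component_trans Za _.
  by apply: (near _ _ _ _ _ t); apply: supp_delta => //; [apply: Or31|apply: Or32].
have <- : connected_component [set: S] (mk (delta R a0)) = [set: S]; last exact: component_connected.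
apply/seteqP; split=> // x _; have [a [b [c [t s]]]] := supp_ex x.
apply: connected_component_trans (all _ _ _ t) _.
by apply: (near _ _ _ _ _ t) => //; apply: supp_delta => //; apply: Or31.
Qed.

Section Chart.
Variables (a : N) (n : nat) (q : nat -> N) (m : nat -> R2) (k : nat -> R2 -> R).
Hypotheses (n3 : (3 <= n)%N) (q_tri : forall j, (j < n)%N -> tri a (q j) (q (csucc n j)))
  (q_inj : forall i j, (i < n)%N -> (j < n)%N -> q i = q j -> i = j)
  (q_onto : forall b c, tri a b c -> exists2 j, (j < n)%N & b = q j)
  (F : fan n m k).

(** Lays the star out in the plane with [a] at the origin and its neighbour [q j] at [m j]. *)
Definition proj x : R2 := combine n m (fun j => co x (q j)).
Definition raw (p : R2) (s : R) (z : N) : R :=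
  if z == a then 1 - s else \sum_(j < n) (z == q j)%:R * (s / (\sum_(i < n) k i p) * k j p).

Lemma csucc_lt j : (j < n)%N -> (csucc n j < n)%N.
Proof. by move=> jn; rewrite /csucc; case: (ltnP j.+1 n) => // _; exact: (leq_ltn_trans (leq0n j) jn). Qed.

Lemma q_neq j : (j < n)%N -> (q j == a) = false.
Proof. by move=> /q_tri /(oc_neq oc); rewrite eq_sym => /negbTE. Qed.

Lemma q_eq i j : (i < n)%N -> (j < n)%N -> (q i == q j) = (i == j).
Proof. by move=> hi hj; apply/eqP/eqP => [/q_inj->|->]. Qed.

Lemma q_sum (g : nat -> R) i : (i < n)%N -> \sum_(j < n) (q i == q j)%:R * g j = g i.
Proof.
move=> hi; have := sum_delta 1 g hi; rewrite mul1r => <-; apply: eq_bigr => j _.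
by rewrite q_eq// eq_sym mulr1.
Qed.

Lemma star_index b c : tri a b c -> exists2 j, (j < n)%N & b = q j /\ c = q (csucc n j).
Proof.
move=> t; have [j jn E] := q_onto t; exists j => //; split=> //.
by apply: (oc_fun oc t); rewrite E; exact: q_tri.
Qed.

Lemma star_sum (f : N -> R) : (forall z, z != a -> (forall j, (j < n)%N -> z != q j) -> f z = 0) ->
  \sum_z f z = f a + \sum_(j < n) f (q j).
Proof.
move=> f0.
transitivity (\sum_z ((z == a)%:R * f a + \sum_(j < n) (z == q j)%:R * f (q j))).
  apply: eq_bigr => z _; have [->|za] := eqVneq z a.
    rewrite mul1r big1 ?addr0// => j _; by rewrite eq_sym q_neq// mul0r.
  rewrite mul0r add0r; have [[j jn ->]|no] := pselect (exists2 j, (j < n)%N & z = q j).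
    by rewrite (q_sum (fun j => f (q j))).
  rewrite big1 ?f0// => [j jn|j _].
    by apply/eqP => E; apply: no; exists j.
  by case: eqP => [E|]; [case: no; exists j|rewrite mul0r].
rewrite big_split /= exchange_big /=; congr (_ + _).
  rewrite (bigD1 a)//= eqxx mul1r big1 ?addr0// => z /negbTE ->; exact: mul0r.
apply: eq_bigr => j _; rewrite (bigD1 (q j))//= eqxx mul1r big1 ?addr0// => z /negbTE ->.
exact: mul0r.
Qed.

Lemma star_consecutive x : closed_star a x -> consecutive n (fun j => co x (q j)).
Proof.
move=> [b [c [t s]]]; have [j jn [bE cE]] := star_index t; exists j => // i i_n ij ij'.
by apply: s; rewrite ?bE ?cE ?q_neq ?q_eq//; exact: csucc_lt.
Qed.

Lemma star_co_sum x : closed_star a x -> co x a + \sum_(j < n) co x (q j) = 1.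
Proof.
move=> [b [c [t s]]]; rewrite -(co_sum x) star_sum// => z za zq.
by have [j jn [bE cE]] := star_index t; apply: s => //; rewrite ?bE ?cE zq//; exact: csucc_lt.
Qed.

Lemma k_proj x j : closed_star a x -> (j < n)%N -> k j (proj x) = co x (q j).
Proof. by move=> sx jn; rewrite /proj (fan_coord F)// => [i|]; [exact: co_ge0|exact: star_consecutive]. Qed.

(** The Minkowski functional of the polygon with corners [m j], onto which the star is laid out. *)
Definition gauge p := \sum_(i < n) k i p.

Lemma gauge_ge0 p : 0 <= gauge p.
Proof. by apply: sumr_ge0 => i _; exact: fan_ge0 F _ _. Qed.

Lemma gauge_eq0 p : gauge p = 0 -> p = 0.
Proof.
move=> g0; rewrite -(fan_combine F p); have k0 i : (i < n)%N -> k i p = 0.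
  move=> i_n; apply: le_anti; rewrite (fan_ge0 F) andbT -g0 /gauge (bigD1 (Ordinal i_n))//= lerDl.
  by apply: sumr_ge0 => j _; exact: fan_ge0 F _ _.
by rewrite /combine !big1// => i _; rewrite k0// mul0r.
Qed.

Lemma gauge0 : gauge 0 = 0.
Proof.
have E : combine n m (fun=> 0) = 0 by rewrite /combine !big1// => i _; rewrite mul0r.
rewrite /gauge big1// => i _; rewrite -E (fan_coord F (c := fun=> 0))//.
by exists 0%N => //; lia.
Qed.

Lemma gauge_proj x : closed_star a x -> gauge (proj x) = 1 - co x a.
Proof.
move=> sx; rewrite -(star_co_sum sx) /gauge addrC addKr; apply: eq_bigr => j _; exact: k_proj.
Qed.

Lemma gauge_cont (A : set R2) : {within A, continuous gauge}.
Proof. by apply: wc_sum => i; exact: fan_cont F _ _. Qed.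

Lemma raw_a p s : raw p s a = 1 - s. Proof. by rewrite /raw eqxx. Qed.

Lemma raw_q p s j : (j < n)%N -> raw p s (q j) = s / gauge p * k j p.
Proof. by move=> jn; rewrite /raw q_neq// (q_sum (fun j => s / gauge p * k j p)). Qed.

Lemma raw_out p s z : z != a -> (forall j, (j < n)%N -> z != q j) -> raw p s z = 0.
Proof. by move=> /negbTE za zq; rewrite /raw za big1// => j _; rewrite (negbTE (zq _ _))// mul0r. Qed.

(* [raw p s] is the point with [s = 1 - co a] in the direction [p]. *)
Lemma raw_valid p s : 0 <= s <= 1 -> (p = 0 -> s = 0) ->
  valid tri (raw p s) /\ exists j, (j < n)%N /\ forall z, z != a -> z != q j -> z != q (csucc n j) -> raw p s z = 0.
Proof.
move=> /andP[s0 s1] ps; have [j jn kz] := fan_consecutive F p.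
have out z : z != a -> z != q j -> z != q (csucc n j) -> raw p s z = 0.
  move=> za zj zj'; have [[i i_n E]|no] := pselect (exists2 i, (i < n)%N & z = q i).
    subst z; rewrite raw_q// kz ?mulr0//; [by rewrite -q_eq|by rewrite -q_eq//; exact: csucc_lt].
  by apply: raw_out => // i i_n; apply/eqP => E; apply: no; exists i.
split; last by exists j.
split.
- move=> z; rewrite /raw; case: eqP => _; first by rewrite subr_ge0.
  by apply: sumr_ge0 => i _; rewrite mulr_ge0 ?ler0n// mulr_ge0 ?(fan_ge0 F)// divr_ge0// gauge_ge0.
- rewrite star_sum; last by move=> z; exact: raw_out.
  rewrite raw_a; under eq_bigr do rewrite raw_q//.
  rewrite -mulr_sumr -/(gauge p); have [g0|g0] := eqVneq (gauge p) 0.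
    by rewrite g0 mulr0 addr0 (ps (gauge_eq0 g0)) subr0.
  by rewrite divfK// subrK.
by exists a, (q j), (q (csucc n j)); split=> //; exact: q_tri.
Qed.

Lemma raw_star p s : 0 <= s <= 1 -> (p = 0 -> s = 0) -> closed_star a (mk (raw p s)).
Proof.
move=> s01 ps; have [v [j [jn out]]] := raw_valid s01 ps.
by exists (q j), (q (csucc n j)); split; [exact: q_tri|move=> z; rewrite mkptE//; exact: out].
Qed.

Lemma proj_raw p s : 0 <= s <= 1 -> (p = 0 -> s = 0) ->
  proj (mk (raw p s)) = (s / gauge p * p.1, s / gauge p * p.2).
Proof.
move=> s01 ps; have [v _] := raw_valid s01 ps; rewrite /proj mkptE//.
have pE := fan_combine F p; have /= <- := congr1 fst pE; have /= <- := congr1 snd pE.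
rewrite /combine !mulr_sumr; congr pair; apply: eq_bigr => j _; by rewrite raw_q// mulrA.
Qed.

Lemma raw_proj x : closed_star a x -> mk (raw (proj x) (1 - co x a)) = x.
Proof.
move=> sx; have gx := gauge_proj sx.
have s01 : 0 <= 1 - co x a <= 1.
  by rewrite -gx gauge_ge0 gx lerBlDr lerDl co_ge0.
have ps : proj x = 0 -> 1 - co x a = 0 by rewrite -gx => ->; exact: gauge0.
have [v _] := raw_valid s01 ps; apply: co_ext => z; rewrite mkptE//.
have [->|za] := eqVneq z a; first by rewrite raw_a opprB addrCA subrr addr0.
have [[j jn ->]|no] := pselect (exists2 j, (j < n)%N & z = q j).
  rewrite raw_q// gx k_proj//; have [E|E] := eqVneq (1 - co x a) 0; last by rewrite divff// mul1r.
  rewrite E mul0r mul0r; have : \sum_(j < n) co x (q j) = 0.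
    by have := star_co_sum sx; rewrite -[in RHS](subrK (co x a) 1) E add0r => /eqP; rewrite addrC -subr_eq0 addrK => /eqP.
  move/eqP; rewrite psumr_eq0 => [/allP/(_ (Ordinal jn))|i _]; last exact: co_ge0.
  by rewrite mem_index_enum => /(_ isT)/eqP.
rewrite raw_out// => [|j jn]; last by apply/eqP => E; apply: no; exists j.
have [b [c [t s]]] := sx; have [j jn [bE cE]] := star_index t; rewrite s//.
  by apply/eqP => E; apply: no; exists j; rewrite // E.
by apply/eqP => E; apply: no; exists (csucc n j); rewrite ?csucc_lt// E.
Qed.

Lemma proj_cont (A : set S) : {within A, continuous proj}.
Proof.
apply: within_pair; apply: wc_sum => i; apply: wcM; [exact: co_cont|exact: wc_cst| exact: co_cont|exact: wc_cst].
Qed.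

Definition unproj p := mk (raw p (gauge p)).

Lemma gauge01 p : gauge p <= 1 -> 0 <= gauge p <= 1 /\ (p = 0 -> gauge p = 0).
Proof. by move=> g1; rewrite gauge_ge0 g1; split=> // ->; exact: gauge0. Qed.

Lemma projK x : closed_star a x -> unproj (proj x) = x.
Proof. by move=> sx; rewrite /unproj gauge_proj//; exact: raw_proj. Qed.

Lemma unprojK p : gauge p <= 1 -> proj (unproj p) = p.
Proof.
move=> g1; have [g01 p0] := gauge01 g1; rewrite /unproj proj_raw//.
have [g0|g0] := eqVneq (gauge p) 0; last by rewrite divff// !mul1r -surjective_pairing.
by rewrite (gauge_eq0 g0) !mulr0.
Qed.

Lemma co_unproj p : gauge p <= 1 -> co (unproj p) a = 1 - gauge p.
Proof. by move=> /gauge01[g01 p0]; have [v _] := raw_valid g01 p0; rewrite /unproj mkptE// raw_a. Qed.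

Lemma unproj_cont : {within [set p | gauge p <= 1], continuous unproj}.
Proof.
apply: mkpt_cont => [p /= g1|z]; first by have [g01 p0] := gauge01 g1; have [] := raw_valid g01 p0.
rewrite /raw; case: (z == a); first by apply: wcD; [exact: wc_cst|apply: wcN; exact: gauge_cont].
apply: wc_sum => j; apply: wcM; first exact: wc_cst.
apply: (within_eq (f := k j)); last exact: fan_cont F _ _.
move=> p _; have [g0|g0] := eqVneq (gauge p) 0; last by rewrite divff// mul1r.
rewrite g0 !mul0r; apply: le_anti; rewrite (fan_ge0 F) -g0 /gauge (bigD1 j)//= lerDl andbT.
by apply: sumr_ge0 => i _; exact: fan_ge0 F _ _.
Qed.

Lemma proj_open_star : proj @` open_star a = [set p | gauge p < 1].
Proof.
apply/seteqP; split=> [_ [x xa <-]|p /= g1].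
  by rewrite /= gauge_proj ?ltrBlDr ?ltrDl//; exact: star_ex.
exists (unproj p); last by apply: unprojK; exact: ltW.
by rewrite /open_star /= co_unproj ?subr_gt0// ltW.
Qed.

Lemma proj_chart : chart (open_star a) proj unproj.
Proof.
split; first exact: open_star_open.
- rewrite proj_open_star; have -> : [set p | gauge p < 1] = gauge @^-1` [set u : R | u < 1] by [].
  apply: open_comp; last exact: open_lt.
  by move=> p _; exact/within_setT/gauge_cont.
rewrite proj_open_star; split.
- by rewrite -proj_open_star.
- by move=> _ [p /= g1 <-]; rewrite /open_star /= co_unproj ?subr_gt0// ltW.
- by move=> x /set_mem xa; apply: projK; exact: star_ex.
- by move=> p /set_mem /= g1; apply: unprojK; exact: ltW.
split; first exact: proj_cont.
by apply: continuous_subspaceW unproj_cont => p /= /ltW.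
Qed.

Lemma proj_two i j x : (i < n)%N -> (j < n)%N -> i != j -> supp a (q i) (q j) x ->
  proj x = (co x (q i) * (m i).1 + co x (q j) * (m j).1, co x (q i) * (m i).2 + co x (q j) * (m j).2).
Proof.
move=> hi hj ij s.
have two (g : nat -> R) : \sum_(l < n) co x (q l) * g l = co x (q i) * g i + co x (q j) * g j.
  rewrite (bigD1 (Ordinal hi))//= (bigD1 (Ordinal hj)) /=; last by rewrite eq_sym -val_eqE.
  rewrite addrA big1 ?addr0// => l /andP[li lj]; rewrite s ?mul0r// ?q_neq// ?q_eq//.
by rewrite /proj /combine (two (fun j => (m j).1)) (two (fun j => (m j).2)).
Qed.

End Chart.
End Stars.

(** * Transition maps and the oriented atlas *)

Section Atlas.
Variables (R : realType) (N : finType) (tri : N -> N -> N -> bool).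
Hypothesis oc : oriented_complex tri.
Variables (a0 b0 c0 : N).
Hypothesis tri0 : tri a0 b0 c0.
Local Notation R2 := (R * R)%type.
Local Notation S := (space R tri).

Record star (a : N) := Star {
  st_n : nat; st_q : nat -> N; st_m : nat -> R2; st_k : nat -> R2 -> R;
  st_n3 : (3 <= st_n)%N;
  st_tri : forall j, (j < st_n)%N -> tri a (st_q j) (st_q (csucc st_n j));
  st_inj : forall i j, (i < st_n)%N -> (j < st_n)%N -> st_q i = st_q j -> i = j;
  st_onto : forall b c, tri a b c -> exists2 j, (j < st_n)%N & b = st_q j;
  st_fan : fan st_n st_m st_k }.

Lemma star_at a b c : tri a b c -> star a.
Proof.
move=> t; apply: (sval (cid (_ : exists s : star a, True))); have [n [q [n3 q1 q2 q3]]] := link_list oc t.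
by have [m [k F]] := fan_ex R n3; exists (Star n3 q1 q2 q3 F).
Qed.

Definition sproj a (s : star a) : S -> R2 := proj (st_n s) (st_q s) (st_m s).
Definition sunproj a (s : star a) : R2 -> S := unproj tri0 a (st_n s) (st_q s) (st_k s).

Lemma star_projK a (s : star a) x : closed_star a x -> sunproj s (sproj s x) = x.
Proof. exact: (projK oc tri0 (st_n3 s) (@st_tri _ s) (@st_inj _ s) (@st_onto _ s) (st_fan s)). Qed.

Lemma star_chart a (s : star a) : chart (open_star a) (sproj s) (sunproj s).
Proof. exact: (proj_chart oc tri0 (st_n3 s) (@st_tri _ s) (@st_inj _ s) (@st_onto _ s) (st_fan s)). Qed.

(* The vector assigned to [z]; junk if [z] is not in the link of [a]. *)
Definition corner a (s : star a) (z : N) : R2 :=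
  st_m s (find (fun j => st_q s j == z) (iota 0 (st_n s))).

Lemma cornerE a (s : star a) j : (j < st_n s)%N -> corner s (st_q s j) = st_m s j.
Proof.
move=> jn; rewrite /corner; congr (st_m s _).
have hasj : has (fun i => st_q s i == st_q s j) (iota 0 (st_n s)).
  by apply/hasP; exists j; rewrite ?mem_iota ?add0n.
apply: (@st_inj _ s) => //; first by move: hasj; rewrite has_find size_iota.
have := nth_find 0%N hasj; rewrite nth_iota ?add0n; first by move/eqP.
by move: hasj; rewrite has_find size_iota.
Qed.

Lemma corner_cross a (s : star a) b c : tri a b c -> 0 < cross (corner s b) (corner s c).
Proof.
move=> t; have [j jn [-> ->]] := star_index oc (@st_tri _ s) (@st_onto _ s) t.
rewrite !cornerE ?csucc_lt//.
exact: (fan_cross (st_fan s)).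
Qed.

Lemma sprojE a (s : star a) b c (x : S) : tri a b c -> supp a b c x ->
  sproj s x = (co x b * (corner s b).1 + co x c * (corner s c).1,
               co x b * (corner s b).2 + co x c * (corner s c).2).
Proof.
move=> t; have [j jn [-> ->]] := star_index oc (@st_tri _ s) (@st_onto _ s) t.
have j'n := csucc_lt jn.
rewrite !cornerE// => sx; apply: (proj_two oc (st_m s) (@st_tri _ s) (@st_inj _ s) jn j'n _ sx).
by apply/eqP => E; have [_ /negP] := oc_neqs oc (st_tri (s := s) jn); rewrite -E.
Qed.

Lemma supp_sum a b c (x : S) : tri a b c -> supp a b c x -> co x a = 1 - co x b - co x c.
Proof.
move=> t s; have [ab bc ac] := oc_neqs oc t.
have := co_sum x; rewrite (bigD1 a)//= (bigD1 b) 1?eq_sym//= (bigD1 c) /=; last by rewrite eq_sym ac eq_sym bc.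
rewrite big1 => [<-|z /andP[/andP[z1 z2] z3]]; [by ring|exact: s].
Qed.

(** The stars overlap within the two triangles at the edge from [a] to [a']. On each of them both
    layouts are linear in barycentric coordinates, of which one is 1 minus the other two, so the
    transition is bent along that edge. *)
Lemma transition a a' (s : star a) (s' : star a') : a != a' ->
  orientation_preserving (sproj s @` (open_star a `&` open_star a')) (sproj s' \o sunproj s).
Proof.
move=> aa'; have [[x0 [x0a x0a']]|none] := pselect ((open_star a `&` open_star a' : set S) !=set0); last first.
  move=> x r r0 H; exfalso; apply: none.
  have [|y ys _] := H (0, 0); last by exists y.
  by rewrite /closed_disk /= expr0n addr0 ler01.
have cases (x : S) : 0 < co x a -> 0 < co x a' ->
    (exists c, tri a a' c /\ supp a a' c x) \/ exists d, tri a d a' /\ supp a d a' x.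
  move=> xa xa'; have [b [c [t sx]]] := star_ex oc xa.
  have : a' = b \/ a' = c.
    have [->|nb] := eqVneq a' b; first by left.
    have [->|nc] := eqVneq a' c; first by right.
    by move: xa'; rewrite sx ?ltxx// eq_sym.
  by case=> E; subst a'; [left; exists c|right; exists b].
have [c [d [tc td]]] : exists c d, tri a a' c /\ tri a d a'.
  have [[c [t _]]|[d [t _]]] := cases x0 x0a x0a'.
    by have [e t'] := oc_opposite oc t; exists c, e; split=> //; exact (oc_rot oc t').
  by have [e t'] := oc_next oc t; exists e, d.
have tc' : tri a' c a := oc_rot oc tc.
have td' : tri a' a d := oc_rot2 oc td.
have cd := corner_cross s tc; have dd := corner_cross s td.
have cc' := corner_cross s' tc'; have dd' := corner_cross s' td'.
apply: (@bent_orientation _ _ _ (corner s a') (corner s c) (corner s d) (corner s' a) (corner s' c) (corner s' d)) => //.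
  by move: dd; rewrite /cross; lra.
move=> _ [x [xa xa'] <-]; rewrite /= star_projK; last exact (star_ex oc xa).
have [[c1 [t1 sx]]|[d1 [t1 sx]]] := cases x xa xa'.
  have cE : c1 = c := oc_fun oc t1 tc; subst c1.
  exists (co x a'), (co x c); split; first exact: co_ge0.
  left; rewrite (sprojE s tc sx); split=> //.
  have sx' : supp a' c a x by exact: supp_rot.
  rewrite (sprojE s' tc' sx') (supp_sum tc sx); congr pair; ring.
have dE : d1 = d := oc_fun oc (oc_rot2 oc t1) td'.
subst d1; exists (co x a'), (co x d); split; first exact: co_ge0.
right; rewrite (sprojE s td sx); split; first by congr pair; ring.
have sx' : supp a' a d x by do 2 apply: supp_rot.
rewrite (sprojE s' td' sx') (supp_sum td sx); congr pair; ring.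
Qed.

Lemma co_pos (x : S) : exists z, 0 < co x z.
Proof.
apply: contrapT => H; have := co_sum x; rewrite big1 => [/eqP|z _]; first by rewrite eq_sym oner_eq0.
by apply: le_anti; rewrite co_ge0 andbT leNgt; apply/negP => h; apply: H; exists z.
Qed.

Lemma space_surface : surface R S.
Proof.
split.
- by exists (mkpt tri0 (delta R a0)).
- exact (space_connected oc tri0).
- exact (space_compact tri0).
- exact: space_hausdorff.
move=> x; have [z xz] := co_pos x; have [b [c [t _]]] := star_ex oc xz.
exists (open_star z), (sproj (star_at t)), (sunproj (star_at t)); split=> //.
exact: star_chart.
Qed.

Lemma space_orientable : orientable R S.
Proof.
(* Only nodes that lie in a triangle carry a chart. *)
pose I := {a : N | `[< exists b c, tri a b c >]}.
have st (i : I) : star (val i).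
  by have /cid[b /cid[c t]] := elimT (asboolP _) (valP i); exact: star_at t.
exists I, (fun i => open_star (val i)), (fun i => sproj (st i)), (fun i => sunproj (st i)); split.
- by move=> i; exact: star_chart.
- apply/seteqP; split=> // x _.
  have [z xz] := co_pos x.
  have live : `[< exists b c, tri z b c >] by apply/asboolP; have [b [c [t _]]] := star_ex oc xz; exists b, c.
  by exists (exist _ z live).
move=> i j; have [E|ne] := eqVneq i j; last by apply: transition; rewrite val_eqE.
subst j; apply: id_orientation => _ [x [xi _] <-] /=.
by rewrite star_projK//; exact (star_ex oc xi).
Qed.

End Atlas.

(** For radial formulas at the centre of a disk: [h] may jump where [g] vanishes as long as it stays
    bounded. *)
Lemma wc_squeeze (R : realType) (T : topologicalType) (A : set T) (g h : T -> R) :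
  {within A, continuous g} -> {within A `&` [set x | g x != 0], continuous h} ->
  (forall x, A x -> `|h x| <= 1) -> {within A, continuous (fun x => g x * h x)}.
Proof.
move=> cg ch h1; apply/within_contP => x Ax O; have [g0|g0] := eqVneq (g x) 0.
  rewrite g0 mul0r => /nbhs_ballP[e e0 eO].
  have gO : nbhs (g x) (ball (0 : R) e) by rewrite g0; exact: nbhsx_ballx.
  have /within_contP/(_ x Ax _ gO)[W Wx HW] := cg.
  exists W => // y Wy Ay; apply: eO; have := HW y Wy Ay.
  rewrite /ball /= !sub0r !normrN normrM; apply: le_lt_trans.
  by rewrite -[leRHS]mulr1 ler_wpM2l// h1.
move=> Ox; have cgh : {within A `&` [set x | g x != 0], continuous (fun x => g x * h x)}.
  by apply: wcM => //; apply: continuous_subspaceW cg => y [].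
have /within_contP/(_ x (conj Ax g0) _ Ox)[W Wx HW] := cgh.
have gO : nbhs (g x) [set u : R | u != 0].
  by apply: open_nbhs_nbhs; split=> //; exact: open_neq.
have /within_contP/(_ x Ax _ gO)[W' Wx' HW'] := cg.
exists (W `&` W'); first exact: filterI.
by move=> y [Wy Wy'] Ay; apply: HW => //; split=> //; exact: HW'.
Qed.

(** * Closed stars as closed disks *)

Section StarDisk.
Variables (R : realType) (N : finType) (tri : N -> N -> N -> bool).
Hypothesis oc : oriented_complex tri.
Variables (a0 b0 c0 : N).
Hypothesis tri0 : tri a0 b0 c0.
Local Notation R2 := (R * R)%type.
Local Notation S := (space R tri).
Variables (a : N) (s : star R tri a).
Local Notation n := (st_n s).
Local Notation q := (st_q s).
Local Notation m := (st_m s).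
Local Notation k := (st_k s).
Local Notation gauge := (gauge n k).
Local Notation raw := (raw a n q k).
Let F := st_fan s.

Definition norm2 (p : R2) := Num.sqrt (p.1 ^+ 2 + p.2 ^+ 2).

Lemma norm2_ge0 p : 0 <= norm2 p. Proof. exact: sqrtr_ge0. Qed.

Lemma norm2_sqr p : norm2 p ^+ 2 = p.1 ^+ 2 + p.2 ^+ 2.
Proof. by rewrite sqr_sqrtr// addr_ge0// sqr_ge0. Qed.

Lemma norm2_eq0 p : norm2 p = 0 -> p = 0.
Proof.
move=> p0; have := norm2_sqr p; rewrite p0 expr0n => /esym/sumsq_eq0[p1 p2].
exact: pair_ext.
Qed.

Lemma norm20 : norm2 0 = 0. Proof. by rewrite /norm2 /= expr0n addr0 sqrtr0. Qed.

Lemma norm2_disk p : closed_disk p <-> norm2 p <= 1.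
Proof.
rewrite /closed_disk /= -norm2_sqr; split=> h; last by rewrite expr_le1// norm2_ge0.
by rewrite -(@expr_le1 _ 2)// norm2_ge0.
Qed.

Lemma norm2_open_disk p : open_disk p <-> norm2 p < 1.
Proof.
rewrite /open_disk /= -norm2_sqr; split=> h; last by rewrite expr_lt1// norm2_ge0.
by rewrite -(@expr_lt1 _ 2)// norm2_ge0.
Qed.

Lemma norm2_scale (t : R) p : 0 <= t -> norm2 (t * p.1, t * p.2) = t * norm2 p.
Proof.
move=> t0; rewrite /norm2 /= !exprMn -mulrDr sqrtrM ?sqr_ge0//.
by rewrite sqrtr_sqr ger0_norm.
Qed.

Lemma norm2_cont (A : set R2) : {within A, continuous norm2}.
Proof. by rewrite /norm2; wcont. Qed.

(** [unproj] with the Euclidean norm in place of the gauge, which rounds the polygon to the unit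
    disk and carries the circle to the link. *)
Definition disk_star p : S := mkpt tri0 (raw p (norm2 p)).
Definition star_disk (x : S) : R2 :=
  ((1 - co x a) * ((sproj s x).1 / norm2 (sproj s x)),
   (1 - co x a) * ((sproj s x).2 / norm2 (sproj s x))).

Lemma disk_cond p : closed_disk p -> 0 <= norm2 p <= 1 /\ (p = 0 -> norm2 p = 0).
Proof. by move=> /norm2_disk h; rewrite norm2_ge0 h; split=> // ->; exact: norm20. Qed.

Lemma disk_valid p : closed_disk p -> valid tri (raw p (norm2 p)).
Proof.
move=> /disk_cond[h1 h2].
by have [] := raw_valid oc (@st_tri _ _ _ _ s) (@st_inj _ _ _ _ s) F h1 h2.
Qed.

Lemma disk_star_in p : closed_disk p -> closed_star a (disk_star p).
Proof.
move=> /disk_cond[h1 h2].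
exact: (raw_star oc tri0 (@st_tri _ _ _ _ s) (@st_inj _ _ _ _ s) F h1 h2).
Qed.

Lemma co_disk_star p : closed_disk p -> co (disk_star p) a = 1 - norm2 p.
Proof. by move=> pd; rewrite /disk_star mkptE ?raw_a//; exact: disk_valid. Qed.

Lemma sproj_disk_star p : closed_disk p ->
  sproj s (disk_star p) = (norm2 p / gauge p * p.1, norm2 p / gauge p * p.2).
Proof.
move=> /disk_cond[h1 h2].
exact: (proj_raw oc tri0 (@st_tri _ _ _ _ s) (@st_inj _ _ _ _ s) F h1 h2).
Qed.

Lemma star_gauge (x : S) : closed_star a x -> gauge (sproj s x) = 1 - co x a.
Proof. exact: (gauge_proj oc (@st_tri _ _ _ _ s) (@st_inj _ _ _ _ s) (@st_onto _ _ _ _ s) F). Qed.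

Lemma star_co_le1 (x : S) : closed_star a x -> 0 <= 1 - co x a <= 1.
Proof.
move=> sx; have := gauge_ge0 F (sproj s x); rewrite star_gauge// => ->.
by rewrite lerBlDr lerDl co_ge0.
Qed.

Lemma star_proj0 (x : S) : closed_star a x -> norm2 (sproj s x) = 0 -> 1 - co x a = 0.
Proof.
by move=> sx /norm2_eq0 E; rewrite -star_gauge// E; exact: (gauge0 tri0 (st_n3 s) F).
Qed.

Lemma star_diskE (x : S) : star_disk x =
  ((1 - co x a) / norm2 (sproj s x) * (sproj s x).1, (1 - co x a) / norm2 (sproj s x) * (sproj s x).2).
Proof. by rewrite /star_disk; congr pair; rewrite mulrA mulrAC. Qed.

Lemma norm2_star_disk (x : S) : closed_star a x -> norm2 (star_disk x) = 1 - co x a.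
Proof.
move=> sx; have /andP[h0 h1] := star_co_le1 sx; rewrite star_diskE norm2_scale; last first.
  by rewrite divr_ge0// norm2_ge0.
have [E|E] := eqVneq (norm2 (sproj s x)) 0; last by rewrite divfK.
by rewrite E mulr0 star_proj0.
Qed.

Lemma disk_starK p : closed_disk p -> star_disk (disk_star p) = p.
Proof.
move=> pd; rewrite star_diskE co_disk_star// sproj_disk_star// opprB addrCA subrr addr0.
have [E|E] := eqVneq (norm2 p) 0.
  by rewrite E !mul0r (norm2_eq0 E).
have g0 : gauge p != 0.
  by apply: contra_neq E => /(gauge_eq0 F) ->; exact: norm20.
have l0 : 0 <= norm2 p / gauge p by rewrite divr_ge0 ?norm2_ge0 ?(gauge_ge0 F).
rewrite norm2_scale// [RHS]surjective_pairing /=; congr pair; by field; rewrite E g0.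
Qed.

Lemma k_scale (x : S) (t : R) j : closed_star a x -> 0 <= t -> (j < n)%N ->
  k j (t * (sproj s x).1, t * (sproj s x).2) = t * co x (q j).
Proof.
move=> sx t0 jn; have -> : (t * (sproj s x).1, t * (sproj s x).2) = combine n m (fun j => t * co x (q j)).
  by rewrite /sproj /proj /combine /= !mulr_sumr; congr pair; apply: eq_bigr => i _; rewrite mulrA.
rewrite (fan_coord F (c := fun j => t * co x (q j)))// => [i|]; first by rewrite mulr_ge0// co_ge0.
have [i i_n H] := star_consecutive oc (@st_tri _ _ _ _ s) (@st_inj _ _ _ _ s) (@st_onto _ _ _ _ s) sx.
by exists i => // l ln l1 l2; rewrite H// mulr0.
Qed.

Lemma star_diskK (x : S) : closed_star a x -> disk_star (star_disk x) = x.
Proof.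
move=> sx; rewrite /disk_star norm2_star_disk//.
rewrite -[RHS](raw_proj oc tri0 (st_n3 s) (@st_tri _ _ _ _ s) (@st_inj _ _ _ _ s) (@st_onto _ _ _ _ s) F sx).
congr (mkpt _ _); apply/funext => z; rewrite /raw -/(sproj s x); case: eqP => // _.
apply: eq_bigr => j _; congr (_ * _).
have [->|E] := eqVneq (1 - co x a) 0; first by rewrite !mul0r.
have n0 : norm2 (sproj s x) != 0 by apply: contra_neq E; exact: star_proj0.
set t := (1 - co x a) / norm2 (sproj s x).
have t0 : 0 <= t by rewrite divr_ge0 ?norm2_ge0//; have /andP[] := star_co_le1 sx.
have tn : t != 0 by rewrite mulf_neq0// invr_neq0.
rewrite star_diskE -/t (k_scale sx t0 (ltn_ord j)).
have k1 : k j (sproj s x) = co x (q j).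
  exact: (k_proj oc (@st_tri _ _ _ _ s) (@st_inj _ _ _ _ s) (@st_onto _ _ _ _ s) F sx (ltn_ord j)).
have -> : \sum_(i < n) k i (t * (sproj s x).1, t * (sproj s x).2) = t * \sum_(i < n) k i (sproj s x).
  rewrite [RHS]mulr_sumr; apply: eq_bigr => i _; rewrite (k_scale sx t0 (ltn_ord i)).
  by rewrite (k_proj oc (@st_tri _ _ _ _ s) (@st_inj _ _ _ _ s) (@st_onto _ _ _ _ s) F sx (ltn_ord i)).
have g0 : gauge (sproj s x) != 0 by rewrite star_gauge.
rewrite k1 -/(gauge (sproj s x)); field; by rewrite g0 tn.
Qed.

Lemma star_disk_in (x : S) : closed_star a x -> closed_disk (star_disk x).
Proof.
by move=> sx; apply/norm2_disk; rewrite norm2_star_disk//; have /andP[] := star_co_le1 sx.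
Qed.

Lemma disk_star_cont : {within @closed_disk R, continuous disk_star}.
Proof.
apply: mkpt_cont => [p|z]; first exact: disk_valid.
rewrite /raw; case: (z == a); first by apply: wcD; [exact: wc_cst|apply: wcN; exact: norm2_cont].
apply: wc_sum => j; apply: wcM; first exact: wc_cst.
apply: (within_eq (f := fun p => norm2 p * (k j p / gauge p))).
  by move=> p _; rewrite -/(gauge p) mulrA mulrAC.
apply: wc_squeeze; first exact: norm2_cont.
  apply: wcM; first exact: (fan_cont F).
  apply: wcV; last exact: (gauge_cont F).
  by move=> p [_ /= p0]; apply: contra_neq p0 => /(gauge_eq0 F) ->; exact: norm20.
move=> p _; rewrite ger0_norm; last by rewrite divr_ge0 ?(gauge_ge0 F) ?(fan_ge0 F).
have [->|g0] := eqVneq (gauge p) 0; first by rewrite invr0 mulr0.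
rewrite ler_pdivrMr ?mul1r; last by rewrite lt_neqAle eq_sym g0 (gauge_ge0 F).
by rewrite /gauge (bigD1 j)//= lerDl; apply: sumr_ge0 => i _; exact: (fan_ge0 F).
Qed.

Lemma star_disk_cont : {within closed_star a, continuous star_disk}.
Proof.
have cp (A : set S) : {within A, continuous (sproj s)} by exact: proj_cont.
have cn (A : set S) : {within A, continuous (fun x => norm2 (sproj s x))}.
  apply: (within_comp (B := [set: R2]) (f := sproj s)) => //; exact: norm2_cont.
have cc : {within closed_star a, continuous (fun x : S => 1 - co x a)}.
  by apply: wcD; [exact: wc_cst|apply: wcN; exact: co_cont].
have n0 (x : S) : (closed_star a `&` [set x | 1 - co x a != 0]) x -> norm2 (sproj s x) != 0.
  by move=> [sx /= h]; apply: contra_neq h; exact: star_proj0.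
have le1 (u v : R) : `|u| <= v -> `|u / v| <= 1.
  move=> uv; have v0 : 0 <= v := le_trans (normr_ge0 _) uv.
  have [->|v1] := eqVneq v 0; first by rewrite invr0 mulr0 normr0.
  have vp : 0 < v by rewrite lt_neqAle eq_sym v1.
  by rewrite normrM normfV (ger0_norm v0) ler_pdivrMr ?mul1r.
have c1 (p : R2) : `|p.1| <= norm2 p.
  by rewrite -sqrtr_sqr ler_wsqrtr// lerDl sqr_ge0.
have c2 (p : R2) : `|p.2| <= norm2 p.
  by rewrite -sqrtr_sqr ler_wsqrtr// lerDr sqr_ge0.
apply: within_pair; apply: wc_squeeze => //; try (by move=> x _; exact: le1).
  by apply: wcM; [apply: wc_fst; exact: cp|apply: wcV => //; exact: cn].
by apply: wcM; [apply: wc_snd; exact: cp|apply: wcV => //; exact: cn].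
Qed.

Lemma disk_star_open : disk_star @` @open_disk R = open_star a.
Proof.
apply/seteqP; split=> [_ [p pd <-]|x xa].
  have pd' : closed_disk p by move: pd; rewrite /open_disk /closed_disk /=; exact: ltW.
  by rewrite /open_star /= co_disk_star// subr_gt0; exact/norm2_open_disk.
have sx := star_ex oc xa; exists (star_disk x); last exact: star_diskK.
by apply/norm2_open_disk; rewrite norm2_star_disk// ltrBlDr ltrDl.
Qed.

Lemma disk_star_image : disk_star @` @closed_disk R = closed_star a.
Proof.
apply/seteqP; split=> [_ [p pd <-]|x sx]; first exact: disk_star_in.
by exists (star_disk x); [exact: star_disk_in|exact: star_diskK].
Qed.

(** The closed star is closed as the image of a compact disk; conversely each of its points is a
    limit of points moved along the segment towards [a]. *)
Lemma closure_star : closure (open_star a : set S) = closed_star a.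
Proof.
have cl : closed (closed_star a : set S).
  rewrite -disk_star_image; apply: compact_closed; first exact: space_hausdorff.
  by apply: continuous_compact; [exact: disk_star_cont|exact: disk_compact].
apply/seteqP; split=> [x h|x sx O].
  have : closure (closed_star a : set S) x by apply: closure_subset h => y ya; exact (star_ex oc ya).
  by rewrite -((closure_id _).1 cl).
have [c [d [t sup]]] := sx; pose g (u : R) z := (1 - u) * co x z + u * delta R a z.
have i01 (u : R) : `[0, 1]%classic u = (0 <= u <= 1) :> Prop by rewrite /= in_itv.
have gv u : 0 <= u <= 1 -> valid tri (g u).
  move=> u01; have := convex_valid t sup (supp_delta R oc tri0 t (Or31 _ _ erefl)) u01.
  by rewrite (live_delta R tri0 t).
have cg : {within `[0, 1], continuous (fun u : R => mkpt tri0 (g u))}.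
  apply: mkpt_cont => [u|z]; first by rewrite i01; exact: gv.
  apply: wcD; apply: wcM; [|exact: wc_cst|exact: wc_id|exact: wc_cst].
  by apply: wcD; [exact: wc_cst|apply: wcN; exact: wc_id].
have z01 : `[0, 1]%classic (0 : R) by rewrite i01 lexx ler01.
have g0 : mkpt tri0 (g 0) = x.
  apply: co_ext => z; rewrite mkptE; first by rewrite /g subr0 mul1r mul0r addr0.
  by apply: gv; rewrite lexx ler01.
move=> Ox; have /within_contP/(_ _ z01 O) := cg; rewrite g0 => /(_ Ox)[W /nbhs_ballP[e e0 eW] WO].
pose u := Num.min (e / 2) 1.
have u0 : 0 < u by rewrite /u lt_min divr_gt0 ?ltr01.
have u1 : u <= 1 by rewrite /u ge_min lexx orbT.
have ue : u < e by rewrite /u gt_min; apply/orP; left; rewrite ltr_pdivrMr ?ltr_pMr ?ltr1n.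
have uu : 0 <= u <= 1 by rewrite u1 ltW.
exists (mkpt tri0 (g u)); split.
  rewrite /open_star /= mkptE; last exact: gv.
  rewrite /g /delta eqxx mulr1.
  by apply: ltr_wpDl => //; rewrite mulr_ge0 ?co_ge0 ?subr_ge0.
by apply: WO; [apply: eW; rewrite /ball /= sub0r normrN gtr0_norm|rewrite i01].
Qed.

Lemma closed_star_face : homeo_between (@closed_disk R) (closure (open_star a)) disk_star star_disk /\
  disk_star @` @open_disk R = open_star a.
Proof.
split; last exact: disk_star_open.
rewrite closure_star; split.
- by rewrite disk_star_image.
- by move=> _ [x sx <-]; exact: star_disk_in.
- by move=> p /set_mem; exact: disk_starK.
- by move=> x /set_mem; exact: star_diskK.
by split; [exact: disk_star_cont|exact: star_disk_cont].
Qed.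

Lemma boundary_star : boundary (open_star a : set S) = closed_star a `&` [set x | co x a = 0].
Proof.
rewrite /boundary closure_star ((interior_id _).1 (open_star_open R tri a)).
apply/seteqP; split=> x [sx xa]; split=> //=.
  by apply: le_anti; rewrite co_ge0 andbT leNgt; exact/negP.
by rewrite /open_star /= xa ltxx.
Qed.

End StarDisk.

(** * The barycentric subdivision of a labelled map *)

Section MapComplex.
Variables (G : mgraph) (L : finType) (lab : dart G -> L).
Hypothesis H : labelled_map lab.
Hypothesis G_conn : forall u v : vert G, connect (@adjacent_vert G) u v.
Implicit Type d : dart G.

Definition next_dart d : dart G := s2val (cid2 (lm_next H d)).
Local Notation phi := next_dart.

Lemma lab_next d : lab (phi d) = lab d. Proof. by rewrite /phi; case: cid2. Qed.
Lemma tail_next d : tail (phi d) = head d. Proof. by rewrite /phi; case: cid2. Qed.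

Lemma next_inj : injective phi.
Proof.
move=> d d' E; apply: (lm_head H); first by rewrite -lab_next E lab_next.
by rewrite -tail_next E tail_next.
Qed.

(* The face on the left of [d] is represented by a canonical dart of its boundary. *)
Definition left_face d : dart G := froot phi d.

Lemma left_faceP d d' : left_face d = left_face d' <-> fconnect phi d d'.
Proof.
split=> [E|h]; first by rewrite -(root_connect (fconnect_sym next_inj)) -/(left_face d) -/(left_face d') E eqxx.
by apply/eqP; rewrite (root_connect (fconnect_sym next_inj)).
Qed.

Lemma left_face_next d : left_face (phi d) = left_face d.
Proof. by apply/esym/left_faceP; exact: fconnect1. Qed.

Lemma lab_left d d' : left_face d = left_face d' -> lab d = lab d'.
Proof.
move=> /left_faceP/iter_findex <-; elim: (findex _ _ _) => [//|i IH].
by rewrite iterS lab_next.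
Qed.

Lemma left_tail d d' : left_face d = left_face d' -> tail d = tail d' -> d = d'.
Proof. by move=> /lab_left; exact: lm_tail. Qed.

Lemma left_head d d' : left_face d = left_face d' -> head d = head d' -> d = d'.
Proof. by move=> /lab_left; exact: lm_head. Qed.

Lemma left_edge d d' : left_face d = left_face d' -> d.1 = d'.1 -> d = d'.
Proof. by move=> /lab_left E /dart_eq[//|dE]; case: (lm_rdart H (d := d')); rewrite -dE. Qed.

(** A face appears only as its canonical dart; the other darts are isolated and lie in no
    triangle. *)
Definition node := (vert G + edge G + dart G)%type.
Definition nV (v : vert G) : node := inl (inl v).
Definition nE (e : edge G) : node := inl (inr e).
Definition nF d : node := inr (left_face d).

(** The triangles at the tail and at the head of [d], each in its three rotations. With the face on
    the left of [d], the orders vertex-edge-face at the tail and edge-vertex-face at the head are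
    both counterclockwise. *)
Inductive flag : node -> node -> node -> Prop :=
| flag_VEF d : flag (nV (tail d)) (nE d.1) (nF d)
| flag_EFV d : flag (nE d.1) (nF d) (nV (tail d))
| flag_FVE d : flag (nF d) (nV (tail d)) (nE d.1)
| flag_EVF d : flag (nE d.1) (nV (head d)) (nF d)
| flag_VFE d : flag (nV (head d)) (nF d) (nE d.1)
| flag_FEV d : flag (nF d) (nE d.1) (nV (head d)).

Definition tri (a b c : node) : bool := `[< flag a b c >].

Lemma triP a b c : tri a b c -> flag a b c. Proof. exact: asboolW. Qed.
Lemma tri_flag a b c : flag a b c -> tri a b c. Proof. exact: asboolT. Qed.

Lemma prev_dart d : exists d', phi d' = d.
Proof. by exists (finv phi d); rewrite f_finv//; exact: next_inj. Qed.

(** The vertex permutation of the combinatorial map: it permutes the darts with a given tail. *)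
Definition rotation d := phi (rdart d).

Lemma rotation_inj : injective rotation.
Proof. by move=> d d' /next_inj/(inv_inj (@rdartK G)). Qed.

Lemma tail_rotation d : tail (rotation d) = tail d.
Proof. by rewrite tail_next head_rdart. Qed.

(** Two nodes of a triangle in order determine its dart: a face passes a vertex once and an edge in
    one direction only, and the cyclic order tells tails from heads. *)
Lemma flag_fun a b c c' : flag a b c -> flag a b c' -> c = c'.
Proof.
case=> d h.
- by inversion h as [d' E1 E2| | | | |]; rewrite /nF (dart_tail_eq E2 E1).
- by inversion h as [|d' E1 E2| | | |]; rewrite (left_edge E2 E1).
- by inversion h as [| |d' E1 E2| | |]; rewrite (left_tail E1 E2).
- inversion h as [| | |d' E1 E2| |]; have -> // : d = d'.
  by apply: (inv_inj (@rdartK G)); apply: dart_tail_eq => //; rewrite !tail_rdart.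
- by inversion h as [| | | |d' E1 E2|]; rewrite (left_head E2 E1).
by inversion h as [| | | | |d' E1 E2]; rewrite (left_edge E1 E2).
Qed.

Lemma no_flip a b c : flag a b c -> ~ flag a c b.
Proof.
have key d d' : d.1 = d'.1 -> left_face d = left_face d' -> tail d = head d' -> False.
  by move=> e f; rewrite (left_edge f e) => E; have := tail_head d'; rewrite E eqxx.
case=> d h; inversion h as [d' E1 E2 E3|d' E1 E2 E3|d' E1 E2 E3|d' E1 E2 E3|d' E1 E2 E3|d' E1 E2 E3].
- by apply: (key d d').
- by apply: (key d d').
- by apply: (key d d').
- by apply: (key d' d).
- by apply: (key d' d).
by apply: (key d' d).
Qed.

Lemma next_orbit (Z : dart G -> Prop) : (forall d, Z d -> Z (phi d)) ->
  forall d d', left_face d = left_face d' -> Z d -> Z d'.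
Proof.
move=> step d d' /left_faceP/iter_findex <- Zd; elim: (findex _ _ _) => [//|i IH].
by rewrite iterS; exact: step.
Qed.

(** Orbits of a permutation of a finite set are cycles, so going backward long enough reaches the
    next dart. *)
Lemma rotation_back (Z : dart G -> Prop) : (forall d, Z (rotation d) -> Z d) ->
  forall d, Z d -> Z (rotation d).
Proof.
move=> step d Zd; have back i x : Z (iter i rotation x) -> Z x.
  by elim: i => [//|i IH] /step.
apply: (back (order rotation (rotation d)).-1).
by have := finv_f rotation_inj d; rewrite /finv => ->.
Qed.

Lemma vertex_link v (Z : node -> Prop) :
  (exists b c, flag (nV v) b c /\ Z b) -> (forall b c, flag (nV v) b c -> Z b -> Z c) ->
  forall b c, flag (nV v) b c -> Z b.
Proof.
move=> [b0 [c0 [t0 Z0]]] step.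
have toE d : head d = v -> Z (nF d) -> Z (nE d.1).
  by move=> dv; apply: step; rewrite -dv; exact: flag_VFE.
have toF d : tail d = v -> Z (nE d.1) -> Z (nF d).
  by move=> dv; apply: step; rewrite -dv; exact: flag_VEF.
have ex : exists2 d, tail d = v & Z (nE d.1).
  inversion t0 as [d E1 E2 E3| | | |d E1 E2 E3|]; subst b0.
    by exists d.
  by exists (rdart d) => //; rewrite ?tail_rdart//; apply: (toE d).
have rot d : tail d = v -> Z (nE (rotation d).1) -> Z (nE d.1).
  move=> dv Zr; apply: (toE (rdart d)); first by rewrite head_rdart.
  have -> : nF (rdart d) = nF (rotation d) by rewrite /nF left_face_next.
  by apply: toF => //; rewrite tail_rotation.
have rot' d : tail d = v -> Z (nE d.1) -> Z (nE (rotation d).1).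
  move=> dv Zd; have [] // := @rotation_back (fun d => tail d = v /\ Z (nE d.1)) _ d (conj dv Zd).
  by move=> d' [dv' Zd']; rewrite tail_rotation in dv'; split=> //; exact: rot.
have all d : tail d = v -> Z (nE d.1).
  move=> dv; have := lm_link H (v := v) (M := fun d => `[< Z (nE d.1) >]).
  move=> h; apply: (elimT (asboolP _)); apply: h => //.
    by have [d0 d0v Zd0] := ex; exists d0 => //; exact/asboolP.
  (* The relation in [lm_link] is exactly one step of the rotation, because a label leaves a vertex
     only once. *)
  move=> d1 d2 d1v d2v E; have -> : d2 = rotation d1.
    by apply: (lm_tail H); rewrite ?lab_next// tail_rotation d1v.
  by apply/asbool_equiv_eq; split; [exact: rot'|exact: rot].
move=> b c t; inversion t as [d E1 E2 E3| | | |d E1 E2 E3|]; subst b; first exact: all.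
have -> : nF d = nF (phi d) by rewrite /nF left_face_next.
by apply: toF; [rewrite tail_next|apply: all; rewrite tail_next].
Qed.

Lemma edge_link e (Z : node -> Prop) :
  (exists b c, flag (nE e) b c /\ Z b) -> (forall b c, flag (nE e) b c -> Z b -> Z c) ->
  forall b c, flag (nE e) b c -> Z b.
Proof.
move=> [b0 [c0 [t0 Z0]]] step.
have FV d : d.1 = e -> Z (nF d) -> Z (nV (tail d)) by move=> E; subst e; apply: step; exact: flag_EFV.
have VF d : d.1 = e -> Z (nV (head d)) -> Z (nF d) by move=> E; subst e; apply: step; exact: flag_EVF.
have [d dE Zd] : exists2 d, d.1 = e & Z (nF d).
  inversion t0 as [|d E1 E2 E3| |d E1 E2 E3| |]; subst b0; first by exists d.
  by exists d => //; exact: VF.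
have Zr : Z (nF (rdart d)) by apply: VF => //; rewrite head_rdart; exact: FV.
have all d' : d'.1 = e -> Z (nF d') by rewrite -dE => /dart_eq[]->.
move=> b c t; inversion t as [|d' E1 E2 E3| |d' E1 E2 E3| |]; subst b; first exact: all.
by rewrite -tail_rdart; apply: FV => //; exact: all.
Qed.

Lemma face_link f (Z : node -> Prop) :
  (exists b c, flag (inr f) b c /\ Z b) -> (forall b c, flag (inr f) b c -> Z b -> Z c) ->
  forall b c, flag (inr f) b c -> Z b.
Proof.
move=> [b0 [c0 [t0 Z0]]] step.
have VE d : left_face d = f -> Z (nV (tail d)) -> Z (nE d.1).
  by move=> E; subst f; apply: step; exact: flag_FVE.
have EV d : left_face d = f -> Z (nE d.1) -> Z (nV (head d)).
  by move=> E; subst f; apply: step; exact: flag_FEV.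
have [d dE Zd] : exists2 d, left_face d = f & Z (nE d.1).
  inversion t0 as [| |d E1 E2 E3| | |d E1 E2 E3]; subst b0; last by exists d.
  by exists d => //; exact: VE.
have all d' : left_face d' = f -> Z (nE d'.1).
  move=> d'E; have [] // := @next_orbit (fun d => left_face d = f /\ Z (nE d.1)) _ d d' _ (conj dE Zd).
    move=> d1 [f1 Z1]; have f2 : left_face (phi d1) = f by rewrite left_face_next.
    by split=> //; apply: VE => //; rewrite tail_next; exact: EV.
  by rewrite dE d'E.
move=> b c t; inversion t as [| |d' E1 E2 E3| | |d' E1 E2 E3]; subst b; last exact: all.
have [d1 d1E] := prev_dart d'; rewrite -d1E tail_next; apply: EV; last first.
  by apply: all; rewrite -left_face_next d1E.
by rewrite -left_face_next d1E.
Qed.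

Lemma map_complex : oriented_complex tri.
Proof.
split.
- by move=> a b c /triP[d|d|d|d|d|d]; apply: tri_flag; constructor.
- by move=> a b c c' /triP h /triP; exact: flag_fun.
- move=> a b c /triP[d|d|d|d|d|d].
  + have [d' E] := prev_dart d; exists (nE d'.1); apply: tri_flag.
    by rewrite -E tail_next /nF left_face_next; exact: flag_VFE.
  + by exists (nF (rdart d)); apply: tri_flag; rewrite -head_rdart; exact: (flag_EVF (rdart d)).
  + by exists (nV (head d)); apply: tri_flag; constructor.
  + by exists (nV (tail d)); apply: tri_flag; constructor.
  + by exists (nF (rdart d)); apply: tri_flag; rewrite -tail_rdart; exact: (flag_VEF (rdart d)).
  exists (nE (phi d).1); apply: tri_flag.
  by rewrite -tail_next /nF -left_face_next; exact: flag_FVE.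
- by move=> a b c /triP[].
- by move=> a b c /triP h; apply/negP => /triP; exact: no_flip.
- move=> a Z ex step b c /triP t.
  have ex' : exists b c, flag a b c /\ Z b by have [b1 [c1 [/triP t1 Z1]]] := ex; exists b1, c1.
  have step' b1 c1 : flag a b1 c1 -> Z b1 -> Z c1 by move=> t1; apply: step; exact: tri_flag.
  case: a ex' step' t {ex step} => [[v|e]|f] ex step; [exact: (vertex_link ex step)|
    exact: (edge_link ex step)|exact: (face_link ex step)].
move=> Z [a [b [c [t0 Za]]]] step.
have {step}step x y z : flag x y z -> Z x -> Z y by move=> h; apply: (step _ _ z); exact: tri_flag.
have cyc x y z : flag x y z -> Z x -> [/\ Z x, Z y & Z z].
  move=> h Zx; have Zy := step _ _ _ h Zx; split=> //; apply: (step y z x) => //.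
  by case: h; constructor.
have VE d : Z (nV (tail d)) -> Z (nE d.1) /\ Z (nF d).
  by move=> /(cyc _ _ _ (flag_VEF d))[].
have EV d : Z (nE d.1) -> Z (nV (head d)) by move=> /(cyc _ _ _ (flag_EVF d))[].
have [v0 Zv0] : exists v, Z (nV v).
  move: t0 Za => /triP[d|d|d|d|d|d] Za.
  - by exists (tail d).
  - by exists (tail d); have [] := cyc _ _ _ (flag_EFV d) Za.
  - by exists (tail d); have [] := cyc _ _ _ (flag_FVE d) Za.
  - by exists (head d); have [] := cyc _ _ _ (flag_EVF d) Za.
  - by exists (head d).
  by exists (head d); have [] := cyc _ _ _ (flag_FEV d) Za.
have Zv v : Z (nV v).
  have /connectP[p + ->] := G_conn v0 v; elim: p v0 Zv0 => [//|w p IH] u Zu /= /andP[/existsP[e /eqP E]].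
  apply: IH; have ue : u \in ends e by rewrite E !inE eqxx.
  have [d de du] := dart_of ue; have -> : w = head d.
    have := ends_dart d; rewrite de E => /setP/(_ (head d)); rewrite !inE eqxx orbT => /orP[]/eqP// h.
    by have := tail_head d; rewrite du -h eqxx.
  by apply: EV; have [] := VE d; rewrite ?du.
move=> x y z /triP[d|d|d|d|d|d]; rewrite ?Zv//; by have [] := VE d (Zv _).
Qed.

End MapComplex.

(** * The graph in the geometric realisation *)

Section MapEmbedding.
Variables (R : realType) (G : mgraph) (L : finType) (lab : dart G -> L).
Hypothesis H : labelled_map lab.
Hypothesis G_conn : forall u v : vert G, connect (@adjacent_vert G) u v.
Hypothesis no_isolated : forall v : vert G, exists e : edge G, v \in ends e.
Variable d0 : dart G.
Implicit Type d : dart G.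
Local Notation tri := (tri H).
Local Notation S := (space R tri).
Local Notation nF := (nF H).
Let oc := map_complex H G_conn.
Let tri0 : tri _ _ _ := tri_flag (flag_VEF H d0).
Local Notation mk := (mkpt tri0).

Lemma vert_live v : exists b c, tri (nV v) b c.
Proof.
have [e ve] := no_isolated v; have [d _ <-] := dart_of ve.
by exists (nE d.1), (nF d); apply: tri_flag; constructor.
Qed.

Definition vert_point v : S := mk (delta R (nV v)).

Lemma co_vert v : co (vert_point v) = delta R (nV v).
Proof. by have [b [c t]] := vert_live v; rewrite /vert_point (live_delta R tri0 t). Qed.

(** Coordinates of the two ends along an edge, which runs from one end through its own node, reached
    at [t = 1 / 2], to the other end. *)
Definition lo (t : R) := Num.max 0 (1 - 2 * t).
Definition hi (t : R) := Num.max 0 (2 * t - 1).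

Lemma lo_hi (t : R) : 0 <= t <= 1 ->
  (t <= 1 / 2 /\ lo t = 1 - 2 * t /\ hi t = 0) \/ (1 / 2 <= t /\ lo t = 0 /\ hi t = 2 * t - 1).
Proof.
move=> t01; case: (lerP t (1 / 2)) => h; [left|right].
  by rewrite /lo /hi max_r ?max_l; [|lra|lra].
by rewrite /lo /hi max_l ?max_r; [split; [exact: ltW|]|lra|lra].
Qed.

Definition edge_coord (e : edge G) (t : R) (z : node G) : R :=
  (z == nV (tail (e, false)))%:R * lo t + (z == nV (head (e, false)))%:R * hi t +
  (z == nE e)%:R * (1 - lo t - hi t).

Lemma delta_sum (a : node G) (x : R) : \sum_z (z == a)%:R * x = x.
Proof. by rewrite (bigD1 a)//= eqxx mul1r big1 ?addr0// => z /negbTE ->; rewrite mul0r. Qed.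

Lemma edge_valid e (t : R) : 0 <= t <= 1 -> valid tri (edge_coord e t).
Proof.
move=> t01; have cases := lo_hi t01; split.
- by move=> z; rewrite /edge_coord; case: cases => -[h [-> ->]];
    rewrite !addr_ge0// mulr_ge0 ?ler0n//; lra.
- by rewrite /edge_coord !big_split /= !delta_sum; ring.
case: cases => -[_ [lE hE]].
  exists (nV (tail (e, false))), (nE e), (nF (e, false)); split; first exact: (tri_flag (flag_VEF H (e, false))).
  by move=> z /negbTE z1 /negbTE z2 _; rewrite /edge_coord z1 z2 hE !mul0r mulr0 !addr0.
exists (nE e), (nV (head (e, false))), (nF (e, false)); split; first exact: (tri_flag (flag_EVF H (e, false))).
by move=> z /negbTE z1 /negbTE z2 _; rewrite /edge_coord z1 z2 lE !mul0r mulr0 !addr0.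
Qed.

Definition edge_path e (t : R) : S := mk (edge_coord e t).

Lemma co_edge e (t : R) : 0 <= t <= 1 -> co (edge_path e t) = edge_coord e t.
Proof. by move=> t01; rewrite /edge_path mkptE//; exact: edge_valid. Qed.

Lemma nV_eq u v : (nV u == nV v :> node G) = (u == v). Proof. by []. Qed.
Lemma nE_eq e e' : (nE e == nE e' :> node G) = (e == e'). Proof. by []. Qed.
Lemma nVE v e : (nV v == nE e :> node G) = false. Proof. by []. Qed.
Lemma nEV v e : (nE e == nV v :> node G) = false. Proof. by []. Qed.

Lemma edge_coord_tail e t : edge_coord e t (nV (tail (e, false))) = lo t.
Proof.
by rewrite /edge_coord eqxx nV_eq (negbTE (tail_head _)) nVE mul1r !mul0r !addr0.
Qed.

Lemma edge_coord_head e t : edge_coord e t (nV (head (e, false))) = hi t.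
Proof.
by rewrite /edge_coord eqxx nV_eq eq_sym (negbTE (tail_head _)) nVE mul1r !mul0r addr0 add0r.
Qed.

Lemma edge_coord_edge e e' t : edge_coord e t (nE e') = (e' == e)%:R * (1 - lo t - hi t).
Proof. by rewrite /edge_coord !nEV !mul0r !add0r nE_eq. Qed.

Lemma edge_coord_face e t d : edge_coord e t (inr d) = 0.
Proof. by rewrite /edge_coord !mul0r !addr0. Qed.

Lemma edge_interior (t : R) : 0 < t < 1 -> 0 < 1 - lo t - hi t.
Proof.
move=> t01; have t01' : 0 <= t <= 1 by lra.
by have [[h [-> ->]]|[h [-> ->]]] := lo_hi t01'; lra.
Qed.

Lemma unit_interior (t : R) : 0 < t < 1 -> 0 <= t <= 1. Proof. by lra. Qed.

Lemma vert_point_inj : injective vert_point.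
Proof.
move=> u v E; apply/eqP; have := congr1 (fun x => co x (nV u)) E.
rewrite /= !co_vert /delta eqxx nV_eq; case: (u == v) => // /eqP.
by rewrite oner_eq0.
Qed.

Lemma edge_path_cont e : {within @unit_interval R, continuous (edge_path e)}.
Proof.
apply: mkpt_cont => [t t01|z]; first exact: edge_valid.
have cid : {within @unit_interval R, continuous (fun t : R => t)} by exact: wc_id.
have cl : {within @unit_interval R, continuous lo}.
  apply: wc_max; first exact: wc_cst.
  by apply: wcD; [exact: wc_cst|apply: wcN; apply: wcM => //; exact: wc_cst].
have ch : {within @unit_interval R, continuous hi}.
  apply: wc_max; first exact: wc_cst.
  by apply: wcD; [apply: wcM => //; exact: wc_cst|exact: wc_cst].
rewrite /edge_coord; apply: wcD; first (apply: wcD; apply: wcM => //; exact: wc_cst).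
apply: wcM; first exact: wc_cst.
by apply: wcD; [apply: wcD; [exact: wc_cst|exact: wcN]|exact: wcN].
Qed.

Lemma edge_path_inj e : set_inj (@unit_interval R) (edge_path e).
Proof.
move=> s t /set_mem s01 /set_mem t01 E.
have := congr1 (fun x => co x (nV (tail (e, false)))) E.
have := congr1 (fun x => co x (nV (head (e, false)))) E.
rewrite /= !co_edge// !edge_coord_tail !edge_coord_head.
by have [[h1 [-> ->]]|[h1 [-> ->]]] := lo_hi s01; have [[h2 [-> ->]]|[h2 [-> ->]]] := lo_hi t01; lra.
Qed.

Lemma lo0 : lo 0 = 1 /\ hi 0 = 0.
Proof. by have [|[h [-> ->]]|[h _]] := @lo_hi 0; lra. Qed.

Lemma hi1 : lo 1 = 0 /\ hi 1 = 1.
Proof. by have [|[h _]|[h [-> ->]]] := @lo_hi 1; lra. Qed.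

Lemma edge_path0 e : edge_path e 0 = vert_point (tail (e, false)).
Proof.
have [l0 h0] := lo0; apply: co_ext => z; rewrite co_edge ?lexx ?ler01// co_vert.
by rewrite /edge_coord l0 h0 /delta mulr1 mulr0 subrr subr0 mulr0 !addr0.
Qed.

Lemma edge_path1 e : edge_path e 1 = vert_point (head (e, false)).
Proof.
have [l1 h1] := hi1; apply: co_ext => z; rewrite co_edge ?lexx ?ler01// co_vert.
by rewrite /edge_coord l1 h1 /delta mulr1 mulr0 subr0 subrr mulr0 addr0 add0r.
Qed.

Lemma edge_path_ends e : vert_point @` [set` ends e] = [set edge_path e 0; edge_path e 1].
Proof.
rewrite edge_path0 edge_path1; have E := ends_dart (e, false); rewrite /= in E.
apply/seteqP; split=> [_ [v /= + <-]|x [] ->].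
- by rewrite E !inE => /orP[]/eqP->; [left|right].
- by exists (tail (e, false)) => //=; rewrite E !inE eqxx.
by exists (head (e, false)) => //=; rewrite E !inE eqxx orbT.
Qed.

Lemma edge_path_vert e v (t : R) : 0 < t < 1 -> edge_path e t <> vert_point v.
Proof.
move=> t01 /(congr1 (fun x => co x (nE e))); rewrite /= co_edge ?unit_interior// co_vert.
by rewrite edge_coord_edge eqxx mul1r /delta nEV; have := edge_interior t01 => + E; rewrite E ltxx.
Qed.

Lemma edge_path_path e e' (s t : R) : 0 < s < 1 -> 0 < t < 1 -> edge_path e s = edge_path e' t -> e = e'.
Proof.
move=> s01 t01 /(congr1 (fun x => co x (nE e))); rewrite /= !co_edge ?unit_interior//.
rewrite !edge_coord_edge eqxx mul1r; case: eqP => // _; rewrite mul0r => E.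
by have := edge_interior s01; rewrite E ltxx.
Qed.

Definition map_embedding : embedding R G S :=
  Embedding vert_point_inj edge_path_cont edge_path_inj edge_path_ends edge_path_vert edge_path_path.
Local Notation Phi := map_embedding.

(** The dart tells in which half of the edge the point lies: between the node of [e] and
    [tail d]. *)
Lemma edge_arcP e x : (exists2 t, unit_interval t & edge_path e t = x) <->
  exists2 d, d.1 = e & forall z, z != nV (tail d) -> z != nE e -> co x z = 0.
Proof.
split=> [[t t01 <-]|[d <- s]].
  rewrite co_edge//; have [[_ [lE hE]]|[_ [lE hE]]] := lo_hi t01.
    by exists (e, false) => // z /negbTE z1 /negbTE z2; rewrite /edge_coord z1 z2 hE !mul0r mulr0 !addr0.
  exists (e, true) => // z /negbTE z1 /negbTE z2.
  by rewrite /edge_coord lE z2 (_ : head (e, false) = tail (e, true))// z1 !mul0r mulr0 !addr0.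
have sum : co x (nV (tail d)) = 1 - co x (nE d.1).
  have := co_sum x; rewrite (bigD1 (nV (tail d)))//= (bigD1 (nE d.1))//= big1 => [<-|z /andP[z1 z2]]; last exact: s.
  by rewrite addr0 addrK.
have x0 := co_ge0 x (nE d.1); have x1 := co_ge0 x (nV (tail d)).
set u := co x (nE d.1) in sum x0 s *.
have [dE|dE] : d = (d.1, false) \/ d = rdart (d.1, false) by exact: dart_eq.
  have t01 : 0 <= u / 2 <= 1 by lra.
  exists (u / 2) => //; apply: co_ext => z; rewrite co_edge//.
  have [lE hE] : lo (u / 2) = 1 - u /\ hi (u / 2) = 0.
    by have [[h [-> ->]]|[h [-> ->]]] := lo_hi t01; lra.
  rewrite /edge_coord lE hE -dE mulr0 addr0.
  have [->|z1] := eqVneq z (nV (tail d)); first by rewrite nVE mul1r mul0r addr0.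
  rewrite mul0r add0r; have [->|z2] := eqVneq z (nE d.1); first by rewrite mul1r -/u; ring.
  by rewrite mul0r s.
have t01 : 0 <= 1 - u / 2 <= 1 by lra.
exists (1 - u / 2) => //; apply: co_ext => z; rewrite co_edge//.
have [lE hE] : lo (1 - u / 2) = 0 /\ hi (1 - u / 2) = 1 - u.
  by have [[h [-> ->]]|[h [-> ->]]] := lo_hi t01; lra.
have hd : head (d.1, false) = tail d by rewrite [in RHS]dE.
rewrite /edge_coord lE hE hd mulr0 add0r.
have [->|z1] := eqVneq z (nV (tail d)); first by rewrite nVE mul1r mul0r addr0.
rewrite mul0r add0r; have [->|z2] := eqVneq z (nE d.1); first by rewrite mul1r -/u; ring.
by rewrite mul0r s.
Qed.

Lemma edge_supp (x : S) d : co x (nF d) = 0 -> supp (nF d) (nV (tail d)) (nE d.1) x ->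
  exists2 t, unit_interval t & edge_path d.1 t = x.
Proof.
move=> x0 s; apply/edge_arcP; exists d => // z z1 z2.
by have [->|z3] := eqVneq z (nF d); [|exact: s].
Qed.

Lemma nF_arc e (t : R) d : unit_interval t -> co (edge_path e t) (inr d) = 0.
Proof. by move=> t01; rewrite co_edge// edge_coord_face. Qed.

Lemma graph_pointsP (x : S) : graph_points Phi x <-> forall d, co x (inr d) = 0.
Proof.
split=> [[[v _ <-]|[e _ [t t01 <-]]] d|x0].
- by rewrite co_vert.
- exact: nF_arc.
have [a [b [c [/triP t s]]]] := supp_ex x; right.
have fl d : supp (nF d) (nV (tail d)) (nE d.1) x -> exists2 e, True & exists2 t, unit_interval t & edge_path e t = x.
  by move=> sd; exists d.1 => //; apply: edge_supp sd; exact: x0.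
have fl' d : supp (nF d) (nE d.1) (nV (head d)) x -> exists2 e, True & exists2 t, unit_interval t & edge_path e t = x.
  move=> sd; exists d.1 => //; apply/edge_arcP; exists (rdart d) => // z z1 z2.
  by have [->|z3] := eqVneq z (nF d); [exact: x0|apply: sd].
by case: t s => d s; [apply: (fl d)|apply: (fl d)|apply: (fl d)|apply: (fl' d)|apply: (fl' d)|apply: (fl' d)];
  move=> z z1 z2 z3; exact: s.
Qed.

Lemma face_node (x : S) d : 0 < co x (inr d) -> left_face H d = d.
Proof.
move=> /(star_ex oc)[b [c [/triP t _]]].
by inversion t as [| |d' E1 E2 E3| | |d' E1 E2 E3]; subst; rewrite /left_face root_root//;
  apply: fconnect_sym; exact: next_inj.
Qed.

Lemma one_face (x : S) d d' : 0 < co x (inr d) -> 0 < co x (inr d') -> d = d'.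
Proof.
move=> xd xd'; have [b [c [/triP t s]]] := star_ex oc xd; apply/eqP; apply: contraT => ne.
have z0 : inr d' != inr d :> node G by rewrite eq_sym.
by inversion t as [| |d1 E1 E2 E3| | |d1 E1 E2 E3]; subst b c; move: xd'; rewrite s ?ltxx.
Qed.

(** Off the graph exactly one face coordinate is positive, so the open stars of the face nodes
    partition the complement into connected open sets. *)
Lemma face_star f : face Phi f -> exists d, f = open_star (nF d).
Proof.
move=> [x ngx ->]; have [d xd] : exists d, 0 < co x (inr d).
  apply: contrapT => no; apply: ngx; apply/graph_pointsP => d; apply: le_anti.
  by rewrite co_ge0 andbT leNgt; apply/negP => xd; apply: no; exists d.
exists d; have E := face_node xd; rewrite /nF E.
have out (y : S) d' : open_star (inr d') y -> (~` graph_points Phi) y.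
  by move=> yd /graph_pointsP/(_ d') y0; move: yd; rewrite /open_star /= y0 ltxx.
apply/seteqP; split; last first.
  by apply: connected_component_max => // [y /out//|]; exact (@open_star_connected R _ _ oc _ _ _ tri0 (inr d)).
move=> y Cy; have Cx : connected_component (~` graph_points Phi) x x by exact: connected_component_refl.
have Cc : connected (connected_component (~` graph_points Phi) x) by exact: component_connected.
apply: (locally_constant_connected (Q := open_star (inr d : node G)) Cc _ Cx Cy xd) => z Cz.
have nz := connected_component_sub Cz.
have [d' zd'] : exists d', 0 < co z (inr d').
  apply: contrapT => no; apply: nz; apply/graph_pointsP => d'; apply: le_anti.
  by rewrite co_ge0 andbT leNgt; apply/negP => zd; apply: no; exists d'.
exists (open_star (inr d' : node G)).
  by apply: open_nbhs_nbhs; split=> //; exact: open_star_open.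
move=> w wd' _; split=> h; first by rewrite (one_face h zd').
by rewrite (one_face h wd').
Qed.

Definition face_len d := order (next_dart H) d.

Lemma iter_left i d : left_face H (iter i (next_dart H) d) = left_face H d.
Proof. by elim: i => [//|i IH]; rewrite iterS left_face_next. Qed.

Lemma face_len_ge2 d : (2 <= face_len d)%N.
Proof.
rewrite /face_len; have := order_gt0 (next_dart H) d; rewrite leq_eqVlt => /orP[/eqP E|//].
have := iter_order (@next_inj _ _ _ H) d; rewrite -E /= => Ed.
by have := tail_next H d; rewrite Ed => Et; have := tail_head d; rewrite -Et eqxx.
Qed.

Lemma iter_next_inj d i j : (i < face_len d)%N -> (j < face_len d)%N ->
  iter i (next_dart H) d = iter j (next_dart H) d -> i = j.
Proof. by move=> hi hj E; rewrite -(findex_iter hi) E findex_iter. Qed.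

Definition face_vert d (i : 'I_(face_len d)) := tail (iter i (next_dart H) d).
Definition face_edge d (i : 'I_(face_len d)) := (iter i (next_dart H) d).1.

Lemma face_vert_inj d : injective (@face_vert d).
Proof.
move=> i j E; apply/val_inj/(@iter_next_inj d _ _ (ltn_ord i) (ltn_ord j)).
by apply: (left_tail (H := H)) => //; rewrite !iter_left.
Qed.

Lemma face_edge_inj d : injective (@face_edge d).
Proof.
move=> i j E; apply/val_inj/(@iter_next_inj d _ _ (ltn_ord i) (ltn_ord j)).
by apply: (left_edge (H := H)) => //; rewrite !iter_left.
Qed.

Lemma face_edge_ends d (i : 'I_(face_len d)) :
  ends (face_edge i) = [set face_vert i; face_vert (ordS i)]%SET.
Proof.
rewrite /face_edge ends_dart /face_vert; congr [set _; _]%SET.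
rewrite -(tail_next H) -iterS; congr tail.
have := ltn_ord i; rewrite leq_eqVlt => /orP[/eqP E|h]; last by rewrite /= modn_small.
by rewrite /= -iterS E modnn /face_len iter_order//; exact: next_inj.
Qed.

Definition face_bound d : cycle_of G :=
  CycleOf (face_len_ge2 d) (@face_vert_inj d) (@face_edge_inj d) (@face_edge_ends d).

Lemma left_iter d d' : nF d = nF d' -> exists i : 'I_(face_len d), d' = iter i (next_dart H) d.
Proof.
move=> [/left_faceP h]; have hi : (findex (next_dart H) d d' < face_len d)%N by exact: findex_max.
by exists (Ordinal hi); rewrite /= iter_findex.
Qed.

Lemma star_boundary d : closed_star (nF d) `&` [set x : S | co x (nF d) = 0] = cycle_points Phi (face_bound d).
Proof.
apply/seteqP; split=> [x [[b [c [/triP t s]]] /= x0]|x [i _ [t t01 <-]]].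
  inversion t as [| |d1 E1 E2 E3| | |d1 E1 E2 E3]; subst b c.
    have [i d1E] : exists i : 'I_(face_len d), d1 = iter i (next_dart H) d by apply: left_iter; rewrite /nF E1.
    exists i => //; rewrite /= /face_edge -d1E; apply/edge_arcP; exists d1 => // z z1 z2.
    by have [->//|z3] := eqVneq z (nF d); exact: s.
  have [i d1E] : exists i : 'I_(face_len d), d1 = iter i (next_dart H) d by apply: left_iter; rewrite /nF E1.
  exists i => //; rewrite /= /face_edge -d1E; apply/edge_arcP; exists (rdart d1) => // z z1 z2.
  by have [->//|z3] := eqVneq z (nF d); exact: s.
split; last exact: nF_arc.
set di := iter i (next_dart H) d; have dF : nF d = nF di by rewrite /nF iter_left.
have /edge_arcP[d1 d1E s] : exists2 u, unit_interval u & edge_path (face_edge i) u = edge_path (face_edge i) t by exists t.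
have {}s : supp (nF d) (nV (tail d1)) (nE d1.1) (edge_path (face_edge i) t).
  by move=> z _ z1 z2; apply: s => //; rewrite -d1E.
have [E|E] : d1 = di \/ d1 = rdart di by apply: dart_eq; rewrite d1E.
  by exists (nV (tail d1)), (nE d1.1); split=> //; apply: tri_flag; rewrite dF E; constructor.
exists (nE d1.1), (nV (tail d1)); split; last by move=> z z1 z2 z3; exact: s.
by apply: tri_flag; rewrite dF E tail_rdart; exact: (flag_FEV H di).
Qed.

Lemma map_closed_2cell : closed_2cell_embedding Phi.
Proof.
move=> f /face_star[d ->].
pose s := star_at R oc (tri_flag (flag_FVE H d)).
split; last by exists (face_bound d); rewrite (boundary_star oc tri0 s) star_boundary.
by exists (disk_star tri0 s), (star_disk s); exact: closed_star_face.
Qed.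

End MapEmbedding.

Theorem labelled_map_embedding (R : realType) (G : mgraph) (L : finType) (lab : dart G -> L) :
  labelled_map lab -> (forall u v : vert G, connect (@adjacent_vert G) u v) ->
  (forall v : vert G, exists e : edge G, v \in ends e) -> (0 < #|edge G|)%N ->
  exists (S : topologicalType) (Phi : embedding R G S),
    [/\ surface R S, orientable R S & closed_2cell_embedding Phi].
Proof.
move=> H G_conn no_isolated /card_gt0P[e _].
pose oc := map_complex H G_conn; pose tri0 := tri_flag (flag_VEF H (e, false)).
exists (space R (tri H)), (map_embedding R H no_isolated (e, false)).
split; [exact: (space_surface R oc tri0)|exact: (space_orientable R oc tri0)|exact: map_closed_2cell].
Qed.

Lemma connected_incident (G : mgraph) : two_connected G ->
  (forall u v : vert G, connect (@adjacent_vert G) u v) /\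
  (forall v : vert G, exists e : edge G, v \in ends e).
Proof.
move=> [big conn]; have G_conn u v : connect (@adjacent_vert G) u v.
  have := conn finset.set0; rewrite cards0 => /(_ isT u v); rewrite !inE => /(_ isT isT).
  by apply: connect_sub => x y /and3P[_ _ /connect1].
split=> // v; have [u uv] : exists u, u != v.
  apply: contrapT => no; move: big; rewrite -cardsT (_ : [set: vert G]%SET = [set v]%SET) ?cards1//.
  apply/setP => w; rewrite !inE; apply/esym/eqP; apply: contrapT => wv; apply: no.
  by exists w; exact/eqP.
have /connectP[[|w p] /= + E] := G_conn v u; first by rewrite E eqxx in uv.
by move=> /andP[/existsP[e /eqP eE] _]; exists e; rewrite eE !inE eqxx.
Qed.

Theorem theorem3p4 (R : realType) (G : mgraph) (P : topologicalType)
    (Psi : embedding R G P) (l : nat) (F : 'I_l -> set P)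
    (G_2conn : two_connected G)
    (P_proj : projective_plane R P)
    (Psi_closed : closed_2cell_embedding Psi)
    (F_ring : face_ring Psi F)
    (F_elem : elementary F)
    (F_nonc : noncontractible R F)
    (l_odd : odd l)
    (l_ge3 : (3 <= l)%N) :
  exists (S : topologicalType) (Phi : embedding R G S),
    [/\ surface R S, orientable R S & closed_2cell_embedding Phi].

Proof.
have [G_conn no_isolated] := connected_incident G_2conn.
have [L [lab labP]] := ring_labelled_map P_proj Psi_closed no_isolated F_ring F_elem F_nonc l_odd l_ge3.
apply: (labelled_map_embedding R labP G_conn no_isolated).
have /card_gt0P[v _] : (0 < #|vert G|)%N by apply: leq_ltn_trans G_2conn.1.
by have [e _] := no_isolated v; apply/card_gt0P; exists e.
Qed.
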